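(* Work in either the $C^*$-setting or the $W^*$-setting. Let $X=(X(n))_{n\in\mathbb{Z}_+}$ be a standard subproduct system, and let $T=(T_n)_{n\in\mathbb{Z}_+}$ be a completely contractive, covariant representation of $X$ on a Hilbert space $\mathcal{H}$. Then there exists a unique unital, completely positive, completely contractive linear map $\Psi:\mathcal{E}(X)\to B(\mathcal{H})$ that satisfies $$\Psi(S_n(\zeta))=T_n(\zeta)\quad\text{and}\quad \Psi(S_n(\zeta)^* )=T_n(\zeta)^*\qquad\text{for all } n\in\mathbb{Z}_+,\ \zeta\in X(n),$$ and $$\Psi(ab)=\Psi(a)\Psi(b)\qquad\text{for all } a\in\mathcal{T}_+(X),\ b\in\mathcal{E}(X).$$
   Context: Conventions. Hilbert spaces are complex; $C^*$-algebras need not be unital; all representations of operator algebras on Hilbert spaces are assumed nondegenerate. $\mathcal{L}(F)$ denotes the adjointable operators on a Hilbert module $F$. Two settings are considered. $C^*$-setting: $\mathcal{M}$ is a $C^*$-algebra; a correspondence over $\mathcal{M}$ is a right Hilbert $C^*$-module $F$ over $\mathcal{M}$ (inner product $\langle\cdot,\cdot\rangle$ linear in the second variable) with a left action $a\zeta=\varphi(a)\zeta$ given by a $*$-homomorphism $\varphi:\mathcal{M}\to\mathcal{L}(F)$; tensor products are interior tensor products. $W^*$-setting: $\mathcal{M}$ is a von Neumann algebra, correspondences are required to be self-dual with $\varphi$ normal, and tensor products and direct sums of correspondences mean the self-dual completions of the usual ones. For a representation $\sigma$ of $\mathcal{M}$ on $\mathcal{H}$, $F\otimes_\sigma\mathcal{H}$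 is the Hilbert space with $(\zeta_1\otimes h_1,\zeta_2\otimes h_2)=(h_1,\sigma(\langle\zeta_1,\zeta_2\rangle)h_2)$. Standard subproduct system: a family $X=(X(n))_{n\in\mathbb{Z}_+}$ of correspondences over $\mathcal{M}$ with $X(0)=\mathcal{M}$ such that $X(n+m)$ is an orthogonally complementable sub-bimodule of $X(n)\otimes X(m)$ for all $n,m$ (where $X(n)\otimes\mathcal{M}$ and $\mathcal{M}\otimes X(n)$ are identified with $X(n)$ via the module actions, so the left actions are nondegenerate). Put $E=X(1)$; then $X(n)\subseteq E^{\otimes n}$ ($E^{\otimes 0}=\mathcal{M}$), and $p_n\in\mathcal{L}(E^{\otimes n})$ is the orthogonal projection onto $X(n)$. Completely contractive, covariant representation of $X$ on $\mathcal{H}$: a family $T=(T_n)_{n\in\mathbb{Z}_+}$ of linear maps $T_n:X(n)\to B(\mathcal{H})$ such that $\sigma:=T_0$ is a $C^*$-representation of $\mathcal{M}$ on $\mathcal{H}$; each $T_n$ is completely contractive (with $X(n)$ viewed inside its linking algebra); $T_n(\zeta a)=T_n(\zeta)\sigma(a)$ and $T_n(a\zeta)=\sigma(a)T_n(\zeta)$; and $T_{n+m}(p_{n+m}(\zeta\otimes\eta))=T_n(\zeta)T_m(\eta)$ for $\zeta\in X(n),\eta\in X(m)$. In the $W^*$-setting $\sigma$ is also required to be normal, and each $T_n$ continuous from the $\sigma$-topology of $X(n)$ (generated by the functionals $x\mapsto\sum_i\omega_i(\langle\eta_i,x\rangle)$ with $\omega_i\in\mathcal{M}_*$, $\eta_i\in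 X(n)$, $\sum_i\|\omega_i\|\|\eta_i\|<\infty$) to the ultraweak topology (this continuity is automatic when $\sigma$ is normal). $X$-Fock space and shift: $\mathcal{F}_X=\bigoplus_{n\in\mathbb{Z}_+}X(n)$, and for $\zeta\in X(n)$, $S_n(\zeta)\in\mathcal{L}(\mathcal{F}_X)$ is given by $S_n(\zeta)\eta=p_{n+m}(\zeta\otimes\eta)$ for $\eta\in X(m)$. The tensor algebra $\mathcal{T}_+(X)$ is the norm closed (non-selfadjoint) subalgebra of $\mathcal{L}(\mathcal{F}_X)$ generated by all $S_n(\zeta)$, $n\in\mathbb{Z}_+$, $\zeta\in X(n)$. $\mathcal{T}_+(X)^1$ is $\mathcal{T}_+(X)$ if it is unital and $\mathcal{T}_+(X)+\mathbb{C}I_{\mathcal{F}_X}$ otherwise. $\mathcal{E}(X)$ is the operator system $\overline{\mathrm{span}}\{ab^*: a,b\in\mathcal{T}_+(X)^1\}$ (norm closure) in $\mathcal{L}(\mathcal{F}_X)$. *)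

(* Defs.v *)
From HB Require Import structures.
From mathcomp Require Import all_boot all_order all_algebra.
From mathcomp Require Import complex.
From mathcomp Require Import all_classical reals topology normedtype.
Set Implicit Arguments.
Unset Strict Implicit.
Unset Printing Implicit Defensive.
Import Order.TTheory GRing.Theory Num.Theory.
Import numFieldNormedType.Exports.
Local Open Scope classical_set_scope.
Local Open Scope ring_scope.
Local Open Scope complex_scope.

(* Not necessarily unital; this is why the product is a separate operation
   and not the one of a MathComp ring. *)
HB.mixin Record isCStarAlgebra (R : realType) A
    of CompleteNormedModule R[i] A := {
  cmul : A -> A -> A;
  cstar : A -> A;
  cmulA : forall a b c, cmul a (cmul b c) = cmul (cmul a b) c;
  cmul_linearl : forall (k : R[i]) a a' b,
    cmul (k *: a + a') b = k *: cmul a b + cmul a' b;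
  cmul_linearr : forall (k : R[i]) a b b',
    cmul a (k *: b + b') = k *: cmul a b + cmul a b';
  cstarK : forall a, cstar (cstar a) = a;
  cstar_antilinear : forall (k : R[i]) a b,
    cstar (k *: a + b) = (Num.conj k) *: cstar a + cstar b;
  cstarM : forall a b, cstar (cmul a b) = cmul (cstar b) (cstar a);
  cmul_norm : forall a b, `|cmul a b| <= `|a| * `|b|;
  cstar_norm : forall a, `|cmul (cstar a) a| = `|a| ^+ 2
}.

#[short(type="cstarAlgType")]
HB.structure Definition CStarAlgebra (R : realType) :=
  { A of isCStarAlgebra R A & CompleteNormedModule R[i] A }.

Definition cpos (R : realType) (A : cstarAlgType R) (a : A) : Prop :=
  exists b : A, a = cmul (cstar b) b.

HB.mixin Record isHilbertSpace (R : realType) H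
    of CompleteNormedModule R[i] H := {
  hip : H -> H -> R[i];
  hip_linearr : forall (k : R[i]) x y y',
    hip x (k *: y + y') = k * hip x y + hip x y';
  hip_conj : forall x y, hip x y = Num.conj (hip y x);
  hip_norm : forall x, hip x x = `|x| ^+ 2
}.

#[short(type="hilbertType")]
HB.structure Definition HilbertSpace (R : realType) :=
  { H of isHilbertSpace R H & CompleteNormedModule R[i] H }.

HB.mixin Record isHilbertModule (R : realType) (A : cstarAlgType R) F
    of CompleteNormedModule R[i] F := {
  ract : F -> A -> F;
  mip : F -> F -> A;
  ract_linearl : forall (k : R[i]) x x' a,
    ract (k *: x + x') a = k *: ract x a + ract x' a;
  ract_linearr : forall (k : R[i]) x a a',
    ract x (k *: a + a') = k *: ract x a + ract x a';
  ractM : forall x a b, ract x (cmul a b) = ract (ract x a) b;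
  mip_linearr : forall (k : R[i]) x y y',
    mip x (k *: y + y') = k *: mip x y + mip x y';
  mip_ract : forall x y a, mip x (ract y a) = cmul (mip x y) a;
  mip_star : forall x y, mip x y = cstar (mip y x);
  mip_pos : forall x, cpos (mip x x);
  mip_norm : forall x, `|mip x x| = `|x| ^+ 2
}.

#[short(type="hilbertModType")]
HB.structure Definition HilbertModule (R : realType) (A : cstarAlgType R) :=
  { F of isHilbertModule R A F & CompleteNormedModule R[i] F }.

(* [lact_adj] says at once that every [lact a] is adjointable and that
   [lact], as a map into the adjointable operators, preserves adjoints. *)
HB.mixin Record isCorrespondence (R : realType) (A : cstarAlgType R) F
    of HilbertModule R A F := {
  lact : A -> F -> F;
  lact_linear : forall (k : R[i]) a b x,
    lact (k *: a + b) x = k *: lact a x + lact b x;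
  lactM : forall a b x, lact (cmul a b) x = lact a (lact b x);
  lact_adj : forall a x y, mip (lact a x) y = mip x (lact (cstar a) y)
}.

#[short(type="corrType")]
HB.structure Definition Correspondence (R : realType) (A : cstarAlgType R) :=
  { F of isCorrespondence R A F & HilbertModule R A F }.

Definition self_corr (R : realType) (A : cstarAlgType R) : Type := A.

Section SelfCorrespondence.
Variables (R : realType) (A : cstarAlgType R).

HB.instance Definition _ := CompleteNormedModule.on (self_corr A).

Let sact (x : self_corr A) (a : A) : self_corr A := cmul (x : A) a.
Let sip (x y : self_corr A) : A := cmul (cstar (x : A)) (y : A).
Let slact (a : A) (x : self_corr A) : self_corr A := cmul a (x : A).

Let sact_linearl (k : R[i]) x x' a :
  sact (k *: x + x') a = k *: sact x a + sact x' a.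
Proof. exact: cmul_linearl. Qed.
Let sact_linearr (k : R[i]) x a a' :
  sact x (k *: a + a') = k *: sact x a + sact x a'.
Proof. exact: cmul_linearr. Qed.
Let sactM x a b : sact x (cmul a b) = sact (sact x a) b.
Proof. exact: cmulA. Qed.
Let sip_linearr (k : R[i]) x y y' :
  sip x (k *: y + y') = k *: sip x y + sip x y'.
Proof. exact: cmul_linearr. Qed.
Let sip_ract x y a : sip x (sact y a) = cmul (sip x y) a.
Proof. exact: cmulA. Qed.
Let sip_star x y : sip x y = cstar (sip y x).
Proof. by rewrite /sip cstarM cstarK. Qed.
Let sip_pos x : cpos (sip x x).
Proof. by exists x. Qed.
Let sip_norm x : `|sip x x| = `|x| ^+ 2.
Proof. exact: cstar_norm. Qed.

HB.instance Definition _ := isHilbertModule.Build R A (self_corr A)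
  sact_linearl sact_linearr sactM sip_linearr sip_ract sip_star sip_pos
  sip_norm.

Let slact_linear (k : R[i]) a b x :
  slact (k *: a + b) x = k *: slact a x + slact b x.
Proof. exact: cmul_linearl. Qed.
Let slactM a b x : slact (cmul a b) x = slact a (slact b x).
Proof. by rewrite /slact cmulA. Qed.
Let slact_adj a x y : mip (slact a x) y = mip x (slact (cstar a) y).
Proof. by rewrite /mip /= /sip /slact cstarM cmulA. Qed.

HB.instance Definition _ := isCorrespondence.Build R A (self_corr A)
  slact_linear slactM slact_adj.

End SelfCorrespondence.

Definition lspan (R : realType) (V : lmodType R[i]) (S : set V) : set V :=
  [set x | exists (n : nat) (c : 'I_n -> R[i]) (v : 'I_n -> V),
     (forall i, S (v i)) /\ x = \sum_(i < n) c i *: v i].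

(* The next definitions take an inner product [ip : F -> F -> V] as a
   parameter; they are used with [hip] (V the complex numbers), with [mip],
   and with [link_ip] below. *)
Section Operators.
Variables (F : zmodType) (V : Type) (ip : F -> F -> V).

Definition is_adjoint (a b : F -> F) : Prop :=
  forall x y, ip (a x) y = ip x (b y).

(* The adjoint is unique when [ip] is definite. *)
Definition adj (a : F -> F) : F -> F := xget (fun=> 0) (is_adjoint a).

Definition adjointable : set (F -> F) := [set a | exists b, is_adjoint a b].

End Operators.

(* Matrices of operators act on F^k, with inner product
   <x, y> = \sum_i <x_i, y_i>. *)
Section MatricesOfOperators.
Variables (R : realType) (V : normedZmodType R[i]) (F : zmodType).
Variables (ip : F -> F -> V) (k : nat).

Definition mxapp (a : 'M[F -> F]_k) (x : 'I_k -> F) : 'I_k -> F :=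
  fun i => \sum_j a i j (x j).

Definition ipn (x y : 'I_k -> F) : V := \sum_i ip (x i) (y i).

(* The operator norm of [a] is at most [c]. *)
Definition mxnorm_le (a : 'M[F -> F]_k) (c : R[i]) : Prop :=
  forall x : 'I_k -> F,
    `|ipn (mxapp a x) (mxapp a x)| <= c ^+ 2 * `|ipn x x|.

(* [a = b^* b] in the matrices over [L], an algebra of operators closed
   under adjoints. *)
Definition mxpos (L : set (F -> F)) (a : 'M[F -> F]_k) : Prop :=
  exists b : 'M[F -> F]_k, (forall i j, L (b i j)) /\
    forall i j, a i j = \sum_l (adj ip (b l i) \o b l j).

End MatricesOfOperators.

Section OperatorNorm.
Variables (R : realType) (F : normedModType R[i]).

Definition bounded_op : set (F -> F) :=
  [set a | linear a /\ exists c : R[i], forall x, `|a x| <= c * `|x|].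

Definition opclosure (S : set (F -> F)) : set (F -> F) :=
  [set a | forall e : R[i], 0 < e ->
     exists2 b, S b & forall x, `|a x - b x| <= e * `|x|].

End OperatorNorm.

(* The element [x] of [F] inside the linking algebra, as an operator on the
   direct sum of [A] and [F]. *)
Section Linking.
Variables (R : realType) (A : cstarAlgType R) (F : hilbertModType A).

Definition link_ip (p q : A * F) : A :=
  cmul (cstar p.1) q.1 + mip p.2 q.2.

Definition link (x : F) (p : A * F) : A * F := (0, ract x p.1).

End Linking.

Section Representations.
Variables (R : realType) (A : cstarAlgType R) (H : hilbertType R).

Record is_rep (sigma : A -> H -> H) : Prop := {
  rep_bounded : forall a, bounded_op (sigma a);
  rep_linear : forall (k : R[i]) a b,
    sigma (k *: a + b) = k *: sigma a + sigma b;
  rep_mul : forall a b, sigma (cmul a b) = sigma a \o sigma b;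
  rep_star : forall a, is_adjoint (@hip R H) (sigma a) (sigma (cstar a));
  rep_nondegenerate :
    closure (lspan [set x | exists a h, x = sigma a h]) = setT
}.

End Representations.

Section WeakTopologies.
Variables (R : realType).

Definition weak_closure (V : Type) (Phi : set (V -> R[i])) (S : set V) :
    set V :=
  [set x | forall (n : nat) (f : 'I_n -> V -> R[i]) (e : R[i]),
     (forall i, Phi (f i)) -> 0 < e ->
     exists2 y, S y & forall i, `|f i x - f i y| < e].

Definition weak_continuous (V W : Type) (Phi : set (V -> R[i]))
    (Psi : set (W -> R[i])) (t : V -> W) : Prop :=
  forall (x : V) (g : W -> R[i]) (e : R[i]), Psi g -> 0 < e ->
    exists (n : nat) (f : 'I_n -> V -> R[i]) (d : R[i]),
      [/\ forall i, Phi (f i), 0 < d &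
        forall y, (forall i, `|f i x - f i y| < d) ->
          `|g (t x) - g (t y)| < e].

Definition csum_to (u : nat -> R[i]) (l : R[i]) : Prop :=
  forall e : R[i], 0 < e ->
    exists N, forall n, (N <= n)%N -> `|\sum_(i < n) u i - l| < e.

Definition nnsummable (u : nat -> R[i]) : Prop :=
  exists c : R[i], forall n, \sum_(i < n) u i <= c.

(* Ultraweakly continuous functionals on B(H) (only their values on bounded
   operators are constrained). *)
Definition ultraweak (H : hilbertType R) : set ((H -> H) -> R[i]) :=
  [set w | exists h k : nat -> H,
     [/\ nnsummable (fun i => `|h i| ^+ 2), nnsummable (fun i => `|k i| ^+ 2) &
       forall a, bounded_op a -> csum_to (fun i => hip (h i) (a (k i))) (w a)]].

(* [pi] realizes [A] as a von Neumann algebra on [K]: it is faithful and its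
   range is nondegenerate and equal to its bicommutant. *)
Record is_von_neumann (A : cstarAlgType R) (K : hilbertType R)
    (pi : A -> K -> K) : Prop := {
  vn_rep : is_rep pi;
  vn_faithful : injective pi;
  vn_bicommutant : forall b : K -> K, bounded_op b ->
    (forall c : K -> K, bounded_op c ->
       (forall a, pi a \o c = c \o pi a) -> b \o c = c \o b) ->
    exists a, b = pi a
}.

Definition predual (A : cstarAlgType R) (K : hilbertType R)
    (pi : A -> K -> K) : set (A -> R[i]) :=
  [set w | exists2 v, ultraweak v & w = v \o pi].

(* In the following two definitions [Astar] is the predual of [A], and [c i]
   is (an upper bound of) the norm of [w i]. *)
Definition sigma_functional (A : cstarAlgType R) (Astar : set (A -> R[i]))
    (F : hilbertModType A) : set (F -> R[i]) :=
  [set f | exists (w : nat -> A -> R[i]) (y : nat -> F) (c : nat -> R[i]),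
     [/\ forall i, Astar (w i),
         forall i a, `|w i a| <= c i * `|a|,
         forall i, 0 <= c i,
         nnsummable (fun i => c i * `|y i|) &
         forall x, csum_to (fun i => w i (mip (y i) x)) (f x)]].

(* Ultraweakly continuous functionals on the adjointable operators of a
   self-dual module. *)
Definition op_functional (A : cstarAlgType R) (Astar : set (A -> R[i]))
    (F : hilbertModType A) : set ((F -> F) -> R[i]) :=
  [set f | exists (w : nat -> A -> R[i]) (y z : nat -> F) (c : nat -> R[i]),
     [/\ forall i, Astar (w i),
         forall i a, `|w i a| <= c i * `|a|,
         forall i, 0 <= c i,
         nnsummable (fun i => c i * `|y i| * `|z i|) &
         forall b, adjointable (@mip R A F) b ->
           csum_to (fun i => w i (mip (y i) (b (z i)))) (f b)]].

Definition self_dual (A : cstarAlgType R) (F : hilbertModType A) : Prop :=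
  forall f : F -> A,
    (forall (k : R[i]) x y, f (k *: x + y) = k *: f x + f y) ->
    (forall x a, f (ract x a) = cmul (f x) a) ->
    (exists c : R[i], forall x, `|f x| <= c * `|x|) ->
    exists y, forall x, f x = mip y x.

End WeakTopologies.

Inductive setting (R : realType) (M : cstarAlgType R) : Type :=
| CStarSetting
| WStarSetting (K : hilbertType R) (pi : M -> K -> K) of is_von_neumann pi.

Arguments CStarSetting {R M}.

Section Settings.
Variables (R : realType) (M : cstarAlgType R) (s : setting M).

Definition module_ok (F : hilbertModType M) : Prop :=
  if s is WStarSetting _ _ _ then self_dual F else True.

Definition corr_ok (F : corrType M) : Prop :=
  if s is WStarSetting _ pi _ then
    self_dual F /\
    weak_continuous (predual pi) (@op_functional R M (predual pi) F) (@lact R M F)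
  else True.

(* The self-dual completion of a submodule of a self-dual module is its
   closure in the sigma-topology. *)
Definition mod_closure (F : hilbertModType M) (S : set F) : set F :=
  if s is WStarSetting _ pi _ then
    weak_closure (@sigma_functional R M (predual pi) F) S
  else closure S.

Definition rep_ok (H : hilbertType R) (sigma : M -> H -> H) : Prop :=
  if s is WStarSetting _ pi _ then
    weak_continuous (predual pi) (@ultraweak R H) sigma
  else True.

Definition maps_ok (F : hilbertModType M) (H : hilbertType R)
    (t : F -> H -> H) : Prop :=
  if s is WStarSetting _ pi _ then
    weak_continuous (@sigma_functional R M (predual pi) F) (@ultraweak R H) t
  else True.

(* [t] exhibits [G] as the tensor product of [E] and [F], which determines
   [G] up to a unique unitary bimodule map. *)
Record is_tensor (E F G : corrType M) (t : E -> F -> G) : Prop := {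
  tensor_linearl : forall (k : R[i]) x x' y,
    t (k *: x + x') y = k *: t x y + t x' y;
  tensor_linearr : forall (k : R[i]) x y y',
    t x (k *: y + y') = k *: t x y + t x y';
  tensor_balanced : forall x a y, t (ract x a) y = t x (lact a y);
  tensor_lact : forall a x y, lact a (t x y) = t (lact a x) y;
  tensor_ract : forall a x y, ract (t x y) a = t x (ract y a);
  tensor_mip : forall x x' y y',
    mip (t x y) (t x' y') = mip y (lact (mip x x') y');
  tensor_total : mod_closure (lspan [set z | exists x y, z = t x y]) = setT
}.

Record is_bimodule_isometry (E F : corrType M) (u : E -> F) : Prop := {
  isom_linear : linear u;
  isom_lact : forall a x, u (lact a x) = lact a (u x);
  isom_ract : forall x a, u (ract x a) = ract (u x) a;
  isom_mip : forall x y, mip (u x) (u y) = mip x y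
}.

(* [X n] is embedded by [incl n] in [pw n], the n-th tensor power of E = X(1);
   the identifications of the tensor product of [pw n] and [pw m] with
   [pw (n + m)] are given by [tens]. *)
Record subproduct := Subproduct {
  fiber :> nat -> corrType M;
  pw : nat -> corrType M;
  tens : forall n m, pw n -> pw m -> pw (n + m)%N;
  incl : forall n, fiber n -> pw n;
  (* the identification of M with X(0) *)
  unitX : self_corr M -> fiber 0;
  fiber_ok : forall n, corr_ok (fiber n);
  pw_ok : forall n, corr_ok (pw n);
  tens_tensor : forall n m, is_tensor (@tens n m);
  tensA : forall n m l (x : pw n) (y : pw m) (z : pw l),
    tens x (tens y z) =
    ecast i (pw i) (esym (addnA n m l)) (tens (tens x y) z);
  incl_isom : forall n, is_bimodule_isometry (@incl n);
  (* E^0 = X(0) and E^1 = X(1) *)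
  incl0_surj : forall z, exists x, incl (n := 0) x = z;
  incl1_surj : forall z, exists x, incl (n := 1) x = z;
  unitX_isom : is_bimodule_isometry unitX;
  unitX_surj : forall x, exists a, unitX a = x;
  tens1x : forall n (a : M) (x : pw n), tens (incl (unitX a)) x = lact a x;
  tensx1 : forall n (a : M) (x : pw n),
    ecast i (pw i) (addn0 n) (tens x (incl (unitX a))) = ract x a;
  (* X(n+m) is contained in the tensor product of X(n) and X(m), realized as
     a submodule of [pw (n + m)], and is orthogonally complemented there *)
  sub_tensor : forall n m (x : fiber (n + m)%N),
    mod_closure
      (lspan [set z | exists (y : fiber n) (y' : fiber m),
                        z = tens (incl y) (incl y')])
      (incl x);
  sub_complemented : forall n m (z : pw (n + m)%N),
    mod_closure
      (lspan [set z' | exists (y : fiber n) (y' : fiber m),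
                         z' = tens (incl y) (incl y')])
      z ->
    exists x : fiber (n + m)%N, forall y, mip (incl y) (z - incl x) = 0
}.

End Settings.

Section Systems.
Variables (R : realType) (M : cstarAlgType R) (s : setting M).
Variable X : subproduct s.

(* The orthogonal projection p_n of [pw n] onto X(n), with values seen in
   [X n]. *)
Definition proj n (z : pw X n) : X n :=
  xget 0 [set x | forall y : X n, mip (incl y) (z - incl x) = 0].

Definition sprod n m (x : X n) (y : X m) : X (n + m)%N :=
  proj (tens (incl x) (incl y)).

Record is_cc_rep (H : hilbertType R) (T : forall n, X n -> H -> H) : Prop := {
  ccr_bounded : forall n x, bounded_op (T n x);
  ccr_linear : forall n (k : R[i]) x y,
    T n (k *: x + y) = k *: T n x + T n y;
  ccr_rep : is_rep (fun a : M => T 0%N (unitX X a));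
  ccr_contractive : forall n k (x : 'M[X n]_k) (c : R[i]), 0 <= c ->
    mxnorm_le (@link_ip R M (X n)) (map_mx (@link R M (X n)) x) c ->
    mxnorm_le (V := R[i]) (@hip R H) (map_mx (T n) x) c;
  ccr_ract : forall n x a, T n (ract x a) = T n x \o T 0%N (unitX X a);
  ccr_lact : forall n x a, T n (lact a x) = T 0%N (unitX X a) \o T n x;
  ccr_mul : forall n m (x : X n) (y : X m),
    T (n + m)%N (sprod x y) = T n x \o T m y;
  ccr_normal : rep_ok s (fun a : M => T 0%N (unitX X a));
  ccr_continuous : forall n, maps_ok s (T n)
}.

(* The direct sum of the X(n) in the given setting, which is unique up to
   a unitary module map. *)
Record fock := Fock {
  fock_mod :> hilbertModType M;
  fock_in : forall n, X n -> fock_mod;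
  fock_ok : module_ok s fock_mod;
  fock_linear : forall n, linear (@fock_in n);
  fock_ract : forall n (x : X n) a, fock_in (ract x a) = ract (fock_in x) a;
  fock_isom : forall n (x y : X n), mip (fock_in x) (fock_in y) = mip x y;
  fock_orth : forall n m (x : X n) (y : X m),
    n != m -> mip (fock_in x) (fock_in y) = 0;
  fock_total :
    mod_closure s (lspan [set z | exists n (x : X n), z = fock_in x]) = setT
}.

Variable F : fock.

Definition shift n (x : X n) : F -> F :=
  xget (fun=> 0) [set a | adjointable (@mip R M F) a /\
    forall m (y : X m), a (fock_in F y) = fock_in F (sprod x y)].

Definition is_closed_subalgebra (B : set (F -> F)) : Prop :=
  [/\ B `<=` adjointable (@mip R M F), B 0,
      forall (k : R[i]) a b, B a -> B b -> B (k *: a + b),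
      forall a b, B a -> B b -> B (a \o b) &
      opclosure B `<=` B].

Definition tensor_algebra : set (F -> F) :=
  smallest is_closed_subalgebra [set a | exists n (x : X n), a = shift x].

Definition has_unit (B : set (F -> F)) : Prop :=
  exists2 e, B e & forall a, B a -> e \o a = a /\ a \o e = a.

Definition unitization (B : set (F -> F)) : set (F -> F) :=
  [set a | (has_unit B /\ B a) \/
           (~ has_unit B /\
            exists (b : F -> F) (k : R[i]), B b /\ a = b + k *: idfun)].

Definition operator_system : set (F -> F) :=
  opclosure (lspan [set c | exists a b,
    [/\ unitization tensor_algebra a, unitization tensor_algebra b &
        c = a \o adj (@mip R M F) b]]).

(* The values of [Psi] outside the operator system are irrelevant. *)
Section MapsOnOperatorSystem.
Variables (H : hilbertType R) (Psi : (F -> F) -> (H -> H)).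

Definition bounded_valued : Prop :=
  forall a, operator_system a -> bounded_op (Psi a).

Definition linear_map : Prop :=
  forall (k : R[i]) a b, operator_system a -> operator_system b ->
    Psi (k *: a + b) = k *: Psi a + Psi b.

Definition completely_positive : Prop :=
  forall k (a : 'M[F -> F]_k), (forall i j, operator_system (a i j)) ->
    mxpos (@mip R M F) (adjointable (@mip R M F)) a ->
    mxpos (V := R[i]) (@hip R H) (@bounded_op R H) (map_mx Psi a).

Definition completely_contractive : Prop :=
  forall k (a : 'M[F -> F]_k) (c : R[i]),
    (forall i j, operator_system (a i j)) -> 0 <= c ->
    mxnorm_le (@mip R M F) a c ->
    mxnorm_le (V := R[i]) (@hip R H) (map_mx Psi a) c.

End MapsOnOperatorSystem.

Record is_poisson_map (H : hilbertType R) (T : forall n, X n -> H -> H)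
    (Psi : (F -> F) -> (H -> H)) : Prop := {
  pm_bounded : bounded_valued Psi;
  pm_linear : linear_map Psi;
  pm_unital : Psi idfun = idfun;
  pm_cp : completely_positive Psi;
  pm_cc : completely_contractive Psi;
  pm_shift : forall n (x : X n), Psi (shift x) = T n x;
  pm_shift_adj : forall n (x : X n),
    Psi (adj (@mip R M F) (shift x)) = adj (@hip R H) (T n x);
  pm_mul : forall a b, tensor_algebra a -> operator_system b ->
    Psi (a \o b) = Psi a \o Psi b
}.

End Systems.

(* Main.v *)
(* Let T~_n map the tensor product of X(n) and H over sigma = T_0 to H by x (x)
   h |-> T_n(x) h; it is a contraction. For 0 <= r < 1 put D_r = 1 - r^2 P with
   P = T~_1 T~_1^*; it is positive and commutes with sigma. Let Q(x (x) h) =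
   r^n T_n(x) D_r h for x in X(n), on the tensor product of the Fock module and
   H, with the inner product twisted by D_r, so that no square root of D_r is
   needed. Since T~_n (1 (x) P) T~_n^* = T~_(n+1) T~_(n+1)^*, the sum Q Q^*
   telescopes to 1, so that Q^* is an isometry; moreover Q (S_n(x) (x) 1) = r^n
   T_n(x) Q. Hence a |-> Q (a (x) 1) Q^*, a unital, completely positive and
   completely contractive map, sends S_n(x) S_m(y)^* to r^(n+m) T_n(x)
   T_m(y)^*, and the required map is its limit as r -> 1. It is multiplicative
   in the first argument because T is, and it is unique because the products
   S_n(x) S_m(y)^*, together with the S_n(x), their adjoints and the identity,
   span a dense subspace of the operator system.

   No completed tensor product is formed: vectors are finite formal sums under
   a positive semidefinite form, and Q^* h is replaced by formal sums
   representing the functional u |-> <h, Q u> up to a small error. *)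
From HB Require Import structures.
Require Import Defs.
From mathcomp Require Import all_boot all_order all_algebra.
From mathcomp Require Import complex.
From mathcomp Require Import all_classical reals topology normedtype.
From mathcomp Require Import ring lra.
Set Implicit Arguments.
Unset Strict Implicit.
Unset Printing Implicit Defensive.
Import Order.TTheory GRing.Theory Num.Theory.
Import numFieldNormedType.Exports.
Local Open Scope classical_set_scope.
Local Open Scope ring_scope.
Local Open Scope complex_scope.

(** The cut-off [r < 1] makes the telescoping sum close up: after [N] degrees the remainder is
    [r^(2N) T~_N T~_N^*], which tends to 0 in norm, whereas for [r = 1] it may have a nonzero limit.
    Complete contractivity of [T] enters through the contractivity of each [T~_n]; that of the
    resulting map comes from the compression, by letting matrices act on tuples of Fock vectors.
    Positivity is derived from the norm, without spectra, for an abstract C*-ring, because it is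
    applied to three kinds of rings: the unitization of [M], matrices over it, and operators on
    tuples of Hilbert space vectors. The two settings differ in how limits are taken. Estimates on
    formal sums see a module element [x] through the numbers [<k, sigma(<x, x>) k>], and in these
    seminorms a subspace is dense in its sigma-closure as soon as [sigma] is normal. This confines
    the W*-setting to a few lemmas on closures and to the existence of adjoints and shifts. *)

Local Notation incl := Defs.incl.

(* Identities in abelian groups, to which [ring] does not apply, are decided by
   comparing the coefficients of both sides. *)
Inductive zexpr : Type :=
| ZVar of nat | ZZero | ZAdd of zexpr & zexpr | ZOpp of zexpr
| ZMuln of zexpr & nat.

Fixpoint zeval (V : zmodType) (env : seq V) (e : zexpr) : V :=
  match e with
  | ZVar n => nth 0 env n
  | ZZero => 0
  | ZAdd a b => zeval env a + zeval env b
  | ZOpp a => - zeval env a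
  | ZMuln a n => zeval env a *+ n
  end.

Fixpoint zcoef (e : zexpr) (n : nat) : int :=
  match e with
  | ZVar m => (m == n)%:Z
  | ZZero => 0
  | ZAdd a b => zcoef a n + zcoef b n
  | ZOpp a => - zcoef a n
  | ZMuln a m => zcoef a n *+ m
  end.

Lemma zevalE (V : zmodType) (env : seq V) e :
  zeval env e = \sum_(i < size env) env`_i *~ zcoef e i.
Proof.
elim: e => [n||a IHa b IHb|a IHa|a IHa m] /=.
- case: (ltnP n (size env)) => hn; last first.
    rewrite nth_default // big1 // => i _.
    by rewrite (_ : (n == i) = false) ?mulr0z //; apply/eqP => e; move: (ltn_ord i); rewrite -e ltnNge hn.
  rewrite (bigD1 (Ordinal hn)) //= eqxx mulr1z big1 ?addr0 // => i /eqP ne.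
  by rewrite (_ : (n == i) = false) ?mulr0z //; apply/eqP => e; apply: ne; apply/val_inj.
- by rewrite big1.
- by rewrite IHa IHb -big_split; apply: eq_bigr => i _; rewrite mulrzDr.
- by rewrite IHa -sumrN; apply: eq_bigr => i _; rewrite mulrNz.
- by rewrite IHa -sumrMnl; apply: eq_bigr => i _; rewrite -mulr_natr mulrzA mulrz_nat.
Qed.

Lemma zexpr_eq (V : zmodType) (env : seq V) a b :
  all (fun i => zcoef a i == zcoef b i) (iota 0 (size env)) ->
  zeval env a = zeval env b.
Proof.
move=> /allP h; rewrite !zevalE; apply: eq_bigr => i _.
by rewrite (eqP (h i _)) // mem_iota ltn_ord.
Qed.

Ltac zlookup x l :=
  match l with
  | ?y :: ?l' =>
    match constr:(tt) with
    | _ => let _ := match constr:(tt) with _ => unify x y end in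
           constr:(Some 0%N)
    | _ => match zlookup x l' with
           | Some ?n => constr:(Some (S n))
           | None => constr:(@None nat) end
    end
  | _ => constr:(@None nat)
  end.

Ltac zappend x l :=
  match l with
  | ?y :: ?l' => let r := zappend x l' in constr:(y :: r)
  | _ => constr:([:: x])
  end.

Ltac zlen l := match l with | _ :: ?l' => let n := zlen l' in constr:(S n) | _ => constr:(0%N) end.

Ltac zreify env t :=
  match t with
  | (?a + ?b)%R => match zreify env a with
      | (?env1, ?ea) => match zreify env1 b with
         | (?env2, ?eb) => constr:((env2, ZAdd ea eb)) end end
  | (- ?a)%R => match zreify env a with
      | (?env1, ?ea) => constr:((env1, ZOpp ea)) end
  | (?a *+ ?n)%R => match zreify env a with
      | (?env1, ?ea) => constr:((env1, ZMuln ea n)) end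
  | 0%R => constr:((env, ZZero))
  | _ => match zlookup t env with
         | Some ?n => constr:((env, ZVar n))
         | None => let n := zlen env in let env' := zappend t env in
                   constr:((env', ZVar n))
         end
  end.

Ltac zabel :=
  match goal with
  | |- @eq ?T ?a ?b =>
    let env0 := constr:(@nil T) in
    match zreify env0 a with
    | (?env1, ?ea) => match zreify env1 b with
      | (?env2, ?eb) =>
         refine (@zexpr_eq _ env2 ea eb _); vm_compute; reflexivity
      end
    end
  end.

Ltac nabel := rewrite ?(mulrDl, mulrDr, mulNr, mulrN, opprD, opprK, mulr1, mul1r, mulr0, mul0r, mulrnAl, mulrnAr, mulrA); zabel.

(** * Real estimates and moduli of complex numbers *)

Lemma archi_inv (R : realType) (c e : R) : 0 < e ->
  exists N, forall n, (N <= n)%N -> c / n.+1%:R <= e.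
Proof.
move=> e0; exists (Num.bound (`|c| / e)) => n Nn.
have h : `|c| / e < n.+1%:R.
  apply: (lt_le_trans (archi_boundP _)); first by rewrite divr_ge0 ?normr_ge0 ?ltW.
  by rewrite ler_nat; apply: leq_trans Nn _.
rewrite ler_pdivrMr ?ltr0Sn //; move: h; rewrite ltr_pdivrMr // => h.
by rewrite mulrC; apply: (le_trans (ler_norm c)); apply: ltW.
Qed.

(** Each of the [n] terms of [(1 - q) (1 + q + ... + q^(n-1)) = 1 - q^n] is at least [(1 - q) q^n].
    For [q < 1] this gives the explicit rate [q^n <= 1 / (n (1 - q))]. *)
Lemma expr_lt1_small (R : realType) (q : R) n : 0 <= q -> q <= 1 ->
  n%:R * q ^+ n * (1 - q) <= 1 - q ^+ n.
Proof.
move=> q0 q1; elim: n => [|n IH]; first by rewrite !mul0r expr0 subrr.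
have qn0 : 0 <= q ^+ n by apply: exprn_ge0.
have qn1 : q ^+ n <= 1 by apply: exprn_ile1.
rewrite exprS -natr1; set a := n%:R in IH *; set b := q ^+ n in IH qn0 qn1 *.
have := ler_wpM2l q0 IH => h.
have h2 : (a + 1) * (q * b) * (1 - q) = q * (a * b * (1 - q)) + q * b * (1 - q) by ring.
rewrite h2; have : 0 <= (1 - q) * (1 - q * b) by apply: mulr_ge0; nra.
nra.
Qed.

(** The norm of [R[i]] has values in [R[i]]; a modulus in [R] is within reach of [lra] and [nra].
    The same purpose is served by [rnorm] below. *)
Definition cabs (R : realType) (k : R[i]) : R := complex.Re `|k|.

Lemma cabsE (R : realType) (k : R[i]) : `|k| = (cabs k)%:C.
Proof. by rewrite /cabs RRe_real ?normr_real. Qed.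

Lemma cabs_ge0 (R : realType) (k : R[i]) : 0 <= cabs k.
Proof. by rewrite -ler0c -cabsE. Qed.

Lemma cabs_real (R : realType) (t : R) : cabs t%:C = `|t|.
Proof. by rewrite /cabs normc_def /= expr0n addr0 sqrtr_sqr. Qed.

Lemma cabsM (R : realType) (k l : R[i]) : cabs (k * l) = cabs k * cabs l.
Proof. by apply: complexI; rewrite -cabsE normrM rmorphM /= -!cabsE. Qed.

Lemma cabsD (R : realType) (k l : R[i]) : cabs (k + l) <= cabs k + cabs l.
Proof. by rewrite -lecR rmorphD /= -!cabsE ler_normD. Qed.

Lemma cabs_conj (R : realType) (k : R[i]) : cabs k^* = cabs k.
Proof. by rewrite /cabs normcJ. Qed.

(** * Unital C*-rings *)

Section CStarRing.
Variables (R : realType) (B : nzRingType).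
Variables (sc : R[i] -> B) (st : B -> B) (nr : B -> R).

(** A predicate on a ring with explicit scalars, star and norm, so that one theory of positivity
    serves [unitz_cstar], [matrix_cstar] and [opr_cstar]. Scalars form a central image of [R[i]].
    The C*-identity and the norm of scalars are required as inequalities; the equalities [nr_st],
    [nr_sq] and [nr_rsE] follow. *)
Record cstar_ring : Prop := {
  sc1 : sc 1 = 1;
  scD : forall k l, sc (k + l) = sc k + sc l;
  scM : forall k l, sc (k * l) = sc k * sc l;
  scC : forall k x, x * sc k = sc k * x;
  stD : forall x y, st (x + y) = st x + st y;
  stM : forall x y, st (x * y) = st y * st x;
  stK : forall x, st (st x) = x;
  st_sc : forall k, st (sc k) = sc k^*;
  nr_ge0 : forall x, 0 <= nr x;
  nrD : forall x y, nr (x + y) <= nr x + nr y;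
  nrM : forall x y, nr (x * y) <= nr x * nr y;
  nr_sc : forall k, nr (sc k) <= cabs k;
  nr_cstar : forall x, nr x ^+ 2 <= nr (st x * x);
  nr_eq0 : forall x, nr x = 0 -> x = 0;
  nr_complete : forall u : nat -> B,
    (forall e, 0 < e -> exists N, forall m n, (N <= m)%N -> (N <= n)%N ->
       nr (u m - u n) <= e) ->
    exists l, forall e, 0 < e -> exists N, forall n, (N <= n)%N ->
       nr (u n - l) <= e
}.

Hypothesis CB : cstar_ring.

Definition real_sc (t : R) : B := sc t%:C.

Let iB : B := sc 'i.

Lemma scCA k x y : x * (sc k * y) = sc k * (x * y).
Proof. by rewrite mulrA (scC CB) mulrA. Qed.

Lemma sc0 : sc 0 = 0.
Proof. by apply: (addrI (sc 0)); rewrite -(scD CB) !addr0. Qed.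

Lemma scN k : sc (- k) = - sc k.
Proof. by apply: (addrI (sc k)); rewrite -(scD CB) !subrr sc0. Qed.

Lemma rs1 : real_sc 1 = 1. Proof. exact: (sc1 CB). Qed.
Lemma rs0 : real_sc 0 = 0. Proof. exact: sc0. Qed.
Lemma rsD s t : real_sc (s + t) = real_sc s + real_sc t.
Proof. by rewrite /real_sc rmorphD (scD CB). Qed.
Lemma rsN t : real_sc (- t) = - real_sc t.
Proof. by rewrite /real_sc rmorphN scN. Qed.
Lemma rsB s t : real_sc (s - t) = real_sc s - real_sc t.
Proof. by rewrite rsD rsN. Qed.
Lemma rsM s t : real_sc (s * t) = real_sc s * real_sc t.
Proof. by rewrite /real_sc rmorphM (scM CB). Qed.
Lemma rsC t x : x * real_sc t = real_sc t * x. Proof. exact: (scC CB). Qed.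
Lemma rsCA t x y : x * (real_sc t * y) = real_sc t * (x * y). Proof. exact: scCA. Qed.

Lemma st0 : st 0 = 0.
Proof. by apply: (addrI (st 0)); rewrite -(stD CB) !addr0. Qed.
Lemma stN x : st (- x) = - st x.
Proof. by apply: (addrI (st x)); rewrite -(stD CB) !subrr st0. Qed.
Lemma stB x y : st (x - y) = st x - st y.
Proof. by rewrite (stD CB) stN. Qed.
Lemma st_rs t : st (real_sc t) = real_sc t.
Proof. by rewrite /real_sc (st_sc CB) conjc_real. Qed.
Lemma st1 : st 1 = 1.
Proof. by rewrite -rs1 st_rs. Qed.

Lemma iB2 : iB * iB = -1.
Proof. by rewrite -(scM CB) -expr2 sqr_i scN (sc1 CB). Qed.
Lemma st_iB : st iB = - iB.
Proof. by rewrite (st_sc CB) -scN; congr sc; apply/eqP; rewrite eq_complex /= oppr0 !eqxx. Qed.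
Lemma iBC x : x * iB = iB * x. Proof. exact: (scC CB). Qed.

Lemma mul_conj_commuting u s : u * s = s * u ->
  (u - iB * s) * (u + iB * s) = u * u + s * s.
Proof.
move=> us; rewrite mulrDr !mulrBl scCA us -[iB * s * (iB * s)]mulrA scCA [iB * (iB * _)]mulrA iB2.
rewrite !mulrA mulN1r mulNr; zabel.
Qed.

Lemma nr0 : nr 0 = 0.
Proof.
apply/le_anti; rewrite (nr_ge0 CB) andbT -sc0.
by apply: le_trans (nr_sc CB _) _; rewrite -[0]/(0%:C) cabs_real normr0.
Qed.

Lemma nr_scl k x : nr (sc k * x) <= cabs k * nr x.
Proof.
by apply: le_trans (nrM CB _ _) _; apply: ler_wpM2r; rewrite ?(nr_ge0 CB) ?(nr_sc CB).
Qed.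

Lemma nr_rsl t x : 0 <= t -> nr (real_sc t * x) <= t * nr x.
Proof. by move=> t0; apply: le_trans (nr_scl _ _) _; rewrite cabs_real ger0_norm. Qed.

Lemma nr_rs t : 0 <= t -> nr (real_sc t) <= t.
Proof. by move=> t0; apply: le_trans (nr_sc CB _) _; rewrite cabs_real ger0_norm. Qed.

Lemma nr_1 : nr 1 <= 1. Proof. by rewrite -rs1 nr_rs. Qed.

Lemma nrN x : nr (- x) = nr x.
Proof.
have h y : nr (- y) <= nr y.
  have -> : - y = sc (- 1) * y by rewrite scN (sc1 CB) mulN1r.
  apply: le_trans (nr_scl _ _) _;
  have -> : (-1 : R[i]) = (-1 : R)%:C by rewrite rmorphN1.
  by rewrite cabs_real normrN1 mul1r.
by apply/le_anti; rewrite h -{1}[x]opprK h.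
Qed.

Lemma nrB x y : nr (x - y) <= nr x + nr y.
Proof. by apply: le_trans (nrD CB _ _) _; rewrite nrN. Qed.

Lemma nr_distC x y : nr (x - y) = nr (y - x).
Proof. by rewrite -nrN opprB. Qed.

Lemma nr_le_dist x y : nr x <= nr y + nr (x - y).
Proof. by rewrite -{1}(subrKC y x); apply: (nrD CB). Qed.

Lemma nr_rsE t x : 0 < t -> nr (real_sc t * x) = t * nr x.
Proof.
move=> t0; apply/le_anti; rewrite nr_rsl ?(ltW t0) //=.
have {1}-> : x = real_sc t^-1 * (real_sc t * x) by rewrite mulrA -rsM mulVf ?gt_eqF // rs1 mul1r.
rewrite -ler_pdivlMl //; apply: nr_rsl; by rewrite invr_ge0 (ltW t0).
Qed.

Lemma nr_st_le x : nr (st x) <= nr x.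
Proof.
have [->|/eqP ne] := eqVneq (nr (st x)) 0; first exact: (nr_ge0 CB).
have lt : 0 < nr (st x) by rewrite lt_neqAle eq_sym (nr_ge0 CB) andbT; apply/eqP.
have := le_trans (nr_cstar CB (st x)) (nrM CB _ _).
by rewrite (stK CB) expr2 ler_pM2r.
Qed.

Lemma nr_st x : nr (st x) = nr x.
Proof. by apply/le_anti; rewrite nr_st_le -{1}[x](stK CB) nr_st_le. Qed.

Lemma nr_sq x : nr (st x * x) = nr x ^+ 2.
Proof.
apply/le_anti; rewrite (nr_cstar CB) andbT expr2.
by apply: le_trans (nrM CB _ _) _; rewrite nr_st.
Qed.

Lemma nr_small0 c x : (forall e, 0 < e -> nr x <= c * e) -> x = 0.
Proof.
move=> h; apply: (nr_eq0 CB); apply/le_anti; rewrite (nr_ge0 CB) andbT.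
apply/ler_addgt0Pr => e e0; rewrite add0r.
have c0 : 0 < `|c| + 1 by rewrite ltr_wpDl.
apply: le_trans (h (e / (`|c| + 1)) _) _; first by rewrite divr_gt0.
rewrite mulrCA ger_pMr // ler_pdivrMr // mul1r.
by apply: (le_trans (ler_norm c)); rewrite lerDl.
Qed.

Let h2 := real_sc (1 / 2).
Lemma half2 x : h2 * x + h2 * x = x.
Proof. by rewrite -mulrDl -rsD (_ : 1/2+1/2 = 1) ?rs1 ?mul1r //; field. Qed.

(** A fixed point [Y] of the step satisfies [(1 - Y)^2 = 1 - Z], so [1 - Y] is a square root of
    [1 - Z]. *)
Fixpoint sqrt_seq (Z : B) n : B :=
  if n is m.+1 then real_sc (1 / 2) * (Z + sqrt_seq Z m * sqrt_seq Z m) else 0.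

Fixpoint rsqrt_seq n : R :=
  if n is m.+1 then (1 + rsqrt_seq m ^+ 2) / 2 else 0.

Lemma rsqrt_seq_bounds n : 0 <= rsqrt_seq n <= 1.
Proof. by elim: n => [|n /andP[a b]] /=; rewrite ?lexx ?ler01 //; apply/andP; split; nra. Qed.

(** The gap [g = 1 - y] obeys [g' = g - g^2 / 2], whose solutions decay like [2 / n]. *)
Lemma rsqrt_seq_rate n : 1 - rsqrt_seq n <= 2 / n.+1%:R.
Proof.
elim: n => [|n IH] /=; first by rewrite subr0 divr1; lra.
have /andP[a b] := rsqrt_seq_bounds n.
rewrite ler_pdivlMr ?ltr0Sn //; move: IH; rewrite ler_pdivlMr ?ltr0Sn //.
rewrite -[n.+2%:R]natr1; set N : R := n.+1%:R; set y := rsqrt_seq n in a b *.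
have N1 : 1 <= N by rewrite ler1n.
move=> IH; have [h|h] := lerP ((1 - y) * (N + 1)) 2; first by nra.
nra.
Qed.

Section Sqrt.
Variable Z : B.
Hypothesis Z1 : nr Z <= 1.
Let Y := sqrt_seq Z.
Let y := rsqrt_seq.

Lemma sqrt_seq_comm c : c * Z = Z * c -> forall n, c * Y n = Y n * c.
Proof.
move=> cZ; elim=> [|n IH] /=; first by rewrite mulr0 mul0r.
rewrite mulrA rsC -!mulrA mulrDr mulrDl cZ; congr (_ * (_ + _)).
by rewrite mulrA IH -mulrA IH mulrA.
Qed.

Lemma sqrt_seq_st : st Z = Z -> forall n, st (Y n) = Y n.
Proof.
move=> sZ; elim=> [|n IH] /=; first exact: st0.
by rewrite (stM CB) (stD CB) (stM CB) IH sZ st_rs rsC.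
Qed.

Lemma nr_sqrt_seq n : nr (Y n) <= y n.
Proof.
elim: n => [|n IH]; first by rewrite nr0.
have /andP[a b] := rsqrt_seq_bounds n.
have -> : Y n.+1 = real_sc (1 / 2) * (Z + Y n * Y n) by [].
have -> : y n.+1 = (1 + y n ^+ 2) / 2 by [].
apply: le_trans (nr_rsl _ _) _; first by lra.
rewrite mulrC mul1r ler_pM2r ?invr_gt0 //.
apply: le_trans (nrD CB _ _) _; apply: lerD => //.
apply: le_trans (nrM CB _ _) _; rewrite expr2.
by apply: ler_pM; rewrite ?(nr_ge0 CB).
Qed.

(** The iterates commute, so [Y'' - Y' = (Y' - Y) (Y' + Y) / 2], the same recursion as for the real
    sequence; both factors are dominated by their real counterparts. *)
Lemma nr_sqrt_seq_step n : nr (Y n.+1 - Y n) <= y n.+1 - y n.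
Proof.
elim: n => [|n IH]; first by rewrite subr0 -[y 0]/0 subr0 nr_sqrt_seq.
rewrite [Y n.+2]/= [Y n.+1 in X in nr (_ - X)]/= -/(Y n) -/(Y n.+1).
have cc : Y n * Y n.+1 = Y n.+1 * Y n.
  by apply: sqrt_seq_comm; rewrite sqrt_seq_comm.
have -> : real_sc (1 / 2) * (Z + Y n.+1 * Y n.+1) - real_sc (1 / 2) * (Z + Y n * Y n) =
   real_sc (1 / 2) * ((Y n.+1 - Y n) * (Y n.+1 + Y n)).
  rewrite -mulrBr; congr (_ * _); rewrite mulrDr !mulrDl !mulNr cc; zabel.
apply: le_trans (nr_rsl _ _) _; first by lra.
have -> : y n.+2 - y n.+1 = 1/2 * ((y n.+1 - y n) * (y n.+1 + y n)).
  have e1 : y n.+2 = (1 + y n.+1 ^+ 2) / 2 by [].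
  have e2 : y n.+1 = (1 + y n ^+ 2) / 2 by [].
  by rewrite e1 [in X in _ - X]e2; field.
rewrite ler_pM2l; last lra.
apply: le_trans (nrM CB _ _) _; apply: ler_pM => //; try exact: (nr_ge0 CB).
by apply: le_trans (nrD CB _ _) _; apply: lerD; apply: nr_sqrt_seq.
Qed.

Lemma nr_sqrt_seq_diff n k : nr (Y (n + k) - Y n) <= y (n + k) - y n.
Proof.
elim: k => [|k IH]; first by rewrite addn0 !subrr nr0.
rewrite addnS -(subrKA (Y (n + k))) -[X in _ <= X](subrKA (y (n + k))).
apply: le_trans (nrD CB _ _) _; apply: lerD => //.
exact: nr_sqrt_seq_step.
Qed.

(* The iteration [Y' = (Z + Y^2) / 2] is dominated by the same iteration on
   the real number 1, which increases to 1; hence it converges even when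
   [nr Z = 1]. *)
Lemma sqrt_one_sub : exists Y0, [/\ nr Y0 <= 1, Z + Y0 * Y0 = Y0 + Y0,
  forall c, c * Z = Z * c -> c * Y0 = Y0 * c & st Z = Z -> st Y0 = Y0].
Proof.
have [|L hL] := nr_complete CB (u := Y).
  move=> e e0; have [N hN] := archi_inv 2 e0; exists N.
  suff w m n : (N <= m)%N -> (m <= n)%N -> nr (Y m - Y n) <= e.
    move=> m n Nm Nn; case/orP: (leq_total m n) => mn; first exact: w.
    by rewrite nr_distC; apply: w.
  move=> Nm mn; rewrite nr_distC -(subnKC mn).
  apply: le_trans (nr_sqrt_seq_diff _ _) _.
  apply: le_trans (hN _ Nm); apply: le_trans (rsqrt_seq_rate m).
  by apply: lerB => //; case/andP: (rsqrt_seq_bounds (m + (n - m))).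
have app e : 0 < e -> exists n, nr (Y n - L) <= e /\ nr (Y n.+1 - L) <= e.
  by move=> e0; have [N hN] := hL e e0; exists N; split; apply: hN.
have L1 : nr L <= 1.
  apply/ler_addgt0Pr => e e0; have [n [hn _]] := app e e0.
  apply: le_trans (nr_le_dist L (Y n)) _; apply: lerD; last by rewrite nr_distC.
  by apply: le_trans (nr_sqrt_seq n) _; case/andP: (rsqrt_seq_bounds n).
exists L; split=> //.
- apply/eqP; rewrite -subr_eq0; apply/eqP.
  apply: (@nr_small0 4) => e e0; have [n [hn hn1]] := app e e0.
  have -> : Z + L * L - (L + L) = (L - Y n) * L + Y n * (L - Y n) + (Y n.+1 - L) + (Y n.+1 - L).
    have eY : Y n.+1 + Y n.+1 = Z + Y n * Y n by rewrite [Y n.+1]/= half2.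
    have -> : (L - Y n) * L + Y n * (L - Y n) + (Y n.+1 - L) + (Y n.+1 - L) =
       L * L - Y n * Y n + (Y n.+1 + Y n.+1) - L - L.
      nabel.
    rewrite eY; zabel.
  have a1 : nr ((L - Y n) * L) <= e.
    apply: le_trans (nrM CB _ _) _; rewrite nr_distC -[e]mulr1.
    by apply: ler_pM => //; apply: (nr_ge0 CB).
  have a2 : nr (Y n * (L - Y n)) <= e.
    apply: le_trans (nrM CB _ _) _; rewrite (nr_distC L) -[e]mul1r.
    apply: ler_pM => //; try apply: (nr_ge0 CB).
    by apply: le_trans (nr_sqrt_seq n) _; case/andP: (rsqrt_seq_bounds n).
  have a3 := nrD CB ((L - Y n) * L) (Y n * (L - Y n)).
  have a4 := nrD CB ((L - Y n) * L + Y n * (L - Y n)) (Y n.+1 - L).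
  have a5 := nrD CB ((L - Y n) * L + Y n * (L - Y n) + (Y n.+1 - L)) (Y n.+1 - L).
  lra.
- move=> c cZ; apply/eqP; rewrite -subr_eq0; apply/eqP.
  apply: (@nr_small0 (2 * nr c)) => e e0; have [n [hn hn1]] := app e e0.
  have -> : c * L - L * c = c * (L - Y n) - (L - Y n) * c.
    have := sqrt_seq_comm cZ n => e1; rewrite !(mulrBr, mulrBl) e1; zabel.
  apply: le_trans (nrB _ _) _.
  have a1 := nrM CB c (L - Y n); have a2 := nrM CB (L - Y n) c.
  have a0 := nr_ge0 CB c.
  rewrite nr_distC in hn; nra.
- move=> sZ; apply/eqP; rewrite -subr_eq0; apply/eqP.
  apply: (@nr_small0 2) => e e0; have [n [hn hn1]] := app e e0.
  have -> : st L - L = st (L - Y n) - (L - Y n).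
    by rewrite stB sqrt_seq_st //; zabel.
  apply: le_trans (nrB _ _) _; rewrite nr_st (nr_distC L); lra.
Qed.

End Sqrt.

(** For self-adjoint [x] the bound says that the spectrum lies in [[0, 2t]]. In this form stability
    under sums is the triangle inequality, and no spectrum has to be defined. *)
Definition cstar_pos (x : B) : Prop :=
  st x = x /\ exists t, 0 <= t /\ nr (real_sc t - x) <= t.

Lemma pos_st x : cstar_pos x -> st x = x. Proof. by case. Qed.

Lemma pos_le x t s : nr (real_sc t - x) <= t -> t <= s -> nr (real_sc s - x) <= s.
Proof.
move=> h ts; have -> : real_sc s - x = real_sc (s - t) + (real_sc t - x) by rewrite rsB; zabel.
apply: le_trans (nrD CB _ _) _.
have := @nr_rs (s - t); rewrite subr_ge0 => /(_ ts); lra.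
Qed.

Lemma pos_large x : cstar_pos x -> exists2 t, 0 < t & nr (real_sc t - x) <= t.
Proof.
case=> _ [t [t0 h]]; exists (t + 1); first by rewrite ltr_wpDl.
by apply: pos_le h _; rewrite lerDl.
Qed.

Lemma posD x y : cstar_pos x -> cstar_pos y -> cstar_pos (x + y).
Proof.
move=> [sx [t [t0 ht]]] [sy [s [s0 hs]]]; split; first by rewrite (stD CB) sx sy.
exists (t + s); split; first exact: addr_ge0.
have -> : real_sc (t + s) - (x + y) = (real_sc t - x) + (real_sc s - y) by rewrite rsD; zabel.
by apply: le_trans (nrD CB _ _) _; apply: lerD.
Qed.

Lemma posZ t x : 0 <= t -> cstar_pos x -> cstar_pos (real_sc t * x).
Proof.
move=> t0 [sx [s [s0 hs]]]; split; first by rewrite (stM CB) sx st_rs rsC.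
exists (t * s); split; first exact: mulr_ge0.
rewrite rsM -mulrBr; apply: le_trans (nr_rsl _ t0) _.
exact: ler_wpM2l.
Qed.

Lemma pos_rs t : 0 <= t -> cstar_pos (real_sc t).
Proof. by move=> t0; split; [exact: st_rs|exists t; rewrite subrr nr0]. Qed.

Lemma pos0 : cstar_pos 0. Proof. by rewrite -rs0; apply: pos_rs. Qed.

Lemma pos_sum (I : Type) (r : seq I) (P : pred I) (f : I -> B) :
  (forall i, P i -> cstar_pos (f i)) -> cstar_pos (\sum_(i <- r | P i) f i).
Proof. by move=> h; elim/big_ind: _ => //; [exact: pos0|exact: posD]. Qed.

Lemma pos_sub_nr x t : st x = x -> nr x <= t -> cstar_pos (real_sc t - x).
Proof.
move=> sx xt; split; first by rewrite stB st_rs sx.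
exists t; split; first exact: le_trans (nr_ge0 CB x) xt.
by rewrite (_ : _ - _ = x) //; zabel.
Qed.

(* For a self-adjoint contraction [u], [u + i sqrt (1 - u^2)] is unitary. *)
Lemma pos_sqr v : st v = v -> cstar_pos (v * v).
Proof.
move=> sv; set t := nr v + 1.
have t0 : 0 < t by rewrite ltr_wpDl ?(nr_ge0 CB).
set u := real_sc t^-1 * v.
have su : st u = u by rewrite (stM CB) sv st_rs rsC.
have u1 : nr u <= 1.
  rewrite nr_rsE ?invr_gt0 // mulrC ler_pdivrMr // mul1r.
  by rewrite lerDl.
have uu1 : nr (u * u) <= 1.
  apply: le_trans (nrM CB _ _) _; rewrite -[1]mulr1.
  by apply: ler_pM => //; apply: (nr_ge0 CB).
have [Y [Y1 eY cY sY]] := sqrt_one_sub uu1.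
have {}sY : st Y = Y by apply: sY; rewrite (stM CB) su.
have {}cY : u * Y = Y * u by apply: cY; rewrite mulrA.
set s := 1 - Y.
have ss : s * s = 1 - u * u.
  have -> : s * s = 1 - (Y + Y) + Y * Y by rewrite /s; nabel.
  rewrite -eY; zabel.
have ssd : st s = s by rewrite stB st1 sY.
have us : u * s = s * u by rewrite /s mulrBr mulrBl cY mulr1 mul1r.
clearbody s.
set w := u + iB * s.
have sw : st w = u - iB * s.
  by rewrite (stD CB) su (stM CB) ssd st_iB mulrN iBC.
have ww : st w * w = 1.
  by rewrite sw /w mul_conj_commuting // ss; zabel.
have w1 : nr w <= 1.
  have := nr_cstar CB w; rewrite ww => h.
  have := le_trans h nr_1; by rewrite expr_le1 ?(nr_ge0 CB).
(* [s] is the imaginary part of the unitary [w]. Since [s^2 = 1 - u^2], the bound [nr s <= 1] is the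
   test of [cstar_pos] for [u^2] with constant 1. *)
have s1 : nr s <= 1.
  have e : real_sc 2 * s = iB * (st w - w).
    have -> : st w - w = - (iB * s + iB * s) by rewrite sw /w; zabel.
    rewrite mulrN mulrDr mulrA iB2 (_ : 2 = 1 + 1) // rsD rs1; nabel.
  have := nr_scl 'i (st w - w); rewrite -e nr_rsE //.
  have -> : cabs ('i : R[i]) = 1 by rewrite /cabs normc_def /= expr0n expr1n add0r sqrtr1.
  have := nrB (st w) w; rewrite nr_st; lra.
split; first by rewrite (stM CB) sv.
exists (t ^+ 2); split; first by rewrite exprn_ge0 // ltW.
have -> : real_sc (t ^+ 2) - v * v = real_sc (t ^+ 2) * (s * s).
  rewrite ss mulrBr mulr1; congr (_ - _); rewrite /u mulrA -[_ * v * _]mulrA rsC !mulrA -!rsM.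
  by rewrite (_ : t ^+ 2 / t / t = 1) ?rs1 ?mul1r //; field; rewrite gt_eqF.
apply: le_trans (nr_rsl _ _) _; first by rewrite exprn_ge0 // ltW.
rewrite ger_pMr ?exprn_gt0 //; apply: le_trans (nrM CB _ _) _.
by rewrite -[1]mulr1; apply: ler_pM => //; apply: (nr_ge0 CB).
Qed.

(** With [t] from [pos_large], [x = t (1 - Z)] where [nr Z <= 1], and [sqrt_one_sub] applies. The
    last clause makes the roots of commuting elements commute. *)
Lemma pos_sqrt x : cstar_pos x -> exists v, [/\ st v = v, v * v = x &
  forall c, c * x = x * c -> c * v = v * c].
Proof.
move=> px; have [t t0 h] := pos_large px; have sx := pos_st px.
set Z := 1 - real_sc t^-1 * x.
have eZ : real_sc t * Z = real_sc t - x.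
  by rewrite /Z mulrBr mulr1 mulrA -rsM divff ?gt_eqF // rs1 mul1r.
have Z1 : nr Z <= 1 by move: h; rewrite -eZ nr_rsE // ger_pMr.
have [Y [Y1 eY cY sY]] := sqrt_one_sub Z1.
have {}sY : st Y = Y by apply: sY; rewrite stB st1 (stM CB) sx st_rs rsC.
exists (real_sc (Num.sqrt t) * (1 - Y)); split.
- by rewrite (stM CB) stB st1 sY st_rs rsC.
- rewrite mulrA -[_ * _ * real_sc _]mulrA rsC !mulrA -rsM -expr2 sqr_sqrtr ?ltW // -mulrA.
  have -> : (1 - Y) * (1 - Y) = 1 - (Y + Y) + Y * Y by nabel.
  rewrite -eY; have -> : 1 - (Z + Y * Y) + Y * Y = 1 - Z by zabel.
  rewrite mulrBr mulr1 eZ; zabel.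
- move=> c cx; rewrite mulrA rsC -!mulrA mulrBr mulrBl mulr1 mul1r cY //.
  by rewrite mulrBr mulrBl mulr1 mul1r mulrA rsC -!mulrA cx.
Qed.

(** For the commuting roots [v] of [x] and [w] of [t - x], the element [u = v + i w] has
    [u^* u = t], and [v] is its real part; hence the square of [nr v] is at most [t]. *)
Lemma nr_le_pos x t : 0 <= t -> cstar_pos x -> cstar_pos (real_sc t - x) -> nr x <= t.
Proof.
move=> t0 px py; have [v [sv vv cv]] := pos_sqrt px.
have [w [sw ww cw]] := pos_sqrt py.
have vw : v * w = w * v.
  by apply: cw; rewrite mulrBr mulrBl rsC -vv mulrA.
set u := v + iB * w.
have su : st u = v - iB * w.
  by rewrite (stD CB) sv (stM CB) sw st_iB mulrN iBC.
have uu : st u * u = real_sc t.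
  by rewrite su /u mul_conj_commuting // ww vv; zabel.
have u1 : nr u ^+ 2 <= t.
  by have := nr_cstar CB u; rewrite uu => /le_trans; apply; apply: nr_rs.
have v1 : nr v <= nr u.
  have e : real_sc 2 * v = st u + u by rewrite su /u (_ : 2 = 1 + 1) // rsD rs1 mulrDl !mul1r; zabel.
  have := nrD CB (st u) u; rewrite -e nr_rsE // nr_st; lra.
rewrite -vv; apply: le_trans (nrM CB _ _) _; apply: le_trans u1; rewrite expr2.
by apply: ler_pM => //; apply: (nr_ge0 CB).
Qed.

(** Any bound of the norm serves as the constant in [cstar_pos], not only the one that the
    definition supplies. *)
Lemma pos_nr_sub x t : cstar_pos x -> nr x <= t -> nr (real_sc t - x) <= t.
Proof.
move=> px xt; have t0 := le_trans (nr_ge0 CB x) xt.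
apply: nr_le_pos => //; first exact: pos_sub_nr (pos_st px) xt.
by rewrite (_ : _ - _ = x) //; zabel.
Qed.

Lemma nr_pos_mono x y : cstar_pos x -> cstar_pos y -> nr x <= nr (x + y).
Proof.
move=> px py; apply: nr_le_pos => //; first exact: (nr_ge0 CB).
have -> : real_sc (nr (x + y)) - x = (real_sc (nr (x + y)) - (x + y)) + y by zabel.
by apply: posD => //; apply: pos_sub_nr => //; rewrite (stD CB) !pos_st.
Qed.

Lemma pos_mono_le x y : cstar_pos x -> cstar_pos (y - x) -> nr x <= nr y.
Proof. by move=> px py; rewrite -[y](subrKC x); apply: nr_pos_mono. Qed.

Lemma pos_anti x : cstar_pos x -> cstar_pos (- x) -> x = 0.
Proof.
move=> px py; apply: (nr_eq0 CB); apply/le_anti; rewrite (nr_ge0 CB) andbT.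
by have := nr_pos_mono px py; rewrite subrr nr0.
Qed.

(** By [pos_nr_sub] the constant [nr x + 1] serves for all [x + e] with [e <= 1], so the bound
    survives the limit. *)
Lemma pos_closed x : (forall e, 0 < e -> cstar_pos (x + real_sc e)) -> cstar_pos x.
Proof.
move=> h; have sx : st x = x.
  have := pos_st (h 1 ltr01); rewrite (stD CB) st_rs; exact: addIr.
split=> //; exists (nr x + 1); split; first by rewrite addr_ge0 ?(nr_ge0 CB).
apply/ler_addgt0Pr => e0 e00; have [e [e1 ee0 le1]] : exists e, [/\ 0 < e, e + e <= e0 & e <= 1].
  exists (Num.min (e0 / 2) 1); split; first by rewrite lt_min divr_gt0 //=.
    have : Num.min (e0 / 2) 1 <= e0 / 2 by rewrite ge_min lexx.
    lra.
  by rewrite ge_min lexx orbT.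
have ph := h e e1.
have n1 : nr (x + real_sc e) <= nr x + 1.
  apply: le_trans (nrD CB _ _) _; apply: lerD => //; apply: le_trans le1; apply: nr_rs; exact: ltW.
have := pos_nr_sub ph n1 => n2.
have -> : real_sc (nr x + 1) - x = (real_sc (nr x + 1) - (x + real_sc e)) + real_sc e by zabel.
apply: le_trans (nrD CB _ _) _; apply: lerD => //.
by apply: le_trans (nr_rs (ltW e1)) _; lra.
Qed.

(* [p] is the absolute value of [a] and [n] twice its negative part. *)
Lemma selfadjoint_abs a : st a = a -> exists p r n, [/\ cstar_pos p, st r = r,
  st n = n & p = a + n] /\ [/\ n * a * n = - ((r * n) * (r * n)), st (r * n) = r * n,
  n * n = r * (r * n) + r * (r * n) & (r * n = 0 -> n = 0)].
Proof.
move=> sa; have [p0 [sp0 pp cp0]] := pos_sqrt (pos_sqr sa).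
have psq : cstar_pos (a * a) := pos_sqr sa.
(* The construction of [pos_sqrt] is repeated to obtain a root that is known to be positive: [1 - Y]
   is, because [nr Y <= 1]. *)
have pp_pos : exists p, [/\ cstar_pos p, p * p = a * a & forall c, c * a = a * c -> c * p = p * c].
  have [t t0 h] := pos_large psq.
  set Z := 1 - real_sc t^-1 * (a * a).
  have eZ : real_sc t * Z = real_sc t - a * a.
    by rewrite /Z mulrBr mulr1 [_ * (_ * (a * a))]mulrA -rsM divff ?gt_eqF // rs1 mul1r.
  have Z1 : nr Z <= 1 by move: h; rewrite -eZ nr_rsE // ger_pMr.
  have [Y [Y1 eY cY sY]] := sqrt_one_sub Z1.
  have {}sY : st Y = Y by apply: sY; rewrite stB st1 !(stM CB) sa st_rs rsC.
  have q : cstar_pos (1 - Y) by rewrite -rs1; apply: pos_sub_nr.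
  exists (real_sc (Num.sqrt t) * (1 - Y)); split.
  - by apply: posZ => //; apply: sqrtr_ge0.
  - rewrite mulrA -[_ * _ * real_sc _]mulrA rsC !mulrA -rsM -expr2 sqr_sqrtr ?ltW // -mulrA.
    have -> : (1 - Y) * (1 - Y) = 1 - (Y + Y) + Y * Y by nabel.
    rewrite -eY; have -> : 1 - (Z + Y * Y) + Y * Y = 1 - Z by zabel.
    rewrite mulrBr mulr1 eZ; zabel.
  - move=> c ca; rewrite mulrA rsC -!mulrA mulrBr mulrBl mulr1 mul1r cY //.
    rewrite mulrBr mulrBl mulr1 mul1r scCA -!mulrA; congr (_ - _ * _).
    by rewrite mulrA ca -mulrA ca.
move: pp_pos => [p [hp ppa cp]] {p0 sp0 pp cp0}.
have ap : a * p = p * a by apply: cp.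
have [r [sr rr cr]] := pos_sqrt hp.
have ar : a * r = r * a by apply: cr.
have pr : p * r = r * p by apply: cr.
set n := p - a.
(* [a n = a p - a^2 = p a - p^2 = - p n]: on its negative part, [a] acts as [- p]. *)
have an : a * n = - (p * n) by rewrite /n !mulrBr ap ppa; zabel.
have rn : r * n = n * r by rewrite /n mulrBr mulrBl pr ar.
have pn : p * n = n * p by rewrite /n mulrBr mulrBl ap.
have sn : st n = n by rewrite stB (pos_st hp) sa.
exists p, r, n; split; split=> //; first by rewrite /n; zabel.
- rewrite -mulrA an mulrN; congr (- _).
  have aux (x y : B) : x * y = y * x -> y * (x * x * y) = x * y * (x * y).
    move=> e; rewrite (mulrA y) (mulrA y x x) -e -(mulrA x y x) -e !mulrA.
    by rewrite -(mulrA x y x) -e !mulrA.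
  by rewrite -rr aux.
- by rewrite (stM CB) sn sr.
- by rewrite mulrA rr {1}/n mulrBl an; zabel.
- move=> rn0; apply: (nr_eq0 CB).
  have pn0 : p * n = 0 by rewrite -rr -mulrA rn0 mulr0.
  have nn0 : n * n = 0.
    by rewrite {1}/n mulrBl an pn0; zabel.
  have := nr_cstar CB n; rewrite sn nn0 nr0 => h.
  by apply/eqP; move: h; rewrite le_eqVlt ltNge sqr_ge0 orbF sqrf_eq0.
Qed.

(* Kaplansky: if [z = c n], with [n] the negative part of [c^* c], then
   [z^* z <= 0 <= z z^*]; as [z^* z] and [z z^*] have the same spectrum apart
   from 0, both vanish. *)
Lemma pos_star_mul c : cstar_pos (st c * c).
Proof.
set a := st c * c.
have sa : st a = a by rewrite /a (stM CB) (stK CB).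
have [p [r [n [[hp sr sn epa] [nan srn _ rn0]]]]] := selfadjoint_abs sa.
set w := r * n in nan srn rn0; set q := w * w.
have pq : cstar_pos q by apply: pos_sqr.
set z := c * n.
have zz : st z * z = - q by rewrite /z (stM CB) sn mulrA -[n * st c * c]mulrA nan.
set Bz := z * st z.
(* [s = z + z^*] and [d = i z - i z^*] are self-adjoint with [z z^* + z^* z = (s^2 + d^2) / 2],
   while [z^* z = - q]. *)
have pB : cstar_pos Bz.
  set s := z + st z; set d := iB * (z - st z).
  have ss : st s = s by rewrite /s (stD CB) (stK CB) addrC.
  have sd : st d = d.
    by rewrite /d (stM CB) stB (stK CB) st_iB mulrN iBC -mulrN opprB.
  have dd : d * d = - ((z - st z) * (z - st z)).
    by rewrite /d mulrA -[iB * _ * iB]mulrA iBC !mulrA iB2 mulN1r mulNr.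
  have e : Bz = real_sc (1/2) * (s * s + d * d) + q.
    have -> : s * s + d * d = (Bz - q) + (Bz - q).
      by rewrite dd /s -zz /Bz; nabel.
    by rewrite mulrDr half2; zabel.
  rewrite e; apply: posD => //; apply: posZ; first by lra.
  by apply: posD; apply: pos_sqr.
set b := nr Bz.
have bz : b = nr z ^+ 2 by rewrite /b /Bz -{1}[z](stK CB) nr_sq nr_st.
have bq : nr q = b by rewrite bz -nr_sq zz nrN.
have b0 : 0 <= b by apply: (nr_ge0 CB).
have n1 : nr (real_sc b - Bz) <= b by apply: pos_nr_sub.
(* This replaces the comparison of spectra. As [nr (b - Bz) <= b], the left side has norm at most
   [b^3]. Moving [z] through the factors turns it into [- q (b + q)^2], and the positive summand
   [2 b q^2] of [q (b + q)^2] alone has norm at least [2 b^3]. Hence [b = 0]. *)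
have e1 : st z * ((real_sc b - Bz) * ((real_sc b - Bz) * z)) = - (q * ((real_sc b + q) * (real_sc b + q))).
  have e0 : (real_sc b - Bz) * z = z * (real_sc b + q).
    by rewrite mulrBl mulrDr /Bz -mulrA zz rsC; nabel.
  have aux (y1 y2 x x' : B) : x * y2 = y2 * x' -> y1 * (x * (x * y2)) = y1 * y2 * (x' * x').
    by move=> e; rewrite e (mulrA x) e !mulrA.
  by rewrite (aux _ _ _ _ e0) zz mulNr.
have n2 : nr (q * ((real_sc b + q) * (real_sc b + q))) <= b ^+ 3.
  rewrite -nrN -e1.
  apply: le_trans (nrM CB _ _) _; rewrite nr_st.
  have h1 : nr ((real_sc b - Bz) * ((real_sc b - Bz) * z)) <= b * (b * nr z).
    apply: le_trans (nrM CB _ _) _; apply: ler_pM => //; try exact: (nr_ge0 CB).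
    apply: le_trans (nrM CB _ _) _; apply: ler_pM => //; exact: (nr_ge0 CB).
  apply: le_trans (ler_wpM2l (nr_ge0 CB z) h1) _.
  by rewrite (_ : nr z * _ = b ^+ 2 * nr z ^+ 2) ?bz -?exprM -?exprD //; ring.
have sq : st q = q by apply: pos_st.
have qq : cstar_pos (q * q) by apply: pos_sqr.
have e2 : q * ((real_sc b + q) * (real_sc b + q)) =
  real_sc (2 * b) * (q * q) + (real_sc (b ^+ 2) * q + (q * w) * (q * w)).
  have qw : q * w = w * q by rewrite /q mulrA.
  have -> : q * w * (q * w) = q * (q * q).
    by rewrite qw {1}/q -!mulrA; congr (_ * _); rewrite mulrA -qw -mulrA.
  rewrite mulrDl !mulrDr mulr_natl mulr2n rsD !mulrDl expr2 rsM.
  have aux (x y : B) : x * y = y * x -> x * (y * y) + x * (y * x) + (x * (x * y) + x * (x * x)) =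
    y * (x * x) + y * (x * x) + (y * y * x + x * (x * x)).
    move=> e; have e2 : x * (y * x) = y * (x * x) by rewrite mulrA e mulrA.
    have e3 : x * (y * y) = y * y * x by rewrite mulrA e -mulrA e mulrA.
    by rewrite e e2 e3; zabel.
  by apply: aux; apply: rsC.
have n3 : nr (real_sc (2 * b) * (q * q)) <= b ^+ 3.
  apply: le_trans n2; rewrite e2; apply: nr_pos_mono.
    by apply: posZ => //; rewrite mulr_ge0.
  apply: posD; first by apply: posZ => //; rewrite exprn_ge0.
  apply: pos_sqr; rewrite (stM CB) sq srn /q mulrA //.
have bb0 : b = 0.
  apply/eqP/negPn/negP => bne; have bp : 0 < b by rewrite lt_neqAle eq_sym bne.
  move: n3; rewrite nr_rsE ?mulr_gt0 //.
  have : b ^+ 2 <= nr (q * q) by rewrite -bq; have := nr_cstar CB q; rewrite sq.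
  move=> h1 h2'.
  have h3 : 2 * b * b ^+ 2 <= b ^+ 3 by apply: le_trans h2'; rewrite ler_wpM2l // mulr_ge0.
  have : 0 < b ^+ 3 by rewrite exprn_gt0.
  by move: h3; rewrite -mulrA -exprS; lra.
have n0 : n = 0.
  apply: rn0; apply: (nr_eq0 CB).
  have := nr_cstar CB w; rewrite srn -/q bq bb0 => h.
  by apply/eqP; move: h; rewrite le_eqVlt ltNge sqr_ge0 orbF sqrf_eq0.
by move: epa; rewrite n0 addr0 => <-.
Qed.

Lemma pos_conj c x : cstar_pos x -> cstar_pos (st c * x * c).
Proof.
move=> px; have [v [sv <- _]] := pos_sqrt px.
have -> : st c * (v * v) * c = st (v * c) * (v * c) by rewrite (stM CB) sv !mulrA.
exact: pos_star_mul.
Qed.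

Lemma nr_star_mul_le c x t : cstar_pos x -> nr x <= t -> cstar_pos (real_sc t * (st c * c) - st c * x * c).
Proof.
move=> px xt; have -> : real_sc t * (st c * c) - st c * x * c = st c * (real_sc t - x) * c.
  by rewrite mulrBr mulrBl rsC !mulrA.
by apply: pos_conj; apply: pos_sub_nr => //; apply: pos_st.
Qed.

Lemma neumann Z q : 0 <= q -> q < 1 -> nr Z <= q -> exists I, [/\ I * (1 - Z) = 1,
  (1 - Z) * I = 1 & forall c, c * Z = Z * c -> c * I = I * c].
Proof.
move=> q0 q1 Zq; pose S := fix S n : B := if n is m.+1 then 1 + Z * S m else 0.
have Sb k : nr (S k) <= (1 - q)^-1.
  elim: k => [|k IH] /=; first by rewrite nr0 invr_ge0 subr_ge0 ltW.
  apply: le_trans (nrD CB _ _) _.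
  have h : nr (Z * S k) <= q * (1 - q)^-1.
    by apply: le_trans (nrM CB _ _) _; apply: ler_pM => //; apply: (nr_ge0 CB).
  have -> : (1 - q)^-1 = 1 + q * (1 - q)^-1 by field; rewrite subr_eq0 gt_eqF.
  by apply: lerD => //; apply: nr_1.
have Sd n k : nr (S (n + k)%N - S n) <= q ^+ n * (1 - q)^-1.
  elim: n => [|n IH]; first by rewrite subr0 expr0 mul1r.
  have -> : S (n.+1 + k)%N - S n.+1 = Z * (S (n + k)%N - S n) by rewrite mulrBr addSn /=; zabel.
  rewrite exprS -mulrA; apply: le_trans (nrM CB _ _) _.
  by apply: ler_pM => //; apply: (nr_ge0 CB).
have small e : 0 < e -> exists N, forall n, (N <= n)%N -> q ^+ n.+1 * (1 - q)^-1 <= e.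
  move=> e0; have qq : 0 < 1 - q by rewrite subr_gt0.
  have [N hN] := archi_inv (1 / (1 - q) / (1 - q)) e0; exists N => n Nn.
  apply: le_trans (hN n Nn); rewrite mul1r.
  have := expr_lt1_small n.+1 q0 (ltW q1); set b := q ^+ n.+1; set d := n.+1%:R => h.
  have d0 : 0 < d by rewrite ltr0Sn.
  have b0 : 0 <= b by apply: exprn_ge0.
  rewrite mulrAC ler_pM2r ?invr_gt0 // ler_pdivlMr // -[(1 - q)^-1]mul1r ler_pdivlMr //.
  by rewrite [b * d]mulrC; lra.
have [|L hL] := nr_complete CB (u := fun n => S n.+1).
  move=> e e0; have [N hN] := small _ e0; exists N.
  suff w m n : (N <= m)%N -> (m <= n)%N -> nr (S m.+1 - S n.+1) <= e.
    move=> m n Nm Nn; case/orP: (leq_total m n) => mn; first exact: w.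
    by rewrite nr_distC; apply: w.
  move=> Nm mn; rewrite nr_distC -(subnKC mn) -addSn.
  by apply: le_trans (Sd _ _) _; apply: hN.
have app e : 0 < e -> exists n, nr (S n.+1 - L) <= e /\ nr (S n.+2 - L) <= e.
  by move=> e0; have [N hN] := hL e e0; exists N; split; apply: hN.
have cS c : c * Z = Z * c -> forall n, c * S n = S n * c.
  move=> cZ; elim=> [|n IH] /=; first by rewrite mulr0 mul0r.
  by rewrite mulrDr mulrDl mulr1 mul1r mulrA cZ -mulrA IH mulrA.
have cL c : c * Z = Z * c -> c * L = L * c.
  move=> cZ; apply/eqP; rewrite -subr_eq0; apply/eqP.
  apply: (@nr_small0 (2 * nr c)) => e e0; have [n [hn _]] := app e e0.
  have -> : c * L - L * c = c * (L - S n.+1) - (L - S n.+1) * c.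
    have := cS c cZ n.+1 => e1; rewrite !(mulrBr, mulrBl) e1; zabel.
  apply: le_trans (nrB _ _) _.
  have a1 := nrM CB c (L - S n.+1); have a2 := nrM CB (L - S n.+1) c.
  have a0 := nr_ge0 CB c.
  rewrite nr_distC in hn; nra.
have ZL : (1 - Z) * L = 1.
  apply/eqP; rewrite -subr_eq0; apply/eqP.
  apply: (@nr_small0 2) => e e0; have [n [hn hn1]] := app e e0.
  have -> : (1 - Z) * L - 1 = Z * (S n.+1 - L) - (S n.+2 - L).
    rewrite [S n.+2]/= -/(S n.+1); set s := S n.+1; nabel.
  apply: le_trans (nrB _ _) _; have := nrM CB Z (S n.+1 - L).
  have := nr_ge0 CB (S n.+1 - L); have := nr_ge0 CB Z; nra.
have LZ : L * (1 - Z) = 1 by move: ZL; rewrite mulrBr mulrBl mulr1 mul1r (cL Z).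
by exists L.
Qed.

(** Here [b = (g + e)^(-1/2)] and [r] is its inverse. If [g = <x, x>], then [x = (x b) r] with [x b]
    of norm at most 1: a substitute for the polar decomposition when [g] is not invertible. *)
Lemma pos_inv_sqrt g e : cstar_pos g -> 0 < e -> exists b r, [/\ st b = b, st r = r,
  b * r = 1, r * b = 1 & r * r = g + real_sc e] /\
  (cstar_pos (1 - b * g * b) /\ nr (b * g * b) <= 1).
Proof.
move=> pg e0; have pge : cstar_pos (g + real_sc e) by apply: posD => //; apply/pos_rs/ltW.
have [r [sr rr cr]] := pos_sqrt pge.
(* The summand [e] keeps [t] positive. As [t] bounds the norm of [g + e] and [g] is positive,
   [nr Z <= 1 - e / t < 1], and the Neumann series applies. *)
set t := nr (g + real_sc e) + e.
have t0 : 0 < t by rewrite ltr_wpDl ?(nr_ge0 CB).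
set Z := 1 - real_sc t^-1 * (g + real_sc e).
have eZ : real_sc t * Z = real_sc t - (g + real_sc e).
  by rewrite /Z mulrBr mulr1 mulrA -rsM divff ?gt_eqF // rs1 mul1r.
have Zq : nr Z <= 1 - e / t.
  have : nr (real_sc t * Z) <= t - e.
    rewrite eZ; apply: nr_le_pos.
    - by rewrite /t addrK (nr_ge0 CB).
    - by apply: pos_sub_nr; rewrite ?pos_st // /t lerDl ltW.
    - by rewrite (_ : _ - _ = g) // rsB; zabel.
  by rewrite nr_rsE // mulrC -ler_pdivlMr // mulrBl divff ?gt_eqF.
have q0 : 0 <= 1 - e / t := le_trans (nr_ge0 CB _) Zq.
have q1 : 1 - e / t < 1 by rewrite gtrBl divr_gt0.
have [I [IZ ZI cI]] := neumann q0 q1 Zq.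
have oZ : 1 - Z = real_sc t^-1 * (r * r) by rewrite /Z rr; zabel.
have rI : r * I = I * r.
  by apply: cI; rewrite /Z -rr mulrBr mulrBl mulr1 mul1r scCA !mulrA.
exists (real_sc t^-1 * (I * r)), r.
set b := real_sc t^-1 * (I * r).
have br : b * r = 1.
  by rewrite /b -!mulrA -scCA -oZ IZ.
have rb : r * b = 1.
  by rewrite /b scCA (mulrA r I r) rI -mulrA -scCA -oZ IZ.
have sb : st b = b.
  have : st b * r = 1 by rewrite -{1}sr -(stM CB) rb st1.
  by move=> h; rewrite -[st b]mulr1 -rb mulrA h mul1r.
have bgb : 1 - b * g * b = real_sc e * (b * b).
  have -> : g = r * r - real_sc e by rewrite rr; zabel.
  by rewrite mulrBr mulrBl (mulrA b r r) br mul1r rb rsC -mulrA; zabel.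
have pb : cstar_pos (1 - b * g * b) by rewrite bgb; apply: posZ (ltW e0) (pos_sqr sb).
do 2 split=> //.
apply: nr_le_pos => //; last by rewrite rs1.
by rewrite -{1}sb; apply: pos_conj.
Qed.

Lemma pos_star_mul_sum (I : Type) (r : seq I) (f : I -> B) :
  cstar_pos (\sum_(i <- r) st (f i) * f i).
Proof. by apply: pos_sum => i _; apply: pos_star_mul. Qed.

Lemma st_sum (I : Type) (r : seq I) (P : pred I) (f : I -> B) :
  st (\sum_(i <- r | P i) f i) = \sum_(i <- r | P i) st (f i).
Proof. by apply: (big_morph st (stD CB) st0). Qed.

Lemma nr_sum (I : Type) (r : seq I) (P : pred I) (f : I -> B) :
  nr (\sum_(i <- r | P i) f i) <= \sum_(i <- r | P i) nr (f i).
Proof.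
elim/big_ind2: _ => //; first by rewrite nr0.
by move=> x1 x2 y1 y2 h1 h2'; apply: le_trans (nrD CB _ _) _; apply: lerD.
Qed.

End CStarRing.

Lemma le_of_sqr (R : realType) (a b : R) : 0 <= b -> a ^+ 2 <= b ^+ 2 -> a <= b.
Proof. by move=> b0; rewrite -ler_sqrt ?sqr_ge0 // !sqrtr_sqr (ger0_norm b0); apply: le_trans (ler_norm a). Qed.

(** * Pre-Hilbert modules and matrices over a C*-ring *)

Section PreHilbert.
Variables (R : realType) (B : nzRingType).
Variables (sc : R[i] -> B) (st : B -> B) (nr : B -> R).
Hypothesis CB : cstar_ring sc st nr.
Notation rs := (real_sc sc).
Notation pos := (cstar_pos sc st nr).

(** A possibly degenerate inner product with values in [B], with the structure that the
    Cauchy-Schwarz inequality calls for. It covers columns over [B], Hilbert modules over the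
    unitization, and tuples of module elements. *)
Record prehilbert (V : zmodType) (ip : V -> V -> B) (ra : V -> B -> V) : Prop := {
  phD : forall x y z, ip x (y + z) = ip x y + ip x z;
  ph_ra : forall x y b, ip x (ra y b) = ip x y * b;
  ph_st : forall x y, st (ip x y) = ip y x;
  ph_pos : forall x, pos (ip x x)
}.

Definition vn (V : zmodType) (ip : V -> V -> B) (x : V) : R := Num.sqrt (nr (ip x x)).

Section Theory.
Variables (V : zmodType) (ip : V -> V -> B) (ra : V -> B -> V).
Hypothesis HV : prehilbert ip ra.

Lemma ph0 x : ip x 0 = 0.
Proof. by apply: (addrI (ip x 0)); rewrite -(phD HV) !addr0. Qed.
Lemma phN x y : ip x (- y) = - ip x y.
Proof. by apply: (addrI (ip x y)); rewrite -(phD HV) !subrr ph0. Qed.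
Lemma phB x y z : ip x (y - z) = ip x y - ip x z.
Proof. by rewrite (phD HV) phN. Qed.
Lemma phDl x y z : ip (x + y) z = ip x z + ip y z.
Proof. by rewrite -(ph_st HV) (phD HV) (stD CB) !(ph_st HV). Qed.
Lemma ph0l x : ip 0 x = 0.
Proof. by rewrite -(ph_st HV) ph0 (st0 CB). Qed.
Lemma phNl x y : ip (- x) y = - ip x y.
Proof. by rewrite -(ph_st HV) phN (stN CB) (ph_st HV). Qed.
Lemma phBl x y z : ip (x - y) z = ip x z - ip y z.
Proof. by rewrite phDl phNl. Qed.
Lemma ph_ral x y b : ip (ra x b) y = st b * ip x y.
Proof. by rewrite -(ph_st HV) (ph_ra HV) (stM CB) (ph_st HV). Qed.

Lemma vn_ge0 x : 0 <= vn ip x. Proof. exact: sqrtr_ge0. Qed.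
Lemma vn_sqr x : vn ip x ^+ 2 = nr (ip x x).
Proof. by rewrite sqr_sqrtr ?(nr_ge0 CB). Qed.

(** Expand [<z, z> >= 0] for [z = y - x <x, y> / s]. With [s] any positive bound of the norm of
    [<x, x>], the case [<x, x> = 0] is included. *)
Lemma ph_cauchy_schwarz_pos x y s : 0 < s -> nr (ip x x) <= s ->
  pos (rs s * ip y y - ip y x * ip x y).
Proof.
move=> s0 hs; set e := ip x y.
have ee : ip y x = st e by rewrite (ph_st HV).
have se : st (rs s^-1 * e) = rs s^-1 * st e by rewrite (stM CB) (st_rs CB) (rsC CB).
set z := y - ra x (rs s^-1 * e).
have ez : ip z z = ip y y - rs s^-1 * (st e * e) - rs s^-1 * (st e * e)
     + rs s^-1 * (rs s^-1 * (st e * ip x x * e)).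
  rewrite /z phB !phBl !ph_ral !(ph_ra HV) se ee -/e -!mulrA.
  rewrite (rsCA CB s^-1 (ip x x) e) (rsCA CB s^-1 (st e) (_ * e)) (rsCA CB s^-1 (st e) e); zabel.
have e1 : rs s * ip y y - ip y x * e = rs s * (ip z z + rs s^-1 * (rs s^-1 * (rs s * (st e * e) - st e * ip x x * e))).
  rewrite ez ee mulrDr !mulrBr !(mulrA (rs s)) -!(rsM CB) divff ?gt_eqF // (rs1 CB).
  rewrite !mul1r !mulrDr !mulrN !mulrA -!(rsM CB) divff ?gt_eqF // mulVf ?gt_eqF // (rs1 CB) !mul1r.
  zabel.
have si : 0 <= s^-1 by rewrite invr_ge0 ltW.
rewrite e1; apply: (posZ CB); first exact: ltW.
apply: (posD CB); first exact: ph_pos HV z.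
by do 2 apply: (posZ CB) => //; apply: (nr_star_mul_le CB) => //; apply: (ph_pos HV).
Qed.

Lemma ph_cauchy_schwarz_sqr x y : nr (ip x y) ^+ 2 <= nr (ip x x) * nr (ip y y).
Proof.
have h s : 0 < s -> nr (ip x x) <= s -> nr (ip x y) ^+ 2 <= s * nr (ip y y).
  move=> s0 hs; have := ph_cauchy_schwarz_pos y s0 hs => hp.
  have := pos_mono_le CB _ hp; rewrite (nr_rsE CB) // -(ph_st HV x y) => hh.
  by rewrite -(nr_sq CB); apply: hh; apply: (pos_star_mul CB).
set a := nr (ip x x); set b := nr (ip y y); set c := _ ^+ 2.
apply/ler_addgt0Pr => e e0.
have a0 : 0 <= a by apply: (nr_ge0 CB). have b0 : 0 <= b by apply: (nr_ge0 CB).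
have b1 : 0 < b + 1 by rewrite ltr_wpDl.
have d0 : 0 < e / (b + 1) by rewrite divr_gt0.
have := h (a + e / (b + 1)); rewrite ltr_wpDl // lerDl ltW // => /(_ isT isT).
rewrite -/b -/c mulrDl => hh; apply: le_trans hh _; rewrite lerD2l.
by rewrite mulrAC ler_pdivrMr // ler_wpM2l ?lerDl // ltW.
Qed.

Lemma ph_cauchy_schwarz x y : nr (ip x y) <= vn ip x * vn ip y.
Proof.
apply: le_of_sqr; first by rewrite mulr_ge0 ?vn_ge0.
by rewrite exprMn !vn_sqr ph_cauchy_schwarz_sqr.
Qed.

Lemma vnD x y : vn ip (x + y) <= vn ip x + vn ip y.
Proof.
apply: le_of_sqr; first by rewrite addr_ge0 ?vn_ge0.
rewrite vn_sqr (phD HV) !phDl.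
have h1 := ph_cauchy_schwarz x y; have h2 := ph_cauchy_schwarz y x.
have h3 := nrD CB (ip x x + ip y x) (ip x y + ip y y).
have h4 := nrD CB (ip x x) (ip y x); have h5 := nrD CB (ip x y) (ip y y).
rewrite sqrrD !vn_sqr; lra.
Qed.

Lemma vn_sum (I : Type) (r : seq I) (f : I -> V) :
  vn ip (\sum_(i <- r) f i) <= \sum_(i <- r) vn ip (f i).
Proof.
elim/big_ind2: _ => //; first by rewrite /vn ph0 (nr0 CB) sqrtr0.
by move=> x1 x2 y1 y2 h1 h2; apply: le_trans (vnD _ _) _; apply: lerD.
Qed.

End Theory.

(* Paschke's inequality, by replacing [x] by [x (<x,x> + e)^(-1/2)]. *)
Lemma ph_bounded_pos (V W : zmodType) (ip : V -> V -> B) (ra : V -> B -> V)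
  (ip' : W -> W -> B) (ra' : W -> B -> W) (L : V -> W) (c : R) :
  prehilbert ip ra -> prehilbert ip' ra' ->
  (forall x b, L (ra x b) = ra' (L x) b) -> 0 <= c ->
  (forall x, nr (ip' (L x) (L x)) <= c * nr (ip x x)) ->
  forall x, pos (rs c * ip x x - ip' (L x) (L x)).
Proof.
move=> HV HW Lra c0 Lc x; set g := ip x x; set m := ip' (L x) (L x).
have key e : 0 < e -> pos (rs c * (g + rs e) - m).
  move=> e0; have [b [r [[sb sr br rb rr] [pb nb]]]] := pos_inv_sqrt CB (ph_pos HV x) e0.
  have h : nr (b * m * b) <= c.
    have := Lc (ra x b); rewrite Lra (ph_ra HV) (ph_ral HV) (ph_ra HW) (ph_ral HW) sb ?mulrA.
    move=> h; apply: le_trans h _; rewrite -[X in _ <= X]mulr1; exact: ler_wpM2l.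
  have sm : st m = m by apply: (pos_st (ph_pos HW _)).
  have sbm : st (b * m * b) = b * m * b by rewrite !(stM CB) sb sm mulrA.
  have := pos_conj CB r (pos_sub_nr CB sbm h).
  rewrite sr mulrBr mulrBl (rsC CB) -(mulrA (rs c)) rr.
  suff -> : r * (b * m * b) * r = m by [].
  by rewrite !mulrA rb mul1r -mulrA br mulr1.
apply: (pos_closed CB) => e e0; have c1 : 0 < c + 1 by rewrite ltr_wpDl.
have d0 : 0 < e / (c + 1) by rewrite divr_gt0.
have -> : rs c * g - m + rs e = (rs c * (g + rs (e / (c + 1))) - m) + rs (e - c * (e / (c + 1))).
  by rewrite mulrDr (rsB CB) -(rsM CB); zabel.
apply: (posD CB); first exact: key.
apply: (pos_rs CB); have -> : e - c * (e / (c + 1)) = e / (c + 1); last exact: ltW.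
by field; rewrite gt_eqF.
Qed.

End PreHilbert.

(** * Matrices over a C*-ring *)

Section MatrixCStar.
Variables (R : realType) (B : nzRingType).
Variables (sc : R[i] -> B) (st : B -> B) (nr : B -> R).
Hypothesis CB : cstar_ring sc st nr.
Notation rs := (real_sc sc).
Notation pos := (cstar_pos sc st nr).

Definition mst m n (A : 'M[B]_(m, n)) : 'M[B]_(n, m) := \matrix_(i, j) st (A j i).

Lemma mstM m n p (A : 'M[B]_(m, n)) (C : 'M_(n, p)) : mst (A *m C) = mst C *m mst A.
Proof.
by apply/matrixP => i j; rewrite !mxE (st_sum CB); apply: eq_bigr => k _; rewrite !mxE (stM CB).
Qed.
Lemma mstK m n (A : 'M[B]_(m, n)) : mst (mst A) = A.
Proof. by apply/matrixP => i j; rewrite !mxE (stK CB). Qed.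
Lemma mstD m n (A C : 'M[B]_(m, n)) : mst (A + C) = mst A + mst C.
Proof. by apply/matrixP => i j; rewrite !mxE (stD CB). Qed.

Definition cip m (x y : 'cV[B]_m) : B := (mst x *m y) ord0 ord0.
Definition cra m (x : 'cV[B]_m) (b : B) : 'cV[B]_m := \col_i (x i ord0 * b).
Notation cn := (vn nr (@cip _)).

Lemma cipE m (x y : 'cV[B]_m) : cip x y = \sum_i st (x i ord0) * y i ord0.
Proof. by rewrite /cip mxE; apply: eq_bigr => i _; rewrite mxE. Qed.

Lemma cV_prehilbert m : prehilbert sc st nr (@cip m) (@cra m).
Proof.
split=> [x y z|x y b|x y|x].
- by rewrite !cipE -big_split; apply: eq_bigr => i _; rewrite mxE mulrDr.
- by rewrite !cipE mulr_suml; apply: eq_bigr => i _; rewrite mxE mulrA.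
- by rewrite !cipE (st_sum CB); apply: eq_bigr => i _; rewrite (stM CB) (stK CB).
- by rewrite cipE; apply: (pos_star_mul_sum CB).
Qed.
Let HC m := cV_prehilbert m.

Lemma cip_mul m n (A : 'M[B]_(m, n)) (x : 'cV_m) (y : 'cV_n) :
  cip x (A *m y) = cip (mst A *m x) y.
Proof. by rewrite /cip mstM mstK mulmxA. Qed.

Lemma nr_le_cn m (x : 'cV[B]_m) i : nr (x i ord0) <= cn x.
Proof.
apply: le_of_sqr; first exact: vn_ge0.
rewrite (vn_sqr CB) -(nr_sq CB) cipE (bigD1 i) //=.
apply: (nr_pos_mono CB); first exact: (pos_star_mul CB).
by apply: (pos_sum CB) => j _; apply: (pos_star_mul CB).
Qed.

Lemma cn_le_sum m (x : 'cV[B]_m) : cn x <= \sum_i nr (x i ord0).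
Proof.
have ex : x = \sum_i cra (delta_mx i ord0) (x i ord0).
  apply/matrixP => i j; rewrite ord1 summxE (bigD1 i) //= !mxE !eqxx mul1r big1 ?addr0 // => k /negbTE ki.
  by rewrite !mxE eq_sym ki /= mul0r.
rewrite {1}ex; apply: le_trans (vn_sum CB (HC m) _ _) _; apply: ler_sum => i _.
apply: le_of_sqr; first exact: (nr_ge0 CB).
rewrite (vn_sqr CB) cipE (bigD1 i) //= !mxE !eqxx mul1r big1 ?addr0 ?(nr_sq CB) // => k /negbTE ki.
by rewrite !mxE ki /= mul0r mulr0.
Qed.

Section Norm.
Variable n : nat.
Implicit Types A C : 'M[B]_n.+1.

(** Matrices are normed as operators on the column module. The norm lies between the norm of each
    entry and the sum of the norms of all entries, so convergence is entrywise. Sizes are [n.+1]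
    since a ring has [1 != 0]. *)
Definition mbounds A : set R :=
  [set c | 0 <= c /\ forall x : 'cV[B]_n.+1, cn (A *m x) <= c * cn x]%classic.
Definition mnr A : R := inf (mbounds A).

Lemma mbounds_sum A : mbounds A (\sum_i \sum_j nr (A i j)).
Proof.
split; first by do 2 apply: sumr_ge0 => ? _; apply: (nr_ge0 CB).
move=> x; apply: le_trans (cn_le_sum _) _; rewrite mulr_suml; apply: ler_sum => i _.
rewrite mulr_suml mxE; apply: le_trans (nr_sum CB _ _ _) _; apply: ler_sum => j _.
by apply: le_trans (nrM CB _ _) _; apply: ler_wpM2l; [exact: (nr_ge0 CB)|exact: nr_le_cn].
Qed.

Lemma has_inf_mbounds A : has_inf (mbounds A).
Proof. by split; [exists (\sum_i \sum_j nr (A i j)); exact: mbounds_sum|exists 0 => c []]. Qed.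

Lemma mnr_ge0 A : 0 <= mnr A.
Proof. by apply: lb_le_inf; [case: (has_inf_mbounds A)|move=> c []]. Qed.

Lemma mnr_le A c : 0 <= c -> (forall x : 'cV[B]_n.+1, cn (A *m x) <= c * cn x) -> mnr A <= c.
Proof. by move=> c0 h; apply: ge_inf; [case: (has_inf_mbounds A)|]. Qed.

Lemma mnr_le_sum A : mnr A <= \sum_i \sum_j nr (A i j).
Proof. by have [h1 h2] := mbounds_sum A; apply: mnr_le. Qed.

Lemma mnrP A (x : 'cV[B]_n.+1) : cn (A *m x) <= mnr A * cn x.
Proof.
have x0 := vn_ge0 nr (@cip _) x.
have [e|ne] := eqVneq (cn x) 0.
  by have [_ h] := mbounds_sum A; have := h x; rewrite e !mulr0.
have xp : 0 < cn x by rewrite lt_neqAle eq_sym ne.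
rewrite -ler_pdivrMr //; apply: lb_le_inf; first by case: (has_inf_mbounds A).
by move=> c [c0 h]; rewrite ler_pdivrMr.
Qed.

Lemma nr_le_mnr A i j : nr (A i j) <= mnr A.
Proof.
have -> : A i j = (A *m delta_mx j (ord0 : 'I_1)) i ord0.
  by rewrite -colE mxE.
apply: le_trans (nr_le_cn _ _) _; apply: le_trans (mnrP _ _) _.
rewrite -[X in _ <= X]mulr1; apply: ler_wpM2l; first exact: mnr_ge0.
apply: le_of_sqr => //; rewrite expr1n (vn_sqr CB) cipE (bigD1 j) //= !mxE !eqxx big1.
  by rewrite addr0 mulr1 (st1 CB) (nr_1 CB).
by move=> k /negbTE kj; rewrite !mxE kj /= mulr0.
Qed.

Lemma cn_scl m k (x : 'cV[B]_m) : cn (cra x (sc k)) <= cabs k * cn x.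
Proof.
apply: le_of_sqr; first by rewrite mulr_ge0 ?cabs_ge0 ?vn_ge0.
rewrite exprMn !(vn_sqr CB) (ph_ra (HC m)) (ph_ral CB (HC m)) -mulrA.
rewrite (scC CB); apply: le_trans (nrM CB _ _) _; rewrite (nr_st CB).
have h := nr_scl CB k (cip x x).
have h1 := nr_sc CB k; have h2 := nr_ge0 CB (sc k); have h3 := nr_ge0 CB (cip x x).
rewrite expr2 -mulrA; apply: ler_pM => //; exact: (nr_ge0 CB).
Qed.

Lemma mul_col_scalar m k (x : 'cV[B]_m) : (sc k)%:M *m x = cra x (sc k).
Proof. by apply/matrixP => i j; rewrite mul_scalar_mx !mxE ord1 (scC CB). Qed.

Theorem matrix_cstar :
  cstar_ring (fun k => (sc k)%:M : 'M[B]_n.+1) (@mst n.+1 n.+1) mnr.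
Proof.
split.
- by rewrite (sc1 CB).
- by move=> k l; rewrite (scD CB) raddfD.
- by move=> k l; rewrite (scM CB) scalar_mxM.
- move=> k A; apply/matrixP => i j; rewrite -[RHS]/(((sc k)%:M *m A) i j) mul_scalar_mx !mxE (bigD1 j) //= mxE eqxx mulr1n big1.
    by rewrite addr0 (scC CB).
  by move=> l /negbTE lj; rewrite mxE lj mulr0n mulr0.
- exact: mstD.
- by move=> A C; apply: mstM.
- exact: mstK.
- move=> k; apply/matrixP => i j; rewrite !mxE eq_sym; case: eqP => _ /=.
    by rewrite !mulr1n (st_sc CB).
  by rewrite !mulr0n (st0 CB).
- exact: mnr_ge0.
- move=> A C; apply: mnr_le; first by rewrite addr_ge0 ?mnr_ge0.
  move=> x; rewrite mulmxDl mulrDl; apply: le_trans (vnD CB (HC _) _ _) _.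
  by apply: lerD; apply: mnrP.
- move=> A C; apply: mnr_le; first by rewrite mulr_ge0 ?mnr_ge0.
  move=> x; rewrite -[(A * C) *m x]mulmxA -mulrA; apply: le_trans (mnrP _ _) _.
  by apply: ler_wpM2l; [exact: mnr_ge0|exact: mnrP].
- move=> k; apply: mnr_le; first exact: cabs_ge0.
  by move=> x; rewrite mul_col_scalar cn_scl.
- move=> A; have AA0 := mnr_ge0 (mst A * A).
  suff h : mnr A <= Num.sqrt (mnr (mst A * A)).
    by rewrite -(sqr_sqrtr AA0); apply: lerXn2r; rewrite ?nnegrE ?mnr_ge0 ?sqrtr_ge0.
  apply: mnr_le; first exact: sqrtr_ge0.
  move=> x; apply: le_of_sqr; first by rewrite mulr_ge0 ?sqrtr_ge0 ?vn_ge0.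
  rewrite (vn_sqr CB) exprMn sqr_sqrtr // cip_mul mulmxA.
  rewrite -(ph_st (HC _)) (nr_st CB); apply: le_trans (ph_cauchy_schwarz CB (HC _) _ _) _.
  have := mnrP (mst A * A) x; have := vn_ge0 nr (@cip _) x; rewrite -[mst A *m A]/(mst A * A); nra.
- move=> A A0; apply/matrixP => i j; rewrite mxE; apply: (nr_eq0 CB); apply/le_anti.
  by rewrite (nr_ge0 CB) andbT -A0 nr_le_mnr.
- move=> u hu.
  have [L hL] : exists L : 'I_n.+1 -> 'I_n.+1 -> B, forall i j e, 0 < e ->
      exists N, forall m, (N <= m)%N -> nr (u m i j - L i j) <= e.
    have h i j : exists l, forall e, 0 < e -> exists N, forall m, (N <= m)%N -> nr (u m i j - l) <= e.
      apply: (nr_complete CB) => e e0; have [N hN] := hu e e0; exists N => a b Na Nb.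
      by have := nr_le_mnr (u a - u b) i j; rewrite !mxE => /le_trans; apply; apply: hN.
    have [L hL] := choice (fun p : 'I_n.+1 * 'I_n.+1 => h p.1 p.2).
    by exists (fun i j => L (i, j)) => i j; apply: (hL (i, j)).
  exists (\matrix_(i, j) L i j) => e e0.
  set K : R := (n.+1 * n.+1)%:R; have K0 : 0 < K by rewrite ltr0n muln_gt0.
  have d0 : 0 < e / K by rewrite divr_gt0.
  have [N hN] := choice (fun p : 'I_n.+1 * 'I_n.+1 => hL p.1 p.2 _ d0).
  exists (\max_p N p)%N => m Nm; apply: le_trans (mnr_le_sum _) _.
  have -> : e = \sum_(i < n.+1) \sum_(j < n.+1) (e / K).
    rewrite !sumr_const !card_ord -mulrnA -mulr_natr mulrAC -mulrA divff ?mulr1 //.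
    by rewrite gt_eqF.
  do 2 apply: ler_sum => ? _; rewrite !mxE; apply: (hN (_, _)).
  by apply: leq_trans Nm; apply: (leq_bigmax (_, _)).
Qed.

End Norm.

Notation mpos := (@cstar_pos R _ (fun k => (sc k)%:M) (@mst _ _) (@mnr _)).

Lemma mpos_form n (A : 'M[B]_n.+1) (x : 'cV[B]_n.+1) : mpos A -> pos (cip x (A *m x)).
Proof.
move=> pA; have [v [sv <- _]] := pos_sqrt (matrix_cstar n) pA.
by rewrite -mulmxA cip_mul sv; apply: (ph_pos (HC _)).
Qed.

(* Tested on the columns of the negative part of [A]. *)
Lemma form_mpos n (A : 'M[B]_n.+1) : mst A = A ->
  (forall x : 'cV[B]_n.+1, pos (cip x (A *m x))) -> mpos A.
Proof.
move=> sA hA; have [p [r [m [[hp sr sm epa] [nan srn _ rn0]]]]] := selfadjoint_abs (matrix_cstar n) sA.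
suff w0 : r * m = 0 by move: epa; rewrite (rn0 w0) addr0 => <-.
set w := r * m in nan srn *; apply/matrixP => l j; rewrite [RHS]mxE.
have e1 : cip (col j m) (A *m col j m) = - \sum_k st (w k j) * w k j.
  have -> : cip (col j m) (A *m col j m) = (m * A * m) j j.
    have -> : A *m col j m = col j (A *m m) by rewrite !colE mulmxA.
    rewrite -mulrA /cip !mxE; apply: eq_bigr => k _; rewrite !mxE; congr (_ * _).
    by rewrite -[in RHS]sm mxE.
  rewrite nan mxE -{1}srn; congr (- _); rewrite mxE; apply: eq_bigr => k _.
  by rewrite mxE.
have h0 : \sum_k st (w k j) * w k j = 0.
  apply: (pos_anti CB); first exact: (pos_star_mul_sum CB).
  by rewrite -e1.
apply: (nr_eq0 CB); apply/eqP; have := nr_cstar CB (w l j).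
have : nr (st (w l j) * w l j) <= 0.
  rewrite -(nr0 CB) -h0 (bigD1 l) //=; apply: (nr_pos_mono CB); first exact: (pos_star_mul CB).
  by apply: (pos_sum CB) => k _; apply: (pos_star_mul CB).
by move=> h1 h2; have := le_trans h2 h1; rewrite le_eqVlt ltNge sqr_ge0 orbF sqrf_eq0.
Qed.

Section Gram.
Variables (V : zmodType) (ip : V -> V -> B) (ra : V -> B -> V).
Hypothesis HV : prehilbert sc st nr ip ra.

Definition gram n (x : 'I_n -> V) : 'M[B]_n := \matrix_(i, j) ip (x i) (x j).

Definition lincomb n (x : 'I_n -> V) (b : 'cV[B]_n) : V := \sum_i ra (x i) (b i ord0).

Lemma ph_sumr (I : Type) (r : seq I) (f : I -> V) x :
  ip x (\sum_(i <- r) f i) = \sum_(i <- r) ip x (f i).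
Proof. by apply: (big_morph _ (phD HV x) (ph0 HV x)). Qed.

Lemma ph_suml (I : Type) (r : seq I) (f : I -> V) x :
  ip (\sum_(i <- r) f i) x = \sum_(i <- r) ip (f i) x.
Proof. by apply: (big_morph (ip^~ x) (fun y z => phDl CB HV y z x) (ph0l CB HV x)). Qed.

Lemma gram_form n (x : 'I_n -> V) (b c : 'cV[B]_n) :
  cip b (gram x *m c) = ip (lincomb x b) (lincomb x c).
Proof.
rewrite cipE ph_suml; apply: eq_bigr => i _; rewrite ph_sumr mxE mulr_sumr.
by apply: eq_bigr => j _; rewrite (ph_ra HV) (ph_ral CB HV) mxE mulrA.
Qed.

Lemma mst_gram n (x : 'I_n -> V) : mst (gram x) = gram x.
Proof. by apply/matrixP => i j; rewrite !mxE (ph_st HV). Qed.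

Lemma gram_mpos n (x : 'I_n.+1 -> V) : mpos (gram x).
Proof.
by apply: form_mpos; [exact: mst_gram|move=> b; rewrite gram_form; apply: (ph_pos HV)].
Qed.

End Gram.

(** The quadratic form of the difference at coefficients [b] is covered by [ph_bounded_pos] at the
    single vector [lincomb ra x b]: a bounded module map satisfies the same bound at all matrix
    levels. *)
Lemma gram_bounded_mpos (V W : zmodType) (ip : V -> V -> B) (ra : V -> B -> V)
  (ip' : W -> W -> B) (ra' : W -> B -> W) (L : V -> W) (c : R) n (x : 'I_n.+1 -> V) :
  prehilbert sc st nr ip ra -> prehilbert sc st nr ip' ra' ->
  (forall x b, L (ra x b) = ra' (L x) b) -> {morph L : x y / x + y} -> L 0 = 0 -> 0 <= c ->
  (forall x, nr (ip' (L x) (L x)) <= c * nr (ip x x)) ->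
  mpos ((rs c)%:M * gram ip x - gram ip' (fun i => L (x i))).
Proof.
move=> HV HW Lra LD L0 c0 Lc.
have CM := matrix_cstar n.
have s1 := mst_gram HV x; have s2 := mst_gram HW (fun i => L (x i)).
apply: form_mpos => [|b].
  by rewrite (stB CM) (stM CM) s1 s2 -[(rs c)%:M]/(real_sc (fun k => (sc k)%:M) c) (st_rs CM) (rsC CM).
rewrite mulmxBl (phB (HC _)) -mulmxA mul_scalar_mx.
have -> : cip b (rs c *: (gram ip x *m b)) = rs c * cip b (gram ip x *m b).
  rewrite !cipE mulr_sumr; apply: eq_bigr => i _.
  have -> : (rs c *: (gram ip x *m b)) i ord0 = rs c * (gram ip x *m b) i ord0 by rewrite mxE.
  by rewrite (rsCA CB).
rewrite (gram_form HV) (gram_form HW).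
have -> : lincomb ra' (fun i => L (x i)) b = L (lincomb ra x b).
  by rewrite /lincomb (big_morph L LD L0); apply: eq_bigr => i _; rewrite Lra.
exact: (ph_bounded_pos CB HV HW Lra c0 Lc).
Qed.

End MatrixCStar.

(** * C*-algebras and their unitizations *)

Section RealNorm.
Variables (R : realType) (V : normedModType R[i]).
Implicit Types x y : V.

Definition rnorm x : R := complex.Re `|x|.

Lemma rnormE x : `|x| = (rnorm x)%:C.
Proof. by rewrite /rnorm RRe_real ?normr_real. Qed.
Lemma rnorm_ge0 x : 0 <= rnorm x.
Proof. by rewrite -ler0c -rnormE. Qed.
Lemma rnormD x y : rnorm (x + y) <= rnorm x + rnorm y.
Proof. by rewrite -lecR rmorphD /= -!rnormE ler_normD. Qed.
Lemma rnormZ k x : rnorm (k *: x) = cabs k * rnorm x.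
Proof. by apply: complexI; rewrite rmorphM /= -!rnormE -cabsE normrZ. Qed.
Lemma rnormN x : rnorm (- x) = rnorm x.
Proof. by rewrite /rnorm normrN. Qed.
Lemma rnormB x y : rnorm (x - y) <= rnorm x + rnorm y.
Proof. by rewrite -(rnormN y) rnormD. Qed.
Lemma rnorm_distC x y : rnorm (x - y) = rnorm (y - x).
Proof. by rewrite -rnormN opprB. Qed.
Lemma rnorm0 : rnorm (0 : V) = 0.
Proof. by rewrite /rnorm normr0. Qed.
Lemma rnorm_eq0 x : rnorm x = 0 -> x = 0.
Proof. by move=> h; apply/eqP; rewrite -normr_eq0 rnormE h. Qed.
Lemma rnorm_sum (I : Type) (r : seq I) (f : I -> V) :
  rnorm (\sum_(i <- r) f i) <= \sum_(i <- r) rnorm (f i).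
Proof.
elim/big_ind2: _ => //; first by rewrite rnorm0.
by move=> x1 x2 y1 y2 h1 h2; apply: le_trans (rnormD _ _) _; apply: lerD.
Qed.
Lemma rnorm_small0 c x : (forall e, 0 < e -> rnorm x <= c * e) -> x = 0.
Proof.
move=> h; apply: rnorm_eq0; apply/le_anti; rewrite rnorm_ge0 andbT.
apply/ler_addgt0Pr => e e0; rewrite add0r.
have c0 : 0 < `|c| + 1 by rewrite ltr_wpDl.
apply: le_trans (h (e / (`|c| + 1)) _) _; first by rewrite divr_gt0.
rewrite mulrCA ger_pMr // ler_pdivrMr // mul1r.
by apply: (le_trans (ler_norm c)); rewrite lerDl.
Qed.

Definition lim_to (u : nat -> V) (l : V) : Prop :=
  forall e, 0 < e -> exists N, forall n, (N <= n)%N -> rnorm (u n - l) <= e.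

Lemma closure_rnorm (S : set V) x :
  closure S x <-> forall e, 0 < e -> exists2 y, S y & rnorm (x - y) <= e.
Proof.
split=> [h e e0|h].
  have e0' : 0 < e%:C :> R[i] by rewrite ltcR.
  have [y [Sy]] := h _ (nbhsx_ballx x _ e0').
  rewrite -ball_normE /= rnormE ltcR => hy.
  by exists y => //; apply: ltW.
move=> A /nbhs_ballP[e /= e0 hA].
have ee : e = (complex.Re e)%:C by rewrite RRe_real // gtr0_real.
have e1 : 0 < complex.Re e by rewrite -ltcR -ee.
have [y Sy hy] := h (complex.Re e / 2) ltac:(by rewrite divr_gt0).
exists y; split=> //; apply: hA; rewrite -ball_normE /= rnormE ee ltcR.
by apply: le_lt_trans hy _; rewrite ltr_pdivrMr // ltr_pMr // ltr1n.
Qed.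

End RealNorm.

Lemma rnorm_complete (R : realType) (V : completeNormedModType R[i]) (u : nat -> V) :
  (forall e, 0 < e -> exists N, forall m n, (N <= m)%N -> (N <= n)%N ->
     rnorm (u m - u n) <= e) ->
  exists l, lim_to u l.
Proof.
move=> hu.
have : cvg (u @ \oo).
  apply/cauchy_cvgP/cauchy_exP => e /= e0.
  have ee : e = (complex.Re e)%:C by rewrite RRe_real // gtr0_real.
  have e1 : 0 < complex.Re e by rewrite -ltcR -ee.
  have e2 : 0 < complex.Re e / 2 by rewrite divr_gt0.
  have [N hN] := hu _ e2.
  exists (u N); exists N => // n /= Nn.
  rewrite -ball_normE /= rnormE ee ltcR.
  apply: le_lt_trans (hN _ _ (leqnn N) Nn) _.
  by rewrite ltr_pdivrMr // ltr_pMr // ltr1n.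
move=> /cvgrPdist_le h; exists (lim (u @ \oo)) => e e0.
have [N _ hN] := h e%:C ltac:(by rewrite ltcR).
exists N => n Nn; rewrite rnorm_distC -lecR -rnormE; exact: hN.
Qed.

Lemma real_complete (R : realType) (u : nat -> R) :
  (forall e, 0 < e -> exists N, forall m n, (N <= m)%N -> (N <= n)%N ->
     `|u m - u n| <= e) ->
  exists l, forall e, 0 < e -> exists N, forall n, (N <= n)%N -> `|u n - l| <= e.
Proof.
move=> hu.
have : cvg (u @ \oo).
  apply/cauchy_cvgP/cauchy_exP => e /= e0.
  have e2 : 0 < e / 2 by rewrite divr_gt0.
  have [N hN] := hu _ e2.
  exists (u N); exists N => // n /= Nn.
  rewrite -ball_normE /=; apply: le_lt_trans (hN _ _ (leqnn N) Nn) _.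
  by rewrite ltr_pdivrMr // ltr_pMr // ltr1n.
move=> /cvgrPdist_le h; exists (lim (u @ \oo)) => e e0.
have [N _ hN] := h e e0.
by exists N => n Nn; rewrite distrC; apply: hN.
Qed.

Lemma cabs_ge_Re (R : realType) (k : R[i]) : `|complex.Re k| <= cabs k.
Proof. by rewrite -lecR -cabsE normc_ge_Re. Qed.

Lemma cabs_ge_Im (R : realType) (k : R[i]) : `|complex.Im k| <= cabs k.
Proof.
rewrite /cabs normc_def /= -sqrtr_sqr ler_sqrt ?lerDr ?sqr_ge0 //.
by rewrite addr_ge0 ?sqr_ge0.
Qed.

Lemma cabs_le (R : realType) (k : R[i]) : cabs k <= `|complex.Re k| + `|complex.Im k|.
Proof.
apply: le_of_sqr; first by rewrite addr_ge0.
rewrite /cabs normc_def /= sqr_sqrtr ?addr_ge0 ?sqr_ge0 //.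
rewrite sqrrD !real_normK ?num_real // -addrA lerD2l lerDr.
by rewrite mulrn_wge0 // mulr_ge0.
Qed.

Lemma complex_complete (R : realType) (u : nat -> R[i]) :
  (forall e, 0 < e -> exists N, forall m n, (N <= m)%N -> (N <= n)%N ->
     cabs (u m - u n) <= e) ->
  exists l, forall e, 0 < e -> exists N, forall n, (N <= n)%N -> cabs (u n - l) <= e.
Proof.
move=> hu.
have [|a ha] := @real_complete R (fun n => complex.Re (u n)).
  move=> e e0; have [N hN] := hu e e0; exists N => m n Nm Nn.
  by apply: le_trans (hN m n Nm Nn); rewrite -(raddfB (@complex.Re R)) cabs_ge_Re.
have [|b hb] := @real_complete R (fun n => complex.Im (u n)).
  move=> e e0; have [N hN] := hu e e0; exists N => m n Nm Nn.
  by apply: le_trans (hN m n Nm Nn); rewrite -(raddfB (@complex.Im R)) cabs_ge_Im.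
exists (a +i* b) => e e0; have e2 : 0 < e / 2 by rewrite divr_gt0.
have [N1 h1] := ha _ e2; have [N2 h2] := hb _ e2.
exists (maxn N1 N2) => n; rewrite geq_max => /andP[n1 n2].
apply: le_trans (cabs_le _) _; rewrite (raddfB (@complex.Re R)) (raddfB (@complex.Im R)) /=.
have := h1 n n1; have := h2 n n2; lra.
Qed.

Section CStarAlgebraTheory.
Variables (R : realType) (A : cstarAlgType R).
Implicit Types a b c : A.

Lemma cmulDl a b c : cmul (a + b) c = cmul a c + cmul b c.
Proof. by have := cmul_linearl 1 a b c; rewrite !scale1r. Qed.
Lemma cmulDr a b c : cmul a (b + c) = cmul a b + cmul a c.
Proof. by have := cmul_linearr 1 a b c; rewrite !scale1r. Qed.
Lemma cmul0l a : cmul 0 a = 0.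
Proof. by apply: (addrI (cmul 0 a)); rewrite -cmulDl !addr0. Qed.
Lemma cmul0r a : cmul a 0 = 0.
Proof. by apply: (addrI (cmul a 0)); rewrite -cmulDr !addr0. Qed.
Lemma cmulZl k a b : cmul (k *: a) b = k *: cmul a b.
Proof. by have := cmul_linearl k a 0 b; rewrite cmul0l !addr0. Qed.
Lemma cmulZr k a b : cmul a (k *: b) = k *: cmul a b.
Proof. by have := cmul_linearr k a b 0; rewrite cmul0r !addr0. Qed.
Lemma cstarD a b : cstar (a + b) = cstar a + cstar b.
Proof. by have := cstar_antilinear 1 a b; rewrite rmorph1 !scale1r. Qed.
Lemma cstar0 : cstar (0 : A) = 0.
Proof. by apply: (addrI (cstar 0)); rewrite -cstarD !addr0. Qed.
Lemma cstarZ k a : cstar (k *: a) = k^* *: cstar a.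
Proof. by have := cstar_antilinear k a 0; rewrite cstar0 !addr0. Qed.

Lemma rnorm_cmul a b : rnorm (cmul a b) <= rnorm a * rnorm b.
Proof. by rewrite -lecR rmorphM /= -!rnormE cmul_norm. Qed.
Lemma rnorm_cstar_mul a : rnorm (cmul (cstar a) a) = rnorm a ^+ 2.
Proof. by apply: complexI; rewrite rmorphXn /= -!rnormE cstar_norm. Qed.
Lemma rnorm_cstar a : rnorm (cstar a) = rnorm a.
Proof.
have h b : rnorm b <= rnorm (cstar b).
  have [->|/eqP ne] := eqVneq (rnorm b) 0; first exact: rnorm_ge0.
  have lt : 0 < rnorm b by rewrite lt_neqAle eq_sym rnorm_ge0 andbT; apply/eqP.
  by have := rnorm_cmul (cstar b) b; rewrite rnorm_cstar_mul expr2 ler_pM2r.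
by apply/le_anti; rewrite h andbT -{2}[a]cstarK h.
Qed.

(* The unitization with [(a, k)] standing for [a + k 1], normed by the maximum
   of the norm as an operator on [A] and of [|k|]; this is a C*-norm
   whether or not [A] has a unit. *)
Definition unitz : Type := (A * R[i])%type.
HB.instance Definition _ := GRing.Zmodule.on unitz.
Implicit Types x y z : unitz.

Definition umul x y : unitz :=
  (cmul x.1 y.1 + y.2 *: x.1 + x.2 *: y.1, x.2 * y.2).
Definition uone : unitz := (0, 1).

Lemma umulA : associative umul.
Proof.
move=> [a k] [b l] [c m]; rewrite /umul /=; congr (_, _); last exact: mulrA.
rewrite !(cmulDl, cmulDr, cmulZl, cmulZr, scalerDr, scalerA, cmulA) [m * l]mulrC [m * k]mulrC.
by zabel.
Qed.
Lemma umul1l : left_id uone umul.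
Proof. by move=> [a k]; rewrite /umul /= cmul0l scaler0 scale1r !add0r mul1r. Qed.
Lemma umul1r : right_id uone umul.
Proof. by move=> [a k]; rewrite /umul /= cmul0r scaler0 scale1r add0r addr0 mulr1. Qed.
Lemma umulDl : left_distributive umul +%R.
Proof.
move=> [a k] [b l] [c m]; rewrite /umul /=; congr (_, _); last exact: mulrDl.
rewrite !(cmulDl, scalerDr, scalerDl) /=; zabel.
Qed.
Lemma umulDr : right_distributive umul +%R.
Proof.
move=> [a k] [b l] [c m]; rewrite /umul /=; congr (_, _); last exact: mulrDr.
rewrite !(cmulDr, scalerDr, scalerDl) /=; zabel.
Qed.
Lemma uone_neq0 : uone != 0 :> unitz.
Proof. by apply/eqP => -[] /eqP; rewrite oner_eq0. Qed.
HB.instance Definition _ := GRing.Zmodule_isNzRing.Build unitz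
  umulA umul1l umul1r umulDl umulDr uone_neq0.

Definition uin (a : A) : unitz := (a, 0).
Definition usc (k : R[i]) : unitz := (0, k).
Definition ust x : unitz := (cstar x.1, x.2^*).
Definition uact x (m : A) : A := cmul x.1 m + x.2 *: m.

Lemma umulE x y : x * y = (cmul x.1 y.1 + y.2 *: x.1 + x.2 *: y.1, x.2 * y.2).
Proof. by []. Qed.
Lemma uactM x y m : uact (x * y) m = uact x (uact y m).
Proof.
rewrite /uact umulE /= !(cmulDl, cmulDr, cmulZl, cmulZr, scalerDr, scalerA, cmulA); zabel.
Qed.
Lemma uactD x y m : uact (x + y) m = uact x m + uact y m.
Proof. by rewrite /uact /= cmulDl scalerDl; zabel. Qed.
Lemma uact_in a m : uact (uin a) m = cmul a m.
Proof. by rewrite /uact /= scale0r addr0. Qed.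
Lemma uact_star x m n : cmul (cstar (uact x m)) n = cmul (cstar m) (uact (ust x) n).
Proof.
by rewrite /uact cstarD cstarM cstarZ cmulDl cmulDr -cmulA cmulZl cmulZr.
Qed.
Lemma uinD a b : uin (a + b) = uin a + uin b.
Proof. by congr (_, _); rewrite /= addr0. Qed.
Lemma uinM a b : uin (cmul a b) = uin a * uin b.
Proof. by rewrite umulE /= !scale0r !addr0 mulr0. Qed.
Lemma uin_st a : uin (cstar a) = ust (uin a).
Proof. by congr (_, _); rewrite /= -[RHS]/(conjc 0) conjc0. Qed.
Lemma uinZ k a : uin (k *: a) = usc k * uin a.
Proof. by rewrite umulE /= cmul0l scaler0 !add0r mulr0. Qed.
Lemma uin_inj : injective uin.
Proof. by move=> a b []. Qed.
Lemma uin_act x a : x * uin a = uin (uact x a).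
Proof. by rewrite umulE /uact /= scale0r addr0 mulr0. Qed.

Definition ubounds x : set R :=
  [set c | [/\ 0 <= c, cabs x.2 <= c & forall m, rnorm (uact x m) <= c * rnorm m]].
Definition unr x : R := inf (ubounds x).

Lemma ubounds_sum x : ubounds x (rnorm x.1 + cabs x.2).
Proof.
split; first by rewrite addr_ge0 ?rnorm_ge0 ?cabs_ge0.
  by rewrite lerDr rnorm_ge0.
move=> m; apply: le_trans (rnormD _ _) _; rewrite rnormZ mulrDl lerD2r.
exact: rnorm_cmul.
Qed.
Lemma has_inf_ubounds x : has_inf (ubounds x).
Proof. by split; [exists (rnorm x.1 + cabs x.2); exact: ubounds_sum|exists 0 => c []]. Qed.
Lemma unr_ge0 x : 0 <= unr x.
Proof. by apply: lb_le_inf; [case: (has_inf_ubounds x)|move=> c []]. Qed.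
Lemma unr_le x (c : R) : 0 <= c -> cabs x.2 <= c ->
  (forall m, rnorm (uact x m) <= c * rnorm m) -> unr x <= c.
Proof. by move=> c0 h1 h2; apply: ge_inf; [case: (has_inf_ubounds x)|]. Qed.
Lemma unr_le_sum x : unr x <= rnorm x.1 + cabs x.2.
Proof. by have [h1 h2 h3] := ubounds_sum x; apply: unr_le. Qed.
Lemma unr_scalar x : cabs x.2 <= unr x.
Proof. by apply: lb_le_inf; [case: (has_inf_ubounds x)|move=> c []]. Qed.
Lemma unrP x m : rnorm (uact x m) <= unr x * rnorm m.
Proof.
have [e|ne] := eqVneq (rnorm m) 0.
  by have [_ _ h] := ubounds_sum x; have := h m; rewrite e !mulr0.
have xp : 0 < rnorm m by rewrite lt_neqAle eq_sym ne rnorm_ge0.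
rewrite -ler_pdivrMr //; apply: lb_le_inf; first by case: (has_inf_ubounds x).
by move=> c [c0 _ h]; rewrite ler_pdivrMr.
Qed.

Lemma unr_in a : unr (uin a) = rnorm a.
Proof.
apply/le_anti/andP; split.
  by apply: le_trans (unr_le_sum _) _; rewrite /= /cabs normr0 /= addr0.
have := unrP (uin a) (cstar a); rewrite uact_in -{1}[a]cstarK rnorm_cstar_mul rnorm_cstar.
have [->|ne] := eqVneq (rnorm a) 0; first by rewrite unr_ge0.
have xp : 0 < rnorm a by rewrite lt_neqAle eq_sym ne rnorm_ge0.
by rewrite expr2 ler_pM2r.
Qed.

(** [x.1] acts as [x - x.2], and both terms are controlled by [unr]. With this, completeness of the
    unitization reduces to that of [A] and of [R[i]]. *)
Lemma rnorm_fst_le x : rnorm x.1 <= unr x + unr x.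
Proof.
have e : uin x.1 = x - usc x.2 by congr (_, _); rewrite /= ?oppr0 ?addr0 ?subrr.
rewrite -unr_in; apply: unr_le; first by rewrite addr_ge0 ?unr_ge0.
  by rewrite /= /cabs normr0 /= addr_ge0 ?unr_ge0.
move=> m; have -> : uact (uin x.1) m = uact x m - x.2 *: m.
  by rewrite uact_in /uact; zabel.
apply: le_trans (rnormB _ _) _; rewrite mulrDl; apply: lerD; first exact: unrP.
by rewrite rnormZ; apply: ler_wpM2r; rewrite ?rnorm_ge0 ?unr_scalar.
Qed.

Theorem unitz_cstar : cstar_ring usc ust unr.
Proof.
split=> //.
- by move=> k l; congr (_, _); rewrite /= addr0.
- by move=> k l; rewrite umulE /= cmul0l !scaler0 !addr0.
- by move=> k x; rewrite !umulE /= cmul0l cmul0r !scaler0 addr0 !add0r mulrC.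
- by move=> x y; congr (_, _); rewrite /= ?cstarD ?rmorphD.
- move=> x y; rewrite !umulE /ust /= !cstarD cstarM !cstarZ rmorphM /= [x.2^* * _]mulrC.
  by congr (_, _); zabel.
- by move=> [a k]; rewrite /ust /= cstarK conjcK.
- by move=> k; rewrite /ust /= cstar0.
- exact: unr_ge0.
- move=> x y; apply: unr_le; first by rewrite addr_ge0 ?unr_ge0.
    by apply: le_trans (cabsD _ _) _; apply: lerD; apply: unr_scalar.
  move=> m; rewrite uactD mulrDl; apply: le_trans (rnormD _ _) _.
  by apply: lerD; apply: unrP.
- move=> x y; apply: unr_le; first by rewrite mulr_ge0 ?unr_ge0.
    by rewrite cabsM; apply: ler_pM; rewrite ?cabs_ge0 ?unr_scalar.
  move=> m; rewrite uactM -mulrA; apply: le_trans (unrP _ _) _.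
  by apply: ler_wpM2l; rewrite ?unr_ge0 ?unrP.
- move=> k; apply: le_trans (unr_le_sum _) _; by rewrite /= rnorm0 add0r.
- move=> x; have s0 := unr_ge0 (ust x * x).
  suff h : unr x <= Num.sqrt (unr (ust x * x)).
    by rewrite -(sqr_sqrtr s0); apply: lerXn2r; rewrite ?nnegrE ?unr_ge0 ?sqrtr_ge0.
  apply: unr_le; first exact: sqrtr_ge0.
    apply: le_of_sqr; first exact: sqrtr_ge0.
    rewrite sqr_sqrtr //; apply: le_trans (unr_scalar _).
    by rewrite /= cabsM cabs_conj expr2.
  move=> m; apply: le_of_sqr; first by rewrite mulr_ge0 ?sqrtr_ge0 ?rnorm_ge0.
  rewrite exprMn sqr_sqrtr // -rnorm_cstar_mul uact_star -uactM.
  apply: le_trans (rnorm_cmul _ _) _; rewrite rnorm_cstar.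
  have := unrP (ust x * x) m; have := rnorm_ge0 m; nra.
- move=> x x0.
  have h2 : x.2 = 0.
    apply/eqP; rewrite -normr_eq0 cabsE; have := unr_scalar x; rewrite x0 => h.
    by rewrite (_ : cabs x.2 = 0) //; apply/le_anti; rewrite h cabs_ge0.
  have h1 : x.1 = 0.
    apply: rnorm_eq0; apply/le_anti; rewrite rnorm_ge0 andbT.
    by have := rnorm_fst_le x; rewrite x0 addr0.
  by rewrite [x]surjective_pairing h1 h2.
- move=> u hu.
  have [l1 hl1] : exists l, lim_to (fun n => (u n).1) l.
    apply: rnorm_complete => e e0; have [|N hN] := hu (e / 2); first by rewrite divr_gt0.
    exists N => m n Nm Nn; have := rnorm_fst_le (u m - u n); have := hN m n Nm Nn.
    rewrite [(u m - u n).1]/=; lra.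
  have [|l2 hl2] := @complex_complete R (fun n => (u n).2).
    move=> e e0; have [N hN] := hu e e0; exists N => m n Nm Nn.
    by apply: le_trans (hN m n Nm Nn); apply: (unr_scalar (u m - u n)).
  exists (l1, l2) => e e0; have e2 : 0 < e / 2 by rewrite divr_gt0.
  have [N1 h1] := hl1 _ e2; have [N2 h2] := hl2 _ e2.
  exists (maxn N1 N2) => n; rewrite geq_max => /andP[n1 n2].
  apply: le_trans (unr_le_sum _) _; have := h1 n n1; have := h2 n n2.
  rewrite [(u n - _).1]/= [(u n - _).2]/=; lra.
Qed.

End CStarAlgebraTheory.

Notation "x ^cj" := (conjc x) (at level 1, left associativity, format "x ^cj").

Section ComplexNumbers.
Variable R : realType.
Implicit Types k l : R[i].

Lemma conjcM k l : (k * l)^cj = k^cj * l^cj. Proof. exact: rmorphM. Qed.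
Lemma conjcD k l : (k + l)^cj = k^cj + l^cj. Proof. exact: rmorphD. Qed.
Lemma conjcN k : (- k)^cj = - k^cj. Proof. exact: rmorphN. Qed.
Lemma conjc_sum (I : Type) (r : seq I) (f : I -> R[i]) :
  (\sum_(i <- r) f i)^cj = \sum_(i <- r) (f i)^cj.
Proof. exact: rmorph_sum. Qed.
Lemma RCD (a b : R) : (a + b)%:C = a%:C + b%:C. Proof. exact: rmorphD. Qed.
Lemma RCN (a : R) : (- a)%:C = - a%:C. Proof. exact: rmorphN. Qed.
Lemma RCM (a b : R) : (a * b)%:C = a%:C * b%:C. Proof. exact: rmorphM. Qed.
Lemma addcJ_Re k : k + k^cj = (complex.Re k + complex.Re k)%:C.
Proof. by rewrite addcJ RCD -mulr2n mulr_natl. Qed.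
Lemma real_nat n : (n%:R)%:C = n%:R :> R[i]. Proof. exact: rmorph_nat. Qed.

Lemma mul_conjcE k : k^cj * k = (cabs k ^+ 2)%:C.
Proof. by rewrite rmorphXn /= -cabsE sqr_normc mulrC. Qed.

Lemma cabs_eq0 k : cabs k = 0 -> k = 0.
Proof. by move=> h; apply/eqP; rewrite -normr_eq0 cabsE h. Qed.

Lemma cabs0 : cabs (0 : R[i]) = 0. Proof. by rewrite /cabs normr0. Qed.
Lemma cabsN k : cabs (- k) = cabs k. Proof. by rewrite /cabs normrN. Qed.
Lemma cabsB k l : cabs (k - l) <= cabs k + cabs l.
Proof. by rewrite -(cabsN l) cabsD. Qed.
Lemma cabs_distC k l : cabs (k - l) = cabs (l - k).
Proof. by rewrite -cabsN opprB. Qed.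
Lemma cabs_sum (I : Type) (r : seq I) (f : I -> R[i]) :
  cabs (\sum_(i <- r) f i) <= \sum_(i <- r) cabs (f i).
Proof.
elim/big_ind2: _ => //; first by rewrite cabs0.
by move=> x1 x2 y1 y2 h1 h2; apply: le_trans (cabsD _ _) _; apply: lerD.
Qed.
Lemma cabs_ge0_Re k : 0 <= k -> k = (complex.Re k)%:C.
Proof. by move=> h; rewrite RRe_real // ger0_real. Qed.
Lemma Re_ge0 k : 0 <= k -> 0 <= complex.Re k.
Proof. by rewrite lecE => /andP[]. Qed.
Lemma cabs_small0 c k : (forall e, 0 < e -> cabs k <= c * e) -> k = 0.
Proof.
move=> h; apply: cabs_eq0; apply/le_anti; rewrite cabs_ge0 andbT.
apply/ler_addgt0Pr => e e0; rewrite add0r.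
have c0 : 0 < `|c| + 1 by rewrite ltr_wpDl.
apply: le_trans (h (e / (`|c| + 1)) _) _; first by rewrite divr_gt0.
rewrite mulrCA ger_pMr // ler_pdivrMr // mul1r.
by apply: (le_trans (ler_norm c)); rewrite lerDl.
Qed.

End ComplexNumbers.

(** * Semidefinite forms on formal sums *)

(* Elements of a pre-Hilbert space as finite formal sums, represented by lists
   over [E]; [beta] is the inner product of two terms and [s] the scaling of a
   term. *)
Section Kernel.
Variables (R : realType) (E : Type) (beta : E -> E -> R[i]) (s : R[i] -> E -> E).

Definition kf (u v : seq E) : R[i] := \sum_(p <- u) \sum_(q <- v) beta p q.
Definition kscl (k : R[i]) (u : seq E) := map (s k) u.
Definition kn (u : seq E) : R := Num.sqrt (complex.Re (kf u u)).

Record is_kernel : Prop := {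
  kernel_herm : forall p q, beta p q = (beta q p)^cj;
  kernel_scl : forall k p q, beta p (s k q) = k * beta p q;
  kernel_pos : forall u, 0 <= kf u u
}.

Lemma kf_nil u : kf u [::] = 0.
Proof. by rewrite /kf big1 // => p _; rewrite big_nil. Qed.
Lemma kf_cat_r u v w : kf u (v ++ w) = kf u v + kf u w.
Proof. by rewrite /kf -big_split; apply: eq_bigr => p _; rewrite big_cat. Qed.
Lemma kf_cat_l u v w : kf (u ++ v) w = kf u w + kf v w.
Proof. by rewrite /kf big_cat. Qed.

Hypothesis K : is_kernel.

Lemma kf_conj u v : kf u v = (kf v u)^cj.
Proof.
rewrite /kf conjc_sum exchange_big /=; apply: eq_bigr => p _.
by rewrite conjc_sum; apply: eq_bigr => q _; apply: kernel_herm.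
Qed.
Lemma kf_scl_r k u v : kf u (kscl k v) = k * kf u v.
Proof.
rewrite /kf mulr_sumr; apply: eq_bigr => p _; rewrite big_map mulr_sumr.
by apply: eq_bigr => q _; apply: kernel_scl.
Qed.
Lemma kf_scl_l k u v : kf (kscl k u) v = k^cj * kf u v.
Proof. by rewrite kf_conj kf_scl_r conjcM -kf_conj. Qed.

Lemma kn_ge0 u : 0 <= kn u. Proof. exact: sqrtr_ge0. Qed.
Lemma kn_sqr u : (kn u ^+ 2)%:C = kf u u.
Proof. by rewrite sqr_sqrtr ?Re_ge0 ?(kernel_pos K) // -(cabs_ge0_Re (kernel_pos K u)). Qed.

Lemma kn_sqr_le c u : 0 <= c -> kf u u <= (c ^+ 2)%:C -> kn u <= c.
Proof. by move=> c0; rewrite -kn_sqr lecR; apply: le_of_sqr. Qed.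

Lemma kf_cauchy_schwarz u v : cabs (kf u v) <= kn u * kn v.
Proof.
apply: le_of_sqr; first by rewrite mulr_ge0 ?kn_ge0.
set e := kf u v; set a := kn u; set b := kn v.
have h d : 0 < d -> cabs e ^+ 2 <= a ^+ 2 * (b ^+ 2 + d).
  move=> d0; have bd : 0 < b ^+ 2 + d by rewrite ltr_wpDl ?sqr_ge0.
  set t := (b ^+ 2 + d)^-1; have t0 : 0 < t by rewrite invr_gt0.
  have := kernel_pos K (u ++ kscl (- (t%:C * e^cj)) v).
  rewrite kf_cat_l !kf_cat_r !kf_scl_l !kf_scl_r -!kn_sqr (kf_conj v u) -/e -/a -/b.
  have -> : (a ^+ 2)%:C + - (t%:C * e^cj) * e
     + ((- (t%:C * e^cj))^cj * e^cj + (- (t%:C * e^cj))^cj * (- (t%:C * e^cj) * (b ^+ 2)%:C)) =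
     (a ^+ 2 - (t * cabs e ^+ 2 + t * cabs e ^+ 2) + t * (t * cabs e ^+ 2) * b ^+ 2)%:C.
    rewrite conjcN conjcM conjc_real conjcK.
    have := mul_conjcE e; move: (cabs e ^+ 2) (a ^+ 2) (b ^+ 2) => ce a2 b2 Ee.
    rewrite !(RCD, RCN, RCM) -Ee; ring.
  rewrite ler0c => hh.
  have tb : t * (b ^+ 2 + d) = 1 by rewrite mulVf // gt_eqF.
  have ce := sqr_ge0 (cabs e).
  rewrite -ler_pdivrMr // -/t; move: hh.
  have -> : t * (t * cabs e ^+ 2) * b ^+ 2 = t * cabs e ^+ 2 * (t * (b ^+ 2 + d)) - t * cabs e ^+ 2 * (t * d) by ring.
  have : 0 <= t * cabs e ^+ 2 * (t * d) by apply: mulr_ge0; apply: mulr_ge0 => //; apply: ltW.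
  rewrite tb; lra.
apply/ler_addgt0Pr => d d0; rewrite exprMn.
have a1 : 0 < a ^+ 2 + 1 by rewrite ltr_wpDl ?sqr_ge0.
apply: le_trans (h (d / (a ^+ 2 + 1)) _) _; first by rewrite divr_gt0.
by rewrite mulrDr lerD2l mulrCA ger_pMr // ler_pdivrMr // mul1r lerDl.
Qed.

Lemma kn_cat u v : kn (u ++ v) <= kn u + kn v.
Proof.
apply: le_of_sqr; first by rewrite addr_ge0 ?kn_ge0.
rewrite -lecR kn_sqr kf_cat_l !kf_cat_r (kf_conj v u).
have -> : kf u u + kf u v + ((kf u v)^cj + kf v v) =
  (kn u ^+ 2 + 2 * complex.Re (kf u v) + kn v ^+ 2)%:C.
  rewrite !rmorphD /= !kn_sqr rmorphM /= real_nat -addcJ; ring.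
rewrite lecR sqrrD; have := kf_cauchy_schwarz u v; have := cabs_ge_Re (kf u v).
have := ler_norm (complex.Re (kf u v)); lra.
Qed.

Lemma kn_scl k u : kn (kscl k u) = cabs k * kn u.
Proof.
apply/le_anti; apply/andP; split; apply: le_of_sqr; rewrite ?mulr_ge0 ?kn_ge0 ?cabs_ge0 //;
  by rewrite -lecR kn_sqr kf_scl_l kf_scl_r mulrA mul_conjcE -kn_sqr -rmorphM -exprMn lexx.
Qed.

Section ApproximateRiesz.
Variables (q : seq E -> R[i]) (C : R).
Hypothesis q_cat : forall u v, q (u ++ v) = q u + q v.
Hypothesis q_scl : forall k u, q (kscl k u) = k * q u.
Hypothesis q_bound : forall u, cabs (q u) <= C * kn u.

(* Near-minimizers of [|u|^2 - 2 Re q(u)] almost represent [q]. *)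
Lemma approx_riesz e : 0 < e ->
  exists w, forall u, cabs (kf w u - q u) <= e * kn u.
Proof.
move=> e0; pose J u := kn u ^+ 2 - 2 * complex.Re (q u).
pose S := [set x | exists u, x = J u].
have Sinf : has_inf S.
  split; first by exists (J [::]), [::].
  exists (- C ^+ 2) => _ [u ->]; rewrite /J.
  have := q_bound u; have := cabs_ge_Re (q u); have := ler_norm (complex.Re (q u)).
  move=> h1 h2 h3; have := sqr_ge0 (kn u - C); rewrite sqrrB; lra.
have [_ [w ->] hw] : exists2 x, S x & x < inf S + e ^+ 2.
  by apply: inf_adherent => //; apply: exprn_gt0.
exists w => u; set d := kf w u - q u; set N := kn u.
apply: le_of_sqr; first by rewrite mulr_ge0 ?kn_ge0 // ltW.
(* [J] at [w + k u] is at least its infimum, hence at least [J w - e^2]; the scalar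
   [k = - t conj(d)] points in the direction of steepest descent. *)
have h t : 0 <= t -> 2 * t * cabs d ^+ 2 - t ^+ 2 * cabs d ^+ 2 * N ^+ 2 <= e ^+ 2.
  move=> t0; set k := - (t%:C * d^cj).
  have := ge_inf Sinf.2 (_ : S (J (w ++ kscl k u))) => /(_ (ex_intro _ _ erefl)) hJ.
  have : J (w ++ kscl k u) = J w - (2 * t * cabs d ^+ 2 - t ^+ 2 * cabs d ^+ 2 * N ^+ 2).
    have e1 : kn (w ++ kscl k u) ^+ 2 = kn w ^+ 2 + (complex.Re (k * kf w u) + complex.Re (k * kf w u)) + cabs k ^+ 2 * N ^+ 2.
      apply: complexI; rewrite kn_sqr kf_cat_l !kf_cat_r (kf_conj (kscl k u) w) kf_scl_r.
      rewrite rmorphD rmorphD /= kn_sqr -addcJ_Re kf_scl_l kf_scl_r mulrA mul_conjcE.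
      rewrite (RCM (cabs k ^+ 2) (N ^+ 2)) /N kn_sqr; ring.
    rewrite /J e1 q_cat q_scl (raddfD (@complex.Re R)).
    have ek : cabs k ^+ 2 = t ^+ 2 * cabs d ^+ 2.
      by rewrite /k cabsN cabsM cabs_conj cabs_real exprMn (ger0_norm t0).
    have e2 : complex.Re (k * kf w u) - complex.Re (k * q u) = - (t * cabs d ^+ 2).
      rewrite -(raddfB (@complex.Re R)) -mulrBr -/d /k mulNr -mulrA mul_conjcE -rmorphM.
      by rewrite -rmorphN.
    rewrite ek; lra.
  lra.
apply/ler_addgt0Pr => y y0; rewrite exprMn.
have ee : 0 < e ^+ 2 by rewrite exprn_gt0.
(* The summand [z] keeps [t = 1 / (N^2 + z)] defined when [N = 0]; it costs [e^2 z = y] in the final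
   estimate. *)
set z := y / e ^+ 2; have z0 : 0 < z by rewrite divr_gt0.
have N0 : 0 < N ^+ 2 + z by rewrite ltr_wpDl ?sqr_ge0.
have := h (N ^+ 2 + z)^-1; rewrite invr_ge0 ltW // => /(_ isT).
set t := _^-1; have tN : t * (N ^+ 2 + z) = 1 by rewrite mulVf // gt_eqF.
have t0 : 0 < t by rewrite invr_gt0.
have cd := sqr_ge0 (cabs d).
have cz : 0 <= t * cabs d ^+ 2 * (t * z) by apply: mulr_ge0; apply: mulr_ge0 => //; apply: ltW.
have -> : e ^+ 2 * N ^+ 2 + y = e ^+ 2 * (N ^+ 2 + z).
  by rewrite mulrDr /z [e ^+ 2 * (y / _)]mulrCA divff ?gt_eqF // mulr1.
rewrite -(ler_pdivrMr _ _ N0) -/t.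
have -> : t ^+ 2 * cabs d ^+ 2 * N ^+ 2 = t * cabs d ^+ 2 * (t * (N ^+ 2 + z)) - t * cabs d ^+ 2 * (t * z) by ring.
rewrite tN; lra.
Qed.

End ApproximateRiesz.

End Kernel.

(** * Hilbert modules and correspondences *)

Section HilbertModuleTheory.
Variables (R : realType) (A : cstarAlgType R) (F : hilbertModType A).
Implicit Types (x y z : F) (a b : A) (u v : unitz A).

Lemma mipDr x y z : mip x (y + z) = mip x y + mip x z.
Proof. by have := @mip_linearr R A F 1 x y z; rewrite !scale1r. Qed.
Lemma mip0r x : mip x (0 : F) = 0.
Proof. by apply: (addrI (mip x 0)); rewrite -mipDr !addr0. Qed.
Lemma mipZr k x y : mip x (k *: y) = k *: mip x y.
Proof. by have := @mip_linearr R A F k x y 0; rewrite mip0r !addr0. Qed.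
Lemma mipDl x y z : mip (x + y) z = mip x z + mip y z.
Proof. by rewrite mip_star mipDr cstarD -!mip_star. Qed.
Lemma mip0l x : mip (0 : F) x = 0.
Proof. by rewrite mip_star mip0r cstar0. Qed.
Lemma mipZl k x y : mip (k *: x) y = k^cj *: mip x y.
Proof. by rewrite mip_star mipZr cstarZ -mip_star. Qed.
Lemma mipNr x y : mip x (- y) = - mip x y.
Proof. by rewrite -scaleN1r mipZr scaleN1r. Qed.
Lemma mipNl x y : mip (- x) y = - mip x y.
Proof. by apply: (addrI (mip x y)); rewrite -mipDl !subrr mip0l. Qed.
Lemma mipBr x y z : mip x (y - z) = mip x y - mip x z.
Proof. by rewrite mipDr mipNr. Qed.
Lemma mipBl x y z : mip (x - y) z = mip x z - mip y z.
Proof. by rewrite mipDl mipNl. Qed.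
Lemma mip_ractl x y a : mip (ract x a) y = cmul (cstar a) (mip x y).
Proof. by rewrite mip_star mip_ract cstarM -mip_star. Qed.
Lemma mip_sumr (I : Type) (r : seq I) (f : I -> F) x :
  mip x (\sum_(i <- r) f i) = \sum_(i <- r) mip x (f i).
Proof. by apply: (big_morph _ (mipDr x) (mip0r x)). Qed.
Lemma mip_suml (I : Type) (r : seq I) (f : I -> F) x :
  mip (\sum_(i <- r) f i) x = \sum_(i <- r) mip (f i) x.
Proof. by apply: (big_morph (mip^~ x) (fun y z => mipDl y z x) (mip0l x)). Qed.

Lemma rnorm_mip_sqr x : rnorm (mip x x) = rnorm x ^+ 2.
Proof. by apply: complexI; rewrite rmorphXn /= -!rnormE mip_norm. Qed.

Lemma mip_eq0 x : mip x x = 0 -> x = 0.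
Proof.
move=> h; apply: rnorm_eq0; apply/eqP; by rewrite -sqrf_eq0 -rnorm_mip_sqr h rnorm0.
Qed.

Lemma mip_ext x y : (forall z, mip z x = mip z y) -> x = y.
Proof.
move=> h; apply/eqP; rewrite -subr_eq0; apply/eqP; apply: mip_eq0.
by rewrite mipBr h subrr.
Qed.

Lemma mip_extl x y : (forall z, mip x z = mip y z) -> x = y.
Proof. by move=> h; apply: mip_ext => z; rewrite mip_star h -mip_star. Qed.

Lemma ractDl x y a : ract (x + y) a = ract x a + ract y a.
Proof. by have := @ract_linearl R A F 1 x y a; rewrite !scale1r. Qed.
Lemma ractDr x a b : ract x (a + b) = ract x a + ract x b.
Proof. by have := @ract_linearr R A F 1 x a b; rewrite !scale1r. Qed.
Lemma ract0l a : ract (0 : F) a = 0.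
Proof. by apply: (addrI (ract 0 a)); rewrite -ractDl !addr0. Qed.
Lemma ract0r x : ract x (0 : A) = 0.
Proof. by apply: (addrI (ract x 0)); rewrite -ractDr !addr0. Qed.
Lemma ractZl k x a : ract (k *: x) a = k *: ract x a.
Proof. by have := @ract_linearl R A F k x 0 a; rewrite ract0l !addr0. Qed.
Lemma ractZr k x a : ract x (k *: a) = k *: ract x a.
Proof. by have := @ract_linearr R A F k x a 0; rewrite ract0r !addr0. Qed.

Definition ura x u : F := ract x u.1 + u.2 *: x.
Definition uip x y : unitz A := uin (mip x y).

Lemma cpos_upos a : cpos a -> cstar_pos (@usc R A) (@ust R A) (@unr R A) (uin a).
Proof.
by move=> [b ->]; rewrite uinM uin_st; apply: (pos_star_mul (unitz_cstar A)).
Qed.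

Lemma mip_ura x y u : uin (mip x (ura y u)) = uin (mip x y) * u.
Proof. by rewrite umulE /= scale0r addr0 mul0r /ura mipDr mipZr mip_ract. Qed.

Lemma hilbertmod_prehilbert :
  prehilbert (@usc R A) (@ust R A) (@unr R A) uip ura.
Proof.
split=> [x y z|x y b|x y|x].
- by rewrite /uip mipDr uinD.
- exact: mip_ura.
- by rewrite /uip -uin_st -mip_star.
- by apply/cpos_upos/mip_pos.
Qed.

Lemma rnorm_mip x y : rnorm (mip x y) <= rnorm x * rnorm y.
Proof.
have := ph_cauchy_schwarz (unitz_cstar A) hilbertmod_prehilbert x y.
by rewrite /vn /uip !unr_in !rnorm_mip_sqr !sqrtr_sqr !(ger0_norm (rnorm_ge0 _)).
Qed.

Definition tip k (x y : 'I_k -> F) : unitz A := uin (ipn (@mip R A F) x y).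
Definition tra k (x : 'I_k -> F) u : 'I_k -> F := fun i => ura (x i) u.

Lemma tuple_prehilbert k :
  prehilbert (@usc R A) (@ust R A) (@unr R A) (@tip k) (@tra k).
Proof.
split=> [x y z|x y b|x y|x]; rewrite /tip /ipn.
- rewrite -uinD -big_split; congr uin; apply: eq_bigr => i _; exact: mipDr.
- rewrite !(big_morph _ (@uinD R A) (erefl : uin 0 = 0)) mulr_suml.
  by apply: eq_bigr => i _; apply: mip_ura.
- by rewrite -uin_st (big_morph _ (@cstarD R A) (@cstar0 R A)); congr uin; apply: eq_bigr => i _; rewrite -mip_star.
- rewrite (big_morph _ (@uinD R A) (erefl : uin 0 = 0)).
  by apply: (pos_sum (unitz_cstar A)) => i _; apply/cpos_upos/mip_pos.
Qed.

End HilbertModuleTheory.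

Section CorrespondenceTheory.
Variables (R : realType) (A : cstarAlgType R) (F : corrType A).
Implicit Types (x y z : F) (a b : A) (u v : unitz A).

(** An operator with an adjoint is additive, homogeneous and right linear, as is seen by testing
    against all vectors. *)
Lemma lactD x y a : lact a (x + y) = lact a x + lact a y.
Proof. by apply: mip_extl => z; rewrite !(mipDl, lact_adj). Qed.
Lemma lactZ k x a : lact a (k *: x) = k *: lact a x.
Proof. by apply: mip_extl => z; rewrite !(mipZl, lact_adj). Qed.
Lemma lactDl x a b : lact (a + b) x = lact a x + lact b x.
Proof. by have := @lact_linear R A F 1 a b x; rewrite !scale1r. Qed.
Lemma lact0l x : lact (0 : A) x = 0.
Proof. by apply: (addrI (lact 0 x)); rewrite -lactDl !addr0. Qed.
Lemma lactZl k x a : lact (k *: a) x = k *: lact a x.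
Proof. by have := @lact_linear R A F k a 0 x; rewrite lact0l !addr0. Qed.
Lemma lact_ract a x b : lact a (ract x b) = ract (lact a x) b.
Proof. by apply: mip_extl => z; rewrite mip_ractl !lact_adj mip_ractl. Qed.
Lemma mip_lact a x y : mip x (lact a y) = mip (lact (cstar a) x) y.
Proof. by rewrite lact_adj cstarK. Qed.
Definition ulact u x : F := lact u.1 x + u.2 *: x.

Lemma ulact_adj u x y : mip (ulact u x) y = mip x (ulact (ust u) y).
Proof. by rewrite /ulact mipDl mipZl lact_adj mipDr mipZr. Qed.
Lemma ulactM u v x : ulact (u * v) x = ulact u (ulact v x).
Proof.
rewrite /ulact umulE /= !lactDl !lactZl lactM lactD lactZ scalerDr scalerA; zabel.
Qed.
Lemma ulactD u v x : ulact (u + v) x = ulact u x + ulact v x.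
Proof. by rewrite /ulact /= lactDl scalerDl; zabel. Qed.
Lemma ulact_in a x : ulact (uin a) x = lact a x.
Proof. by rewrite /ulact scale0r addr0. Qed.
Lemma ulact_pos u x : cstar_pos (@usc R A) (@ust R A) (@unr R A) u ->
  cstar_pos (@usc R A) (@ust R A) (@unr R A) (uin (mip x (ulact u x))).
Proof.
move=> /(pos_sqrt (unitz_cstar A))[v [sv <- _]].
by rewrite ulactM -{1}sv -ulact_adj; apply/cpos_upos/mip_pos.
Qed.

(** [|a|^2 - a^* a] is a square in the unitization, so it acts as a positive operator; contractivity
    of the left action follows. *)
Lemma lact_bound_pos a x : cstar_pos (@usc R A) (@ust R A) (@unr R A)
  (uin ((rnorm a ^+ 2)%:C *: mip x x - mip (lact a x) (lact a x))).
Proof.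
have CA := unitz_cstar A.
have h : cstar_pos (@usc R A) (@ust R A) (@unr R A) (real_sc (@usc R A) (rnorm a ^+ 2) - uin (cmul (cstar a) a)).
  apply: (pos_sub_nr CA); first by rewrite -uin_st cstarM cstarK.
  by rewrite unr_in rnorm_cstar_mul.
have := ulact_pos x h.
suff -> : ulact (real_sc (@usc R A) (rnorm a ^+ 2) - uin (cmul (cstar a) a)) x =
   (rnorm a ^+ 2)%:C *: x - lact (cmul (cstar a) a) x.
  by rewrite mipBr mipZr lactM lact_adj.
by rewrite /ulact /= subr0 sub0r -scaleN1r lactZl scaleN1r addrC.
Qed.

Lemma rnorm_lact a x : rnorm (lact a x) <= rnorm a * rnorm x.
Proof.
apply: le_of_sqr; first by rewrite mulr_ge0 ?rnorm_ge0.
have h := lact_bound_pos a x.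
have := nr_pos_mono (unitz_cstar A) (cpos_upos (mip_pos (lact a x))) h.
rewrite -uinD subrKC !unr_in rnormZ !rnorm_mip_sqr cabs_real ger0_norm ?sqr_ge0 //.
by rewrite exprMn.
Qed.

End CorrespondenceTheory.

Section LinearMaps.
Variables (R : realType) (V W : lmodType R[i]) (a : V -> W).
Hypothesis la : linear a.
Lemma linear_funD x y : a (x + y) = a x + a y.
Proof. by have := la 1 x y; rewrite !scale1r. Qed.
Lemma linear_fun0 : a 0 = 0.
Proof. by apply: (addrI (a 0)); rewrite -linear_funD !addr0. Qed.
Lemma linear_funZ k x : a (k *: x) = k *: a x.
Proof. by have := la k x 0; rewrite linear_fun0 !addr0. Qed.
Lemma linear_funN x : a (- x) = - a x.
Proof. by rewrite -scaleN1r linear_funZ scaleN1r. Qed.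
Lemma linear_funB x y : a (x - y) = a x - a y.
Proof. by rewrite linear_funD linear_funN. Qed.
Lemma linear_fun_sum (I : Type) (r : seq I) (P : pred I) (f : I -> V) :
  a (\sum_(i <- r | P i) f i) = \sum_(i <- r | P i) a (f i).
Proof. exact: (big_morph a linear_funD linear_fun0). Qed.
End LinearMaps.

(** * Hilbert spaces *)

Section HilbertSpaceTheory.
Variables (R : realType) (H : hilbertType R).
Implicit Types x y z : H.

Lemma hipDr x y z : hip x (y + z) = hip x y + hip x z.
Proof. by have := @hip_linearr R H 1 x y z; rewrite scale1r mul1r. Qed.
Lemma hip0r x : hip x (0 : H) = 0.
Proof. by apply: (addrI (hip x 0)); rewrite -hipDr !addr0. Qed.
Lemma hipZr k x y : hip x (k *: y) = k * hip x y.
Proof. by have := @hip_linearr R H k x y 0; rewrite hip0r !addr0. Qed.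
Lemma hip_cj x y : hip x y = (hip y x)^cj.
Proof. exact: hip_conj. Qed.
Lemma hipDl x y z : hip (x + y) z = hip x z + hip y z.
Proof. by rewrite hip_cj hipDr conjcD -!hip_cj. Qed.
Lemma hip0l x : hip (0 : H) x = 0.
Proof. by rewrite hip_cj hip0r conjc0. Qed.
Lemma hipZl k x y : hip (k *: x) y = k^cj * hip x y.
Proof. by rewrite hip_cj hipZr conjcM -hip_cj. Qed.
Lemma hipNr x y : hip x (- y) = - hip x y.
Proof. by rewrite -scaleN1r hipZr mulN1r. Qed.
Lemma hipNl x y : hip (- x) y = - hip x y.
Proof. by apply: (addrI (hip x y)); rewrite -hipDl !subrr hip0l. Qed.
Lemma hipBr x y z : hip x (y - z) = hip x y - hip x z.
Proof. by rewrite hipDr hipNr. Qed.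
Lemma hipBl x y z : hip (x - y) z = hip x z - hip y z.
Proof. by rewrite hipDl hipNl. Qed.
Lemma hip_sumr (I : Type) (r : seq I) (f : I -> H) x :
  hip x (\sum_(i <- r) f i) = \sum_(i <- r) hip x (f i).
Proof. by apply: (big_morph _ (hipDr x) (hip0r x)). Qed.
Lemma hip_suml (I : Type) (r : seq I) (f : I -> H) x :
  hip (\sum_(i <- r) f i) x = \sum_(i <- r) hip (f i) x.
Proof. by apply: (big_morph (hip^~ x) (fun y z => hipDl y z x) (hip0l x)). Qed.
Lemma hip_sqr x : hip x x = (rnorm x ^+ 2)%:C.
Proof. by rewrite hip_norm rmorphXn /= -rnormE. Qed.
Lemma hip_ge0 x : 0 <= hip x x.
Proof. by rewrite hip_sqr ler0c sqr_ge0. Qed.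
Lemma hip_eq0 x : hip x x = 0 -> x = 0.
Proof.
rewrite hip_sqr => h; apply: rnorm_eq0; apply/eqP; rewrite -sqrf_eq0.
by apply/eqP; apply: complexI.
Qed.
Lemma hip_ext x y : (forall z, hip z x = hip z y) -> x = y.
Proof.
move=> h; apply/eqP; rewrite -subr_eq0; apply/eqP; apply: hip_eq0.
by rewrite hipBr h subrr.
Qed.

Lemma hilbert_kernel : is_kernel (@hip R H) (fun k x => k *: x).
Proof.
split=> [||u]; [exact: hip_cj|by move=> *; exact: hipZr|].
by rewrite /kf; under eq_bigr do rewrite -hip_sumr; rewrite -hip_suml hip_ge0.
Qed.

Lemma hilbert_kf (u v : seq H) : kf (@hip R H) u v = hip (\sum_(x <- u) x) (\sum_(x <- v) x).
Proof. by rewrite /kf hip_suml; apply: eq_bigr => p _; rewrite hip_sumr. Qed.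

Lemma hilbert_kn (u : seq H) : kn (@hip R H) u = rnorm (\sum_(x <- u) x).
Proof.
rewrite /kn hilbert_kf hip_sqr /= sqrtr_sqr ger0_norm //; exact: rnorm_ge0.
Qed.

Lemma hip_cauchy_schwarz x y : cabs (hip x y) <= rnorm x * rnorm y.
Proof.
have := kf_cauchy_schwarz hilbert_kernel [:: x] [:: y].
by rewrite hilbert_kf !hilbert_kn !big_seq1.
Qed.

Definition real_bound (a : H -> H) (c : R) := forall x, rnorm (a x) <= c * rnorm x.

Lemma bounded_opP (a : H -> H) :
  bounded_op a <-> linear a /\ exists2 c, 0 <= c & real_bound a c.
Proof.
split=> [[la [c hc]]|[la [c c0 hc]]]; split=> //.
  exists (cabs c); first exact: cabs_ge0.
  move=> x; rewrite -lecR RCM -cabsE -!rnormE -[X in _ * X]normr_id -normrM.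
  by apply: le_trans (hc x) _; apply: real_ler_norm; apply: ger0_real; apply: le_trans (hc x).
by exists c%:C => x; rewrite !rnormE -RCM lecR.
Qed.

Lemma bounded_op_linear (a : H -> H) : bounded_op a -> linear a.
Proof. by case. Qed.

(** The approximate representing vectors for [1 / (n + 1)] form a Cauchy sequence, by testing their
    differences on themselves. *)
Lemma riesz (q : H -> R[i]) (C : R) :
  (forall k x y, q (k *: x + y) = k * q x + q y) ->
  (forall x, cabs (q x) <= C * rnorm x) ->
  exists w, forall x, q x = hip w x.
Proof.
move=> lq bq.
have q0 : q 0 = 0.
  by have := lq 1 0 0; rewrite scale1r mul1r addr0 => h; apply: (addrI (q 0)); rewrite -h addr0.
have qD x y : q (x + y) = q x + q y by have := lq 1 x y; rewrite scale1r mul1r.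
have qZ k x : q (k *: x) = k * q x by have := lq k x 0; rewrite q0 !addr0.
pose Q (u : seq H) := q (\sum_(x <- u) x).
have scl k (u : seq H) : \sum_(x <- kscl (fun k x => k *: x) k u) x = k *: \sum_(x <- u) x.
  by rewrite big_map scaler_sumr.
have app e : 0 < e -> exists w, forall x, cabs (hip w x - q x) <= e * rnorm x.
  move=> e0; have [|||w hw] := @approx_riesz _ _ _ _ hilbert_kernel Q C _ _ _ e e0.
  - by move=> u v; rewrite /Q big_cat qD.
  - by move=> k u; rewrite /Q scl qZ.
  - by move=> u; rewrite hilbert_kn; apply: bq.
  exists (\sum_(x <- w) x) => x; have := hw [:: x].
  by rewrite hilbert_kf hilbert_kn /Q !big_seq1.
have [w hw] := choice (fun n : nat => app (1 / n.+1%:R) (divr_gt0 ltr01 (ltr0Sn _ n))).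
have wd n m x : cabs (hip (w n - w m) x) <= (1 / n.+1%:R + 1 / m.+1%:R) * rnorm x.
  rewrite hipBl (_ : _ - _ = (hip (w n) x - q x) - (hip (w m) x - q x)); last by ring.
  by apply: le_trans (cabsB _ _) _; rewrite mulrDl; apply: lerD; apply: hw.
have wn n m : rnorm (w n - w m) <= 1 / n.+1%:R + 1 / m.+1%:R.
  have := wd n m (w n - w m); rewrite hip_sqr cabs_real ger0_norm ?sqr_ge0 // expr2.
  have [->|ne] := eqVneq (rnorm (w n - w m)) 0; first by rewrite addr_ge0 // divr_ge0.
  by rewrite ler_pM2r // lt_neqAle eq_sym ne rnorm_ge0.
have [|l hl] := @rnorm_complete R H w.
  move=> e e0; have [N hN] := archi_inv 1 (divr_gt0 e0 (ltr0Sn R 1)); exists N => m n Nm Nn.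
  apply: le_trans (wn m n) _; by rewrite [e]splitr; apply: lerD; apply: hN.
exists l => x; apply/eqP; rewrite -subr_eq0; apply/eqP.
apply: (@cabs_small0 _ (2 * rnorm x)) => e e0.
have [N1 h1] := hl e e0; have [N2 h2] := archi_inv 1 e0; set n := maxn N1 N2.
have -> : q x - hip l x = hip (w n - l) x - (hip (w n) x - q x) by rewrite hipBl; ring.
apply: le_trans (cabsB _ _) _.
have a1 := hip_cauchy_schwarz (w n - l) x; have a2 := hw n x.
have a3 := h1 n (leq_maxl _ _); have a4 := h2 n (leq_maxr _ _).
have a5 := rnorm_ge0 x; have := ler_wpM2r a5 a3; have := ler_wpM2r a5 a4.
move: a2; move: (1 / _) => y; lra.
Qed.

Lemma adj_exists (a : H -> H) : bounded_op a -> exists b, is_adjoint (@hip R H) a b.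
Proof.
move=> /bounded_opP[la [c c0 hc]].
have h y : exists w, forall x, hip (a x) y = hip x w.
  have [|x|w hw] := @riesz (fun x => hip y (a x)) (c * rnorm y).
  - by move=> k x x'; rewrite la hipDr hipZr.
  - apply: le_trans (hip_cauchy_schwarz _ _) _; rewrite mulrC mulrAC.
    by apply: ler_wpM2r => //; apply: rnorm_ge0.
  by exists w => x; rewrite hip_cj hw -hip_cj.
have [b hb] := choice h; exists b => x y; exact: hb.
Qed.

Lemma hip_adj (a : H -> H) x y : bounded_op a -> hip (a x) y = hip x (adj (@hip R H) a y).
Proof.
move=> ba; have hb := adj_exists ba.
exact: (@xgetPex _ (fun=> 0) (is_adjoint (@hip R H) a) hb x y).
Qed.

Lemma adj_unique (a b : H -> H) : is_adjoint (@hip R H) a b -> adj (@hip R H) a = b.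
Proof.
move=> h; apply/funext => y; apply: hip_ext => x.
have := @xgetPex _ (fun=> 0) (is_adjoint (@hip R H) a) (ex_intro _ _ h) x y.
by rewrite /adj => <-; rewrite -h.
Qed.

Lemma adj_bound (a : H -> H) c : bounded_op a -> 0 <= c -> real_bound a c ->
  real_bound (adj (@hip R H) a) c.
Proof.
move=> ba c0 hc x; set y := adj _ a x.
have [->|ne] := eqVneq (rnorm y) 0; first by rewrite mulr_ge0 ?rnorm_ge0.
have y0 : 0 < rnorm y by rewrite lt_neqAle eq_sym ne rnorm_ge0.
rewrite -(ler_pM2r y0) -expr2.
have := hip_cauchy_schwarz (a y) x; rewrite hip_adj // hip_sqr cabs_real ger0_norm ?sqr_ge0 //.
have := hc y; have := rnorm_ge0 x; nra.
Qed.

Lemma adj_bounded (a : H -> H) : bounded_op a -> bounded_op (adj (@hip R H) a).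
Proof.
move=> ba; have [la [c c0 hc]] := (bounded_opP a).1 ba.
apply/bounded_opP; split; last by exists c => //; apply: adj_bound.
move=> k x y; apply: hip_ext => z; rewrite -hip_adj // !hipDr !hipZr.
by rewrite !hip_adj.
Qed.

Lemma bounded_op_comp (a b : H -> H) : bounded_op a -> bounded_op b -> bounded_op (a \o b).
Proof.
move=> /bounded_opP[la [c c0 hc]] /bounded_opP[lb [d d0 hd]]; apply/bounded_opP; split.
  by move=> k x y; rewrite /= lb la.
exists (c * d); first exact: mulr_ge0.
move=> x /=; apply: le_trans (hc _) _; rewrite -mulrA; exact: ler_wpM2l.
Qed.

Lemma bounded_op_lin (k : R[i]) (a b : H -> H) : bounded_op a -> bounded_op b ->
  bounded_op (k *: a + b).
Proof.
move=> /bounded_opP[la [c c0 hc]] /bounded_opP[lb [d d0 hd]]; apply/bounded_opP; split.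
  move=> l x y; rewrite !fctE la lb !scalerDr !scalerA [k * l]mulrC; zabel.
exists (cabs k * c + d); first by rewrite addr_ge0 ?mulr_ge0 ?cabs_ge0.
move=> x; rewrite !fctE; apply: le_trans (rnormD _ _) _; rewrite rnormZ mulrDl -mulrA.
by apply: lerD => //; apply: ler_wpM2l; rewrite ?cabs_ge0.
Qed.

Lemma bounded_op_id : bounded_op (idfun : H -> H).
Proof. by apply/bounded_opP; split=> //; exists 1 => // x; rewrite mul1r. Qed.

End HilbertSpaceTheory.

(** * Tensor products of modules and representations *)

Section RepresentationForms.
Variables (R : realType) (A : cstarAlgType R) (H : hilbertType R).
Variable sigma : A -> H -> H.
Hypothesis rep : is_rep sigma.
Notation UC := (unitz_cstar A).

Lemma rep_lin a : linear (sigma a).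
Proof. exact: bounded_op_linear (rep_bounded rep a). Qed.
Lemma repD a b h : sigma (a + b) h = sigma a h + sigma b h.
Proof. by have := rep_linear rep 1 a b; rewrite !scale1r => ->. Qed.
Lemma rep0 h : sigma 0 h = 0.
Proof. by apply: (addrI (sigma 0 h)); rewrite -repD !addr0. Qed.
Lemma repZ k a h : sigma (k *: a) h = k *: sigma a h.
Proof. by have := rep_linear rep k a 0; rewrite addr0 => ->; rewrite !fctE rep0 addr0. Qed.
Lemma repM a b h : sigma (cmul a b) h = sigma a (sigma b h).
Proof. by rewrite (rep_mul rep). Qed.
Lemma rep_adj a x y : hip (sigma a x) y = hip x (sigma (cstar a) y).
Proof. exact: rep_star. Qed.
Lemma rep_sum (I : Type) (r : seq I) (f : I -> A) h :
  sigma (\sum_(i <- r) f i) h = \sum_(i <- r) sigma (f i) h.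
Proof. exact: (big_morph (sigma^~ h) (fun a b => repD a b h) (rep0 h)). Qed.

Definition urep (u : unitz A) (h : H) : H := sigma u.1 h + u.2 *: h.

Lemma urep_in a h : urep (uin a) h = sigma a h.
Proof. by rewrite /urep /= scale0r addr0. Qed.
Lemma urepD u v h : urep (u + v) h = urep u h + urep v h.
Proof. by rewrite /urep /= repD scalerDl; zabel. Qed.
Lemma urep0 h : urep 0 h = 0.
Proof. by rewrite /urep /= rep0 scale0r addr0. Qed.
Lemma urep_lin u : linear (urep u).
Proof. by move=> k x y; rewrite /urep rep_lin !scalerDr !scalerA [k * _]mulrC; zabel. Qed.
Lemma urepM u v h : urep (u * v) h = urep u (urep v h).
Proof.
rewrite /urep umulE /= !repD !repZ repM (linear_funD (rep_lin _)) (linear_funZ (rep_lin _)).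
rewrite scalerDr scalerA; zabel.
Qed.
Lemma urep_adj u x y : hip (urep u x) y = hip x (urep (ust u) y).
Proof. by rewrite /urep hipDl hipZl rep_adj hipDr hipZr. Qed.
Lemma urepN u h : urep (- u) h = - urep u h.
Proof. by apply: (addrI (urep u h)); rewrite -urepD !subrr urep0. Qed.
Lemma urep_sum (I : Type) (r : seq I) (f : I -> unitz A) h :
  urep (\sum_(i <- r) f i) h = \sum_(i <- r) urep (f i) h.
Proof. exact: (big_morph (urep^~ h) (fun a b => urepD a b h) (urep0 h)). Qed.
Lemma urep_sc k h : urep (usc A k) h = k *: h.
Proof. by rewrite /urep /= rep0 add0r. Qed.
Lemma urep1 h : urep 1 h = h. Proof. by rewrite /urep /= rep0 add0r scale1r. Qed.

(** Positivity together with commutation with [sigma] keeps the form twisted by [D] semidefinite. It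
    is applied to the identity, to [defect] and, in [kn_map_lvP], to [1 - P^2]. *)
Record pos_commutant (D : H -> H) : Prop := {
  pc_lin : linear D;
  pc_sym : forall x y, hip (D x) y = hip x (D y);
  pc_pos : forall x, 0 <= hip x (D x);
  pc_comm : forall a x, D (sigma a x) = sigma a (D x)
}.

Lemma pos_commutant_id : pos_commutant idfun.
Proof. by split=> // x; apply: hip_ge0. Qed.

Section WithD.
Variable D : H -> H.
Hypothesis PD : pos_commutant D.

Lemma pc_urep u x : D (urep u x) = urep u (D x).
Proof. by rewrite /urep (linear_funD (pc_lin PD)) (linear_funZ (pc_lin PD)) (pc_comm PD). Qed.

Definition uform n (C : 'M[unitz A]_n) (h h' : 'I_n -> H) : R[i] :=
  \sum_i \sum_j hip (h i) (urep (C i j) (D (h' j))).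

(** As [D] commutes with [sigma], one factor [v] can be moved to the other side of the inner
    product, and the form becomes a sum of values [<y, D y>]. *)
Lemma uform_sqr n (v : 'M[unitz A]_n.+1) h : mst (@ust R A) v = v ->
  uform (v * v) h h =
  \sum_l hip (\sum_j urep (v l j) (h j)) (D (\sum_j urep (v l j) (h j))).
Proof.
move=> sv; rewrite /uform; under [RHS]eq_bigr => l _.
  rewrite (linear_fun_sum (pc_lin PD)) hip_suml.
  under eq_bigr => i _ do rewrite hip_sumr.
  over.
rewrite [RHS]exchange_big /=; apply: eq_bigr => i _.
rewrite [RHS]exchange_big /=; apply: eq_bigr => j _.
rewrite mxE urep_sum hip_sumr; apply: eq_bigr => l _.
by rewrite pc_urep urepM urep_adj -[in v i l]sv mxE.
Qed.

Lemma uformD n (C C' : 'M[unitz A]_n) h h' : uform (C + C') h h' = uform C h h' + uform C' h h'.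
Proof.
rewrite /uform -big_split; apply: eq_bigr => i _; rewrite -big_split; apply: eq_bigr => j _.
by rewrite mxE urepD hipDr.
Qed.

Lemma uform_scalar n k h h' : uform ((usc A k)%:M : 'M_n) h h' = k * \sum_i hip (h i) (D (h' i)).
Proof.
rewrite /uform mulr_sumr; apply: eq_bigr => i _; rewrite (bigD1 i) //= mxE eqxx mulr1n urep_sc hipZr.
rewrite big1 ?addr0 // => j /negbTE ji; by rewrite mxE eq_sym ji mulr0n urep0 hip0r.
Qed.

Lemma uform_ge0 n (C : 'M[unitz A]_n.+1) h :
  cstar_pos (fun k => (usc A k)%:M) (@mst _ (@ust R A) n.+1 n.+1) (@mnr _ _ (@ust R A) (@unr R A) n) C ->
  0 <= uform C h h.
Proof.
move=> /(pos_sqrt (matrix_cstar UC n))[v [sv <- _]].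
by rewrite uform_sqr //; apply: sumr_ge0 => l _; apply: (pc_pos PD).
Qed.

Section ModuleKernel.
Variables (V : zmodType) (ip : V -> V -> A) (ra : V -> unitz A -> V).
Hypothesis HV : prehilbert (@usc R A) (@ust R A) (@unr R A) (fun x y => uin (ip x y)) ra.

(* The inner product of the tensor product of [V] and [H] over [sigma], twisted
   by [D]. *)
Definition mbeta (p q : V * H) : R[i] := hip p.2 (sigma (ip p.1 q.1) (D q.2)).
Definition mscl (k : R[i]) (p : V * H) : V * H := (p.1, k *: p.2).

Lemma mbeta_uform (u : seq (V * H)) p0 :
  kf mbeta u u = uform (gram (fun x y => uin (ip x y)) (fun i : 'I_(size u) => (nth p0 u i).1))
    (fun i => (nth p0 u i).2) (fun i => (nth p0 u i).2).
Proof.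
rewrite /kf /uform (big_nth p0) big_mkord; apply: eq_bigr => i _.
rewrite (big_nth p0) big_mkord; apply: eq_bigr => j _.
by rewrite mxE urep_in.
Qed.

Lemma ip_cstar x y : cstar (ip x y) = ip y x.
Proof. by apply: uin_inj; rewrite uin_st (ph_st HV). Qed.

(** The square norm of a formal sum is the value of [uform] at the Gram matrix of its module
    entries, which is positive by [gram_mpos]. *)
Theorem module_kernel : is_kernel mbeta mscl.
Proof.
split.
- move=> p q; by rewrite /mbeta -hip_cj rep_adj ip_cstar (pc_sym PD) (pc_comm PD).
- by move=> k p q; rewrite /mbeta /= (linear_funZ (pc_lin PD)) (linear_funZ (rep_lin _)) hipZr.
- case=> [|p u]; first by rewrite kf_nil.
  by rewrite (mbeta_uform _ p); apply: uform_ge0; apply: (gram_mpos UC HV).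
Qed.

End ModuleKernel.

(** This bounds [L (x) 1] on formal sums: the inequality between Gram matrices in
    [gram_bounded_mpos] is passed to the forms by [uform_ge0]. The constant [c] bounds the square of
    the norm of [L]. *)
Lemma module_bounded (V W : zmodType) (ip : V -> V -> A) (ra : V -> unitz A -> V)
  (ip' : W -> W -> A) (ra' : W -> unitz A -> W) (L : V -> W) (c : R) (u : seq (V * H)) :
  prehilbert (@usc R A) (@ust R A) (@unr R A) (fun x y => uin (ip x y)) ra ->
  prehilbert (@usc R A) (@ust R A) (@unr R A) (fun x y => uin (ip' x y)) ra' ->
  (forall x b, L (ra x b) = ra' (L x) b) -> {morph L : x y / x + y} -> L 0 = 0 -> 0 <= c ->
  (forall x, rnorm (ip' (L x) (L x)) <= c * rnorm (ip x x)) ->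
  kf (mbeta ip') [seq (L p.1, p.2) | p <- u] [seq (L p.1, p.2) | p <- u] <= c%:C * kf (mbeta ip) u u.
Proof.
move=> HV HW Lra LD L0 c0 Lc; case: u => [|p u].
  by rewrite !kf_nil mulr0.
set v := p :: u; rewrite (mbeta_uform ip v p).
have -> : kf (mbeta ip') [seq (L q.1, q.2) | q <- v] [seq (L q.1, q.2) | q <- v] =
  uform (gram (fun x y => uin (ip' x y)) (fun i : 'I_(size v) => L (nth p v i).1))
    (fun i => (nth p v i).2) (fun i => (nth p v i).2).
  rewrite /kf big_map /uform (big_nth p) big_mkord; apply: eq_bigr => i _.
  rewrite big_map (big_nth p) big_mkord; apply: eq_bigr => j _.
  by rewrite mxE urep_in.
have Lc' x : unr (uin (ip' (L x) (L x))) <= c * unr (uin (ip x x)) by rewrite !unr_in.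
have := @gram_bounded_mpos _ _ _ _ _ UC _ _ _ _ _ _ L c (size u) (fun i => (nth p v i).1) HV HW Lra LD L0 c0 Lc'.
move=> /(uform_ge0 (fun i => (nth p v i).2)) h; rewrite -subr_ge0.
apply: le_trans h _; rewrite le_eqVlt; apply/orP; left; apply/eqP.
rewrite /uform mulr_sumr -sumrB; apply: eq_bigr => i _; rewrite mulr_sumr -sumrB.
apply: eq_bigr => j _; rewrite -[_ * _]/(_ *m _) mul_scalar_mx.
rewrite !mxE urepD urepN hipDr hipNr; congr (_ - _).
by rewrite urepM urep_sc hipZr.
Qed.

End WithD.
End RepresentationForms.

(** * Contractivity of the map x (x) h |-> t(x) h *)

Section RowContraction.
Variables (R : realType) (A : cstarAlgType R) (H : hilbertType R).
Variable sigma : A -> H -> H.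
Hypothesis rep : is_rep sigma.
Variables (F : hilbertModType A) (t : F -> H -> H).
Hypothesis t_bounded : forall x, bounded_op (t x).
Hypothesis t_linear : forall (k : R[i]) x y, t (k *: x + y) = k *: t x + t y.
Hypothesis t_ract : forall x a, t (ract x a) = t x \o sigma a.
Hypothesis t_contractive : forall k (x : 'M[F]_k) (c : R[i]), 0 <= c ->
    mxnorm_le (@link_ip R A F) (map_mx (@link R A F) x) c ->
    mxnorm_le (V := R[i]) (@hip R H) (map_mx t x) c.
Notation UC := (unitz_cstar A).
Notation HF := (hilbertmod_prehilbert F).

Lemma t_add x y h : t (x + y) h = t x h + t y h.
Proof. by have := t_linear 1 x y; rewrite !scale1r => ->. Qed.
Lemma t_zero h : t 0 h = 0.
Proof. by apply: (addrI (t 0 h)); rewrite -t_add !addr0. Qed.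
Lemma t_scale k x h : t (k *: x) h = k *: t x h.
Proof. by have := t_linear k x 0; rewrite addr0 => ->; rewrite !fctE t_zero addr0. Qed.
Lemma t_sum (I : Type) (r : seq I) (f : I -> F) h :
  t (\sum_(i <- r) f i) h = \sum_(i <- r) t (f i) h.
Proof. exact: (big_morph (t^~ h) (fun x y => t_add x y h) (t_zero h)). Qed.
Lemma t_lin x : linear (t x). Proof. exact: bounded_op_linear. Qed.
Lemma t_ura x u h : t (ura x u) h = t x (urep sigma u h).
Proof.
by rewrite /ura t_add t_ract t_scale /urep (linear_funD (t_lin x)) (linear_funZ (t_lin x)).
Qed.

(** The row [x b] is padded by zero rows to a square matrix, as complete contractivity is stated for
    those. In the linking algebra it acts on the column [a] of the [A]-components of the argument,
    and [x b a] has inner square [a^* b G b a <= a^* a], with [G] the Gram matrix. *)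
Lemma link_row_contraction n (x : 'I_n.+1 -> F) (b : 'M[unitz A]_n.+1) :
  mst (@ust R A) b = b ->
  cstar_pos (fun k => (usc A k)%:M) (@mst _ (@ust R A) n.+1 n.+1) (@mnr _ _ (@ust R A) (@unr R A) n)
    (1 - b * gram (@uip _ _ F) x * b) ->
  mxnorm_le (@link_ip R A F) (map_mx (@link R A F)
    (\matrix_(i, j) (if i == ord0 :> 'I_n.+1 then \sum_l ura (x l) (b l j) else 0))) 1.
Proof.
move=> sb pb q; set y := fun j => \sum_l ura (x l) (b l j).
set a : 'cV[unitz A]_n.+1 := \col_j uin (q j).1.
set z := \sum_j ract (y j) (q j).1.
have ey : (\matrix_(i, j) (if i == ord0 :> 'I_n.+1 then \sum_l ura (x l) (b l j) else 0)) =
  \matrix_(i, j) (if i == ord0 :> 'I_n.+1 then y j else 0) :> 'M_n.+1 by [].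
rewrite ey {ey}.
have -> : ipn (@link_ip R A F) (mxapp (map_mx (@link R A F)
   (\matrix_(i, j) (if i == ord0 :> 'I_n.+1 then y j else 0))) q) (mxapp (map_mx (@link R A F)
   (\matrix_(i, j) (if i == ord0 :> 'I_n.+1 then y j else 0))) q) = mip z z.
  have e i : mxapp (map_mx (@link R A F) (\matrix_(i, j) (if i == ord0 :> 'I_n.+1 then y j else 0))) q i
     = (0, if i == ord0 then z else 0).
    rewrite /mxapp /link; have -> : \sum_j map_mx (fun (x0 : F) (p : A * F) => (0, ract x0 p.1))
         (\matrix_(i0, j0) (if i0 == ord0 then y j0 else 0)) i j (q j) =
        \sum_j ((0, if i == ord0 then ract (y j) (q j).1 else 0) : A * F).
      apply: eq_bigr => j _; rewrite !mxE; case: ifP => // _; by rewrite ract0l.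
    have pm : {morph (fun w : F => (0, w) : A * F) : u v / u + v} by move=> u v; congr (_, _); rewrite /= addr0.
    rewrite -(big_morph _ pm (erefl : (0, 0) = 0 :> A * F)); congr (_, _).
    by rewrite /z; case: ifP => _ //; rewrite big1.
  rewrite /ipn (bigD1 ord0) //= e eqxx big1 ?addr0.
    by rewrite /link_ip /= cmul0r add0r.
  by move=> i /negbTE i0; rewrite e i0 /link_ip /= cmul0r mip0l addr0.
have ez : uin (mip z z) = cip (@ust R A) a ((b * gram (@uip _ _ F) x * b) *m a).
  have -> : z = lincomb (@ura _ _ F) x (b *m a).
    rewrite /z /y /lincomb; under [LHS]eq_bigr => j _.
      rewrite (big_morph (fun w => ract w (q j).1) (fun w w' => ractDl w w' _) (ract0l _ _)).
      over.
    rewrite exchange_big; apply: eq_bigr => l _.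
    rewrite mxE; have -> : ura (x l) (\sum_j b l j * a j ord0) = \sum_j ura (x l) (b l j * a j ord0).
      apply: (big_morph (ura (x l))); last by rewrite /ura /= ract0r scale0r addr0.
      by move=> u v; rewrite /ura /= ractDr scalerDl; zabel.
    apply: eq_bigr => j _; rewrite /a mxE uin_act /ura /= scale0r addr0 ractDl ractZl /uact ractDr ractM ractZr //.
  have := gram_form UC HF x (b *m a) (b *m a); rewrite /uip => <-.
  set G := gram _ _; have -> : b * G * b *m a = b *m (G *m (b *m a)) by rewrite !mulmxA.
  by rewrite [RHS](cip_mul UC) sb.
have pz : cstar_pos (@usc R A) (@ust R A) (@unr R A) (cip (@ust R A) a a - uin (mip z z)).
  have := mpos_form UC a pb; rewrite mulmxBl mul1mx ez.
  by rewrite (phB (cV_prehilbert UC _)).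
rewrite expr1n mul1r !rnormE lecR -!unr_in.
have -> : ipn (@link_ip R A F) q q = \sum_i cmul (cstar (q i).1) (q i).1 + \sum_i mip (q i).2 (q i).2.
  by rewrite /ipn -big_split.
rewrite uinD; have -> : uin (\sum_i cmul (cstar (q i).1) (q i).1) = cip (@ust R A) a a.
  rewrite cipE (big_morph _ (@uinD R A) (erefl : uin 0 = 0)); apply: eq_bigr => i _.
  by rewrite /a mxE uinM uin_st.
apply: (pos_mono_le UC); first exact: cpos_upos (mip_pos z).
rewrite addrAC; apply: (posD UC) => //.
rewrite (big_morph _ (@uinD R A) (erefl : uin 0 = 0)).
by apply: (pos_sum UC) => i _; apply/cpos_upos/mip_pos.
Qed.

(* [X = (X b) r] with [b = (X^* X + e)^(-1/2)] and [r = (X^* X + e)^(1/2)];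
   the row [X b] is a contraction. *)
Theorem row_contraction (u : seq (F * H)) :
  (rnorm (\sum_(p <- u) t p.1 p.2) ^+ 2)%:C <= kf (mbeta sigma idfun (@mip R A F)) u u.
Proof.
case: u => [|p0 u']; first by rewrite kf_nil big_nil rnorm0 expr0n.
set u := p0 :: u'; set n := size u'.
pose x (i : 'I_n.+1) := (nth p0 u i).1; pose h (i : 'I_n.+1) := (nth p0 u i).2.
have PI := pos_commutant_id sigma.
set G := gram (@uip _ _ F) x.
rewrite (mbeta_uform sigma idfun _ u p0) -/(@uip _ _ F) -[gram _ _]/G.
have -> : \sum_(p <- u) t p.1 p.2 = \sum_i t (x i) (h i) by rewrite (big_nth p0) big_mkord.
have key e : 0 < e -> (rnorm (\sum_i t (x i) (h i)) ^+ 2)%:C <=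
     uform sigma idfun G h h + e%:C * \sum_i hip (h i) (h i).
  move=> e0; have pG : cstar_pos _ _ _ G := gram_mpos UC HF x.
  have [b [r [[sb sr br rb rr] [pb nb]]]] := pos_inv_sqrt (matrix_cstar UC n) pG e0.
  pose k j := \sum_l urep sigma (r j l) (h l).
  have := t_contractive ler01 (link_row_contraction sb pb) k.
  rewrite expr1n mul1r.
  set y := fun j => \sum_l ura (x l) (b l j).
  have -> : ipn (@hip R H) k k = uform sigma idfun G h h + e%:C * \sum_i hip (h i) (h i).
    have -> : uform sigma idfun G h h + e%:C * \sum_i hip (h i) (h i) = uform sigma idfun (G + (usc A e%:C)%:M) h h.
      by rewrite uformD // uform_scalar.
    by rewrite -rr uform_sqr.
  have -> : ipn (@hip R H) (mxapp (map_mx t (\matrix_(i, j) (if i == ord0 :> 'I_n.+1 then \sum_l ura (x l) (b l j) else 0))) k)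
    (mxapp (map_mx t (\matrix_(i, j) (if i == ord0 :> 'I_n.+1 then \sum_l ura (x l) (b l j) else 0))) k)
     = (rnorm (\sum_i t (x i) (h i)) ^+ 2)%:C.
    have e1 i : mxapp (map_mx t (\matrix_(i, j) (if i == ord0 :> 'I_n.+1 then \sum_l ura (x l) (b l j) else 0))) k i
        = if i == ord0 then \sum_i t (x i) (h i) else 0.
      rewrite /mxapp; under eq_bigr do rewrite !mxE.
      case: ifP => _; last by rewrite big1 // => j _; rewrite t_zero.
      under eq_bigr => j _ do rewrite t_sum.
      rewrite exchange_big; apply: eq_bigr => l _.
      under eq_bigr => j _ do rewrite t_ura /k (linear_fun_sum (urep_lin rep _)).
      rewrite -(linear_fun_sum (t_lin _)); congr (t _ _).
      rewrite exchange_big; under eq_bigr => j _.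
        under eq_bigr => m _ do rewrite -(urepM rep).
        rewrite -(urep_sum rep).
        over.
      have e2 j : \sum_m b l m * r m j = (l == j)%:R by have := congr1 (fun C : 'M__ => C l j) br; rewrite !mxE.
      under eq_bigr => j _ do rewrite e2.
      rewrite (bigD1 l) //= eqxx (urep1 rep) big1 ?addr0 // => j /negbTE jl.
      by rewrite eq_sym jl (urep0 rep).
    rewrite /ipn (bigD1 ord0) //= e1 eqxx hip_sqr [X in _ + X]big1 ?addr0 // => i /negbTE i0.
    by rewrite e1 i0 hip0l.
  have h0 : 0 <= uform sigma idfun G h h + e%:C * \sum_i hip (h i) (h i).
    apply: addr_ge0; first exact: (uform_ge0 rep PI h (gram_mpos UC HF x)).
    by apply: mulr_ge0; [rewrite ler0c ltW|apply: sumr_ge0 => i _; apply: hip_ge0].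
  by rewrite !ger0_norm // ler0c sqr_ge0.
have h0 : 0 <= uform sigma idfun G h h by apply: (uform_ge0 rep PI h (gram_mpos UC HF x)).
have s0 : 0 <= \sum_i hip (h i) (h i) by apply: sumr_ge0 => i _; apply: hip_ge0.
move: key; rewrite -/n; change (size u) with n.+1.
rewrite (cabs_ge0_Re h0) (cabs_ge0_Re s0) => key; rewrite lecR.
set S := complex.Re (\sum_i hip (h i) (h i)) in key *; have S0 : 0 <= S by apply: Re_ge0.
apply/ler_addgt0Pr => e e0; have S1 : 0 < S + 1 by rewrite ltr_wpDl.
have := key (e / (S + 1)) (divr_gt0 e0 S1); rewrite -RCM -RCD lecR => /le_trans; apply.
by rewrite lerD2l mulrAC ler_pdivrMr // ler_pM2l // lerDl.
Qed.

End RowContraction.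

(** * Closures of submodules in the two settings *)

Section PredualFunctionals.
Variables (R : realType) (K : hilbertType R).

Lemma norm_lt_cabs (k : R[i]) (e : R) : (`|k| < e%:C) = (cabs k < e).
Proof. by rewrite cabsE ltcR. Qed.

Lemma csum_toP (u : nat -> R[i]) l :
  csum_to u l <-> forall e : R, 0 < e -> exists N, forall n, (N <= n)%N ->
    cabs (\sum_(i < n) u i - l) < e.
Proof.
split=> [h e e0|h e e0].
  by have [|N hN] := h e%:C; rewrite ?ltcR //; exists N => n Nn; rewrite -norm_lt_cabs hN.
have ee : e = (complex.Re e)%:C by rewrite RRe_real // gtr0_real.
have [|N hN] := h (complex.Re e); first by rewrite -ltcR -ee.
by exists N => n Nn; rewrite ee norm_lt_cabs hN.
Qed.

Lemma csum_to_unique u l l' : csum_to u l -> csum_to u l' -> l = l' :> R[i].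
Proof.
move=> /csum_toP h /csum_toP h'; apply/eqP; rewrite -subr_eq0; apply/eqP.
apply: (@cabs_small0 _ 2) => e e0; have [N hN] := h e e0; have [N' hN'] := h' e e0.
set n := maxn N N'; have := hN n (leq_maxl _ _); have := hN' n (leq_maxr _ _).
have := cabsB (\sum_(i < n) u i - l') (\sum_(i < n) u i - l).
rewrite (_ : _ - _ - _ = l - l'); last by ring.
lra.
Qed.

Lemma csum_to_lin u v l l' (k : R[i]) : csum_to u l -> csum_to v l' ->
  csum_to (fun i => k * u i + v i) (k * l + l').
Proof.
move=> /csum_toP h /csum_toP h'; apply/csum_toP => e e0.
have c0 : 0 < cabs k + 1 by rewrite ltr_wpDl ?cabs_ge0.
have [N hN] := h _ (divr_gt0 (divr_gt0 e0 (ltr0Sn R 1)) c0); have [N' hN'] := h' _ (divr_gt0 e0 (ltr0Sn R 1)).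
exists (maxn N N') => n; rewrite geq_max => /andP[n1 n2].
rewrite big_split /= -mulr_sumr.
have -> : k * \sum_(i < n) u i + \sum_(i < n) v i - (k * l + l') =
  k * (\sum_(i < n) u i - l) + (\sum_(i < n) v i - l') by ring.
apply: le_lt_trans (cabsD _ _) _; rewrite cabsM [e]splitr; apply: ler_ltD; last exact: hN'.
apply: le_trans (ler_wpM2r (cabs_ge0 _) (_ : cabs k <= cabs k + 1)) _; first by rewrite lerDl.
by rewrite mulrC -ler_pdivlMr //; apply/ltW/hN.
Qed.

Lemma csum_to_single (u : nat -> R[i]) : (forall i, (0 < i)%N -> u i = 0) -> csum_to u (u 0%N).
Proof.
move=> h; apply/csum_toP => e e0; exists 1%N => -[//|n] _.
rewrite big_ord_recl big1 ?addr0 ?subrr ?cabs0 // => i _; exact: h.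
Qed.

Lemma nnsummable_single (u : nat -> R[i]) : (forall i, (0 < i)%N -> u i = 0) -> 0 <= u 0%N -> nnsummable u.
Proof.
move=> h u0; exists (u 0%N) => -[|n]; first by rewrite big_ord0.
by rewrite big_ord_recl big1 ?addr0 // => i _; apply: h.
Qed.

Lemma ultraweak_vector (h k : K) : ultraweak (fun a : K -> K => hip h (a k)).
Proof.
exists (fun i => if i == 0%N then h else 0), (fun i => if i == 0%N then k else 0); split.
- apply: nnsummable_single => [[//|i] _|]; first by rewrite /= normr0 expr0n.
  by rewrite /= exprn_ge0.
- apply: nnsummable_single => [[//|i] _|]; first by rewrite /= normr0 expr0n.
  by rewrite /= exprn_ge0.
- move=> a ba; apply: (@csum_to_single (fun i => hip (if i == 0%N then h else 0) (a (if i == 0%N then k else 0)))).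
  by case=> // i _; rewrite /= hip0l.
Qed.

(** Merging two sequences, one in the even and one in the odd places, makes a sum of two ultraweakly
    continuous functionals again of that form. *)
Lemma nnsummable_interleave (u v : nat -> R[i]) :
  (forall i, 0 <= u i) -> (forall i, 0 <= v i) -> nnsummable u -> nnsummable v ->
  nnsummable (fun i => if odd i then v i./2 else u i./2).
Proof.
move=> u0 v0 [c hc] [d hd]; exists (c + d) => n.
suff -> : \sum_(i < n) (if odd i then v i./2 else u i./2) =
   \sum_(i < uphalf n) u i + \sum_(i < n./2) v i by apply: lerD.
elim: n => [|n IH]; first by rewrite !big_ord0 addr0.
rewrite big_ord_recr IH uphalfE /=; case: (boolP (odd n)) => on.
  by rewrite uphalf_half on add1n [\sum_(i < (n./2).+1) v i]big_ord_recr /= addrA.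
by rewrite uphalf_half (negbTE on) add0n [\sum_(i < (n./2).+1) u i]big_ord_recr /= addrAC.
Qed.

Lemma csum_to_interleave (u v : nat -> R[i]) l l' : csum_to u l -> csum_to v l' ->
  csum_to (fun i => if odd i then v i./2 else u i./2) (l + l').
Proof.
move=> /csum_toP h /csum_toP h'; apply/csum_toP => e e0.
have [N hN] := h _ (divr_gt0 e0 (ltr0Sn R 1)); have [N' hN'] := h' _ (divr_gt0 e0 (ltr0Sn R 1)).
exists (maxn N N').*2 => n hn.
have -> : \sum_(i < n) (if odd i then v i./2 else u i./2) =
   \sum_(i < uphalf n) u i + \sum_(i < n./2) v i.
  elim: (n) => [|m IH]; first by rewrite !big_ord0 addr0.
  rewrite big_ord_recr IH uphalfE /=; case: (boolP (odd m)) => on.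
    by rewrite uphalf_half on add1n [\sum_(i < (m./2).+1) v i]big_ord_recr /= addrA.
  by rewrite uphalf_half (negbTE on) add0n [\sum_(i < (m./2).+1) u i]big_ord_recr /= addrAC.
have hh : (maxn N N' <= n./2)%N by rewrite -[maxn _ _]doubleK half_leq.
have h2 : (n./2 <= uphalf n)%N by rewrite uphalf_half leq_addl.
have -> : \sum_(i < uphalf n) u i + \sum_(i < n./2) v i - (l + l') =
  (\sum_(i < uphalf n) u i - l) + (\sum_(i < n./2) v i - l') by ring.
apply: le_lt_trans (cabsD _ _) _; rewrite [e]splitr; apply: ltrD.
  by apply: hN; apply: leq_trans h2; apply: leq_trans hh; apply: leq_maxl.
by apply: hN'; apply: leq_trans hh; apply: leq_maxr.
Qed.

Lemma ultraweakD (v w : (K -> K) -> R[i]) : ultraweak v -> ultraweak w -> ultraweak (fun a => v a + w a).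
Proof.
move=> [h [k [h1 k1 c1]]] [h' [k' [h2 k2 c2]]].
exists (fun i => if odd i then h' i./2 else h i./2), (fun i => if odd i then k' i./2 else k i./2); split.
- have -> : (fun i => `|if odd i then h' i./2 else h i./2| ^+ 2) =
    (fun i => if odd i then `|h' i./2| ^+ 2 else `|h i./2| ^+ 2) by apply/funext => i; case: ifP.
  by apply: (@nnsummable_interleave (fun i => `|h i| ^+ 2) (fun i => `|h' i| ^+ 2)) => // i; rewrite exprn_ge0.
- have -> : (fun i => `|if odd i then k' i./2 else k i./2| ^+ 2) =
    (fun i => if odd i then `|k' i./2| ^+ 2 else `|k i./2| ^+ 2) by apply/funext => i; case: ifP.
  by apply: (@nnsummable_interleave (fun i => `|k i| ^+ 2) (fun i => `|k' i| ^+ 2)) => // i; rewrite exprn_ge0.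
- move=> a ba; have := csum_to_interleave (c1 a ba) (c2 a ba).
  by congr csum_to; apply/funext => i; case: ifP.
Qed.

Lemma ultraweakZ c (v : (K -> K) -> R[i]) : ultraweak v -> ultraweak (fun a => c * v a).
Proof.
move=> [h [k [h1 k1 c1]]]; exists (fun i => c^cj *: h i), k; split=> //.
  move: h1 => [d hd]; exists (`|c| ^+ 2 * d) => n.
  under eq_bigr do rewrite normrZ exprMn.
  rewrite -mulr_sumr normcJ; apply: ler_wpM2l => //; exact: exprn_ge0.
move=> a ba; have h0 : csum_to (fun=> 0) (0 : R[i]).
  by apply/csum_toP => e e0; exists 0%N => n _; rewrite big1 // subrr cabs0.
have := csum_to_lin c (c1 a ba) h0; rewrite addr0; congr csum_to.
by apply/funext => i; rewrite hipZl conjcK addr0.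
Qed.

Lemma ultraweak0 : ultraweak (fun a : K -> K => 0).
Proof. by have := ultraweakZ 0 (ultraweak_vector (0 : K) 0); congr ultraweak; apply/funext => a; rewrite mul0r. Qed.

Lemma ultraweak_lin (v : (K -> K) -> R[i]) k (a b : K -> K) : ultraweak v ->
  bounded_op a -> bounded_op b -> v (k *: a + b) = k * v a + v b.
Proof.
move=> [h [h' [_ _ hv]]] ba bb.
apply: (csum_to_unique (hv _ (bounded_op_lin k ba bb))).
have := csum_to_lin k (hv a ba) (hv b bb); congr csum_to; apply/funext => i.
by rewrite !fctE hipDr hipZr.
Qed.

End PredualFunctionals.

(** Induction on [n]. If the last functional is nonzero at some [y0] in the common kernel of the
    others, subtracting from [g] the multiple of it that agrees with [g] at [y0] leaves a functional
    that vanishes on that kernel. *)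
Lemma common_kernel_combination (R : realType) (V : lmodType R[i]) n (f : 'I_n -> V -> R[i]) (g : V -> R[i]) :
  (forall i k x y, f i (k *: x + y) = k * f i x + f i y) ->
  (forall k x y, g (k *: x + y) = k * g x + g y) ->
  (forall y, (forall i, f i y = 0) -> g y = 0) ->
  exists c : 'I_n -> R[i], forall y, g y = \sum_i c i * f i y.
Proof.
elim: n f g => [|n IH] f g lf lg ker.
  by exists (fun=> 0) => y; rewrite big_ord0; apply: ker => -[].
pose f' (i : 'I_n) := f (widen_ord (leqnSn n) i).
have [all0|/existsNP[y0 /not_implyP[h0 hn0]]] := pselect (forall y, (forall i, f' i y = 0) -> f ord_max y = 0).
  have [|c hc] := IH f' g (fun i => lf _) lg.
    move=> y hy; apply: ker => i; case: (unliftP ord_max i) => [j ->|->]; last exact: all0.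
    by rewrite -[RHS](hy j) /f'; congr (f _ _); apply/val_inj; rewrite /= /bump leqNgt ltn_ord.
  exists (fun i => if insub (val i) is Some j then c j else 0) => y.
  rewrite big_ord_recr /= insubF ?ltnn // mul0r addr0 hc; apply: eq_bigr => i _.
  by rewrite /= insubT //= => hi; congr (c _ * _); apply/val_inj.
set m := f ord_max y0 in hn0.
have m0 : m != 0 by apply/eqP.
pose g' y := g y - g y0 / m * f ord_max y.
have lg' k x y : g' (k *: x + y) = k * g' x + g' y.
  by rewrite /g' lg lf; ring.
have [|c hc] := IH f' g' (fun i => lf _) lg'.
  move=> y hy; rewrite /g'.
  have g0 : g ((- (f ord_max y / m)) *: y0 + y) = 0.
    apply: ker => i; case: (unliftP ord_max i) => [j ->|->].
      have e : lift ord_max j = widen_ord (leqnSn n) j.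
        by apply/val_inj; rewrite /= /bump leqNgt ltn_ord.
      by rewrite lf e (h0 j : f (widen_ord _ j) y0 = 0) (hy j : f (widen_ord _ j) y = 0) mulr0 addr0.
    rewrite lf -/m; field => //.
  move: g0; rewrite lg => h; rewrite -[RHS]h; field => //.
exists (fun i => if insub (val i) is Some j then c j else g y0 / m) => y.
rewrite big_ord_recr /= insubF ?ltnn //.
have := hc y; rewrite /g' => /eqP; rewrite subr_eq => /eqP ->; congr (_ + _).
apply: eq_bigr => i _; rewrite /= insubT //= => hi; congr (c _ * _); exact/val_inj.
Qed.

Section PredualOfAlgebra.
Variables (R : realType) (A : cstarAlgType R) (K : hilbertType R) (pi : A -> K -> K).
Hypothesis rep : is_rep pi.

Lemma predual_linear w : predual pi w -> forall (k : R[i]) a b, w (k *: a + b) = k * w a + w b.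
Proof.
move=> [v hv ->] k a b /=; rewrite (rep_linear rep) (ultraweak_lin k hv) //; exact: (rep_bounded rep).
Qed.

Lemma predual_vector (h k : K) : predual pi (fun a => hip h (pi a k)).
Proof. by exists (fun a => hip h (a k)) => //; apply: ultraweak_vector. Qed.

Lemma predual0 : predual pi (fun=> 0).
Proof. by exists (fun=> 0) => //; apply: ultraweak0. Qed.

Lemma predual_comb n (c : 'I_n -> R[i]) (f : 'I_n -> A -> R[i]) :
  (forall i, predual pi (f i)) -> predual pi (fun a => \sum_i c i * f i a).
Proof.
elim: n c f => [|n IH] c f hf.
  by have := predual0; congr predual; apply/funext => a; rewrite big_ord0.
have [v hv ev] := IH (fun i => c (widen_ord (leqnSn n) i)) _ (fun i => hf (widen_ord (leqnSn n) i)).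
have [w hw ew] := hf ord_max.
exists (fun a => v a + c ord_max * w a); first by apply: ultraweakD => //; apply: ultraweakZ.
by apply/funext => a; rewrite big_ord_recr /= ew; congr (_ + _); rewrite -[RHS]/((v \o pi) a) -ev.
Qed.

(** A linear functional that is bounded on a basic neighbourhood of 0 vanishes, by scaling, on the
    common kernel of finitely many elements of the predual, and so is a combination of them. This
    converts normality, given as continuity, into membership in the predual. *)
Lemma predual_of_continuous (g : A -> R[i]) :
  (forall k x y, g (k *: x + y) = k * g x + g y) ->
  (exists n (f : 'I_n -> A -> R[i]) (d : R[i]), [/\ forall i, predual pi (f i), 0 < d &
     forall y, (forall i, `|f i 0 - f i y| < d) -> `|g 0 - g y| < 1]) ->
  predual pi g.
Proof.
move=> lg [n [f [d [hf d0 hd]]]].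
have g0 : g 0 = 0.
  by have := lg 1 0 0; rewrite scale1r mul1r addr0 => h; apply: (addrI (g 0)); rewrite -h addr0.
have lf i k x y : f i (k *: x + y) = k * f i x + f i y by apply: predual_linear.
have f0 i : f i 0 = 0.
  by have := lf i 1 0 0; rewrite scale1r mul1r addr0 => h; apply: (addrI (f i 0)); rewrite -h addr0.
have [|c hc] := common_kernel_combination lf lg.
  move=> y hy; apply: (@cabs_small0 _ 1) => e e0; rewrite mul1r.
  have := hd ((e^-1)%:C *: y); rewrite g0 sub0r normrN.
  have -> : g ((e^-1)%:C *: y) = (e^-1)%:C * g y by have := lg (e^-1)%:C y 0; rewrite g0 !addr0.
  have h i : `|f i 0 - f i ((e^-1)%:C *: y)| < d.
    have -> : f i ((e^-1)%:C *: y) = (e^-1)%:C * f i y by have := lf i (e^-1)%:C y 0; rewrite f0 !addr0.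
    by rewrite hy mulr0 f0 subr0 normr0.
  move=> /(_ h); rewrite -[1]/(1%:C) norm_lt_cabs cabsM cabs_real ger0_norm ?invr_ge0 ?(ltW e0) //.
  by rewrite mulrC ltr_pdivrMr // mul1r => /ltW.
have -> : g = (fun a => \sum_i c i * f i a) by apply/funext.
exact: predual_comb.
Qed.

Lemma sigma_functional_single (F : hilbertModType A) (w : A -> R[i]) (c : R) (y : F) :
  predual pi w -> 0 <= c -> (forall a, cabs (w a) <= c * rnorm a) ->
  sigma_functional (predual pi) (fun x : F => w (mip y x)).
Proof.
move=> hw c0 hc.
exists (fun i => if i == 0%N then w else (fun=> 0)), (fun=> y), (fun i => if i == 0%N then c%:C else 0); split.
- by case=> [//|i]; apply: predual0.
- case=> [|i] a /=; last by rewrite normr0 mul0r.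
  by rewrite cabsE rnormE -RCM lecR.
- by case=> [|i] //=; rewrite ler0c.
- by apply: nnsummable_single => [[//|i] _|] /=; rewrite ?mul0r // mulr_ge0 // ler0c.
- by move=> x; apply: (@csum_to_single _ (fun i => (if i == 0%N then w else (fun=> 0)) (mip y x))) => -[].
Qed.

End PredualOfAlgebra.

Section ModClosure.
Variables (R : realType) (M : cstarAlgType R) (s : setting M).

Lemma sub_mod_closure (F : hilbertModType M) (S : set F) z : S z -> mod_closure s S z.
Proof.
move=> Sz; rewrite /mod_closure; case: s => [|K pi vn]; first exact: subset_closure.
by move=> n f e _ e0; exists z => // i; rewrite subrr normr0.
Qed.

(** Representations are contractive, because [|a|^2 - a^* a] is a square in the unitization and so
    is mapped to a positive operator. *)
Lemma rep_vector_bound (K : hilbertType R) (pi : M -> K -> K) : is_rep pi -> forall h k a,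
  cabs (hip h (pi a k)) <= rnorm h * rnorm k * rnorm a.
Proof.
move=> rep h k a; apply: le_trans (hip_cauchy_schwarz _ _) _; rewrite -mulrA.
apply: ler_wpM2l; first exact: rnorm_ge0.
apply: le_of_sqr; first by rewrite mulr_ge0 ?rnorm_ge0.
have UC := unitz_cstar M.
have h1 : cstar_pos (@usc R M) (@ust R M) (@unr R M) (real_sc (@usc R M) (rnorm a ^+ 2) - uin (cmul (cstar a) a)).
  apply: (pos_sub_nr UC); first by rewrite -uin_st cstarM cstarK.
  by rewrite unr_in rnorm_cstar_mul.
have [v [sv vv _]] := pos_sqrt UC h1.
have : 0 <= hip k (urep pi (real_sc (@usc R M) (rnorm a ^+ 2) - uin (cmul (cstar a) a)) k).
  by rewrite -vv (urepM rep) -{1}sv -(urep_adj rep) hip_ge0.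
rewrite (urepD rep) (urepN rep) urep_in (urep_sc rep) (repM rep) hipBr hipZr -[cstar a]cstarK.
rewrite -(rep_adj rep) cstarK !hip_sqr -RCM subr_ge0 lecR => hh.
by rewrite exprMn mulrC.
Qed.

(** In the W*-setting the functionals [x |-> <h, pi(<y, x>) k>] are sigma-continuous, and together
    they determine [<y, z>] because [pi] is faithful. *)
Lemma mod_closure_orth (F : hilbertModType M) (S : set F) (y z : F) :
  mod_closure s S z -> (forall x, S x -> mip y x = 0) -> mip y z = 0.
Proof.
rewrite /mod_closure; case: s => [|K pi vn] hz hS.
  apply: (@rnorm_small0 _ _ (rnorm y)) => e e0.
  have [x Sx hx] := (closure_rnorm S z).1 hz e e0.
  rewrite -(subr0 (mip y z)) -(hS x Sx) -mipBr; apply: le_trans (rnorm_mip _ _) _.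
  by apply: ler_wpM2l; rewrite ?rnorm_ge0.
have rep := vn_rep vn; apply: (vn_faithful vn); apply/funext => k.
rewrite (rep0 rep); apply: hip_ext => h; rewrite hip0r.
apply: (@cabs_small0 _ 1) => e e0; rewrite mul1r.
have hf := @sigma_functional_single _ _ _ pi F _ (rnorm h * rnorm k) y (predual_vector pi h k)
   (mulr_ge0 (rnorm_ge0 _) (rnorm_ge0 _)) (rep_vector_bound rep h k).
have [|x Sx hx] := hz 1%N (fun=> (fun x => hip h (pi (mip y x) k))) e%:C (fun=> hf); first by rewrite ltcR.
have := hx ord0; rewrite (hS x Sx) (rep0 rep) hip0r subr0 norm_lt_cabs; exact: ltW.
Qed.

Lemma mod_closure_ext (F : hilbertModType M) (S : set F) (y z : F) :
  mod_closure s S = setT -> (forall x, S x -> mip x y = mip x z) -> y = z.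
Proof.
move=> hT hS; apply/eqP; rewrite -subr_eq0; apply/eqP; apply: mip_ext => x.
rewrite mip_star (@mod_closure_orth F S (y - z) x) ?hT //; first by rewrite cstar0 mip0r.
by move=> w Sw; rewrite mip_star mipBr hS // subrr cstar0.
Qed.

End ModClosure.

Lemma pow_half_small (R : realType) (e : R) : 0 < e -> exists n, (1 / 2) ^+ n <= e.
Proof.
move=> e0; have [N hN] := archi_inv 1 e0; exists N.+1; apply: le_trans (hN N (leqnn N)).
rewrite expr_div_n expr1n ler_pM2l // lef_pV2 ?posrE ?exprn_gt0 ?ltr0Sn //.
by rewrite -natrX ler_nat; apply/ltnW/ltn_expl.
Qed.

(** * Approximation in the seminorms given by vectors of H *)

Section Density.
Variables (R : realType) (M : cstarAlgType R) (s : setting M).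
Variables (H : hilbertType R) (sigma : M -> H -> H).
Hypothesis rep : is_rep sigma.
Hypothesis sigma_ok : rep_ok s sigma.
Variables (F : hilbertModType M) (k : H).

(** The inner product of [x (x) k] and [y (x) k] in the tensor product with [H]. For normal [sigma],
    a sigma-dense subspace is dense in these seminorms, although it need not be so in norm. *)
Definition vbeta (x y : F) : R[i] := hip k (sigma (mip x y) k).

Lemma vbeta_sum (u v : seq F) : kf vbeta u v = vbeta (\sum_(x <- u) x) (\sum_(x <- v) x).
Proof.
rewrite /kf /vbeta mip_suml (rep_sum rep) hip_sumr; apply: eq_bigr => p _.
by rewrite mip_sumr (rep_sum rep) hip_sumr.
Qed.

Lemma vbeta_pos x : 0 <= vbeta x x.
Proof.
by rewrite /vbeta; have [b ->] := mip_pos x; rewrite (repM rep) -[b in sigma b]cstarK -(rep_adj rep) cstarK hip_ge0.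
Qed.

Lemma vbeta_kernel : is_kernel vbeta (fun c x => c *: x).
Proof.
split=> [p q|c p q|u].
- by rewrite /vbeta -hip_cj (rep_adj rep) -mip_star.
- by rewrite /vbeta mipZr (repZ rep) hipZr.
- by rewrite vbeta_sum vbeta_pos.
Qed.

Definition vknorm x : R := kn vbeta [:: x].

Lemma vbeta1 x y : kf vbeta [:: x] [:: y] = vbeta x y.
Proof. by rewrite vbeta_sum !big_seq1. Qed.
Lemma vknorm_sqr x : (vknorm x ^+ 2)%:C = vbeta x x.
Proof. by rewrite (kn_sqr vbeta_kernel) vbeta1. Qed.
Lemma vknorm_ge0 x : 0 <= vknorm x. Proof. exact: kn_ge0. Qed.
Lemma vbeta_cs x y : cabs (vbeta x y) <= vknorm x * vknorm y.
Proof. by rewrite -vbeta1; apply: (kf_cauchy_schwarz vbeta_kernel). Qed.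
Lemma vknorm_sum u : kn vbeta u = vknorm (\sum_(x <- u) x).
Proof. by rewrite /vknorm /kn !vbeta_sum big_seq1. Qed.
Lemma vknormD x y : vknorm (x + y) <= vknorm x + vknorm y.
Proof.
have := kn_cat vbeta_kernel [:: x] [:: y].
by rewrite vknorm_sum !big_cons big_nil addr0.
Qed.
Lemma vbetaBl x y z : vbeta (x - y) z = vbeta x z - vbeta y z.
Proof. by rewrite /vbeta mipBl (repD rep) -scaleN1r (repZ rep) scaleN1r hipBr. Qed.
Lemma vbetaBr x y z : vbeta x (y - z) = vbeta x y - vbeta x z.
Proof. by rewrite /vbeta mipBr (repD rep) -scaleN1r (repZ rep) scaleN1r hipBr. Qed.
Lemma vknorm_le x : vknorm x <= rnorm k * rnorm x.
Proof.
apply: le_of_sqr; first by rewrite mulr_ge0 ?rnorm_ge0.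
have := rep_vector_bound rep k k (mip x x); rewrite -/(vbeta x x) -vknorm_sqr cabs_real.
by rewrite ger0_norm ?sqr_ge0 // rnorm_mip_sqr exprMn -expr2.
Qed.

Lemma predual_rep_vector (K : hilbertType R) (pi : M -> K -> K) (vn : is_von_neumann pi) h :
  s = WStarSetting vn -> predual pi (fun a => hip h (sigma a k)).
Proof.
move=> es; have := sigma_ok; rewrite es /= => hc.
apply: (predual_of_continuous (vn_rep vn)).
  by move=> c x y; rewrite (repD rep) (repZ rep) hipDr hipZr.
have [n [f [d [hf d0 hd]]]] := hc 0 _ 1 (ultraweak_vector h k) ltr01.
by exists n, f, d; split.
Qed.

Variable S : set F.
Hypothesis S0 : S 0.
Hypothesis S_lin : forall c x y, S x -> S y -> S (c *: x + y).

Lemma subspaceD x y : S x -> S y -> S (x + y).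
Proof. by move=> hx hy; rewrite -[x]scale1r; apply: S_lin. Qed.
Lemma subspaceZ c x : S x -> S (c *: x).
Proof. by move=> hx; rewrite -[_ *: _]addr0; apply: S_lin. Qed.
Lemma subspaceB x y : S x -> S y -> S (x - y).
Proof. by move=> hx hy; rewrite addrC -scaleN1r; apply: S_lin. Qed.

(** [approx_riesz] is applied to the functional [<z, .>] on [S] itself; as [S] need not be complete,
    the projection of [z] is obtained up to [e]. *)
Lemma approx_projection z e : 0 < e ->
  exists2 x, S x & forall y, S y -> cabs (vbeta (z - x) y) <= e * vknorm y.
Proof.
move=> e0; pose E := {x : F | S x}.
pose sE (c : R[i]) (p : E) : E := exist _ (c *: sval p) (subspaceZ c (svalP p)).
pose bE (p q : E) := vbeta (sval p) (sval q).
have kfE (u v : seq E) : kf bE u v = kf vbeta (map sval u) (map sval v).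
  by rewrite /kf big_map; apply: eq_bigr => p _; rewrite big_map.
have KE : is_kernel bE sE.
  split=> [p q|c p q|u]; rewrite /bE /sE /=.
  - exact: kernel_herm vbeta_kernel _ _.
  - exact: kernel_scl vbeta_kernel _ _ _.
  - by rewrite kfE; apply: kernel_pos vbeta_kernel _.
pose sm (u : seq E) := \sum_(p <- u) sval p.
have smS u : S (sm u) by rewrite /sm; elim/big_ind: _ => // [|p _]; [exact: subspaceD|exact: svalP].
have knE u : kn bE u = vknorm (sm u).
  by rewrite /kn kfE vbeta_sum /vknorm /kn vbeta1 big_map.
have [|||w hw] := @approx_riesz _ _ _ _ KE (fun u => vbeta z (sm u)) (vknorm z) _ _ _ e e0.
- by move=> u v; rewrite /sm big_cat /vbeta mipDr (repD rep) hipDr.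
- by move=> c u; rewrite /sm big_map /= -scaler_sumr /vbeta mipZr (repZ rep) hipZr.
- by move=> u; rewrite knE; apply: vbeta_cs.
exists (sm w) => // y Sy; have := hw [:: exist _ y Sy].
rewrite kfE vbeta_sum knE /sm !big_seq1 big_map vbetaBl cabs_distC.
exact.
Qed.

(* For W*-modules the closure is only weak.  The functional [<lim xi_j, .>]
   below, where [xi_j] is almost orthogonal to [S], is shown to be
   sigma-continuous by writing each increment as
   [xi_(j+1) - xi_j = d = (d b) r] with [b = (<d,d> + e)^(-1/2)], [r = b^(-1)]. *)
Lemma mod_closure_dense z e : mod_closure s S z -> 0 < e ->
  exists2 x, S x & vknorm (z - x) <= e.
Proof.
move=> hz e0; case es : s hz => [|K pi vn] hz.
  have k0 : 0 < rnorm k + 1 by rewrite ltr_wpDl ?rnorm_ge0.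
  have [x Sx hx] := (closure_rnorm S z).1 hz _ (divr_gt0 e0 k0).
  exists x => //; apply: le_trans (vknorm_le _) _.
  apply: le_trans (ler_wpM2l (rnorm_ge0 _) hx) _.
  by rewrite mulrCA ger_pMr // ler_pdivrMr // mul1r lerDl.
pose ej (j : nat) : R := (1 / 2) ^+ j.
have ej0 j : 0 < ej j by rewrite exprn_gt0 // divr_gt0.
have [sj hsj] := choice (fun j => let: ex_intro2 x Sx hx := approx_projection z (ej0 j) in
   ex_intro (fun x => S x /\ forall y, S y -> cabs (vbeta (z - x) y) <= ej j * vknorm y) x (conj Sx hx)).
pose xi j := z - sj j.
have xiS j y : S y -> cabs (vbeta (xi j) y) <= ej j * vknorm y by case: (hsj j) => _; apply.
have xid i j : vknorm (xi i - xi j) <= ej i + ej j.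
  set y := xi i - xi j; have Sy : S y.
    by rewrite /y /xi (_ : _ - _ = sj j - sj i); [by apply: subspaceB; [case: (hsj j)|case: (hsj i)]|zabel].
  have [->|ne] := eqVneq (vknorm y) 0; first by rewrite addr_ge0 // ltW.
  have y0 : 0 < vknorm y by rewrite lt_neqAle eq_sym ne vknorm_ge0.
  rewrite -(ler_pM2r y0) -expr2 mulrDl.
  have -> : vknorm y ^+ 2 = cabs (vbeta y y).
    by rewrite -vknorm_sqr cabs_real ger0_norm // sqr_ge0.
  rewrite {1}/y vbetaBl; apply: le_trans (cabsB _ _) _; apply: lerD; exact: xiS.
have ej_dec i j : (i <= j)%N -> ej j <= ej i.
  by move=> ij; apply: ler_wiXn2l => //; lra.
have xi_cvg y : exists l, forall d, 0 < d -> exists N, forall n, (N <= n)%N ->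
    cabs (vbeta (xi n) y - l) <= d.
  apply: complex_complete => d d0.
  have y0 : 0 < vknorm y + 1 by rewrite ltr_wpDl ?vknorm_ge0.
  have [N hN] := pow_half_small (divr_gt0 (divr_gt0 d0 (ltr0Sn R 1)) y0).
  exists N => m n Nm Nn; rewrite -vbetaBl; apply: le_trans (vbeta_cs _ _) _.
  have h1 : vknorm (xi m - xi n) <= d / (vknorm y + 1).
    apply: le_trans (xid m n) _; rewrite [d]splitr mulrDl; apply: lerD.
      by apply: le_trans (ej_dec _ _ Nm) hN.
    by apply: le_trans (ej_dec _ _ Nn) hN.
  apply: le_trans (ler_wpM2r (vknorm_ge0 _) h1) _.
  by rewrite mulrAC ler_pdivrMr // ler_pM2l // lerDl.
have [f hf] := choice xi_cvg.
have fS y : S y -> f y = 0.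
  move=> Sy; apply: (@cabs_small0 _ (1 + vknorm y)) => d d0.
  have [N hN] := hf y d d0; have [N' hN'] := pow_half_small d0.
  set n := maxn N N'; have h1 := hN n (leq_maxl _ _); have h2 := xiS n y Sy.
  have h3 : ej n <= d by apply: le_trans (ej_dec _ _ (leq_maxr N N')) hN'.
  have := cabsB (vbeta (xi n) y) (vbeta (xi n) y - f y).
  rewrite (_ : _ - _ = f y); last by ring.
  have := ler_wpM2r (vknorm_ge0 y) h3; lra.
pose d j := xi j.+1 - xi j.
have UC := unitz_cstar M.
have [br hbr] := choice (fun j => let: ex_intro b (ex_intro r h) :=
   pos_inv_sqrt UC (cpos_upos (mip_pos (d j))) (exprn_gt0 2 (ej0 j)) in
   ex_intro (fun br : unitz M * unitz M => [/\ ust br.1 = br.1, ust br.2 = br.2, br.1 * br.2 = 1, br.2 * br.1 = 1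
     & br.2 * br.2 = uin (mip (d j) (d j)) + real_sc (@usc R M) (ej j ^+ 2)] /\
     (cstar_pos (@usc R M) (@ust R M) (@unr R M) (1 - br.1 * uin (mip (d j) (d j)) * br.1) /\
      unr (br.1 * uin (mip (d j) (d j)) * br.1) <= 1)) (b, r) h).
pose y j := ura (d j) (br j).1; pose h j := urep sigma (br j).2 k.
have yh j x : hip (h j) (sigma (mip (y j) x) k) = vbeta (d j) x.
  have [[sb sr b_r rb rr] _] := hbr j.
  rewrite /h (urep_adj rep) sr -(urep_in sigma (mip _ _)) -(urepM rep).
  have -> : uin (mip (y j) x) = (br j).1 * uin (mip (d j) x).
    by have := ph_ral UC (hilbertmod_prehilbert F) (d j) x (br j).1; rewrite sb.
  by rewrite mulrA rb mul1r urep_in.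
have yn j : rnorm (y j) <= 1.
  have [[sb sr b_r rb rr] [_ hn]] := hbr j.
  apply: le_of_sqr => //; rewrite expr1n -rnorm_mip_sqr -unr_in.
  have := ph_ral UC (hilbertmod_prehilbert F) (d j) (y j) (br j).1; rewrite /uip sb => ->.
  have := ph_ra (hilbertmod_prehilbert F) (d j) (d j) (br j).1; rewrite /uip => ->.
  by rewrite mulrA.
(* The square of the left side is [<k, <d, d> k> + e_j^2 |k|^2]. The first term is at most
   [4 e_j^2], since the seminorm of [d j] is at most [ej j.+1 + ej j]; hence the constant
   [2 + rnorm k]. *)
have hn j : rnorm (h j) <= ej j * (2 + rnorm k).
  have [[sb sr b_r rb rr] _] := hbr j.
  apply: le_of_sqr; first by rewrite mulr_ge0 ?addr_ge0 ?rnorm_ge0 // ltW.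
  rewrite -lecR -hip_sqr /h (urep_adj rep) sr -(urepM rep) rr (urepD rep) urep_in (urep_sc rep).
  rewrite hipDr hipZr hip_sqr -/(vbeta _ _) -vknorm_sqr -RCM -RCD lecR.
  have h1 : vknorm (d j) <= 2 * ej j.
    by apply: le_trans (xid _ _) _; have := ej_dec _ _ (leqnSn j); lra.
  have h2 := vknorm_ge0 (d j); have h3 := rnorm_ge0 k; have h4 := ltW (ej0 j).
  have h5 : vknorm (d j) ^+ 2 <= (2 * ej j) ^+ 2 by apply: lerXn2r; rewrite ?nnegrE // mulr_ge0.
  apply: le_trans (_ : _ <= (2 * ej j) ^+ 2 + ej j ^+ 2 * rnorm k ^+ 2) _; first by rewrite lerD2r.
  have -> : (ej j * (2 + rnorm k)) ^+ 2 = (2 * ej j) ^+ 2 + ej j ^+ 2 * rnorm k ^+ 2 +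
     4 * (ej j ^+ 2 * rnorm k) by ring.
  by rewrite lerDl mulr_ge0 // mulr_ge0 // sqr_ge0.
(* [f] is the sum of [<xi_0, .>] and of the increments [<d_j, .>], which are [<h_j, <y_j, .> k>] by
   [yh]. The series of bounds converges because [h_j] decays like [ej j] while [y_j] has norm at
   most 1. *)
have hPhi : sigma_functional (predual pi) f.
  exists (fun i => if i is j.+1 then (fun a => hip (h j) (sigma a k)) else (fun a => hip k (sigma a k))),
    (fun i => if i is j.+1 then y j else xi 0%N),
    (fun i => (if i is j.+1 then rnorm (h j) * rnorm k else rnorm k * rnorm k)%:C); split.
  - by case=> [|j]; apply: (predual_rep_vector _ es).
  - by case=> [|j] a; rewrite cabsE rnormE -RCM lecR; apply: rep_vector_bound.
  - by case=> [|j]; rewrite ler0c mulr_ge0 ?rnorm_ge0.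
  - exists (rnorm k * rnorm k * rnorm (xi 0%N) + 2 * ((2 + rnorm k) * rnorm k))%:C => n.
    have h0 m : \sum_(i < m) rnorm (h i) * rnorm k * rnorm (y i) <= (2 - 2 * ej m) * ((2 + rnorm k) * rnorm k).
      elim: m => [|m IH]; first by rewrite big_ord0 /ej expr0 mulr1 subrr mul0r.
      rewrite big_ord_recr /=; have h1 := hn m; have h2 := yn m.
      have h3 := rnorm_ge0 k; have h4 := rnorm_ge0 (h m); have h5 := rnorm_ge0 (y m).
      have h6 : rnorm (h m) * rnorm k * rnorm (y m) <= ej m * (2 + rnorm k) * rnorm k * 1.
        by apply: ler_pM => //; [apply: mulr_ge0|apply: ler_wpM2r].
      have e1 : 2 * ej m.+1 = ej m by rewrite /ej exprS; field.
      have -> : 2 - 2 * ej m.+1 = (2 - 2 * ej m) + ej m by rewrite e1; lra.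
      rewrite mulrDl; apply: lerD => //; move: h6; lra.
    have h00 : 0 <= (2 + rnorm k) * rnorm k by rewrite mulr_ge0 ?addr_ge0 ?rnorm_ge0.
    case: n => [|n].
      by rewrite big_ord0 ler0c addr_ge0 // !mulr_ge0 ?rnorm_ge0 // addr_ge0 ?rnorm_ge0.
    rewrite big_ord_recl /= rnormE RCD RCM; apply: lerD => //.
    under eq_bigr => i _ do rewrite rnormE -RCM.
    rewrite -(rmorph_sum (real_complex R)) lecR; apply: le_trans (h0 n) _.
    by apply: ler_wpM2r => //; have := ltW (ej0 n); lra.
  - move=> x; apply/csum_toP => c c0.
    have [N hN] := hf x (c / 2) (divr_gt0 c0 (ltr0Sn R 1)).
    exists N.+1 => -[//|n] Nn; rewrite big_ord_recl /=.
    have -> : \sum_(i < n) hip (h i) (sigma (mip (y i) x) k) = vbeta (xi n) x - vbeta (xi 0%N) x.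
      elim: (n) => [|m IH]; first by rewrite big_ord0 subrr.
      by rewrite big_ord_recr /= IH yh /d (vbetaBl (xi m.+1) (xi m)); ring.
    rewrite -/(vbeta (xi 0%N) x) (_ : _ + (_ - _) = vbeta (xi n) x); last by ring.
    by apply: le_lt_trans (hN n Nn) _; rewrite ltr_pdivrMr // ltr_pMr // ltr1n.
(* A sigma-continuous [f] that vanishes on [S] vanishes at [z]. So [<xi_n, z>] tends to 0, while
   [<xi_n, s_n>] is small by almost orthogonality; their difference is the square seminorm of
   [z - s_n]. *)
have fz : f z = 0.
  apply: (@cabs_small0 _ 1) => c c0; rewrite mul1r.
  have [|x Sx hx] := hz 1%N (fun=> f) c%:C (fun=> hPhi); first by rewrite ltcR.
  by have := hx ord0; rewrite (fS x Sx) subr0 norm_lt_cabs; apply: ltW.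
(* A bound for the seminorms of all [sj j], because [xiS] is an estimate relative to the seminorm of
   the tested vector. *)
set B := vknorm (xi 0%N) + 2 + vknorm z.
have B0 : 0 < B by rewrite /B -addrA ltr_wpDl ?vknorm_ge0 // ltr_wpDr ?vknorm_ge0.
have sB j : vknorm (sj j) <= B.
  have -> : sj j = z - ((xi j - xi 0%N) + xi 0%N) by rewrite /xi; zabel.
  have nN x : vknorm (- x) = vknorm x.
    by have := kn_scl vbeta_kernel (-1) [:: x]; rewrite vknorm_sum big_seq1 scaleN1r cabsN -[1]/(1%:C) cabs_real normr1 mul1r.
  apply: le_trans (vknormD _ _) _; rewrite nN; have := vknormD (xi j - xi 0%N) (xi 0%N).
  have := xid j 0%N; have := ej_dec _ _ (leq0n j); rewrite /ej expr0 /B; lra.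
have [N hN] := hf z (e ^+ 2 / 2) (divr_gt0 (exprn_gt0 2 e0) (ltr0Sn R 1)).
have [N' hN'] := pow_half_small (divr_gt0 (divr_gt0 (exprn_gt0 2 e0) (ltr0Sn R 1)) B0).
set n := maxn N N'; exists (sj n); first by case: (hsj n).
apply: le_of_sqr; first exact: ltW.
have := hN n (leq_maxl _ _); rewrite fz subr0 => h1.
have [Sn _] := hsj n; have h2 := xiS n _ Sn.
have h3 : ej n <= e ^+ 2 / 2 / B by apply: le_trans (ej_dec _ _ (leq_maxr N N')) hN'.
have h4 : ej n * vknorm (sj n) <= e ^+ 2 / 2.
  rewrite -[X in _ <= X](divfK (lt0r_neq0 B0)); apply: ler_pM => //; [exact: ltW|exact: vknorm_ge0].
have -> : vknorm (z - sj n) ^+ 2 = cabs (vbeta (xi n) z - vbeta (xi n) (sj n)).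
  by rewrite -vbetaBr -vknorm_sqr cabs_real ger0_norm // sqr_ge0.
have := cabsB (vbeta (xi n) z) (vbeta (xi n) (sj n)); lra.
Qed.

End Density.

Lemma lspan_lin (R : realType) (V : lmodType R[i]) (S : set V) (k : R[i]) x y :
  lspan S x -> lspan S y -> lspan S (k *: x + y).
Proof.
move=> [n [c [v [hv ->]]]] [m [d [w [hw ->]]]].
exists (n + m)%N, (fun i => match fintype.split i with inl a => k * c a | inr b => d b end),
  (fun i => match fintype.split i with inl a => v a | inr b => w b end); split.
  by move=> i; case: fintype.split.
rewrite big_split_ord scaler_sumr; congr (_ + _); apply: eq_bigr => i _.
  by rewrite (unsplitK (inl i)) scalerA.
by rewrite (unsplitK (inr i)).
Qed.

Lemma lspan0 (R : realType) (V : lmodType R[i]) (S : set V) : lspan S 0.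
Proof. by exists 0%N, (fun=> 0), (fun=> 0); split; [case|rewrite big_ord0]. Qed.

Lemma lspan_sub (R : realType) (V : lmodType R[i]) (S : set V) x : S x -> lspan S x.
Proof. by move=> Sx; exists 1%N, (fun=> 1), (fun=> x); split=> //; rewrite big_ord1 scale1r. Qed.

Lemma lspan_min (R : realType) (V : lmodType R[i]) (S P : set V) :
  P 0 -> (forall (k : R[i]) x y, P x -> P y -> P (k *: x + y)) -> S `<=` P -> lspan S `<=` P.
Proof.
move=> P0 Plin SP x [n [c [v [hv ->]]]]; elim/big_ind: _ => //.
  by move=> a b ha hb; rewrite -[a]scale1r; apply: Plin.
by move=> i _; rewrite -[_ *: _]addr0; apply: Plin => //; apply: SP.
Qed.

Section AdjointExtension.
Variables (R : realType) (M : cstarAlgType R) (s : setting M).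

(** In the W*-setting self-duality represents the functional [<z, L .>] outright. In the C*-setting
    the adjoint is known on [S] and hence on its span; there it is Lipschitz with constant [c], so
    it extends to the closure by completeness of [V]. *)
Lemma adjoint_on_closure (V W : hilbertModType M) (L : V -> W) (c : R) (S : set W) :
  linear L -> (forall x a, L (ract x a) = ract (L x) a) -> 0 <= c ->
  (forall x, rnorm (L x) <= c * rnorm x) -> module_ok s V ->
  (forall z, S z -> exists w, forall y, mip (L y) z = mip y w) ->
  forall z, mod_closure s (lspan S) z -> exists w, forall y, mip (L y) z = mip y w.
Proof.
move=> lL rL c0 bL; rewrite /module_ok /mod_closure; case: s => [|K pi vn] okV hS z hz; last first.
  have [|||w hw] := okV (fun y => mip z (L y)).
  - by move=> k x y; rewrite lL mipDr mipZr.
  - by move=> x a; rewrite rL mip_ract.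
  - exists (rnorm z * c)%:C => x; rewrite !rnormE -RCM lecR.
    apply: le_trans (rnorm_mip _ _) _; rewrite -mulrA; apply: ler_wpM2l; rewrite ?rnorm_ge0 //.
  by exists w => y; rewrite mip_star hw -mip_star.
have h1 x : lspan S x -> exists w, forall y, mip (L y) x = mip y w.
  apply: (@lspan_min _ _ S (fun x => exists w, forall y, mip (L y) x = mip y w)) => //.
    by exists 0 => y; rewrite !mip0r.
  by move=> k a b [w hw] [w' hw']; exists (k *: w + w') => y; rewrite !mipDr !mipZr hw hw'.
have app (n : nat) : exists p : W * V, rnorm (z - p.1) <= 1 / n.+1%:R /\ forall y, mip (L y) p.1 = mip y p.2.
  have [x Sx hx] := (closure_rnorm _ z).1 hz _ (divr_gt0 ltr01 (ltr0Sn R n)).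
  by have [w hw] := h1 x Sx; exists (x, w).
have [p hp] := choice app.
have d m n : rnorm ((p m).2 - (p n).2) <= c * rnorm ((p m).1 - (p n).1).
  set w := _ - _; have [->|ne] := eqVneq (rnorm w) 0; first by rewrite mulr_ge0 ?rnorm_ge0.
  have w0 : 0 < rnorm w by rewrite lt_neqAle eq_sym ne rnorm_ge0.
  rewrite -(ler_pM2r w0) -expr2 -rnorm_mip_sqr {2}/w mipBr -!(hp _).2 -mipBr.
  apply: le_trans (rnorm_mip _ _) _; rewrite [X in _ <= X]mulrAC.
  by apply: ler_wpM2r; rewrite ?rnorm_ge0.
have [|w hw] := @rnorm_complete R V (fun n => (p n).2).
  move=> e e0; have c1 : 0 < c + 1 by rewrite ltr_wpDl.
  have [N hN] := archi_inv 1 (divr_gt0 (divr_gt0 e0 c1) (ltr0Sn R 1)).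
  exists N => m n Nm Nn; apply: le_trans (d m n) _.
  have h3 : rnorm ((p m).1 - (p n).1) <= e / (c + 1).
    rewrite (_ : _ - _ = (z - (p n).1) - (z - (p m).1)); last by zabel.
    apply: le_trans (rnormB _ _) _; rewrite [e / _]splitr; apply: lerD.
      by apply: le_trans (hp n).1 (hN _ Nn).
    by apply: le_trans (hp m).1 (hN _ Nm).
  apply: le_trans (ler_wpM2l c0 h3) _.
  by rewrite mulrCA ger_pMr // ler_pdivrMr // mul1r lerDl.
exists w => y; apply/eqP; rewrite -subr_eq0; apply/eqP.
apply: (@rnorm_small0 _ _ (rnorm (L y) + rnorm y)) => e e0.
have [N hN] := hw e e0; have [N' hN'] := archi_inv 1 e0; set n := maxn N N'.
have -> : mip (L y) z - mip y w = mip (L y) (z - (p n).1) + mip y ((p n).2 - w).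
  by rewrite !mipBr -(hp n).2; zabel.
apply: le_trans (rnormD _ _) _; rewrite mulrDl; apply: lerD.
  apply: le_trans (rnorm_mip _ _) _; apply: ler_wpM2l; rewrite ?rnorm_ge0 //.
  by apply: le_trans (hp n).1 (hN' _ (leq_maxr _ _)).
apply: le_trans (rnorm_mip _ _) _; apply: ler_wpM2l; rewrite ?rnorm_ge0 //.
by apply: hN; apply: leq_maxl.
Qed.

End AdjointExtension.

(** * Norms and strong limits in a von Neumann algebra *)

Section VonNeumann.
Variables (R : realType) (M : cstarAlgType R) (K : hilbertType R) (pi : M -> K -> K).
Hypothesis vn : is_von_neumann pi.
Let rep := vn_rep vn.

(* A faithful representation is isometric: the negative part of
   [C^2 - a^* a] annihilates [M]. *)
Lemma vn_isometric a C : 0 <= C -> (forall k, rnorm (pi a k) <= C * rnorm k) -> rnorm a <= C.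
Proof.
move=> C0 hC; have UC := unitz_cstar M.
pose x : unitz M := real_sc (@usc R M) (C ^+ 2) - uin (cmul (cstar a) a).
have sx : ust x = x by rewrite (stB UC) (st_rs UC) -uin_st cstarM cstarK.
have [p [r [n [[hp sr sn epa] [nxn srn nn rn0]]]]] := selfadjoint_abs UC sx.
set w := r * n in nxn srn nn.
have xpos k : 0 <= hip k (urep pi x k).
  rewrite (urepD rep) (urepN rep) (urep_sc rep) urep_in (repM rep) hipBr hipZr.
  rewrite -[cstar a]cstarK -(rep_adj rep) cstarK !hip_sqr -RCM subr_ge0 lecR -exprMn.
  by apply: lerXn2r; rewrite ?nnegrE ?mulr_ge0 ?rnorm_ge0.
have w0 k : urep pi w k = 0.
  apply: hip_eq0; apply/le_anti; rewrite hip_ge0 andbT.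
  rewrite (urep_adj rep) srn -(urepM rep) -oppr_ge0 -hipNr -(urepN rep) -nxn !(urepM rep).
  by rewrite -{1}sn -(urep_adj rep).
have wm m : w * uin m = 0.
  rewrite uin_act; have -> : uact w m = 0; last by [].
  apply: (vn_faithful vn); apply/funext => k.
  rewrite (rep0 rep) -(w0 (pi m k)) -(urep_in pi m) -(urepM rep) uin_act urep_in //.
have nm m : n * uin m = 0.
  apply: (nr_eq0 UC); apply/eqP; rewrite -sqrf_eq0; apply/eqP/le_anti; rewrite sqr_ge0 andbT.
  apply: le_trans (nr_cstar UC _) _; rewrite (stM UC) sn -mulrA (mulrA n n) nn mulrDl -mulrA wm mulr0 addr0 mulr0.
  by rewrite (nr0 UC).
(* Conjugating [p = x + n] by [a^*] removes [n] and leaves [b^2 <= C^2 b] for [b = a a^*], whence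
   [|a|^4 <= C^2 |a|^2]. *)
have := pos_conj UC (uin (cstar a)) hp; rewrite epa mulrDr mulrDl -(mulrA _ n) nm mulr0 addr0.
rewrite /x mulrBr mulrBl (rsC UC) -!uin_st -!(uinM) -mulrA -uinM cstarK => h.
have aa : rnorm (cmul (cmul a (cmul (cstar a) a)) (cstar a)) = rnorm a ^+ 4.
  have -> : cmul (cmul a (cmul (cstar a) a)) (cstar a) = cmul (cstar (cmul a (cstar a))) (cmul a (cstar a)).
    by rewrite cstarM cstarK !cmulA.
  rewrite rnorm_cstar_mul -{1}[a]cstarK rnorm_cstar_mul rnorm_cstar -exprM //.
have p1 : cstar_pos (@usc R M) (@ust R M) (@unr R M) (uin (cmul (cmul a (cmul (cstar a) a)) (cstar a))).
  have -> : cmul (cmul a (cmul (cstar a) a)) (cstar a) = cmul (cstar (cmul a (cstar a))) (cmul a (cstar a)).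
    by rewrite cstarM cstarK !cmulA.
  by rewrite uinM uin_st; apply: (pos_star_mul UC).
have := pos_mono_le UC p1 h; rewrite unr_in aa => h1.
have h2 : rnorm a ^+ 4 <= C ^+ 2 * rnorm a ^+ 2.
  apply: le_trans h1 _; apply: le_trans (nr_rsl UC _ (sqr_ge0 C)) _; rewrite unr_in -{1}[a]cstarK.
  by rewrite rnorm_cstar_mul rnorm_cstar.
have [->//|ne] := eqVneq (rnorm a) 0.
have a0 : 0 < rnorm a by rewrite lt_neqAle eq_sym ne rnorm_ge0.
apply: le_of_sqr => //; rewrite -(ler_pM2r (exprn_gt0 2 a0)) -exprD //.
Qed.

(** The pointwise limit commutes with the commutant, so it is [pi l] by the bicommutant property;
    the norm bound is brought back to [M] by [vn_isometric]. *)
Lemma vn_strong_limit (a : nat -> M) C : 0 <= C -> (forall n, rnorm (a n) <= C) ->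
  (forall k e, 0 < e -> exists N, forall m n, (N <= m)%N -> (N <= n)%N ->
     rnorm (pi (a m) k - pi (a n) k) <= e) ->
  exists l, rnorm l <= C /\ forall k, lim_to (fun n => pi (a n) k) (pi l k).
Proof.
move=> C0 aC hcau.
have [b hb] := choice (fun k => rnorm_complete (hcau k)).
have pib x k : rnorm (pi x k) <= rnorm x * rnorm k.
  apply: le_of_sqr; first by rewrite mulr_ge0 ?rnorm_ge0.
  have := rep_vector_bound rep (pi x k) k x.
  rewrite hip_sqr cabs_real ger0_norm ?sqr_ge0 // => h.
  have [e|ne] := eqVneq (rnorm (pi x k)) 0; first by rewrite e expr0n sqr_ge0.
  have p0 : 0 < rnorm (pi x k) by rewrite lt_neqAle eq_sym ne rnorm_ge0.
  move: h; rewrite expr2 -mulrA ler_pM2l // mulrC => h.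
  by rewrite !expr2; apply: ler_pM; rewrite ?rnorm_ge0.
have bC k : rnorm (b k) <= C * rnorm k.
  apply/ler_addgt0Pr => e e0; have [N hN] := hb k e e0.
  have := rnormB (pi (a N) k) (pi (a N) k - b k); rewrite (_ : _ - (_ - _) = b k); last by zabel.
  move=> h; apply: le_trans h _; apply: lerD; last exact: hN.
  by apply: le_trans (pib _ _) _; apply: ler_wpM2r; rewrite ?rnorm_ge0.
have blin : linear b.
  move=> c x y; apply/eqP; rewrite -subr_eq0; apply/eqP.
  apply: (@rnorm_small0 _ _ (cabs c + 2)) => e e0.
  have [N1 h1] := hb x e e0; have [N2 h2] := hb y e e0; have [N3 h3] := hb (c *: x + y) e e0.
  set n := maxn N1 (maxn N2 N3).
  have -> : b (c *: x + y) - (c *: b x + b y) =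
     c *: (pi (a n) x - b x) + (pi (a n) y - b y) - (pi (a n) (c *: x + y) - b (c *: x + y)).
    by rewrite (rep_lin rep) scalerBr; zabel.
  apply: le_trans (rnormB _ _) _.
  have q1 := h1 n (leq_maxl _ _); have q2 : rnorm (pi (a n) y - b y) <= e.
    by apply: h2; apply: leq_trans (leq_maxl _ _) (leq_maxr _ _).
  have q3 : rnorm (pi (a n) (c *: x + y) - b (c *: x + y)) <= e.
    by apply: h3; apply: leq_trans (leq_maxr _ _) (leq_maxr _ _).
  have q4 := rnormD (c *: (pi (a n) x - b x)) (pi (a n) y - b y); rewrite rnormZ in q4.
  have q5 := ler_wpM2l (cabs_ge0 c) q1; lra.
have bb : bounded_op b by apply/bounded_opP; split=> //; exists C.
have [|l hl] := vn_bicommutant vn bb.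
  move=> c bc hc; apply/funext => k /=; apply/eqP; rewrite -subr_eq0; apply/eqP.
  have [lc [d d0 hd]] := (bounded_opP c).1 bc.
  apply: (@rnorm_small0 _ _ (1 + d)) => e e0.
  have [N1 h1] := hb (c k) e e0; have [N2 h2] := hb k e e0; set n := maxn N1 N2.
  have q1 := h1 n (leq_maxl _ _); have q2 := h2 n (leq_maxr _ _).
  have e1 : pi (a n) (c k) = c (pi (a n) k) by have := congr1 (fun f => f k) (hc (a n)).
  have -> : b (c k) - c (b k) = c (pi (a n) k - b k) - (pi (a n) (c k) - b (c k)).
    by rewrite e1 (linear_funB lc); zabel.
  apply: le_trans (rnormB _ _) _; have := hd (pi (a n) k - b k); have := ler_wpM2l d0 q2; lra.
exists l; split; last by move=> k e e0; rewrite -hl; apply: hb.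
by apply: vn_isometric => // k; rewrite -hl.
Qed.

End VonNeumann.

(** * Subproduct systems and the Fock module *)

Section SubproductTheory.
Variables (R : realType) (M : cstarAlgType R) (s : setting M) (X : subproduct s).
Notation UC := (unitz_cstar M).
Notation upos := (cstar_pos (@usc R M) (@ust R M) (@unr R M)).

Lemma corr_module_ok (E : corrType M) : corr_ok s E -> module_ok s E.
Proof. by rewrite /corr_ok /module_ok; case: s => // K pi vn []. Qed.

Lemma mip_incl n (x y : X n) : mip (incl x) (incl y) = mip x y.
Proof. exact: isom_mip (incl_isom X n) x y. Qed.
Lemma incl_lact n a (x : X n) : incl (lact a x) = lact a (incl x).
Proof. exact: isom_lact (incl_isom X n) a x. Qed.
Lemma incl_ract n (x : X n) a : incl (ract x a) = ract (incl x) a.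
Proof. exact: isom_ract (incl_isom X n) x a. Qed.
Lemma incl_lin n : linear (@incl R M s X n). Proof. exact: isom_linear (incl_isom X n). Qed.

Lemma mip_tens n m (x x' : pw X n) (y y' : pw X m) :
  mip (tens x y) (tens x' y') = mip y (lact (mip x x') y').
Proof. exact: tensor_mip (tens_tensor X n m) x x' y y'. Qed.

Lemma rnorm_tens n m (x : pw X n) (y : pw X m) : rnorm (tens x y) <= rnorm x * rnorm y.
Proof.
apply: le_of_sqr; first by rewrite mulr_ge0 ?rnorm_ge0.
rewrite -rnorm_mip_sqr mip_tens; apply: le_trans (rnorm_mip _ _) _.
have := rnorm_lact (mip x x) y; rewrite rnorm_mip_sqr exprMn.
have := rnorm_ge0 y; nra.
Qed.

Lemma mip_sprod n m (x : X n) (y : X m) (w : X (n + m)%N) :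
  mip (incl w) (tens (incl x) (incl y)) = mip w (sprod x y).
Proof.
have [|z hz] := @sub_complemented _ _ _ X n m (tens (incl x) (incl y)).
  by apply: sub_mod_closure; apply: lspan_sub; exists x, y.
have := @xgetPex _ 0 [set x0 | forall y0 : X (n + m)%N, mip (incl y0) (tens (incl x) (incl y) - incl x0) = 0]
   (ex_intro _ z hz) w.
by move=> /=; rewrite mipBr => /eqP; rewrite subr_eq0 => /eqP ->; rewrite mip_incl.
Qed.

Lemma mip_sprodl n m (x : X n) (y : X m) (w : X (n + m)%N) :
  mip (tens (incl x) (incl y)) (incl w) = mip (sprod x y) w.
Proof. by rewrite mip_star mip_sprod -mip_star. Qed.

Lemma sprod_linr n m (x : X n) k (y y' : X m) :
  sprod x (k *: y + y') = k *: sprod x y + sprod x y'.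
Proof.
apply: mip_ext => w; rewrite mipDr mipZr -!mip_sprod incl_lin.
by rewrite (tensor_linearr (tens_tensor X n m)) mipDr mipZr.
Qed.
Lemma sprod_ract n m (x : X n) (y : X m) a : sprod x (ract y a) = ract (sprod x y) a.
Proof.
apply: mip_ext => w; rewrite mip_ract -!mip_sprod incl_ract.
by rewrite -(tensor_ract (tens_tensor X n m)) mip_ract.
Qed.

(** The projection does not increase inner squares, by Pythagoras, and
    [<x (x) y, x (x) y> = <y, <x, x> y>] is at most [|x|^2 <y, y>] because [|x|^2 - <x, x>] acts as
    a positive operator. *)
Lemma sprod_bound n m (x : X n) (y : X m) :
  upos (uin ((rnorm x ^+ 2)%:C *: mip y y - mip (sprod x y) (sprod x y))).
Proof.
set t := tens (incl x) (incl y); set p := sprod x y.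
have e1 : mip t t = mip p p + mip (t - incl p) (t - incl p).
  rewrite !(mipBl, mipBr) mip_incl mip_sprod mip_sprodl -/p; zabel.
have h : upos (real_sc (@usc R M) (rnorm x ^+ 2) - uin (mip x x)).
  apply: (pos_sub_nr UC); first by rewrite -uin_st -mip_star.
  by rewrite unr_in rnorm_mip_sqr.
have := posD UC (ulact_pos y h) (cpos_upos (mip_pos (t - incl p))).
rewrite -uinD; congr (upos (uin _)).
have -> : ulact (real_sc (@usc R M) (rnorm x ^+ 2) - uin (mip x x)) y = (rnorm x ^+ 2)%:C *: y - lact (mip x x) y.
  by rewrite /ulact /= subr0 sub0r -scaleN1r lactZl scaleN1r addrC.
have e2 : mip t t = mip y (lact (mip x x) y) by rewrite mip_tens mip_incl -incl_lact mip_incl.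
have -> : mip (t - incl p) (t - incl p) = mip t t - mip p p by rewrite e1; zabel.
by rewrite mipBr mipZr e2; zabel.
Qed.

(** On elementary tensors the adjoint of [y |-> x (x) y] is [u (x) v |-> <x, u> v];
    [adjoint_on_closure] carries it over to [X (n + m)], which lies in the closure of their span. *)
Lemma sprod_adjoint n m (x : X n) : exists B : X (n + m)%N -> X m,
  forall y z, mip (sprod x y) z = mip y (B z).
Proof.
suff h (z : X (n + m)%N) : exists w : X m, forall y, mip (sprod x y) z = mip y w.
  by have [B hB] := choice h; exists B => y z; apply: hB.
have [||||||w hw] := @adjoint_on_closure _ _ s (X m) (pw X (n + m)%N) (fun y => tens (incl x) (incl y)) (rnorm x)
   [set z | exists (y : X n) (y' : X m), z = tens (incl y) (incl y')] _ _ _ _ _ _ (incl z) (sub_tensor z).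
- by move=> k y y'; rewrite incl_lin (tensor_linearr (tens_tensor X n m)).
- by move=> y a; rewrite incl_ract (tensor_ract (tens_tensor X n m)).
- exact: rnorm_ge0.
- move=> y; apply: le_trans (rnorm_tens _ _) _.
  have e k (z0 : X k) : rnorm (incl z0) = rnorm z0.
    by apply/eqP; rewrite -(@eqrXn2 _ 2) ?rnorm_ge0 // -!rnorm_mip_sqr mip_incl.
  by rewrite !e.
- by apply/corr_module_ok/fiber_ok.
- move=> _ [u [v ->]]; exists (lact (mip x u) v) => y.
  by rewrite mip_tens mip_incl -incl_lact mip_incl.
by exists w => y; rewrite -mip_sprodl hw.
Qed.

(** [X (n + m + l)] is contained both in the tensor product of [X (n + m)] with [X l] and in that of
    [X n] with [X (m + l)]. So replacing an inner factor by its projection is not seen by the last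
    projection, and the claim reduces to associativity of [tens]. *)
Lemma sprodA n m l (x : X n) (y : X m) (z : X l) :
  sprod x (sprod y z) = ecast i (X i) (esym (addnA n m l)) (sprod (sprod x y) z).
Proof.
have orth_l (d : pw X (n + m)%N) (w : X (n + m + l)%N) : (forall u : X (n + m)%N, mip (incl u) d = 0) ->
    mip (tens d (incl z)) (incl w) = 0.
  move=> hd; apply: mod_closure_orth (sub_tensor w) _ => t.
  apply: (@lspan_min _ _ _ (fun t => mip (tens d (incl z)) t = 0)) => //.
  - by rewrite mip0r.
  - by move=> k a b ha hb; rewrite mipDr mipZr ha hb scaler0 addr0.
  - move=> _ [u [v ->]]; rewrite mip_tens mip_star [mip d _]mip_star hd cstar0 lact0l mip0l cstar0 //.
have orth_r (d : pw X (m + l)%N) (w : X (n + (m + l))%N) : (forall u : X (m + l)%N, mip (incl u) d = 0) ->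
    mip (tens (incl x) d) (incl w) = 0.
  move=> hd; apply: mod_closure_orth (sub_tensor w) _ => t.
  apply: (@lspan_min _ _ _ (fun t => mip (tens (incl x) d) t = 0)) => //.
  - by rewrite mip0r.
  - by move=> k a b ha hb; rewrite mipDr mipZr ha hb scaler0 addr0.
  - by move=> _ [u [v ->]]; rewrite mip_tens -incl_lact mip_star hd cstar0.
have lhs (w : X (n + (m + l))%N) : mip (sprod x (sprod y z)) w =
    mip (tens (incl x) (tens (incl y) (incl z))) (incl w).
  rewrite -mip_sprodl; apply/eqP; rewrite -subr_eq0 -mipBl.
  have -> : tens (incl x) (incl (sprod y z)) - tens (incl x) (tens (incl y) (incl z)) =
     tens (incl x) (incl (sprod y z) - tens (incl y) (incl z)).
    have := tensor_linearr (tens_tensor X n (m + l)) (-1) (incl x) (tens (incl y) (incl z)) (incl (sprod y z)).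
    by rewrite !scaleN1r ![- _ + _]addrC => <-.
  rewrite orth_r // => u; rewrite mipBr mip_sprod mip_incl subrr //.
have rhs (w : X (n + m + l)%N) : mip (sprod (sprod x y) z) w =
    mip (tens (tens (incl x) (incl y)) (incl z)) (incl w).
  rewrite -mip_sprodl; apply/eqP; rewrite -subr_eq0 -mipBl.
  have -> : tens (incl (sprod x y)) (incl z) - tens (tens (incl x) (incl y)) (incl z) =
     tens (incl (sprod x y) - tens (incl x) (incl y)) (incl z).
    have := tensor_linearl (tens_tensor X (n + m) l) (-1) (tens (incl x) (incl y)) (incl (sprod x y)) (incl z).
    by rewrite !scaleN1r ![- _ + _]addrC => <-.
  rewrite orth_l // => u; rewrite mipBr mip_sprod mip_incl subrr //.
have cast i j (e : i = j) (u : X i) (v : pw X i) :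
    (forall w, mip u w = mip v (incl w)) -> forall w, mip (ecast i (X i) e u) w = mip (ecast i (pw X i) e v) (incl w).
  by case: j / e.
apply: mip_extl => w; rewrite lhs tensA; symmetry; exact: cast.
Qed.

Lemma sprod_unit m (a : M) (y : X m) : sprod (unitX X a) y = lact a y.
Proof. by apply: mip_ext => w; rewrite -mip_sprod tens1x -incl_lact mip_incl. Qed.

End SubproductTheory.

(** * Components of the Fock module and truncated shifts *)

Section FockTheory.
Variables (R : realType) (M : cstarAlgType R) (s : setting M) (X : subproduct s) (F : fock X).
Notation UC := (unitz_cstar M).
Notation upos := (cstar_pos (@usc R M) (@ust R M) (@unr R M)).
Notation fin := (fock_in F).

Lemma fock_in_lin n : linear (@fock_in _ _ _ _ F n). Proof. exact: fock_linear. Qed.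

Lemma rnorm_fock_in n (x : X n) : rnorm (fin x) = rnorm x.
Proof. by apply/eqP; rewrite -(@eqrXn2 _ 2) ?rnorm_ge0 // -!rnorm_mip_sqr fock_isom. Qed.

Lemma fock_component n : exists c : F -> X n, forall x z, mip (fin x) z = mip x (c z).
Proof.
suff h (z : F) : exists w : X n, forall x, mip (fin x) z = mip x w.
  by have [c hc] := choice h; exists c => x z; apply: hc.
have zT : mod_closure s (lspan [set z | exists n (x : X n), z = fin x]) z by rewrite fock_total.
apply: (@adjoint_on_closure _ _ s (X n) F (@fock_in _ _ _ _ F n) 1 _ _ _ _ _ _ _ z zT).
- exact: fock_in_lin.
- by move=> x a; rewrite fock_ract.
- by [].
- by move=> x; rewrite rnorm_fock_in mul1r.
- by apply/corr_module_ok/fiber_ok.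
- move=> _ [m [x ->]]; have [e|ne] := eqVneq n m.
    by case: m / e x => x; exists x => y; rewrite fock_isom.
  by exists 0 => y; rewrite fock_orth // mip0r.
Qed.

Definition fcomp n : F -> X n := xget (fun=> 0) [set c | forall x z, mip (fin x) z = mip x (c z)].

Lemma mip_fcomp n (x : X n) z : mip (fin x) z = mip x (fcomp n z).
Proof. exact: (@xgetPex _ (fun=> 0) [set c : F -> X n | forall x z, mip (fin x) z = mip x (c z)] (fock_component n)). Qed.

Lemma mip_fcompl n (x : X n) z : mip z (fin x) = mip (fcomp n z) x.
Proof. by rewrite mip_star mip_fcomp -mip_star. Qed.

Lemma fock_ext (y z : F) : (forall n, fcomp n y = fcomp n z) -> y = z.
Proof.
move=> h; apply: (mod_closure_ext (fock_total F)) => x.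
apply: (@lspan_min _ _ _ (fun x => mip x y = mip x z)).
- by rewrite !mip0l.
- by move=> k a b ha hb; rewrite !mipDl !mipZl ha hb.
- by move=> _ [n [w ->]]; rewrite !mip_fcomp h.
Qed.

Lemma fcomp_lin n : linear (fcomp n).
Proof. by move=> k y z; apply: mip_ext => x; rewrite -mip_fcomp !mipDr !mipZr !mip_fcomp. Qed.

Lemma fcomp_ract n z a : fcomp n (ract z a) = ract (fcomp n z) a.
Proof. by apply: mip_ext => x; rewrite -mip_fcomp !mip_ract mip_fcomp. Qed.

Lemma fcomp_in n (x : X n) : fcomp n (fin x) = x.
Proof. by apply: mip_ext => y; rewrite -mip_fcomp fock_isom. Qed.

Lemma fcomp_in_neq n m (x : X n) : m != n -> fcomp m (fin x) = 0.
Proof. by move=> ne; apply: mip_ext => y; rewrite -mip_fcomp fock_orth // mip0r. Qed.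

Lemma mip_sum_fock_in (a b : nat) (f : forall m, X m) (k : nat) :
  mip (\sum_(a <= m < b) fin (f m)) (\sum_(a <= m < b) fin (f m)) = \sum_(a <= m < b) mip (f m) (f m).
Proof.
rewrite mip_suml; apply: eq_big_nat => m hm; rewrite mip_sumr.
rewrite (bigD1_seq m) ?mem_index_iota ?iota_uniq //= fock_isom big1 ?addr0 // => l ne.
by rewrite fock_orth // eq_sym.
Qed.

Lemma bessel a b (y : F) : upos (uin (mip y y - \sum_(a <= m < b) mip (fcomp m y) (fcomp m y))).
Proof.
set z := \sum_(a <= m < b) fin (fcomp m y).
have -> : mip y y - \sum_(a <= m < b) mip (fcomp m y) (fcomp m y) = mip (y - z) (y - z).
  have e1 : mip y z = \sum_(a <= m < b) mip (fcomp m y) (fcomp m y).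
    by rewrite mip_sumr; apply: eq_bigr => m _; rewrite mip_fcompl.
  have e2 : mip z y = \sum_(a <= m < b) mip (fcomp m y) (fcomp m y).
    by rewrite mip_suml; apply: eq_bigr => m _; rewrite mip_fcomp.
  by rewrite mipBl !mipBr e1 e2 /z mip_sum_fock_in //; zabel.
exact/cpos_upos/mip_pos.
Qed.

Section Shift.
Variables (n : nat) (x : X n).

Definition shift_part a b (y : F) : F := \sum_(a <= m < b) fin (sprod x (fcomp m y)).

Lemma shift_part_lin a b : linear (shift_part a b).
Proof.
move=> k y z; rewrite /shift_part scaler_sumr -big_split; apply: eq_bigr => m _.
by rewrite fcomp_lin sprod_linr fock_in_lin.
Qed.

Lemma shift_part_ract a b y c : shift_part a b (ract y c) = ract (shift_part a b y) c.
Proof.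
rewrite /shift_part (big_morph (fun z => ract z c) (fun u v => ractDl u v c) (ract0l _ c)).
by apply: eq_bigr => m _; rewrite fcomp_ract sprod_ract fock_ract.
Qed.

Lemma mip_shift_part a b (y : F) : mip (shift_part a b y) (shift_part a b y) =
  \sum_(a <= m < b) mip (sprod x (fcomp m y)) (sprod x (fcomp m y)).
Proof.
rewrite /shift_part mip_suml; apply: eq_big_nat => m hm; rewrite mip_sumr.
rewrite (bigD1_seq m) ?mem_index_iota ?iota_uniq //= fock_isom big1 ?addr0 // => l ne.
by rewrite fock_orth // eqn_add2l eq_sym.
Qed.

Lemma shift_part_bound a b (y : F) : upos (uin ((rnorm x ^+ 2)%:C *:
  (\sum_(a <= m < b) mip (fcomp m y) (fcomp m y)) - mip (shift_part a b y) (shift_part a b y))).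
Proof.
rewrite mip_shift_part scaler_sumr -sumrB (big_morph _ (@uinD R M) (erefl : uin 0 = 0)).
by apply: (pos_sum UC) => m _; apply: sprod_bound.
Qed.

Lemma rnorm_shift_part a b (y : F) : rnorm (shift_part a b y) <= rnorm x * rnorm y.
Proof.
apply: le_of_sqr; first by rewrite mulr_ge0 ?rnorm_ge0.
have x0 := sqr_ge0 (rnorm x).
have h1 := posZ UC x0 (bessel a b y).
have h2 := posD UC h1 (shift_part_bound a b y).
have := nr_pos_mono UC (cpos_upos (mip_pos (shift_part a b y))) h2.
have -> : uin (mip (shift_part a b y) (shift_part a b y)) + (real_sc (@usc R M) (rnorm x ^+ 2) *
   uin (mip y y - \sum_(a <= m < b) mip (fcomp m y) (fcomp m y)) +
   uin ((rnorm x ^+ 2)%:C *: (\sum_(a <= m < b) mip (fcomp m y) (fcomp m y)) - mip (shift_part a b y) (shift_part a b y))) =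
   uin ((rnorm x ^+ 2)%:C *: mip y y).
  rewrite -uinZ -!uinD scalerBr; congr uin; zabel.
by rewrite !unr_in rnormZ !rnorm_mip_sqr cabs_real ger0_norm // exprMn.
Qed.

Lemma shift_part_in a b m (y : X m) : (a <= m < b)%N -> shift_part a b (fin y) = fin (sprod x y).
Proof.
move=> hm; rewrite /shift_part (bigD1_seq m) ?mem_index_iota ?iota_uniq //= fcomp_in big1 ?addr0 // => l ne.
by rewrite fcomp_in_neq // (linear_fun0 (sprod_linr x)) (linear_fun0 (@fock_in_lin _)).
Qed.

Lemma shift_part_cat a b c y : (a <= b)%N -> (b <= c)%N ->
  shift_part a c y = shift_part a b y + shift_part b c y.
Proof. by move=> ab bc; rewrite /shift_part -big_cat_nat. Qed.

End Shift.
End FockTheory.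

Lemma pos_urep (R : realType) (A : cstarAlgType R) (H : hilbertType R) (sigma : A -> H -> H) (u : unitz A) k :
  is_rep sigma -> cstar_pos (@usc R A) (@ust R A) (@unr R A) u -> 0 <= hip k (urep sigma u k).
Proof.
move=> rep /(pos_sqrt (unitz_cstar A))[v [sv <- _]].
by rewrite (urepM rep) -{1}sv -(urep_adj rep) hip_ge0.
Qed.

(** The inequality [<y, x> <x, y> <= |x|^2 <y, y>] evaluated at the vector [k]. *)
Lemma rnorm_rep_mip (R : realType) (A : cstarAlgType R) (H : hilbertType R) (sigma : A -> H -> H)
  (F : hilbertModType A) (x y : F) k : is_rep sigma ->
  rnorm (sigma (mip x y) k) <= rnorm x * vknorm sigma k y.
Proof.
move=> rep; have UC := unitz_cstar A; have HF := hilbertmod_prehilbert F.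
have [x0|ne] := eqVneq (rnorm x) 0.
  by rewrite (rnorm_eq0 x0) mip0l (rep0 rep) !rnorm0 mul0r.
have xp : 0 < rnorm x ^+ 2 by rewrite exprn_gt0 // lt_neqAle eq_sym ne rnorm_ge0.
apply: le_of_sqr; first by rewrite mulr_ge0 ?rnorm_ge0 ?vknorm_ge0.
have := pos_urep k rep (ph_cauchy_schwarz_pos UC HF (x := x) y xp _).
rewrite /uip unr_in rnorm_mip_sqr lexx -uinM => /(_ isT).
rewrite (urepD rep) (urepN rep) (urepM rep) (urep_sc rep) !urep_in (repM rep) hipBr hipZr.
rewrite (mip_star y x) -(rep_adj rep) hip_sqr.
by rewrite -/(vbeta sigma k y y) -vknorm_sqr // -RCM subr_ge0 lecR exprMn.
Qed.

Lemma bounded_series_tail (R : realType) (q : nat -> R) C e : (forall n, 0 <= q n) ->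
  (forall n, \sum_(0 <= i < n) q i <= C) -> 0 < e ->
  exists N, forall a b, (N <= a)%N -> \sum_(a <= i < b) q i <= e.
Proof.
move=> q0 qC e0; pose S := [set x | exists n, x = \sum_(0 <= i < n) q i].
have hS : has_sup S.
  split; first by exists 0, 0%N; rewrite big_geq.
  by exists C => _ [n ->].
have [_ [N ->] hN] := sup_adherent e0 hS; exists N => a b Na.
have [ba|ab] := leqP b a; first by rewrite big_geq // ltW.
have hb : \sum_(0 <= i < b) q i <= sup S by apply: sup_upper_bound => //; exists b.
have e1 : \sum_(0 <= i < b) q i = \sum_(0 <= i < N) q i + \sum_(N <= i < a) q i + \sum_(a <= i < b) q i.
  by rewrite -!big_cat_nat //= ltnW.
have : 0 <= \sum_(N <= i < a) q i by apply: sumr_ge0.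
lra.
Qed.

Section Limits.
Variables (R : realType) (V W : normedModType R[i]).

Lemma lim_to_unique (u : nat -> V) l l' : lim_to u l -> lim_to u l' -> l = l'.
Proof.
move=> h h'; apply/eqP; rewrite -subr_eq0; apply/eqP; apply: (@rnorm_small0 _ _ 2) => e e0.
have [N hN] := h e e0; have [N' hN'] := h' e e0; set n := maxn N N'.
have := rnormB (u n - l') (u n - l); rewrite (_ : _ - _ - _ = l - l'); last by zabel.
have := hN n (leq_maxl _ _); have := hN' n (leq_maxr _ _); lra.
Qed.

Lemma lim_to_lin k (u v : nat -> V) l m : lim_to u l -> lim_to v m ->
  lim_to (fun n => k *: u n + v n) (k *: l + m).
Proof.
move=> hu hv e e0; have k1 : 0 < cabs k + 1 by rewrite ltr_wpDl ?cabs_ge0.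
have [N hN] := hu _ (divr_gt0 e0 k1); have [N' hN'] := hv _ (divr_gt0 e0 k1).
exists (maxn N N') => n; rewrite geq_max => /andP[/hN h /hN' h'].
have -> : k *: u n + v n - (k *: l + m) = k *: (u n - l) + (v n - m) by rewrite scalerBr; zabel.
apply: le_trans (rnormD _ _) _; rewrite rnormZ.
have h2 := ler_wpM2l (cabs_ge0 k) h.
have -> : e = cabs k * (e / (cabs k + 1)) + e / (cabs k + 1) by rewrite -{2}[e / _]mul1r -mulrDl mulrC divfK // gt_eqF.
exact: lerD.
Qed.

Lemma lim_to_map (L : V -> W) C (u : nat -> V) l : linear L -> 0 <= C ->
  (forall x, rnorm (L x) <= C * rnorm x) -> lim_to u l -> lim_to (fun n => L (u n)) (L l).
Proof.
move=> lL C0 hL hu e e0; have C1 : 0 < C + 1 by rewrite ltr_wpDl.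
have [N hN] := hu _ (divr_gt0 e0 C1); exists N => n /hN h.
rewrite -(linear_funB lL); apply: le_trans (hL _) _; apply: le_trans (ler_wpM2l C0 h) _.
by rewrite mulrCA ger_pMr // ler_pdivrMr // mul1r lerDl.
Qed.

Lemma lim_to_eventually (u : nat -> V) l N : (forall n, (N <= n)%N -> u n = l) -> lim_to u l.
Proof. by move=> h e e0; exists N => n /h ->; rewrite subrr rnorm0 ltW. Qed.
End Limits.

(** The case analysis on [s] is made for general [F] and [S], because the type of the Fock module
    itself depends on [s]. *)
Lemma setting_cases (R : realType) (M : cstarAlgType R) (s : setting M) (F : hilbertModType M) (S : set F) y (P : Prop) :
  mod_closure s S y -> module_ok s F -> (closure S y -> P) ->
  (forall (K : hilbertType R) (pi : M -> K -> K), is_von_neumann pi -> self_dual F -> P) -> P.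
Proof. by rewrite /mod_closure /module_ok; case: s => [|K pi vn] h ok h1 h2; [apply: h1|apply: h2 vn ok]. Qed.

(** * Existence of the shift operators *)

Section ShiftExistence.
Variables (R : realType) (M : cstarAlgType R) (s : setting M) (X : subproduct s) (F : fock X).
Notation UC := (unitz_cstar M).
Notation upos := (cstar_pos (@usc R M) (@ust R M) (@unr R M)).
Notation fin := (fock_in F).
Notation fspan := (lspan [set z | exists n (x : X n), z = fin x]).
Variables (n : nat) (x : X n).

Lemma sprod0r m : sprod x (0 : X m) = 0. Proof. exact: linear_fun0 (sprod_linr x). Qed.
Lemma fock_in0 m : fin (0 : X m) = 0. Proof. exact: linear_fun0 (fock_in_lin F (n := m)). Qed.
Lemma fcomp0 m : fcomp m (0 : F) = 0. Proof. exact: linear_fun0 (fcomp_lin m). Qed.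

Lemma rnorm_fcomp m (z : F) : rnorm (fcomp m z) <= rnorm z.
Proof.
have [->|ne] := eqVneq (rnorm (fcomp m z)) 0; first exact: rnorm_ge0.
have c0 : 0 < rnorm (fcomp m z) by rewrite lt_neqAle eq_sym ne rnorm_ge0.
rewrite -(ler_pM2l c0) -expr2 -rnorm_mip_sqr -mip_fcomp; apply: le_trans (rnorm_mip _ _) _.
by rewrite rnorm_fock_in.
Qed.

Lemma shift_part_vanish y : fspan y -> exists N, forall a b, (N <= a)%N -> shift_part x a b y = 0.
Proof.
apply: (@lspan_min _ _ _ (fun y => exists N, forall a b, (N <= a)%N -> shift_part x a b y = 0)).
- by exists 0%N => a b _; rewrite (linear_fun0 (shift_part_lin x a b)).
- move=> k u v [N1 h1] [N2 h2]; exists (maxn N1 N2) => a b; rewrite geq_max => /andP[n1 n2].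
  by rewrite shift_part_lin h1 // h2 // scaler0 addr0.
- move=> _ [m [u ->]]; exists m.+1 => a b ma; rewrite /shift_part big_nat_cond big1 // => l /andP[/andP[al _] _].
  rewrite fcomp_in_neq ?sprod0r ?fock_in0 //.
  by rewrite gtn_eqF // (leq_trans ma).
Qed.

Lemma fcomp_shift_part_tail m N b y : (m < N)%N -> fcomp m (shift_part (F := F) x N b y) = 0.
Proof.
move=> mN; rewrite /shift_part (linear_fun_sum (fcomp_lin m)) big_nat_cond big1 // => l /andP[/andP[al _] _].
by rewrite fcomp_in_neq // ltn_eqF // (leq_trans mN) // (leq_trans al) // leq_addl.
Qed.

Lemma fcomp_shift_part m N y : (m < N)%N -> fcomp m (shift_part (F := F) x 0 N y) = fcomp m (shift_part (F := F) x 0 m.+1 y).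
Proof.
by move=> mN; rewrite (shift_part_cat _ _ (leq0n m.+1) mN) (linear_funD (fcomp_lin m)) (fcomp_shift_part_tail _ _ (ltnSn m)) addr0.
Qed.

(** The graph of the shift, given by components so that no convergence is involved: the terms of
    index above [m] have degree above [m] and do not contribute to the component [m]. *)
Definition shifted (y z : F) := forall m, fcomp m z = fcomp m (shift_part (F := F) x 0 m.+1 y).

Lemma shifted_unique y z z' : shifted y z -> shifted y z' -> z = z'.
Proof. by move=> h h'; apply: fock_ext => m; rewrite h h'. Qed.

Lemma shifted_lin k y z y' z' : shifted y z -> shifted y' z' -> shifted (k *: y + y') (k *: z + z').
Proof. by move=> h h' m; rewrite shift_part_lin !fcomp_lin h h'. Qed.

Lemma shifted_ract y z a : shifted y z -> shifted (ract y a) (ract z a).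
Proof. by move=> h m; rewrite shift_part_ract !fcomp_ract h. Qed.

Lemma shifted_in m (y : X m) : shifted (fin y) (fin (sprod x y)).
Proof.
move=> l; have [lm|ml] := ltnP m l.+1; first by rewrite shift_part_in.
rewrite fcomp_in_neq; last by rewrite ltn_eqF // (leq_trans ml) // leq_addl.
rewrite /shift_part big_nat_cond big1 ?fcomp0 // => k /andP[/andP[_ kl] _].
rewrite fcomp_in_neq ?sprod0r ?fock_in0 //.
by rewrite ltn_eqF // (leq_trans kl).
Qed.

Lemma fcomp_shifted m y z : shifted y z -> fcomp (n + m) z = sprod x (fcomp m y).
Proof.
move=> ->; rewrite /shift_part (linear_fun_sum (fcomp_lin _)) (bigD1_seq m) ?mem_index_iota ?iota_uniq ?ltnS ?leq_addl //=.
rewrite fcomp_in big1 ?addr0 // => l ne.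
by rewrite fcomp_in_neq // eqn_add2l eq_sym.
Qed.

Lemma fcomp_shifted_lt l y z : shifted y z -> (l < n)%N -> fcomp l z = 0.
Proof.
move=> -> ln; rewrite /shift_part (linear_fun_sum (fcomp_lin _)) big1 // => m _.
by rewrite fcomp_in_neq // ltn_eqF // (leq_trans ln) // leq_addr.
Qed.

Lemma mip_shifted m y z (w : X (n + m)%N) B : shifted y z ->
  (forall u, mip (sprod x u) w = mip u B) -> mip z (fin w) = mip y (fin B).
Proof. by move=> h hB; rewrite !mip_fcompl (fcomp_shifted _ h) hB. Qed.

Lemma mip_shifted_lt l y z (w : X l) : shifted y z -> (l < n)%N -> mip z (fin w) = 0.
Proof. by move=> h ln; rewrite mip_fcompl (fcomp_shifted_lt h ln) mip0l. Qed.

(** The partial sums are uniformly bounded by [rnorm x] and stabilize on the algebraic sum, so they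
    converge in norm on its closure. *)
Lemma shifted_norm_limit y : closure fspan y -> exists2 z, shifted y z & rnorm z <= rnorm x * rnorm y.
Proof.
move=> hy; have [|z hz] := @rnorm_complete _ F (fun N => shift_part x 0 N y).
  move=> e e0; have x0 := rnorm_ge0 x.
  have x1 : 0 < rnorm x + 1 by rewrite ltr_wpDl.
  have [y' hy' yy'] := (closure_rnorm _ _).1 hy (e / (rnorm x + 1)) (divr_gt0 e0 x1).
  have [N hN] := shift_part_vanish hy'; exists N => a b Na Nb.
  wlog ab : a b Na Nb / (b <= a)%N.
    by move=> h; have [/h->//|/ltnW/h h'] := leqP b a; rewrite rnorm_distC h'.
  rewrite (shift_part_cat _ _ (leq0n b) ab) addrC addKr -[y](subrK y') (linear_funD (shift_part_lin x b a) (y - y') y').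
  rewrite (hN b a Nb) addr0; apply: le_trans (rnorm_shift_part _ _ _ _) _.
  apply: le_trans (ler_wpM2l x0 yy') _.
  by rewrite mulrCA ger_pMr // ler_pdivrMr // mul1r lerDl.
exists z.
  move=> m; apply/eqP; rewrite -subr_eq0; apply/eqP; apply: (@rnorm_small0 _ _ 1) => e e0; rewrite mul1r.
  have [N hN] := hz e e0; have := hN (maxn N m.+1) (leq_maxl _ _).
  rewrite -(fcomp_shift_part (N := maxn N m.+1)) ?leq_maxr // -(linear_funB (fcomp_lin m)) rnorm_distC.
  by apply: le_trans; apply: rnorm_fcomp.
apply/ler_addgt0Pr => e e0; have [N hN] := hz e e0.
have := rnormB (shift_part x 0 N y) (shift_part x 0 N y - z); rewrite (_ : _ - (_ - z) = z); last by zabel.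
move=> h; apply: le_trans h _; apply: lerD; last exact: hN.
exact: rnorm_shift_part.
Qed.

(** Here the partial sums [S_N y] need not converge in norm. For each [u] the elements [<u, S_N y>]
    converge strongly, with tails controlled by Bessel's inequality, to an element of [M] given by
    [vn_strong_limit]. Its star is a bounded module functional of [u], which self-duality represents
    by [z]. *)
Lemma shifted_weak_limit (K : hilbertType R) (pi : M -> K -> K) y : is_von_neumann pi -> self_dual F ->
  exists2 z, shifted y z & rnorm z <= rnorm x * rnorm y.
Proof.
move=> vn sd; have rep := vn_rep vn; have x0 := rnorm_ge0 x.
have tail k e : 0 < e -> exists N, forall a b, (N <= a)%N -> vknorm pi k (shift_part x a b y) <= e.
  move=> e0; pose q m := complex.Re (vbeta pi k (fcomp m y) (fcomp m y)).
  have qE m : (q m)%:C = vbeta pi k (fcomp m y) (fcomp m y) by rewrite /q -cabs_ge0_Re // (vbeta_pos rep).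
  have q0 m : 0 <= q m by apply: Re_ge0; apply: (vbeta_pos rep).
  have qS a b : (\sum_(a <= i < b) q i)%:C = hip k (pi (\sum_(a <= m < b) mip (fcomp m y) (fcomp m y)) k).
    by rewrite (rep_sum rep) hip_sumr rmorph_sum; apply: eq_bigr => i _; apply: qE.
  have qC N : \sum_(0 <= i < N) q i <= vknorm pi k y ^+ 2.
    rewrite -lecR qS (vknorm_sqr rep) -subr_ge0 /vbeta -hipBr.
    have := pos_urep k rep (bessel 0 N y); rewrite urep_in (repD rep) -scaleN1r (repZ rep) scaleN1r.
    by [].
  have x1 : 0 < rnorm x + 1 by rewrite ltr_wpDl.
  have [N hN] := bounded_series_tail q0 qC (exprn_gt0 2 (divr_gt0 e0 x1)).
  exists N => a b Na; apply: le_of_sqr; first exact: ltW.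
  have := pos_urep k rep (shift_part_bound x a b y); rewrite urep_in (repD rep) -scaleN1r !(repZ rep) scaleN1r hipBr hipZr.
  rewrite -qS -/(vbeta pi k _ _) -(vknorm_sqr rep) -RCM subr_ge0 lecR => h; apply: le_trans h _.
  apply: le_trans (ler_wpM2l (sqr_ge0 _) (hN a b Na)) _.
  rewrite expr_div_n mulrCA ger_pMr ?exprn_gt0 // ler_pdivrMr ?exprn_gt0 // mul1r.
  by apply: lerXn2r; rewrite ?nnegrE ?lerDl // addr_ge0.
have ex u : exists l, rnorm l <= rnorm x * rnorm y * rnorm u /\
    forall k, lim_to (fun N => pi (mip u (shift_part x 0 N y)) k) (pi l k).
  apply: (vn_strong_limit vn); first by rewrite !mulr_ge0 ?rnorm_ge0.
    move=> N; apply: le_trans (rnorm_mip _ _) _; rewrite mulrC; apply: ler_wpM2r; rewrite ?rnorm_ge0 //.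
    exact: rnorm_shift_part.
  move=> k e e0; have u1 : 0 < rnorm u + 1 by rewrite ltr_wpDl ?rnorm_ge0.
  have [N hN] := tail k _ (divr_gt0 e0 u1); exists N => a b Na Nb.
  wlog ab : a b Na Nb / (b <= a)%N.
    by move=> h; have [/h->//|/ltnW/h h'] := leqP b a; rewrite rnorm_distC h'.
  rewrite (shift_part_cat _ _ (leq0n b) ab) mipDr (repD rep) addrC addKr.
  apply: le_trans (rnorm_rep_mip _ _ _ rep) _; apply: le_trans (ler_wpM2l (rnorm_ge0 _) (hN b a Nb)) _.
  by rewrite mulrCA ger_pMr // ler_pdivrMr // mul1r lerDl.
have [tau htau] := choice ex.
have uniq u l : (forall k, lim_to (fun N => pi (mip u (shift_part x 0 N y)) k) (pi l k)) -> tau u = l.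
  move=> h; apply: (vn_faithful vn); apply/funext => k.
  by apply: lim_to_unique (h k); case: (htau u).
have [|||z hz] := sd (fun u => cstar (tau u)).
- move=> c u v; have -> : tau (c *: u + v) = c^cj *: tau u + tau v; last by rewrite cstarD cstarZ; congr (_ *: _ + _); exact: conjcK.
  apply: uniq => k; rewrite (repD rep) (repZ rep).
  have := lim_to_lin c^cj ((htau u).2 k) ((htau v).2 k).
  by congr lim_to; apply/funext => N; rewrite mipDl mipZl (repD rep) (repZ rep).
- move=> u a; have -> : tau (ract u a) = cmul (cstar a) (tau u); last by rewrite cstarM cstarK.
  apply: uniq => k; rewrite (repM rep).
  have [la [C C0 bC]] := (bounded_opP _).1 (rep_bounded rep (cstar a)).
  have := lim_to_map la C0 bC ((htau u).2 k).
  by congr lim_to; apply/funext => N; rewrite mip_ractl (repM rep).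
- exists (rnorm x * rnorm y)%:C => u; rewrite !rnormE -RCM lecR rnorm_cstar.
  by case: (htau u).
have tauE u : mip u z = tau u by rewrite mip_star -hz cstarK.
exists z.
  move=> m; apply: mip_ext => v; rewrite -!mip_fcomp tauE; apply: uniq => k.
  apply: (lim_to_eventually (N := m.+1)) => N mN.
  by rewrite !mip_fcomp fcomp_shift_part.
have [->|ne] := eqVneq (rnorm z) 0; first by rewrite mulr_ge0 ?rnorm_ge0.
have c0 : 0 < rnorm z by rewrite lt_neqAle eq_sym ne rnorm_ge0.
by rewrite -(ler_pM2r c0) -expr2 -rnorm_mip_sqr tauE; case: (htau z).
Qed.

Lemma shifted_exists y : exists2 z, shifted y z & rnorm z <= rnorm x * rnorm y.
Proof.
have yT : mod_closure s fspan y by rewrite fock_total.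
apply: (setting_cases yT (fock_ok F)) => [|K pi vn sd]; first exact: shifted_norm_limit.
exact: shifted_weak_limit vn sd.
Qed.

(** The adjoint is found degree by degree and then extended to the closure: it vanishes below degree
    [n] and is the adjoint of [sprod x] on [X (n + k)]. *)
Lemma shift_exists : exists A : F -> F, [/\ linear A, forall y, rnorm (A y) <= rnorm x * rnorm y,
  adjointable (@mip R M F) A & forall y, shifted y (A y)].
Proof.
have [A hA] := choice (fun y => let: ex_intro2 z h1 h2 := shifted_exists y in
  ex_intro (fun z => shifted y z /\ rnorm z <= rnorm x * rnorm y) z (conj h1 h2)).
have Al : linear A by move=> k y z; apply: (@shifted_unique (k *: y + z)); [case: (hA (k *: y + z))|apply: shifted_lin; [case: (hA y)|case: (hA z)]].
have Ar y a : A (ract y a) = ract (A y) a.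
  by apply: (@shifted_unique (ract y a)); [case: (hA (ract y a))|apply: shifted_ract; case: (hA y)].
exists A; split=> // [y||y]; try by case: (hA y).
suff h (z : F) : exists w : F, forall y, mip (A y) z = mip y w.
  by have [B hB] := choice h; exists B => y z; apply: hB.
have zT : mod_closure s fspan z by rewrite fock_total.
apply: (@adjoint_on_closure _ _ s F F A (rnorm x) _ Al Ar (rnorm_ge0 x) _ (fock_ok F) _ z zT).
  by move=> y; case: (hA y).
move=> _ [l [w ->]]; have [ln|nl] := ltnP l n.
  by exists 0 => y; rewrite (mip_shifted_lt _ (hA y).1) // mip0r.
have [k el] : exists k, l = (n + k)%N by exists (l - n)%N; rewrite subnKC.
subst l; have [B hB] := sprod_adjoint k x.
by exists (fin (B w)) => y; apply: mip_shifted (hA y).1 _ => u; apply: hB.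
Qed.

End ShiftExistence.

(** * Shift operators and the operator system *)

Section Operators.
Variables (R : realType) (V : normedModType R[i]).
Implicit Types (a b : V -> V) (S : set (V -> V)).

Lemma opclosureP S a : opclosure S a <->
  forall e : R, 0 < e -> exists2 b, S b & forall x, rnorm (a x - b x) <= e * rnorm x.
Proof.
split=> h e e0.
  have [|b Sb hb] := h e%:C; first by rewrite ltcR.
  by exists b => // x; have := hb x; rewrite !rnormE -RCM lecR.
have ee : e = (complex.Re e)%:C by rewrite RRe_real // gtr0_real.
have [|b Sb hb] := h (complex.Re e); first by rewrite -ltcR -ee.
by exists b => // x; rewrite ee !rnormE -RCM lecR; apply: hb.
Qed.

Lemma sub_opclosure S : S `<=` opclosure S.
Proof. by move=> a Sa; apply/opclosureP => e e0; exists a => // x; rewrite subrr rnorm0 mulr_ge0 ?rnorm_ge0 ?ltW. Qed.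

Lemma opclosure_mono S S' : S `<=` S' -> opclosure S `<=` opclosure S'.
Proof. by move=> SS' a ha e e0; have [b /SS' Sb hb] := ha e e0; exists b. Qed.

Lemma opclosure_idem S : opclosure (opclosure S) `<=` opclosure S.
Proof.
move=> a /opclosureP ha; apply/opclosureP => e e0; have e2 : 0 < e / 2 by rewrite divr_gt0.
have [b /opclosureP hb ab] := ha _ e2; have [c Sc bc] := hb _ e2.
exists c => // x; have -> : a x - c x = (a x - b x) + (b x - c x) by zabel.
apply: le_trans (rnormD _ _) _; have := ab x; have := bc x; have := rnorm_ge0 x; nra.
Qed.

Lemma opclosure_lin S : (forall k a b, S a -> S b -> S (k *: a + b)) ->
  forall k a b, opclosure S a -> opclosure S b -> opclosure S (k *: a + b).
Proof.
move=> lS k a b /opclosureP ha /opclosureP hb; apply/opclosureP => e e0.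
have k1 : 0 < cabs k + 1 by rewrite ltr_wpDl ?cabs_ge0.
have e1 := divr_gt0 e0 k1.
have [a' Sa ha'] := ha _ e1; have [b' Sb hb'] := hb _ e1; exists (k *: a' + b'); first exact: lS.
move=> x; have -> : (k *: a + b) x - (k *: a' + b') x = k *: (a x - a' x) + (b x - b' x).
  by rewrite !fctE scalerBr; zabel.
apply: le_trans (rnormD _ _) _; rewrite rnormZ.
have h2 := ler_wpM2l (cabs_ge0 k) (ha' x).
have -> : e * rnorm x = cabs k * (e / (cabs k + 1) * rnorm x) + e / (cabs k + 1) * rnorm x.
  by rewrite -[X in _ + X]mul1r -mulrDl mulrA [_ * (e / _)]mulrC divfK // gt_eqF.
exact: lerD (hb' x).
Qed.

Lemma opclosure_lspan_min S S' : S `<=` opclosure (lspan S') -> opclosure (lspan S) `<=` opclosure (lspan S').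
Proof.
move=> h a ha; apply: opclosure_idem; apply: opclosure_mono ha.
apply: lspan_min => //; first exact/sub_opclosure/lspan0.
by apply: opclosure_lin => k b c; apply: lspan_lin.
Qed.

Lemma lspan_bounded S a : (forall b, S b -> exists2 c, 0 <= c & forall x, rnorm (b x) <= c * rnorm x) ->
  lspan S a -> exists2 c, 0 <= c & forall x, rnorm (a x) <= c * rnorm x.
Proof.
move=> hS; move: a; apply: lspan_min => //.
  by exists 0 => // x; rewrite rnorm0 mul0r.
move=> k b b' [c c0 hc] [c' c'0 hc']; exists (cabs k * c + c'); first by rewrite addr_ge0 // mulr_ge0 ?cabs_ge0.
move=> x; rewrite fctE; apply: le_trans (rnormD _ _) _; rewrite rnormZ mulrDl -mulrA lerD //.
by apply: ler_wpM2l; rewrite ?cabs_ge0.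
Qed.

Lemma opclosure_bounded S a : (forall b, S b -> exists2 c, 0 <= c & forall x, rnorm (b x) <= c * rnorm x) ->
  opclosure S a -> exists2 c, 0 <= c & forall x, rnorm (a x) <= c * rnorm x.
Proof.
move=> hS /opclosureP ha; have [b /hS [c c0 hc] ab] := ha 1 ltr01.
exists (c + 1); first by rewrite addr_ge0.
move=> x; have -> : a x = b x + (a x - b x) by zabel.
by apply: le_trans (rnormD _ _) _; rewrite mulrDl lerD.
Qed.
End Operators.

Section Adjointables.
Variables (R : realType) (A : cstarAlgType R) (F : hilbertModType A).
Notation adjbl := (adjointable (@mip R A F)).
Notation madj := (adj (@mip R A F)).
Implicit Types (a b : F -> F).

Lemma adjointable_lin a : adjbl a -> linear a.
Proof. by move=> [b hb] k x y; apply: mip_extl => z; rewrite hb mipDl mipZl -!hb -mipZl -mipDl. Qed.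

Lemma adjointable_ract a x c : adjbl a -> a (ract x c) = ract (a x) c.
Proof. by move=> [b hb]; apply: mip_extl => z; rewrite hb !mip_ractl hb. Qed.

Lemma mip_adj a x y : adjbl a -> mip (a x) y = mip x (madj a y).
Proof. by move=> h; apply: (xgetPex (fun=> 0) h). Qed.

Lemma mip_adjr a x y : adjbl a -> mip x (a y) = mip (madj a x) y.
Proof. by move=> h; rewrite mip_star mip_adj // -mip_star. Qed.

Lemma madj_unique a b : is_adjoint (@mip R A F) a b -> madj a = b.
Proof.
by move=> h; apply/funext => y; apply: mip_ext => x; rewrite -mip_adj; [apply: h|exists b].
Qed.

Lemma madj_is_adjoint a : adjbl a -> is_adjoint (@mip R A F) (madj a) a.
Proof. by move=> h x y; rewrite mip_adjr. Qed.
Lemma adjointable_adj a : adjbl a -> adjbl (madj a).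
Proof. by move=> h; exists a; apply: madj_is_adjoint. Qed.
Lemma is_adjoint_comp a b : adjbl a -> adjbl b -> is_adjoint (@mip R A F) (a \o b) (madj b \o madj a).
Proof. by move=> ha hb x y /=; rewrite !mip_adj. Qed.
Lemma adjointable_comp a b : adjbl a -> adjbl b -> adjbl (a \o b).
Proof. by move=> ha hb; exists (madj b \o madj a); apply: is_adjoint_comp. Qed.
Lemma is_adjoint_lin k a b : adjbl a -> adjbl b ->
  is_adjoint (@mip R A F) (k *: a + b) (k^cj *: madj a + madj b).
Proof. by move=> ha hb x y; rewrite !fctE mipDl mipZl mipDr mipZr !mip_adj. Qed.
Lemma adjointable_comb k a b : adjbl a -> adjbl b -> adjbl (k *: a + b).
Proof. by move=> ha hb; exists (k^cj *: madj a + madj b); apply: is_adjoint_lin. Qed.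
Lemma madj_comb k a b : adjbl a -> adjbl b -> madj (k *: a + b) = k^cj *: madj a + madj b.
Proof. by move=> ha hb; apply/madj_unique/is_adjoint_lin. Qed.
Lemma adjointable_id : adjbl idfun. Proof. by exists idfun. Qed.
Lemma madj_id : madj idfun = idfun. Proof. exact: madj_unique. Qed.
Lemma is_adjoint_0 : is_adjoint (@mip R A F) 0 0.
Proof. by move=> x y; rewrite mip0l mip0r. Qed.
Lemma adjointable_0 : adjbl 0. Proof. by exists 0; apply: is_adjoint_0. Qed.

Lemma madj_bound a c : adjbl a -> 0 <= c -> (forall x, rnorm (a x) <= c * rnorm x) ->
  forall x, rnorm (madj a x) <= c * rnorm x.
Proof.
move=> ha c0 hc x; have [->|ne] := eqVneq (rnorm (madj a x)) 0; first by rewrite mulr_ge0 ?rnorm_ge0.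
have p0 : 0 < rnorm (madj a x) by rewrite lt_neqAle eq_sym ne rnorm_ge0.
rewrite -(ler_pM2l p0) -expr2 -rnorm_mip_sqr -mip_adj //; apply: le_trans (rnorm_mip _ _) _.
rewrite [leRHS]mulrCA mulrA; apply: ler_wpM2r; rewrite ?rnorm_ge0 //; exact: hc.
Qed.

(** The adjoints of the approximating operators are Cauchy at every vector, because taking adjoints
    preserves operator bounds. *)
Lemma adjointable_closed a : opclosure adjbl a -> adjbl a.
Proof.
move=> /opclosureP ha.
have exf (n : nat) : exists b, adjbl b /\ forall x, rnorm (a x - b x) <= n.+1%:R^-1 * rnorm x.
  by have [|b h1 h2] := ha (n.+1%:R^-1); rewrite ?invr_gt0 ?ltr0Sn //; exists b.
have [f hf] := choice exf.
suff h y : exists w, forall x, mip (a x) y = mip x w.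
  by have [b hb] := choice h; exists b => x y; apply: hb.
have y0 := rnorm_ge0 y.
have diff m n x : rnorm (f m x - f n x) <= (m.+1%:R^-1 + n.+1%:R^-1) * rnorm x.
  have -> : f m x - f n x = (a x - f n x) - (a x - f m x) by zabel.
  by apply: le_trans (rnormB _ _) _; rewrite mulrDl addrC lerD //; apply: (hf _).2.
have [|w hw] := @rnorm_complete _ F (fun n => madj (f n) y).
  move=> e e0; have [N hN] := archi_inv (2 * rnorm y) e0; exists N => m n Nm Nn.
  have e1 : madj (f m) y - madj (f n) y = madj (-1 *: f n + f m) y.
    by rewrite (madj_comb _ (hf n).1 (hf m).1) conjcN conjc1 !fctE scaleN1r addrC.
  have pm : 0 <= m.+1%:R^-1 :> R by rewrite invr_ge0 ler0n.
  have pn : 0 <= n.+1%:R^-1 :> R by rewrite invr_ge0 ler0n.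
  have h0 : 0 <= m.+1%:R^-1 + n.+1%:R^-1 :> R by apply: addr_ge0.
  rewrite e1; apply: le_trans (madj_bound (adjointable_comb _ (hf n).1 (hf m).1) h0 _ y) _.
    by move=> x; rewrite !fctE scaleN1r addrC; apply: diff.
  have := hN m Nm; have := hN n Nn; move: pm pn; set p : R := m.+1%:R^-1; set q : R := n.+1%:R^-1; nra.
exists w => x; apply/eqP; rewrite -subr_eq0; apply/eqP; apply: (@rnorm_small0 _ _ (1 + rnorm x)) => e e0.
have [N hN] := hw e e0; have [N' hN'] := archi_inv (rnorm x * rnorm y) e0; set n := maxn N N'.
have h1 := hN n (leq_maxl _ _); have h2 := hN' n (leq_maxr _ _).
have -> : mip (a x) y - mip x w = mip (a x - f n x) y + mip x (madj (f n) y - w).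
  by rewrite mipBl mipBr (mip_adj _ _ (hf n).1); zabel.
apply: le_trans (rnormD _ _) _; rewrite mulrDl mul1r; apply: lerD.
  apply: le_trans (rnorm_mip _ _) _; apply: le_trans h2.
  rewrite [leRHS]mulrC mulrA; apply: ler_wpM2r => //; exact: (hf n).2.
apply: le_trans (rnorm_mip _ _) _; apply: ler_wpM2l; rewrite ?rnorm_ge0 //.
Qed.

End Adjointables.

(** * Generators of the tensor algebra and of the operator system *)

Section ShiftOperators.
Variables (R : realType) (M : cstarAlgType R) (s : setting M) (X : subproduct s) (F : fock X).
Notation fin := (fock_in F).
Notation adjbl := (adjointable (@mip R M F)).
Notation madj := (adj (@mip R M F)).
Notation TA := (@tensor_algebra R M s X F).
Notation OS := (@operator_system R M s X F).
Notation Sh := (@Defs.shift R M s X F _).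
Notation shifts := [set a | exists n (x : X n), a = Sh x].

(** Passing to the adjoints reduces the claim to the inner products [<x, a^* z>] with [x] in a total
    set, and these decide equality in both settings. *)
Lemma adjointable_fock_ext a b : adjbl a -> adjbl b ->
  (forall n (x : X n), a (fin x) = b (fin x)) -> a = b.
Proof.
move=> ha hb h; apply/funext => y; apply: mip_extl => z; rewrite !mip_adj //.
congr mip; apply: (mod_closure_ext (fock_total F)) => x.
apply: (@lspan_min _ _ _ (fun x => mip x (madj a z) = mip x (madj b z))).
- by rewrite !mip0l.
- by move=> k u v hu hv; rewrite !mipDl !mipZl hu hv.
- by move=> _ [n [w ->]]; rewrite -!mip_adj // h.
Qed.

Section OneShift.
Variables (n : nat) (x : X n).

Lemma shift_specs : [/\ linear (Sh x), forall y, rnorm (Sh x y) <= rnorm x * rnorm y,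
  adjbl (Sh x) & forall y, shifted x y (Sh x y)].
Proof.
have [A [lA bA aA sA]] := shift_exists F x.
suff -> : Sh x = A by [].
have Ain m (y : X m) : A (fin y) = fin (sprod x y).
  exact: shifted_unique (sA (fin y)) (shifted_in F x y).
have h := @xgetPex _ (fun=> 0) [set a | adjbl a /\ forall m (y : X m), a (fin y) = fin (sprod x y)]
  (ex_intro _ A (conj aA Ain)).
case: h => h1 h2; apply: adjointable_fock_ext => // m y; rewrite Ain; exact: h2.
Qed.

Lemma rnorm_shift y : rnorm (Sh x y) <= rnorm x * rnorm y. Proof. by case: shift_specs. Qed.
Lemma shift_adjointable : adjbl (Sh x). Proof. by case: shift_specs. Qed.
Lemma shift_shifted y : shifted x y (Sh x y). Proof. by case: shift_specs. Qed.
Lemma shift_in m (y : X m) : Sh x (fin y) = fin (sprod x y).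
Proof. exact: shifted_unique (shift_shifted (fin y)) (shifted_in F x y). Qed.

(** Since the adjoints, too, map homogeneous vectors to homogeneous ones, they act on formal sums
    with homogeneous terms. *)
Lemma shift_adj_in m (w : X m) : exists l (v : X l), madj (Sh x) (fin w) = fin v.
Proof.
have [mn|nm] := ltnP m n.
  exists m, 0; rewrite fock_in0; apply: mip_ext => y.
  by rewrite -(mip_adj _ _ shift_adjointable) (mip_shifted_lt _ (shift_shifted y) mn) mip0r.
have [k el] : exists k, m = (n + k)%N by exists (m - n)%N; rewrite subnKC.
subst m; have [B hB] := sprod_adjoint k x; exists k, (B w); apply: mip_ext => y.
by rewrite -(mip_adj _ _ shift_adjointable); apply: mip_shifted (shift_shifted y) _ => u; apply: hB.
Qed.

End OneShift.

Lemma shift_comp n m (x : X n) (y : X m) : Sh x \o Sh y = Sh (sprod x y).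
Proof.
apply: adjointable_fock_ext => [||l z]; try exact: shift_adjointable.
  by apply: adjointable_comp; apply: shift_adjointable.
rewrite /= !shift_in sprodA; case: _ / (esym (addnA n m l)) => //.
Qed.

Lemma shift_unit (a : M) m (y : X m) : Sh (unitX X a) (fin y) = fin (lact a y).
Proof. by rewrite shift_in sprod_unit. Qed.

(* [None] is the identity operator. *)
Definition gen := option {n & X n}.
Definition genop (g : gen) : F -> F := if g is Some p then Sh (projT2 p) else idfun.

Lemma genop_adjointable g : adjbl (genop g).
Proof. by case: g => [[n x]|]; [apply: shift_adjointable|apply: adjointable_id]. Qed.

Lemma genop_bounded g : exists2 c, 0 <= c & forall y, rnorm (genop g y) <= c * rnorm y.
Proof.
case: g => [[n x]|]; first by exists (rnorm x); [apply: rnorm_ge0|apply: rnorm_shift].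
by exists 1 => // y; rewrite mul1r.
Qed.

Lemma lspan_adjointable S : S `<=` adjbl -> lspan S `<=` adjbl.
Proof.
move=> h; apply: lspan_min => //; first exact: adjointable_0.
by move=> k a b; apply: adjointable_comb.
Qed.

Lemma lspan_comp (S : set (F -> F)) : S `<=` adjbl -> (forall a b, S a -> S b -> S (a \o b)) ->
  forall a b, lspan S a -> lspan S b -> lspan S (a \o b).
Proof.
move=> hS hc a b ha hb; move: a ha; apply: lspan_min; first exact: lspan0.
  by move=> k a a' h h'; apply: (lspan_lin k h h').
move=> a Sa; move: b hb; apply: lspan_min.
- suff -> : a \o (0 : F -> F) = (0 : F -> F) by apply: lspan0.
  by apply/funext => y /=; rewrite (linear_fun0 (adjointable_lin (hS _ Sa))).
- move=> k b b' h h'; suff -> : a \o (k *: b + b') = k *: (a \o b) + (a \o b') by apply: lspan_lin.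
  by apply/funext => y /=; rewrite !fctE (adjointable_lin (hS _ Sa)).
- by move=> b Sb; apply/lspan_sub/hc.
Qed.

Definition opbounded (a : F -> F) := exists2 c, 0 <= c & forall x, rnorm (a x) <= c * rnorm x.

Lemma opclosure_comp (S S' S'' : set (F -> F)) : S `<=` adjbl -> S `<=` opbounded -> S' `<=` opbounded ->
  (forall a b, S a -> S' b -> S'' (a \o b)) ->
  forall a b, opclosure S a -> opclosure S' b -> opclosure S'' (a \o b).
Proof.
move=> aS bS bS' hc a b Sa Sb; have [d d0 hd] := opclosure_bounded bS' Sb.
move: Sa Sb => /opclosureP ha /opclosureP hb; apply/opclosureP => e e0.
have e2 : 0 < e / 2 by rewrite divr_gt0.
have small (c t : R) : 0 <= c -> 0 < t -> c * (t / (c + 1)) <= t.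
  by move=> c0 t0; rewrite mulrCA ger_pMr // ler_pdivrMr ?mul1r ?lerDl // ltr_wpDl.
have pos1 c : 0 <= c -> 0 < e / 2 / (c + 1) by move=> c0; rewrite divr_gt0 // ltr_wpDl.
have [a' Sa' aa'] := ha _ (pos1 _ d0).
have la := adjointable_lin (aS _ Sa'); have [c c0 hc'] := bS _ Sa'.
have [b' Sb' bb'] := hb _ (pos1 _ c0).
exists (a' \o b'); first exact: hc.
move=> x /=; have -> : a (b x) - a' (b' x) = (a (b x) - a' (b x)) + a' (b x - b' x).
  by rewrite (linear_funB la); zabel.
have x0 := rnorm_ge0 x.
apply: le_trans (rnormD _ _) _; have -> : e * rnorm x = e / 2 * rnorm x + e / 2 * rnorm x by field.
apply: lerD.
  apply: le_trans (aa' _) _; apply: le_trans (ler_wpM2l (ltW (pos1 _ d0)) (hd x)) _.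
  by rewrite mulrA; apply: ler_wpM2r => //; rewrite mulrC; apply: small.
apply: le_trans (hc' _) _; apply: le_trans (ler_wpM2l c0 (bb' x)) _.
by rewrite mulrA; apply: ler_wpM2r => //; apply: small.
Qed.

Lemma shift_opbounded n (x : X n) : opbounded (Sh x).
Proof. by exists (rnorm x); [apply: rnorm_ge0|apply: rnorm_shift]. Qed.

Lemma lspan_opbounded S : S `<=` opbounded -> lspan S `<=` opbounded.
Proof. by move=> h a; apply: lspan_bounded. Qed.

Lemma madj_opbounded a : adjbl a -> opbounded a -> opbounded (madj a).
Proof. by move=> ha [c c0 hc]; exists c => //; apply: madj_bound. Qed.

Lemma shifts_adjointable : shifts `<=` adjbl.
Proof. by move=> _ [n [x ->]]; apply: shift_adjointable. Qed.
Lemma shifts_opbounded : shifts `<=` opbounded.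
Proof. by move=> _ [n [x ->]]; apply: shift_opbounded. Qed.

(** The norm closure of the span of the shifts is itself a closed algebra, since a product of two
    shifts is a shift. *)
Lemma tensor_algebra_sub : TA `<=` opclosure (lspan shifts).
Proof.
apply: smallest_sub; last by move=> a sa; apply/sub_opclosure/lspan_sub.
split.
- move=> a /(opclosure_mono (lspan_adjointable shifts_adjointable)); exact: adjointable_closed.
- exact/sub_opclosure/lspan0.
- by move=> k a b; apply: opclosure_lin => c u v; apply: lspan_lin.
- apply: opclosure_comp; rewrite ?(lspan_adjointable shifts_adjointable) //.
  + exact: lspan_adjointable shifts_adjointable.
  + exact: lspan_opbounded shifts_opbounded.
  + exact: lspan_opbounded shifts_opbounded.
  + apply: lspan_comp shifts_adjointable _ => _ _ [n [x ->]] [m [y ->]].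
    by exists (n + m)%N, (sprod x y); apply: shift_comp.
- exact: opclosure_idem.
Qed.

Lemma tensor_algebra_shift n (x : X n) : TA (Sh x).
Proof. by apply: sub_gen_smallest; exists n, x. Qed.

Lemma tensor_algebra0 : TA 0.
Proof. by move=> B [[h0 h1 h2 h3 h4] hB]. Qed.

Lemma tensor_algebra_adjointable : TA `<=` adjbl.
Proof.
move=> a /tensor_algebra_sub /(opclosure_mono (lspan_adjointable shifts_adjointable)).
exact: adjointable_closed.
Qed.

(* A unit of the tensor algebra fixes [lact a y], and the left actions are
   nondegenerate. *)
Lemma tensor_algebra_unit e : TA e -> (forall a, TA a -> e \o a = a) -> e = idfun.
Proof.
move=> /tensor_algebra_adjointable ae h; apply: adjointable_fock_ext => [//||n y]; first exact: adjointable_id.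
apply: mip_extl => w; rewrite mip_adj //=; apply/eqP; rewrite -subr_eq0 -mipBr; apply/eqP.
set u := fcomp n (madj e w - w); rewrite mip_fcomp -/u.
suff -> : u = 0 by rewrite mip0r.
have hu a : lact a u = 0.
  apply: mip_ext => z; rewrite mip_lact mip0r -mip_fcomp mipBr -mip_adj //.
  have := congr1 (fun f => f (fin z)) (h _ (tensor_algebra_shift (unitX X (cstar a)))).
  by rewrite /= shift_unit => ->; rewrite subrr.
suff : mip (incl u) (incl u) = 0 by rewrite mip_incl => /mip_eq0.
have tot : mod_closure s (lspan [set z | exists (x : pw X 0) (y : pw X n), z = tens x y]) (incl u).
  by rewrite (tensor_total (tens_tensor X 0 n)).
apply: mod_closure_orth tot _; apply: lspan_min.
- by rewrite mip0r.
- by move=> k a b ha hb; rewrite mipDr mipZr ha hb scaler0 addr0.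
- move=> _ [x [z ->]]; have [x' <-] := incl0_surj x; have [a <-] := unitX_surj x'.
  by rewrite tens1x mip_lact -incl_lact hu (linear_fun0 (@incl_lin _ _ _ _ _)) mip0l.
Qed.

Definition genops := [set a | exists g, a = genop g].
Definition cgens := [set c | exists g g', c = genop g \o madj (genop g')].

Lemma genops_adjointable : genops `<=` adjbl.
Proof. by move=> _ [g ->]; apply: genop_adjointable. Qed.
Lemma genops_opbounded : genops `<=` opbounded.
Proof. by move=> _ [g ->]; apply: genop_bounded. Qed.

Lemma shifts_genops : lspan shifts `<=` lspan genops.
Proof.
apply: lspan_min; first exact: lspan0.
  by move=> k a b; apply: lspan_lin.
by move=> _ [n [x ->]]; apply: lspan_sub; exists (Some (existT _ n x)).
Qed.

Lemma unitization_sub : unitization TA `<=` opclosure (lspan genops).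
Proof.
move=> a [[_ /tensor_algebra_sub]|[_ [b [k [/tensor_algebra_sub hb ->]]]]].
  exact: (opclosure_mono shifts_genops).
rewrite addrC; apply: opclosure_lin.
- by move=> c u v; apply: lspan_lin.
- by apply/sub_opclosure/lspan_sub; exists None.
- exact: opclosure_mono shifts_genops _ hb.
Qed.

(** If the tensor algebra has a unit, this unit is the identity by [tensor_algebra_unit]; otherwise
    the identity is adjoined by definition. In both cases the generator [None] is covered. *)
Lemma unitization_genop g : unitization TA (genop g).
Proof.
have [hu|nu] := pselect (has_unit TA).
  left; split=> //; case: g => [[n x]|]; first exact: tensor_algebra_shift.
  case: hu => e TAe he; have ee : e = idfun by apply: tensor_algebra_unit => // a /he [].
  by rewrite /genop -ee.
right; split=> //; case: g => [[n x]|].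
  by exists (Sh x), 0; split; [apply: tensor_algebra_shift|rewrite scale0r addr0].
by exists 0, 1; split; [apply: tensor_algebra0|rewrite add0r scale1r].
Qed.

Lemma opbounded_comp a b : opbounded a -> opbounded b -> opbounded (a \o b).
Proof.
move=> [c c0 hc] [d d0 hd]; exists (c * d); first exact: mulr_ge0.
by move=> x /=; apply: le_trans (hc _) _; rewrite -mulrA; apply: ler_wpM2l.
Qed.

Lemma cgens_opbounded : cgens `<=` opbounded.
Proof.
move=> _ [g [g' ->]]; apply: opbounded_comp; first exact: genop_bounded.
by apply: madj_opbounded; [apply: genop_adjointable|apply: genop_bounded].
Qed.

Lemma genops_comp_adj a b : lspan genops a -> lspan genops b -> lspan cgens (a \o madj b).
Proof.
move=> ha hb; have ab := lspan_adjointable genops_adjointable hb.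
move: a ha; apply: lspan_min; first exact: lspan0.
  by move=> k a a' h h'; apply: (lspan_lin k h h').
move=> _ [g ->]; suff : adjbl b /\ lspan cgens (genop g \o madj b) by case.
move: b hb {ab}; apply: lspan_min.
- split; first exact: adjointable_0.
  rewrite (madj_unique (@is_adjoint_0 _ _ _)).
  suff -> : genop g \o (0 : F -> F) = (0 : F -> F) by apply: lspan0.
  by apply/funext => y /=; rewrite (linear_fun0 (adjointable_lin (genop_adjointable g))).
- move=> k b b' [ab h] [ab' h']; split; first exact: adjointable_comb.
  rewrite madj_comb //.
  have -> : genop g \o (k^cj *: madj b + madj b') = k^cj *: (genop g \o madj b) + (genop g \o madj b').
    by apply/funext => y /=; rewrite !fctE (adjointable_lin (genop_adjointable g)).
  exact: lspan_lin.
- by move=> _ [g' ->]; split; [apply: genop_adjointable|apply: lspan_sub; exists g, g'].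
Qed.

Lemma opclosure_adj S b : S `<=` adjbl -> opclosure S b -> opclosure [set c | exists2 a, S a & c = madj a] (madj b).
Proof.
move=> aS Sb; have ab : adjbl b by apply: adjointable_closed; apply: opclosure_mono Sb.
move: Sb => /opclosureP hb; apply/opclosureP => e e0; have [c Sc bc] := hb e e0.
exists (madj c); first by exists c.
move=> x; have := @madj_bound _ _ _ (-1 *: c + b) e (adjointable_comb _ (aS _ Sc) ab) (ltW e0) _ x.
rewrite (madj_comb _ (aS _ Sc) ab) conjcN conjc1 !fctE scaleN1r addrC; apply => y.
by rewrite scaleN1r addrC.
Qed.

Lemma operator_system_sub : OS `<=` opclosure (lspan cgens).
Proof.
apply: opclosure_lspan_min => _ [a [b [/unitization_sub ha /unitization_sub hb ->]]].
have hg := lspan_adjointable genops_adjointable.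
have hgb := lspan_opbounded genops_opbounded.
apply: (opclosure_comp (S := lspan genops) hg hgb) (ha) (opclosure_adj hg hb).
- by move=> _ [c hc ->]; apply: madj_opbounded; [apply: hg|apply: hgb].
- by move=> u _ hu [c hc ->]; apply: genops_comp_adj.
Qed.

Lemma operator_system_cgens g g' : OS (genop g \o madj (genop g')).
Proof.
apply/sub_opclosure/lspan_sub; exists (genop g), (genop g').
by split=> //; apply: unitization_genop.
Qed.

Lemma operator_system_comb k a b : OS a -> OS b -> OS (k *: a + b).
Proof. by apply: opclosure_lin => c u v; apply: lspan_lin. Qed.

Lemma operator_system_lspan : lspan cgens `<=` OS.
Proof.
apply: lspan_min; first exact/sub_opclosure/lspan0.
  exact: operator_system_comb.
by move=> _ [g [g' ->]]; apply: operator_system_cgens.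
Qed.

End ShiftOperators.

(** Error bounds are often quadratic in [e]; with [e <= 1] the squares are absorbed in the linear
    term. *)
Lemma le_small (R : realType) (a b C : R) : (forall e, 0 < e -> e <= 1 -> a <= b + C * e) -> a <= b.
Proof.
move=> h; apply/ler_addgt0Pr => e e0.
have C1 : 0 < `|C| + e + 1 by have := normr_ge0 C; lra.
have d0 := divr_gt0 e0 C1; have d1 : e / (`|C| + e + 1) <= 1 by rewrite ler_pdivrMr // mul1r; have := normr_ge0 C; lra.
apply: le_trans (h _ d0 d1) _; rewrite lerD2l; apply: le_trans (ler_wpM2r (ltW d0) (ler_norm C)) _.
rewrite mulrCA ger_pMr // ler_pdivrMr // mul1r; lra.
Qed.

Lemma cabs_small_eq (R : realType) (a b : R[i]) C : (forall e, 0 < e -> e <= 1 -> cabs (a - b) <= C * e) -> a = b.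
Proof.
move=> h; apply/eqP; rewrite -subr_eq0; apply/eqP/cabs_eq0/le_anti; rewrite cabs_ge0 andbT.
by apply: (@le_small _ _ _ C) => e e0 e1; rewrite add0r; apply: h.
Qed.

(** * The contractions of each degree *)

Section ContractionOnKernel.
Variables (R : realType) (H : hilbertType R) (E : Type).
Variables (beta : E -> E -> R[i]) (sc : R[i] -> E -> E) (q : E -> H).
Hypothesis K : is_kernel beta sc.
Hypothesis q_scl : forall k p, q (sc k p) = k *: q p.
Notation kf := (kf beta).
Notation kn := (kn beta).

Definition ksum (u : seq E) : H := \sum_(p <- u) q p.

Lemma ksum_cat u v : ksum (u ++ v) = ksum u + ksum v.
Proof. by rewrite /ksum big_cat. Qed.
Lemma ksum_scl k u : ksum (kscl sc k u) = k *: ksum u.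
Proof. by rewrite /ksum big_map scaler_sumr; apply: eq_bigr => p _. Qed.

Hypothesis contr : forall u, rnorm (ksum u) <= kn u.

(* [w] is, up to [e], the image of [h] under the adjoint of [ksum]. *)
Definition apx (h : H) (e : R) (w : seq E) := forall u, cabs (kf w u - hip h (ksum u)) <= e * kn u.

Lemma apx_exists h e : 0 < e -> exists w, apx h e w.
Proof.
move=> e0; apply: (approx_riesz K (q := fun u => hip h (ksum u)) (C := rnorm h)) => //.
- by move=> u v; rewrite ksum_cat hipDr.
- by move=> k u; rewrite ksum_scl hipZr.
- by move=> u; apply: le_trans (hip_cauchy_schwarz _ _) _; apply: ler_wpM2l; rewrite ?rnorm_ge0.
Qed.

Lemma apx_comb k h h' e e' w w' : apx h e w -> apx h' e' w' ->
  apx (k *: h + h') (cabs k * e + e') (kscl sc k w ++ w').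
Proof.
move=> hw hw' u; rewrite kf_cat_l (kf_scl_l K) hipDl hipZl.
have -> : k^cj * kf w u + kf w' u - (k^cj * hip h (ksum u) + hip h' (ksum u)) =
   k^cj * (kf w u - hip h (ksum u)) + (kf w' u - hip h' (ksum u)) by rewrite mulrBr; zabel.
apply: le_trans (cabsD _ _) _; rewrite cabsM cabs_conj mulrDl -mulrA lerD //.
by apply: ler_wpM2l; rewrite ?cabs_ge0.
Qed.

Lemma apx_zero e w : 0 <= e -> apx 0 e w -> kn w <= e.
Proof.
move=> e0 /(_ w); rewrite hip0l subr0 -(kn_sqr K) cabs_real ger0_norm ?sqr_ge0 // expr2.
have [->//|ne] := eqVneq (kn w) 0.
by rewrite ler_pM2r // lt_neqAle eq_sym ne kn_ge0.
Qed.

Lemma apx_close h e e' w w' : 0 <= e -> 0 <= e' -> apx h e w -> apx h e' w' ->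
  rnorm (ksum w - ksum w') <= e + e'.
Proof.
move=> e0 e'0 hw hw'; have := apx_comb (-1) hw' hw.
rewrite scaleN1r addNr cabsN (_ : cabs 1 = 1) ?mul1r; last by rewrite -[1]/(1%:C) cabs_real normr1.
move=> h0; have := apx_zero (addr_ge0 e'0 e0) h0; rewrite [e' + e]addrC => h1.
by apply: le_trans h1; have := contr (kscl sc (-1) w' ++ w); rewrite ksum_cat ksum_scl scaleN1r addrC.
Qed.

Lemma apx_kn h e w : 0 <= e -> apx h e w -> kn w <= rnorm h + e.
Proof.
move=> e0 hw; have [->|ne] := eqVneq (kn w) 0; first by rewrite addr_ge0 ?rnorm_ge0.
have w0 : 0 < kn w by rewrite lt_neqAle eq_sym ne kn_ge0.
rewrite -(ler_pM2r w0) -expr2.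
have -> : kn w ^+ 2 = cabs (kf w w) by rewrite -(kn_sqr K) cabs_real ger0_norm ?sqr_ge0.
rewrite -[kf w w](subrK (hip h (ksum w))) addrC; apply: le_trans (cabsD _ _) _; rewrite mulrDl lerD //.
by apply: le_trans (hip_cauchy_schwarz _ _) _; apply: ler_wpM2l; rewrite ?rnorm_ge0.
Qed.

Definition is_gram_op (P : H -> H) := forall h e w, 0 <= e -> apx h e w -> rnorm (ksum w - P h) <= e.

(* [P] is the composition of [ksum] with its adjoint. *)
Lemma gram_op_exists : exists P, is_gram_op P.
Proof.
suff ex h : exists k, forall e w, 0 <= e -> apx h e w -> rnorm (ksum w - k) <= e.
  by have [P hP] := choice ex; exists P => h e w; apply: hP.
have exw (n : nat) : exists w, apx h n.+1%:R^-1 w by apply: apx_exists; rewrite invr_gt0.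
have [w hw] := choice exw; have i0 (n : nat) : 0 <= n.+1%:R^-1 :> R by rewrite invr_ge0.
have [|k hk] := @rnorm_complete _ H (fun n => ksum (w n)).
  move=> e e0; have [N hN] := archi_inv 1 (divr_gt0 e0 (ltr0Sn _ 1)); exists N => m n Nm Nn.
  apply: le_trans (apx_close (i0 m) (i0 n) (hw m) (hw n)) _.
  by have := hN m Nm; have := hN n Nn; rewrite !mul1r; move: (m.+1%:R^-1) (n.+1%:R^-1) => a b; lra.
exists k => e v e0 hv; apply/ler_addgt0Pr => d d0.
have [N hN] := hk _ (divr_gt0 d0 (ltr0Sn _ 1)).
have [N' hN'] := archi_inv 1 (divr_gt0 d0 (ltr0Sn _ 1)); set n := maxn N N'.
have h1 := hN n (leq_maxl _ _); have := hN' n (leq_maxr _ _); rewrite mul1r => h2.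
have h3 := apx_close e0 (i0 n) hv (hw n).
have -> : ksum v - k = (ksum v - ksum (w n)) + (ksum (w n) - k) by zabel.
apply: le_trans (rnormD _ _) _; move: h1 h2 h3; move: (n.+1%:R^-1) => c; lra.
Qed.

Variable P : H -> H.
Hypothesis hP : is_gram_op P.

Lemma gram_op_unique h k : (forall e, 0 < e -> exists2 w, apx h e w & rnorm (ksum w - k) <= e) -> P h = k.
Proof.
move=> hk; apply/eqP; rewrite -subr_eq0; apply/eqP; apply: (@rnorm_small0 _ _ 2) => e e0.
have [w hw wk] := hk e e0; have := hP (ltW e0) hw.
have -> : P h - k = (ksum w - k) - (ksum w - P h) by zabel.
by move=> h1; apply: le_trans (rnormB _ _) _; lra.
Qed.

Lemma gram_op_lin : linear P.
Proof.
move=> k x y; have k0 := cabs_ge0 k; apply: gram_op_unique => e e0.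
have k1 : 0 < cabs k + 1 by rewrite ltr_wpDl.
have d0 := divr_gt0 e0 k1; have [w hw] := apx_exists x d0; have [v hv] := apx_exists y d0.
have ed : cabs k * (e / (cabs k + 1)) + e / (cabs k + 1) = e.
  by rewrite -[X in _ + X]mul1r -mulrDl mulrC divfK // gt_eqF.
exists (kscl sc k w ++ v); first by rewrite -ed; apply: apx_comb.
rewrite ksum_cat ksum_scl.
have -> : k *: ksum w + ksum v - (k *: P x + P y) = k *: (ksum w - P x) + (ksum v - P y) by rewrite scalerBr; zabel.
rewrite -[leRHS]ed; apply: le_trans (rnormD _ _) _; rewrite rnormZ lerD //; last exact: hP (ltW d0) hv.
by apply: ler_wpM2l => //; apply: hP (ltW d0) hw.
Qed.

(** With [Q] for [ksum]: [<Q^* h, Q^* k> = <h, Q Q^* k>], up to the errors of the two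
    approximants. *)
Lemma apx_form h k e d w v : 0 <= e -> 0 <= d -> apx h e w -> apx k d v ->
  cabs (kf w v - hip h (P k)) <= e * (rnorm k + d) + rnorm h * d.
Proof.
move=> e0 d0 hw hv; have -> : kf w v - hip h (P k) = (kf w v - hip h (ksum v)) + hip h (ksum v - P k).
  by rewrite hipBr; zabel.
apply: le_trans (cabsD _ _) _; apply: lerD.
  by apply: le_trans (hw v) _; apply: ler_wpM2l => //; apply: apx_kn.
by apply: le_trans (hip_cauchy_schwarz _ _) _; apply: ler_wpM2l; rewrite ?rnorm_ge0 //; apply: hP.
Qed.

Lemma gram_op_sym h k : hip (P h) k = hip h (P k).
Proof.
have h0 := rnorm_ge0 h; have k0 := rnorm_ge0 k.
apply: (@cabs_small_eq _ _ _ (2 * (rnorm k + 1 + rnorm h + 1))) => e e0 e1.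
have [w hw] := apx_exists h e0; have [v hv] := apx_exists k e0.
have h1 := apx_form (ltW e0) (ltW e0) hw hv; have := apx_form (ltW e0) (ltW e0) hv hw.
rewrite -cabs_conj conjcD conjcN -(kf_conj K) -hip_cj => h2.
have -> : hip (P h) k - hip h (P k) = (kf w v - hip h (P k)) - (kf w v - hip (P h) k) by zabel.
apply: le_trans (cabsB _ _) _; nra.
Qed.

Lemma gram_op_real h : hip h (P h) = (complex.Re (hip h (P h)))%:C.
Proof.
have := addcJ_Re (hip h (P h)); rewrite -hip_cj gram_op_sym => e.
apply: (mulfI (_ : 2%:R != 0)); first by rewrite pnatr_eq0.
by rewrite !mulr_natl !mulr2n e RCD.
Qed.

Lemma gram_op_apx h e : 0 < e -> e <= 1 -> exists w, [/\ apx h e w, kn w <= rnorm h + e &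
  `|kn w ^+ 2 - complex.Re (hip h (P h))| <= (2 * rnorm h + 1) * e].
Proof.
move=> e0 e1; have [w hw] := apx_exists h e0; exists w; split=> //; first exact: apx_kn (ltW e0) hw.
have := apx_form (ltW e0) (ltW e0) hw hw; rewrite gram_op_real -(kn_sqr K) -RCN -RCD cabs_real => hh.
apply: le_trans hh _; have h0 := rnorm_ge0 h; nra.
Qed.

Lemma gram_op_pos h : 0 <= hip h (P h).
Proof.
rewrite gram_op_real lecR; apply: (@le_small _ _ _ (2 * rnorm h + 1)) => e e0 e1.
have [w [_ _ hh]] := gram_op_apx h e0 e1.
have := ler_norm (kn w ^+ 2 - complex.Re (hip h (P h))).
have := sqr_ge0 (kn w); lra.
Qed.

(** [|<Q^* h, u>| <= |Q^* h| |u|], where [|Q^* h|^2 = <h, P h>]. *)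
Lemma gram_op_cauchy h u : cabs (hip h (ksum u)) ^+ 2 <= complex.Re (hip h (P h)) * kn u ^+ 2.
Proof.
have h0 := rnorm_ge0 h; have u0 := kn_ge0 beta u; have x0 := cabs_ge0 (hip h (ksum u)).
apply: (@le_small _ _ _ ((2 * rnorm h + 1 + 2 * (rnorm h + 1) + 1) * kn u ^+ 2)) => e e0 e1.
have [w [hw w1 w2]] := gram_op_apx h e0 e1; have w0 := kn_ge0 beta w.
have h1 : cabs (hip h (ksum u)) <= (kn w + e) * kn u.
  have -> : hip h (ksum u) = kf w u - (kf w u - hip h (ksum u)) by zabel.
  apply: le_trans (cabsB _ _) _; rewrite mulrDl lerD //; exact: kf_cauchy_schwarz K _ _.
have h2 : kn w ^+ 2 <= complex.Re (hip h (P h)) + (2 * rnorm h + 1) * e.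
  by have := ler_norm (kn w ^+ 2 - complex.Re (hip h (P h))); lra.
have h3 : (kn w + e) ^+ 2 <= complex.Re (hip h (P h)) + (2 * rnorm h + 1 + 2 * (rnorm h + 1) + 1) * e.
  have : kn w * e <= (rnorm h + 1) * e by nra.
  have : e ^+ 2 <= e by nra.
  nra.
have h5 : cabs (hip h (ksum u)) ^+ 2 <= ((kn w + e) * kn u) ^+ 2 by apply: lerXn2r; rewrite ?nnegrE ?mulr_ge0 //; lra.
apply: le_trans h5 _; rewrite exprMn (mulrAC _ (kn u ^+ 2) e) -mulrDl; apply: ler_wpM2r => //; exact: sqr_ge0.
Qed.

Lemma gram_op_le h : complex.Re (hip h (P h)) <= rnorm h ^+ 2.
Proof.
have h0 := rnorm_ge0 h.
apply: (@le_small _ _ _ (2 * rnorm h + 1 + 2 * rnorm h + 1)) => e e0 e1.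
have [w [_ w1 w2]] := gram_op_apx h e0 e1; have w0 := kn_ge0 beta w.
have := ler_norm (- (kn w ^+ 2 - complex.Re (hip h (P h)))); rewrite normrN.
have : kn w ^+ 2 <= (rnorm h + e) ^+ 2 by apply: lerXn2r; rewrite ?nnegrE //; lra.
have : e ^+ 2 <= e by nra.
nra.
Qed.

(** [|Q Q^* h| <= |Q^* h|], as [ksum] is contractive. *)
Lemma gram_op_sqr_le h : rnorm (P h) ^+ 2 <= complex.Re (hip h (P h)).
Proof.
have h0 := rnorm_ge0 h; have p0 := rnorm_ge0 (P h).
apply: (@le_small _ _ _ (2 * rnorm h + 1 + 2 * (rnorm h + 1) + 1)) => e e0 e1.
have [w [hw w1 w2]] := gram_op_apx h e0 e1; have w0 := kn_ge0 beta w.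
have h1 : rnorm (P h) <= kn w + e.
  have -> : P h = ksum w - (ksum w - P h) by zabel.
  by apply: le_trans (rnormB _ _) _; apply: lerD; [exact: contr|exact: hP (ltW e0) hw].
have h2 : kn w ^+ 2 <= complex.Re (hip h (P h)) + (2 * rnorm h + 1) * e.
  by have := ler_norm (kn w ^+ 2 - complex.Re (hip h (P h))); lra.
have : rnorm (P h) ^+ 2 <= (kn w + e) ^+ 2 by apply: lerXn2r; rewrite ?nnegrE //; lra.
have : kn w * e <= (rnorm h + 1) * e by nra.
have : e ^+ 2 <= e by nra.
nra.
Qed.

(** [|P h - h|^2 = |P h|^2 - 2 <h, P h> + |h|^2 <= |h|^2 - <h, P h>] by [gram_op_sqr_le]. So it is
    enough that [Q^*] does not shrink [h]. *)
Lemma gram_op_id_of_range h : rnorm h ^+ 2 <= complex.Re (hip h (P h)) -> P h = h.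
Proof.
move=> hh; apply/eqP; rewrite -subr_eq0; apply/eqP/hip_eq0/le_anti; rewrite hip_ge0 andbT.
rewrite hipBr !hipBl !hip_sqr (gram_op_sym h h) gram_op_real.
rewrite -[0]/(0%:C) -!rmorphB lecR; have := gram_op_sqr_le h; lra.
Qed.

End ContractionOnKernel.

Definition map_fst (U V W : Type) (L : U -> V) (u : seq (U * W)) : seq (V * W) := [seq (L p.1, p.2) | p <- u].

Lemma kf_flatten (R : realType) (E I : Type) (beta : E -> E -> R[i]) (f : I -> seq E) w u :
  kf beta (flatten [seq f p | p <- w]) u = \sum_(p <- w) kf beta (f p) u.
Proof. by rewrite /kf big_flatten /= big_map. Qed.

Section ModuleLists.
Variables (R : realType) (M : cstarAlgType R) (H : hilbertType R) (sigma : M -> H -> H).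
Hypothesis rep : is_rep sigma.
Variable D : H -> H.
Hypothesis PD : pos_commutant sigma D.

Lemma list_kernel (F : hilbertModType M) : is_kernel (mbeta sigma D (@mip R M F)) (@mscl R H F).
Proof. exact: (module_kernel rep PD (hilbertmod_prehilbert F)). Qed.

Lemma kn_map_fst (F F' : hilbertModType M) (L : F -> F') c u : linear L ->
  (forall x a, L (ract x a) = ract (L x) a) -> 0 <= c -> (forall x, rnorm (L x) <= c * rnorm x) ->
  kn (mbeta sigma D (@mip R M F')) (map_fst L u) <= c * kn (mbeta sigma D (@mip R M F)) u.
Proof.
move=> lL rL c0 bL; have K := list_kernel F; have K' := list_kernel F'.
apply: (kn_sqr_le K'); first by rewrite mulr_ge0 ?kn_ge0.
rewrite exprMn RCM (kn_sqr K).
apply: (@module_bounded _ _ _ _ rep _ PD F F' _ _ _ _ L (c ^+ 2) u (hilbertmod_prehilbert F) (hilbertmod_prehilbert F')) => //.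
- by move=> x b; rewrite /ura (linear_funD lL) (linear_funZ lL) rL.
- exact: linear_funD.
- exact: linear_fun0.
- exact: sqr_ge0.
- by move=> x; rewrite !rnorm_mip_sqr -exprMn; apply: lerXn2r; rewrite ?nnegrE ?mulr_ge0 ?rnorm_ge0.
Qed.

Lemma kf_map_fst_adj (F F' : hilbertModType M) (L : F -> F') (L' : F' -> F) u v :
  (forall x y, mip (L x) y = mip x (L' y)) ->
  kf (mbeta sigma D (@mip R M F')) (map_fst L u) v = kf (mbeta sigma D (@mip R M F)) u (map_fst L' v).
Proof.
move=> h; rewrite /kf big_map; apply: eq_bigr => p _; rewrite big_map; apply: eq_bigr => q _.
by rewrite /mbeta h.
Qed.

End ModuleLists.

Section Levels.
Variables (R : realType) (M : cstarAlgType R) (s : setting M) (X : subproduct s).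
Variables (H : hilbertType R) (T : forall n, X n -> H -> H).
Hypothesis cc : is_cc_rep T.
Definition base_rep (a : M) : H -> H := T (unitX X a).
Notation sigma := base_rep.
Let rep : is_rep sigma := ccr_rep cc.
Let PI := pos_commutant_id sigma.
Notation lkf n := (kf (mbeta sigma idfun (@mip R M (X n)))).
Notation lkn n := (kn (mbeta sigma idfun (@mip R M (X n)))).
Notation pkf n := (kf (mbeta sigma idfun (@mip R M (pw X n)))).
Notation pkn n := (kn (mbeta sigma idfun (@mip R M (pw X n)))).

Definition lvq n (p : X n * H) : H := T p.1 p.2.
Notation Q n := (ksum (@lvq n)).
Notation lapx n := (apx (mbeta sigma idfun (@mip R M (X n))) (@lvq n)).

Let K n : is_kernel (mbeta sigma idfun (@mip R M (X n))) (@mscl R H (X n)) := list_kernel rep PI (X n).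
Let PK n : is_kernel (mbeta sigma idfun (@mip R M (pw X n))) (@mscl R H (pw X n)) := list_kernel rep PI (pw X n).

Lemma T_linear n (x : X n) : linear (T x). Proof. exact: bounded_op_linear (ccr_bounded cc x). Qed.
Lemma lvq_scl n k p : lvq (@mscl R H (X n) k p) = k *: lvq p.
Proof. by rewrite /lvq /= (linear_funZ (@T_linear _ _)). Qed.

Lemma lv_contr n u : rnorm (Q n u) <= lkn n u.
Proof.
apply: le_of_sqr; first exact: kn_ge0.
rewrite -lecR (kn_sqr (K n)).
exact: (row_contraction rep (ccr_bounded cc (n := n)) (@ccr_linear _ _ _ _ _ _ cc n) (@ccr_ract _ _ _ _ _ _ cc n) (@ccr_contractive _ _ _ _ _ _ cc n)).
Qed.

(* [lvP n] is [T~_n T~_n^*]. *)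
Definition lvP n : H -> H := sval (cid (gram_op_exists (K n) (@lvq_scl n) (@lv_contr n))).
Lemma lvPP n : is_gram_op (mbeta sigma idfun (@mip R M (X n))) (@lvq n) (lvP n).
Proof. exact: (svalP (cid (gram_op_exists (K n) (@lvq_scl n) (@lv_contr n)))). Qed.

Lemma level0_isometric u v : lkf 0 u v = hip (Q 0 u) (Q 0 v).
Proof.
rewrite /kf /ksum hip_suml; apply: eq_bigr => p _; rewrite hip_sumr; apply: eq_bigr => q _.
have [a ea] := unitX_surj p.1; have [b eb] := unitX_surj q.1.
rewrite /mbeta /lvq -ea -eb (isom_mip (unitX_isom X)) -/(sigma a) -/(sigma b) (rep_adj rep).
by rewrite -(repM rep).
Qed.

(** [T~_0] is isometric and, [sigma] being nondegenerate, has dense range, so [T~_0 T~_0^* = 1]. By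
    isometry, any [w] whose image is close to [h] is an approximant for [h]. *)
Lemma lvP0 h : lvP 0 h = h.
Proof.
apply: (gram_op_unique (@lvPP 0)) => e e0.
have [y hy hye] : exists2 y, lspan [set x | exists a h, x = sigma a h] y & rnorm (h - y) <= e.
  by apply/(closure_rnorm _ h).1 => //; rewrite (rep_nondegenerate rep).
have [w ew] : exists w, Q 0 w = y.
  move: y hy {hye}; apply: lspan_min.
  - by exists [::]; rewrite /ksum big_nil.
  - move=> k a b [u <-] [v <-]; exists (kscl (@mscl _ _ _) k u ++ v).
    by rewrite ksum_cat (ksum_scl (@lvq_scl 0)).
  - by move=> _ [a [g ->]]; exists [:: (unitX X a, g)]; rewrite /ksum big_seq1.
exists w; last by rewrite ew rnorm_distC.
move=> u; rewrite level0_isometric ew -hipBl; apply: le_trans (hip_cauchy_schwarz _ _) _.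
by apply: ler_pM; rewrite ?rnorm_ge0 ?lv_contr // rnorm_distC.
Qed.

(** [T~_n] intertwines the left action of [a] with [sigma a], and so does its adjoint, because the
    left action and [sigma] respect stars. *)
Lemma lvP_comm n a h : lvP n (sigma a h) = sigma a (lvP n h).
Proof.
have a0 := rnorm_ge0 a; have [la [C C0 bC]] := (bounded_opP _).1 (rep_bounded rep a).
have QL b (u : seq (X n * H)) : Q n (map_fst (lact b) u) = sigma b (Q n u).
  rewrite /ksum big_map (linear_fun_sum (rep_lin rep _)); apply: eq_bigr => p _.
  by rewrite /lvq /= (ccr_lact cc).
have knL b (u : seq (X n * H)) : lkn n (map_fst (lact b) u) <= rnorm b * lkn n u.
  apply: (kn_map_fst rep PI); rewrite ?rnorm_ge0 //.
  - by move=> k x y; rewrite lactD lactZ.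
  - by move=> x c; rewrite lact_ract.
  - exact: rnorm_lact.
apply: (gram_op_unique (@lvPP n)) => e e0.
have m1 : 0 < C + rnorm a + 1 by lra.
have d0 := divr_gt0 e0 m1; have [w hw] := apx_exists (K n) (@lvq_scl n) (@lv_contr n) h d0.
have de c : 0 <= c -> c <= C + rnorm a -> c * (e / (C + rnorm a + 1)) <= e.
  by move=> c0 cC; rewrite mulrCA ger_pMr // ler_pdivrMr // mul1r; lra.
exists (map_fst (lact a) w).
  move=> u; rewrite (kf_map_fst_adj _ _ (L' := lact (cstar a))); last by move=> x y; rewrite lact_adj.
  rewrite (rep_adj rep) -QL; apply: le_trans (hw _) _.
  apply: le_trans (ler_wpM2l (ltW d0) (knL _ _)) _; rewrite rnorm_cstar mulrA.
  by apply: ler_wpM2r; rewrite ?kn_ge0 // mulrC; apply: de => //; lra.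
rewrite QL -(linear_funB la); apply: le_trans (bC _) _.
apply: le_trans (ler_wpM2l C0 (lvPP (ltW d0) hw)) _; apply: de => //; lra.
Qed.

(** * Passage from degree n to degree n + 1 *)

Section Step.
Variable n : nat.
Implicit Types (t : X n * X 1 * H).

(** A triple [(x, e, g)] stands for [x (x) e (x) g]. [tlist] is this vector in the full tensor
    product, [plist] its projection to degree [n + 1], [tapp] its image under [1 (x) T~_1], and
    [tcut x] its image under the adjoint of tensoring with [x] from the left. *)
Definition tlist (tau : seq (X n * X 1 * H)) : seq (pw X (n + 1) * H) :=
  [seq (tens (incl t.1.1) (incl t.1.2), t.2) | t <- tau].
Definition plist (tau : seq (X n * X 1 * H)) : seq (X (n + 1)%N * H) :=
  [seq (sprod t.1.1 t.1.2, t.2) | t <- tau].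
Definition tapp (tau : seq (X n * X 1 * H)) : seq (X n * H) := [seq (t.1.1, T t.1.2 t.2) | t <- tau].
Definition tcut (x : X n) (tau : seq (X n * X 1 * H)) : seq (X 1 * H) :=
  [seq (lact (mip x t.1.1) t.1.2, t.2) | t <- tau].

Lemma Q_plist tau : Q (n + 1) (plist tau) = Q n (tapp tau).
Proof.
rewrite /ksum !big_map; apply: eq_bigr => t _.
by rewrite /lvq /= (ccr_mul cc).
Qed.

Lemma inclZ m k (x : X m) : incl (k *: x) = k *: incl x.
Proof. exact: (linear_funZ (@incl_lin _ _ _ X m) k x). Qed.

Lemma lkf_plistl u tau : lkf (n + 1) (plist tau) u = pkf (n + 1) (tlist tau) (map_fst (@incl _ _ _ _ _) u).
Proof.
rewrite /kf !big_map; apply: eq_bigr => t _; rewrite big_map; apply: eq_bigr => p _.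
by rewrite /mbeta /= mip_sprodl.
Qed.

Lemma lkf_plist u tau : lkf (n + 1) u (plist tau) = pkf (n + 1) (map_fst (@incl _ _ _ _ _) u) (tlist tau).
Proof.
rewrite /kf big_map; apply: eq_bigr => p _; rewrite !big_map; apply: eq_bigr => t _.
by rewrite /mbeta /= mip_sprod.
Qed.

Lemma lkf_incl m u v : lkf m u v = pkf m (map_fst (@incl _ _ _ _ _) u) (map_fst (@incl _ _ _ _ _) v).
Proof.
rewrite /kf big_map; apply: eq_bigr => p _; rewrite !big_map; apply: eq_bigr => t _.
by rewrite /mbeta /= mip_incl.
Qed.

Lemma lkn_incl m u : lkn m u = pkn m (map_fst (@incl _ _ _ _ _) u).
Proof. by rewrite /kn lkf_incl. Qed.

Lemma rnorm_incl m (x : X m) : rnorm (incl x) = rnorm x.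
Proof. by apply/eqP; rewrite -(@eqrXn2 _ 2) ?rnorm_ge0 // -!rnorm_mip_sqr mip_incl. Qed.

(** [tcut x] is adjoint to [y (x) g |-> x (x) y (x) g], which is bounded by [rnorm x]; an adjoint
    has the same bound. *)
Lemma kn_tcut x tau : lkn 1 (tcut x tau) <= rnorm x * pkn (n + 1) (tlist tau).
Proof.
pose L (e : X 1) := tens (incl x) (incl e).
have h1 u : pkn (n + 1) (map_fst L u) <= rnorm x * lkn 1 u.
  apply: (kn_map_fst rep PI); rewrite ?rnorm_ge0 //.
  - by move=> k y z; rewrite /L incl_lin (tensor_linearr (tens_tensor X n 1)).
  - by move=> y a; rewrite /L incl_ract (tensor_ract (tens_tensor X n 1)).
  - by move=> y; apply: le_trans (rnorm_tens _ _) _; rewrite !rnorm_incl.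
have h2 u : lkf 1 u (tcut x tau) = pkf (n + 1) (map_fst L u) (tlist tau).
  rewrite /kf big_map; apply: eq_bigr => p _; rewrite !big_map; apply: eq_bigr => t _.
  by rewrite /mbeta /= mip_tens mip_incl -incl_lact mip_incl.
have [->|ne] := eqVneq (lkn 1 (tcut x tau)) 0; first by rewrite mulr_ge0 ?kn_ge0 ?rnorm_ge0.
have c0 : 0 < lkn 1 (tcut x tau) by rewrite lt_neqAle eq_sym ne kn_ge0.
rewrite -(ler_pM2l c0) -expr2.
have -> : lkn 1 (tcut x tau) ^+ 2 = cabs (lkf 1 (tcut x tau) (tcut x tau)).
  by rewrite -(kn_sqr (K 1)) cabs_real ger0_norm ?sqr_ge0.
rewrite h2; apply: le_trans (kf_cauchy_schwarz (PK _) _ _) _; rewrite mulrA; apply: ler_wpM2r; rewrite ?kn_ge0 //.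
by rewrite mulrC; apply: h1.
Qed.

Lemma T_ulact m (x : X m) u h : T (ulact u x) h = urep sigma u (T x h).
Proof.
rewrite /ulact /urep addrC (ccr_linear cc) (ccr_lact cc) !fctE addrC //.
Qed.

(* With [v = v^*] and [v v] the Gram matrix of the vectors [t.1.1], the right
   side is the sum over the rows [l] of the squared norms of the vectors
   [sum_j v_lj e_j (x) g_j], to which the contraction of level 1 applies. *)
Lemma kn_tapp tau : lkn n (tapp tau) <= pkn (n + 1) (tlist tau).
Proof.
have UC := unitz_cstar M.
apply: (kn_sqr_le (K n)); rewrite ?kn_ge0 // (kn_sqr (PK _)).
case: tau => [|t0 tau]; first by rewrite !kf_nil.
set u := t0 :: tau; pose k := (size tau).+1.
pose y (i : 'I_k) := (nth t0 u i).1.1; pose e (i : 'I_k) := (nth t0 u i).1.2; pose g (i : 'I_k) := (nth t0 u i).2.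
pose hh i := T (e i) (g i); pose G := gram (@uip _ _ (X n)) y.
have -> : lkf n (tapp u) (tapp u) = uform sigma idfun G hh hh.
  rewrite /kf /uform big_map (big_nth t0) big_mkord; apply: eq_bigr => i _.
  by rewrite big_map (big_nth t0) big_mkord; apply: eq_bigr => j _; rewrite mxE urep_in.
have [v [sv vv _]] := pos_sqrt (matrix_cstar UC (size tau)) (gram_mpos UC (hilbertmod_prehilbert (X n)) y).
rewrite -[G]vv (uform_sqr rep PI _ sv).
pose ll l := [seq (ulact (v l i) (e i), g i) | i <- enum 'I_k].
have h1 l : hip (\sum_j urep sigma (v l j) (hh j)) (\sum_j urep sigma (v l j) (hh j)) <= lkf 1 (ll l) (ll l).
  rewrite hip_sqr -(kn_sqr (K 1)) lecR; apply: lerXn2r; rewrite ?nnegrE ?kn_ge0 ?rnorm_ge0 //.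
  apply: le_trans (lv_contr _); rewrite /ksum big_map big_enum /=.
  by under [in leRHS]eq_bigr => j _ do rewrite /lvq /= T_ulact.
apply: le_trans (ler_sum _ (fun l _ => h1 l)) _; rewrite le_eqVlt; apply/orP; left; apply/eqP.
have -> : pkf (n + 1) (tlist u) (tlist u) = \sum_i \sum_j hip (g i) (sigma (mip (e i) (lact (mip (y i) (y j)) (e j))) (g j)).
  rewrite /kf big_map (big_nth t0) big_mkord; apply: eq_bigr => i _.
  rewrite big_map (big_nth t0) big_mkord; apply: eq_bigr => j _.
  by rewrite /mbeta /= mip_tens mip_incl -incl_lact mip_incl.
have -> : \sum_l lkf 1 (ll l) (ll l) = \sum_l \sum_i \sum_j hip (g i) (sigma (mip (ulact (v l i) (e i)) (ulact (v l j) (e j))) (g j)).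
  apply: eq_bigr => l _; rewrite /kf big_map big_enum /=; apply: eq_bigr => i _.
  by rewrite big_map big_enum.
rewrite exchange_big; apply: eq_bigr => i _; rewrite exchange_big; apply: eq_bigr => j _.
rewrite -hip_sumr -(rep_sum rep); congr (hip _ (sigma _ _)).
under eq_bigr => l _ do rewrite ulact_adj -ulactM.
rewrite -mip_sumr; congr mip.
have <- : ulact (uin (mip (y i) (y j))) (e j) = lact (mip (y i) (y j)) (e j) by rewrite ulact_in.
have <- : \sum_l ust (v l i) * v l j = uin (mip (y i) (y j)).
  have := congr1 (fun A : 'M__ => A i j) vv; rewrite !mxE => ev; apply: etrans ev; apply: eq_bigr => l _.
  have -> : v i l = ust (v l i) by rewrite -{1}sv mxE.
  by [].
by rewrite (big_morph (fun u => ulact u (e j)) (fun a b => ulactD a b (e j)) (_ : ulact 0 (e j) = 0)) // /ulact lact0l scale0r addr0.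
Qed.

(** [X (n + 1)] lies in the closure of the span of the tensors of [X n] and [X 1]. In the W*-setting
    this closure is weak, and normality of [sigma] is used to approximate in the seminorm of each
    [g], by [mod_closure_dense]. *)
Lemma tlist_dense u e : 0 < e -> exists tau, forall v,
  cabs (pkf (n + 1) v (map_fst (@incl _ _ _ _ _) u) - pkf (n + 1) v (tlist tau)) <= e * pkn (n + 1) v.
Proof.
have span g x : lspan [set z | exists (y : X n) (y' : X 1), z = tens (incl y) (incl y')] x ->
    exists tau, forall v, pkf (n + 1) v [:: (x, g)] = pkf (n + 1) v (tlist tau).
  move: x; apply: lspan_min.
  - exists [::] => v; rewrite kf_nil /kf; apply: big1 => p _; rewrite big_seq1 /mbeta /= mip0r (rep0 rep) hip0r //.
  - move=> k x y [tau htau] [tau' htau'].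
    exists ([seq (k *: t.1.1, t.1.2, t.2) | t <- tau] ++ tau') => v.
    rewrite /tlist map_cat kf_cat_r -/(tlist _) -htau'.
    have -> : pkf (n + 1) v [seq (tens (incl t.1.1) (incl t.1.2), t.2) | t <- [seq (k *: t.1.1, t.1.2, t.2) | t <- tau]] =
        k * pkf (n + 1) v [:: (x, g)].
      rewrite htau /kf mulr_sumr; apply: eq_bigr => p _; rewrite mulr_sumr !big_map; apply: eq_bigr => t _.
      rewrite /mbeta /= inclZ.
      have := tensor_linearl (tens_tensor X n 1) k (incl t.1.1) 0 (incl t.1.2).
      have t0 : tens (0 : pw X n) (incl t.1.2) = 0.
        have := tensor_linearl (tens_tensor X n 1) (-1) (0 : pw X n) 0 (incl t.1.2).
        by rewrite scaler0 addr0 scaleN1r addNr.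
      by rewrite t0 !addr0 => ->; rewrite mipZr (repZ rep) hipZr.
    rewrite /kf mulr_sumr -big_split; apply: eq_bigr => p _.
    by rewrite !big_seq1 /mbeta /= mipDr mipZr (repD rep) (repZ rep) hipDr hipZr.
  - move=> _ [y [y' ->]]; exists [:: (y, y', g)] => v //.
elim: u e => [|[z g] u IHu] e e0.
  by exists [::] => v; rewrite subrr cabs0 mulr_ge0 ?kn_ge0 ?ltW.
have e2 : 0 < e / 2 by rewrite divr_gt0.
have [tau htau] := IHu _ e2.
have [|k a b ha hb|x Sx hx] := @mod_closure_dense _ _ s _ _ rep (ccr_normal cc) (pw X (n + 1)) g
   (lspan [set z | exists (y : X n) (y' : X 1), z = tens (incl y) (incl y')]) _ _ (incl z) (e / 2) (sub_tensor z) e2.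
- exact: lspan0.
- exact: lspan_lin.
have [tau' htau'] := span g x Sx; exists (tau' ++ tau) => v.
rewrite /tlist map_cat !kf_cat_r -!/(tlist _) -htau'.
have -> : map_fst (@incl _ _ _ _ _) ((z, g) :: u) = [:: (incl z, g)] ++ map_fst (@incl _ _ _ _ _) u by [].
rewrite kf_cat_r.
have -> : pkf (n + 1) v [:: (incl z, g)] + pkf (n + 1) v (map_fst (@incl _ _ _ _ _) u) -
    (pkf (n + 1) v [:: (x, g)] + pkf (n + 1) v (tlist tau)) =
   pkf (n + 1) v [:: (incl z - x, g)] + (pkf (n + 1) v (map_fst (@incl _ _ _ _ _) u) - pkf (n + 1) v (tlist tau)).
  have -> : pkf (n + 1) v [:: (incl z - x, g)] = pkf (n + 1) v [:: (incl z, g)] - pkf (n + 1) v [:: (x, g)].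
    rewrite /kf -sumrB; apply: eq_bigr => p _.
    by rewrite !big_seq1 /mbeta /= mipBr (repD rep) -scaleN1r (repZ rep) scaleN1r hipBr.
  zabel.
apply: le_trans (cabsD _ _) _.
have -> : e * pkn (n + 1) v = e / 2 * pkn (n + 1) v + e / 2 * pkn (n + 1) v by rewrite -mulrDl -splitr.
apply: lerD; last exact: htau.
apply: le_trans (kf_cauchy_schwarz (PK _) _ _) _; rewrite mulrC; apply: ler_wpM2r; rewrite ?kn_ge0 //.
apply: (kn_sqr_le (PK _)); first exact: ltW.
rewrite /kf !big_seq1 /mbeta /= -/(vbeta sigma g (incl z - x) (incl z - x)) -(vknorm_sqr rep) lecR.
by apply: lerXn2r; rewrite ?nnegrE ?vknorm_ge0 // ltW.
Qed.

Section Approximant.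
Variables (h : H) (e d : R) (w : seq (X n * H)) (V : H -> seq (X 1 * H)).
Hypothesis hw : lapx n h e w.
Hypothesis e0 : 0 <= e.
Hypothesis d0 : 0 < d.
Hypothesis hV : forall g, lapx 1 g d (V g).
(** [w] stands for [T~_n^* h] and [V g] for [T~_1^* g], so this list stands for the image of
    [T~_n^* h] under [1 (x) T~_1^*]. *)
Definition step_list : seq (X n * X 1 * H) :=
  flatten [seq [seq (p.1, p'.1, p'.2) | p' <- V p.2] | p <- w].
Definition fst_sum : R := \sum_(p <- w) rnorm p.1.

(** By multiplicativity, [T~_(n+1)] after the projection is [T~_n (1 (x) T~_1)], so the adjoints
    compose. A test vector [u] is first replaced by a list [tau] of elementary tensors, with an
    error governed by [z], which is finally sent to 0. *)
Lemma step_apx : lapx (n + 1) h (e + fst_sum * d) (plist step_list).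
Proof.
move=> u; set N := pkn (n + 1) (tlist step_list); have N0 : 0 <= N by apply: kn_ge0.
have c0 : 0 <= fst_sum by apply: sumr_ge0 => p _; apply: rnorm_ge0.
apply: (@le_small _ _ _ (N + (e + fst_sum * d) + rnorm h)) => z z0 z1.
have [tau htau] := tlist_dense u z0; set I := map_fst _ in htau.
set Nt := pkn (n + 1) (tlist tau); have Nt0 : 0 <= Nt by apply: kn_ge0.
have NtE : Nt <= lkn (n + 1) u + z.
  have [->|ne] := eqVneq Nt 0; first by rewrite addr_ge0 ?kn_ge0 ?ltW.
  have Ntp : 0 < Nt by rewrite lt_neqAle eq_sym ne.
  rewrite -(ler_pM2l Ntp) -expr2 mulrDr [Nt * z]mulrC.
  have -> : Nt ^+ 2 = cabs (pkf (n + 1) (tlist tau) (tlist tau)).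
    by rewrite -(kn_sqr (PK _)) cabs_real ger0_norm ?sqr_ge0.
  have -> : pkf (n + 1) (tlist tau) (tlist tau) = pkf (n + 1) (tlist tau) (I u) -
      (pkf (n + 1) (tlist tau) (I u) - pkf (n + 1) (tlist tau) (tlist tau)) by zabel.
  apply: le_trans (cabsB _ _) _; apply: lerD; last exact: htau.
  by rewrite lkn_incl; apply: kf_cauchy_schwarz (PK _) _ _.
have QE : rnorm (Q (n + 1) u - Q (n + 1) (plist tau)) <= z.
  set rho := u ++ kscl (@mscl _ _ _) (-1) (plist tau).
  have -> : Q (n + 1) u - Q (n + 1) (plist tau) = Q (n + 1) rho.
    by rewrite ksum_cat (ksum_scl (@lvq_scl (n + 1))) scaleN1r.
  apply: le_trans (lv_contr _) _.
  have [->|ne] := eqVneq (lkn (n + 1) rho) 0; first exact: ltW.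
  have rp : 0 < lkn (n + 1) rho by rewrite lt_neqAle eq_sym ne kn_ge0.
  rewrite -(ler_pM2r rp) -expr2.
  have -> : lkn (n + 1) rho ^+ 2 = cabs (lkf (n + 1) rho rho).
    by rewrite -(kn_sqr (K _)) cabs_real ger0_norm ?sqr_ge0.
  rewrite {2}/rho kf_cat_r (kf_scl_r (K _)) mulN1r lkf_plist lkf_incl [leRHS](_ : _ = z * pkn (n + 1) (I rho)); first exact: htau.
  by rewrite lkn_incl.
have A4 : cabs (pkf (n + 1) (tlist step_list) (tlist tau) - lkf n w (tapp tau)) <= fst_sum * d * Nt.
  have -> : pkf (n + 1) (tlist step_list) (tlist tau) = \sum_(p <- w) lkf 1 (V p.2) (tcut p.1 tau).
    rewrite /tlist map_flatten -map_comp kf_flatten; apply: eq_bigr => p _; rewrite /= -map_comp /kf big_map.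
    apply: eq_bigr => p' _; rewrite !big_map; apply: eq_bigr => t _.
    by rewrite /mbeta /= mip_tens mip_incl -incl_lact mip_incl.
  have -> : lkf n w (tapp tau) = \sum_(p <- w) hip p.2 (Q 1 (tcut p.1 tau)).
    rewrite /kf; apply: eq_bigr => p _; rewrite /ksum hip_sumr !big_map; apply: eq_bigr => t _.
    by rewrite /mbeta /lvq /= (ccr_lact cc).
  rewrite -sumrB; apply: le_trans (cabs_sum _ _) _; rewrite /fst_sum !mulr_suml; apply: ler_sum => p _.
  apply: le_trans (hV _ _) _; rewrite [_ * d]mulrC -mulrA; apply: ler_wpM2l; [exact: ltW|exact: kn_tcut].
have A6 : cabs (lkf n w (tapp tau) - hip h (Q n (tapp tau))) <= e * Nt.
  by apply: le_trans (hw _) _; apply: ler_wpM2l => //; apply: kn_tapp.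
have A8 : cabs (hip h (Q (n + 1) (plist tau)) - hip h (Q (n + 1) u)) <= rnorm h * z.
  by rewrite -hipBr; apply: le_trans (hip_cauchy_schwarz _ _) _; apply: ler_wpM2l; rewrite ?rnorm_ge0 // rnorm_distC.
have A2 := htau (tlist step_list); rewrite -/N in A2.
have -> : lkf (n + 1) (plist step_list) u - hip h (Q (n + 1) u) =
  (pkf (n + 1) (tlist step_list) (I u) - pkf (n + 1) (tlist step_list) (tlist tau)) +
  ((pkf (n + 1) (tlist step_list) (tlist tau) - lkf n w (tapp tau)) +
   ((lkf n w (tapp tau) - hip h (Q n (tapp tau))) + (hip h (Q (n + 1) (plist tau)) - hip h (Q (n + 1) u)))).
  by rewrite lkf_plistl Q_plist; zabel.
have B1 := cabsD (lkf n w (tapp tau) - hip h (Q n (tapp tau))) (hip h (Q (n + 1) (plist tau)) - hip h (Q (n + 1) u)).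
have B2 := cabsD (pkf (n + 1) (tlist step_list) (tlist tau) - lkf n w (tapp tau))
   ((lkf n w (tapp tau) - hip h (Q n (tapp tau))) + (hip h (Q (n + 1) (plist tau)) - hip h (Q (n + 1) u))).
apply: le_trans (cabsD _ _) _.
have E0 : 0 <= e + fst_sum * d by rewrite addr_ge0 // mulr_ge0 // ltW.
have := ler_wpM2l E0 NtE.
move: A2 A4 A6 A8 B1 B2; lra.
Qed.

Lemma rnorm_T m (x : X m) g : rnorm (T x g) <= rnorm x * rnorm g.
Proof.
have := lv_contr [:: (x, g)]; rewrite /ksum big_seq1 => h1; apply: le_trans h1 _.
apply: (kn_sqr_le (K m)); first by rewrite mulr_ge0 ?rnorm_ge0.
rewrite /kf !big_seq1 /mbeta /= -/(vbeta sigma g x x) -(vknorm_sqr rep) lecR.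
by apply: lerXn2r; rewrite ?nnegrE ?vknorm_ge0 ?mulr_ge0 ?rnorm_ge0 // mulrC; apply: vknorm_le.
Qed.

Lemma step_ksum : rnorm (Q (n + 1) (plist step_list) - Q n [seq (p.1, lvP 1 p.2) | p <- w]) <= fst_sum * d.
Proof.
have -> : Q (n + 1) (plist step_list) = \sum_(p <- w) T p.1 (Q 1 (V p.2)).
  rewrite Q_plist /ksum big_map big_flatten /= big_map; apply: eq_bigr => p _.
  by rewrite big_map (linear_fun_sum (T_linear _)); apply: eq_bigr.
have -> : Q n [seq (p.1, lvP 1 p.2) | p <- w] = \sum_(p <- w) T p.1 (lvP 1 p.2) by rewrite /ksum big_map.
rewrite -sumrB; apply: le_trans (rnorm_sum _ _) _; rewrite /fst_sum mulr_suml; apply: ler_sum => p _.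
rewrite -(linear_funB (T_linear _)); apply: le_trans (rnorm_T _ _) _; apply: ler_wpM2l; rewrite ?rnorm_ge0 //.
exact: lvPP (ltW d0) (hV _).
Qed.

End Approximant.

(* With [P = T~_1 T~_1^*], [T~_n (1 (x) P) T~_n^* = T~_(n+1) T~_(n+1)^*]. *)
Lemma level_step h e w : 0 <= e -> lapx n h e w ->
  rnorm (Q n [seq (p.1, lvP 1 p.2) | p <- w] - lvP (n + 1) h) <= e.
Proof.
move=> e0 hw; apply: (@le_small _ _ _ (2 * fst_sum w)) => d d0 d1.
have [V hV] := choice (fun g => apx_exists (K 1) (@lvq_scl 1) (@lv_contr 1) g d0).
have c0 : 0 <= fst_sum w by apply: sumr_ge0 => p _; apply: rnorm_ge0.
have h1 := lvPP (addr_ge0 e0 (mulr_ge0 c0 (ltW d0))) (step_apx hw e0 d0 hV).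
have h2 := step_ksum w d0 hV.
set a := Q n _ in h2 *; set b := Q (n + 1) _ in h1 h2.
have -> : a - lvP (n + 1) h = (b - lvP (n + 1) h) - (b - a) by zabel.
apply: le_trans (rnormB _ _) _; lra.
Qed.

End Step.
End Levels.

Lemma geometric_small (R : realType) (q e : R) : 0 <= q -> q < 1 -> 0 < e -> exists N, q ^+ N <= e.
Proof.
move=> q0 q1 e0; have q1' : 0 < 1 - q by rewrite subr_gt0.
have [N hN] := archi_inv (1 - q)^-1 e0; exists N.+1; have := expr_lt1_small N.+1 q0 (ltW q1).
have h0 : 0 <= q ^+ N.+1 by apply: exprn_ge0.
move=> h1; apply: le_trans _ (hN N (leqnn _)); rewrite ler_pdivlMr ?ltr0Sn // -[leRHS]mul1r ler_pdivlMr //; lra.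
Qed.

Lemma all_flat (E : Type) (p : pred E) (ss : seq (seq E)) : all p (flatten ss) = all (all p) ss.
Proof. by elim: ss => //= u ss IHss; rewrite all_cat IHss. Qed.

(** * The defect and the dilation *)

Section Defect.
Variables (R : realType) (M : cstarAlgType R) (s : setting M) (X : subproduct s) (F : fock X).
Variables (H : hilbertType R) (T : forall n, X n -> H -> H).
Hypothesis cc : is_cc_rep T.
Notation sigma := (base_rep T).
Notation fin := (fock_in F).
Notation lkf n := (kf (mbeta sigma idfun (@mip R M (X n)))).
Notation lkn n := (kn (mbeta sigma idfun (@mip R M (X n)))).
Notation Q n := (ksum (@lvq _ _ _ X H T n)).
Notation lapx n := (apx (mbeta sigma idfun (@mip R M (X n))) (@lvq _ _ _ X H T n)).
Notation P := (lvP cc 1).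
Let rep : is_rep sigma := ccr_rep cc.
Let PI := pos_commutant_id sigma.
Let K n : is_kernel (mbeta sigma idfun (@mip R M (X n))) (@mscl R H (X n)) := list_kernel rep PI (X n).

Definition lvP_real n h := gram_op_real (K n) (@lvq_scl _ _ _ _ _ _ cc n) (@lv_contr _ _ _ _ _ _ cc n) (@lvPP _ _ _ _ _ _ cc n) h.
Definition lvP_le n h := gram_op_le (K n) (@lvq_scl _ _ _ _ _ _ cc n) (@lv_contr _ _ _ _ _ _ cc n) (@lvPP _ _ _ _ _ _ cc n) h.
Definition lvP_pos n h := gram_op_pos (K n) (@lvq_scl _ _ _ _ _ _ cc n) (@lv_contr _ _ _ _ _ _ cc n) (@lvPP _ _ _ _ _ _ cc n) h.
Definition lvP_sym n h k := gram_op_sym (K n) (@lvq_scl _ _ _ _ _ _ cc n) (@lv_contr _ _ _ _ _ _ cc n) (@lvPP _ _ _ _ _ _ cc n) h k.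
Definition lvP_sqr_le n h := gram_op_sqr_le (K n) (@lvq_scl _ _ _ _ _ _ cc n) (@lv_contr _ _ _ _ _ _ cc n) (@lvPP _ _ _ _ _ _ cc n) h.
Definition lvP_lin n := gram_op_lin (K n) (@lvq_scl _ _ _ _ _ _ cc n) (@lv_contr _ _ _ _ _ _ cc n) (@lvPP _ _ _ _ _ _ cc n).

Lemma rnorm_lvP n h : rnorm (lvP cc n h) <= rnorm h.
Proof.
apply: le_of_sqr; first exact: rnorm_ge0.
exact: le_trans (lvP_sqr_le n h) (lvP_le n h).
Qed.

(** [1 - P^2] is positive and commutes with [sigma]; the value of its form at [w] is the difference
    of the two square norms. *)
Lemma kn_map_lvP n (w : seq (X n * H)) : lkn n [seq (p.1, P p.2) | p <- w] <= lkn n w.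
Proof.
pose D h := h - P (P h).
have PD : pos_commutant sigma D.
  split.
  - by move=> k x y; rewrite /D !(lvP_lin 1) scalerBr; zabel.
  - by move=> x y; rewrite /D hipBl hipBr (lvP_sym 1 (P x)) (lvP_sym 1 x).
  - move=> x; rewrite /D hipBr -(lvP_sym 1) !hip_sqr -[0]/(0%:C) -rmorphB lecR subr_ge0.
    by apply: lerXn2r; rewrite ?nnegrE ?rnorm_ge0 // rnorm_lvP.
  - by move=> a x; rewrite /D !lvP_comm (linear_funB (rep_lin rep a)).
have := kernel_pos (list_kernel rep PD (X n)) w.
have -> : kf (mbeta sigma D (@mip R M (X n))) w w = lkf n w w - lkf n [seq (p.1, P p.2) | p <- w] [seq (p.1, P p.2) | p <- w].
  rewrite /kf big_map -sumrB; apply: eq_bigr => p _; rewrite big_map -sumrB; apply: eq_bigr => q _.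
  by rewrite /mbeta /= /D (linear_funB (rep_lin rep _)) hipBr (lvP_sym 1) lvP_comm.
rewrite -!(kn_sqr (K n)) -rmorphB lecR subr_ge0 => h.
exact: le_of_sqr (kn_ge0 _ _) h.
Qed.

Variable r : R.
Hypothesis r0 : 0 <= r.
Hypothesis r1 : r < 1.

Definition defect (h : H) : H := h - (r ^+ 2)%:C *: P h.

Let r2 : r ^+ 2 <= 1. Proof. by apply: exprn_ile1 => //; apply: ltW. Qed.

Lemma defect_commutant : pos_commutant sigma defect.
Proof.
split.
- move=> k x y; rewrite /defect (lvP_lin 1) scalerDr !scalerA [_ * k]mulrC -scalerA scalerBr; zabel.
- by move=> x y; rewrite /defect hipBl hipBr hipZl hipZr (lvP_sym 1) conjc_real.
- move=> x; rewrite /defect hipBr hipZr hip_sqr (lvP_real 1) -RCM -[0]/(0%:C) -rmorphB lecR.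
  have := lvP_le 1 x; have := Re_ge0 (lvP_pos 1 x); have := sqr_ge0 r; move: r2.
  set a := complex.Re _; set b := r ^+ 2; set c := rnorm x ^+ 2; nra.
- move=> a x; by rewrite /defect lvP_comm (linear_funB (rep_lin rep a)) (linear_funZ (rep_lin rep a)).
Qed.

Notation PD := defect_commutant.
Notation fkf := (kf (mbeta sigma defect (@mip R M F))).
Notation fkn := (kn (mbeta sigma defect (@mip R M F))).

(** [Q] is given by a formula on homogeneous vectors, so the terms of formal sums are [x (x) h] with
    [x] in some [X n]; [emb] places them over the Fock module, where the operators act. *)
Definition emb (p : {n & X n} * H) : F * H := (fin (projT2 p.1), p.2).
Definition dbeta (p q : {n & X n} * H) : R[i] := mbeta sigma defect (@mip R M F) (emb p) (emb q).
Definition dscl (k : R[i]) (p : {n & X n} * H) : {n & X n} * H := (p.1, k *: p.2).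
Definition dq (p : {n & X n} * H) : H := (r ^+ projT1 p.1)%:C *: T (projT2 p.1) (defect p.2).
Notation dkf := (kf dbeta).
Notation dkn := (kn dbeta).
Notation QD := (ksum dq).

Lemma dkf_emb u v : dkf u v = fkf (map emb u) (map emb v).
Proof. by rewrite /kf big_map; apply: eq_bigr => p _; rewrite big_map. Qed.
Lemma dkn_emb u : dkn u = fkn (map emb u).
Proof. by rewrite /kn dkf_emb. Qed.

Lemma dkernel : is_kernel dbeta dscl.
Proof.
have FK := list_kernel rep PD F; split.
- by move=> p q; apply: (kernel_herm FK).
- by move=> k p q; exact: (kernel_scl FK k (emb p) (emb q)).
- by move=> u; rewrite dkf_emb; apply: (kernel_pos FK).
Qed.

Lemma dq_scl k p : dq (dscl k p) = k *: dq p.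
Proof.
rewrite /dq /= (linear_funZ (pc_lin PD)) (linear_funZ (T_linear cc _)) !scalerA; congr (_ *: _).
exact: mulrC.
Qed.

Section Telescope.
Variables (h : H) (N : nat) (e : R) (w : forall n, seq (X n * H)).
Hypothesis hw : forall n, lapx n h e (w n).
Hypothesis e0 : 0 < e.
Hypothesis e1 : e <= 1.

(** [Q^* h] has the component [r^n T~_n^* h] in degree [n], since [defect] is already part of the
    inner product. Here [w n] approximates [T~_n^* h], and the degrees from [N] on are cut off. *)
Definition dlist : seq ({n & X n} * H) :=
  flatten [seq [seq (existT _ n p.1, (r ^+ n)%:C *: p.2) | p <- w n] | n <- index_iota 0 N].

Lemma dlist_kf1 q : (projT1 q.1 < N)%N ->
  dkf dlist [:: q] = (r ^+ projT1 q.1)%:C * lkf (projT1 q.1) (w (projT1 q.1)) [:: (projT2 q.1, defect q.2)].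
Proof.
case: q => [[m y] g] /= mN; rewrite /dlist kf_flatten (bigD1_seq m) ?mem_index_iota ?iota_uniq //= [X in _ + X]big1_seq ?addr0.
  rewrite /kf big_map mulr_sumr; apply: eq_bigr => p _.
  by rewrite !big_seq1 /dbeta /mbeta /= fock_isom hipZl conjc_real.
move=> n /andP[nm _]; rewrite /kf big_map; apply: big1 => p _.
by rewrite big_seq1 /dbeta /mbeta /= fock_orth // (rep0 rep) hip0r.
Qed.

Lemma dlist_kf u : all (fun q => projT1 q.1 < N)%N u ->
  dkf dlist u = \sum_(q <- u) (r ^+ projT1 q.1)%:C * lkf (projT1 q.1) (w (projT1 q.1)) [:: (projT2 q.1, defect q.2)].
Proof.
elim: u => [|q u IHu] /=; first by rewrite kf_nil big_nil.
by move=> /andP[qN uN]; rewrite big_cons -IHu // -dlist_kf1 // -kf_cat_r.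
Qed.

Lemma dlist_ksum : QD dlist = \sum_(0 <= n < N) (r ^+ (n + n))%:C *: (Q n (w n) - (r ^+ 2)%:C *: Q n [seq (p.1, P p.2) | p <- w n]).
Proof.
rewrite /ksum big_flatten /= big_map; apply: eq_bigr => n _.
rewrite !big_map scaler_sumr -sumrB scaler_sumr; apply: eq_bigr => p _.
rewrite /dq /lvq /= (linear_funZ (pc_lin PD)) (linear_funZ (T_linear cc _)) scalerA -RCM -exprD.
by rewrite /defect (linear_funB (T_linear cc _)) (linear_funZ (T_linear cc _)).
Qed.

Lemma dlist_sqr : dkf dlist dlist = \sum_(0 <= n < N) (r ^+ (n + n))%:C * (lkf n (w n) (w n) - (r ^+ 2)%:C * lkf n (w n) [seq (p.1, P p.2) | p <- w n]).
Proof.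
rewrite dlist_kf; last first.
  rewrite /dlist all_flat all_map; apply/allP => n; rewrite mem_index_iota => /andP[_ nN] /=.
  by rewrite all_map; elim: (w n) => //= p v ->; rewrite nN.
rewrite {1}/dlist big_flatten /= big_map; apply: eq_bigr => n _.
rewrite big_map /= exprD RCM -mulrA -mulr_sumr; congr (_ * _).
have aux v : lkf n (w n) v = \sum_(p <- v) lkf n (w n) [:: p].
  by elim: v => [|p v IHv]; rewrite ?kf_nil ?big_nil // big_cons -IHv -kf_cat_r.
rewrite !aux big_map mulr_sumr -sumrB mulr_sumr; apply: eq_bigr => p _.
rewrite /kf mulr_sumr -sumrB mulr_sumr; apply: eq_bigr => p' _; rewrite !big_seq1 /mbeta /=.
rewrite (linear_funZ (pc_lin PD)) (linear_funZ (rep_lin rep _)) hipZr /defect (linear_funB (rep_lin rep _)) hipBr.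
by rewrite (linear_funZ (rep_lin rep _)) hipZr.
Qed.

Let lapx_P n : rnorm (Q n (w n) - lvP cc n h) <= e.
Proof. exact: lvPP (ltW e0) (@hw n). Qed.
Let lapx_PP n : rnorm (Q n [seq (p.1, P p.2) | p <- w n] - lvP cc n.+1 h) <= e.
Proof. by have := level_step cc (ltW e0) (@hw n); rewrite addn1. Qed.

Lemma telescope (V : lmodType R[i]) (f : nat -> V) :
  \sum_(0 <= n < N) (r ^+ (n + n))%:C *: (f n - (r ^+ 2)%:C *: f n.+1) = f 0%N - (r ^+ (N + N))%:C *: f N.
Proof.
elim: N => [|m IHm]; first by rewrite big_geq // expr0 scale1r subrr.
rewrite big_nat_recr //= IHm scalerBr scalerA -RCM -exprD addn2 -addSnnS addSn; zabel.
Qed.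

(** Write [P_n] for [lvP cc n]. The term of degree [n] differs from [r^(2n) (P_n h - r^2 P_(n+1) h)]
    by at most [(1 + r^2) e <= 2 e], and these expressions telescope, starting from [P_0 h = h]. *)
Lemma dlist_ksum_close : rnorm (QD dlist - (h - (r ^+ (N + N))%:C *: lvP cc N h)) <= N%:R * 2 * e.
Proof.
rewrite -{1}(lvP0 cc h) -(telescope (fun n => lvP cc n h)) dlist_ksum -sumrB; apply: le_trans (rnorm_sum _ _) _.
have -> : N%:R * 2 * e = \sum_(0 <= n < N) (2 * e) by rewrite sumr_const_nat subn0 -[RHS]mulr_natl; ring.
apply: ler_sum => n _; rewrite -scalerBr rnormZ cabs_real ger0_norm ?exprn_ge0 //.
have rn : r ^+ (n + n) <= 1 by apply: exprn_ile1 => //; apply: ltW.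
apply: le_trans (ler_wpM2r (rnorm_ge0 _) rn) _; rewrite mul1r.
set a := Q n (w n); set b := Q n _; have -> : a - (r ^+ 2)%:C *: b - (lvP cc n h - (r ^+ 2)%:C *: lvP cc n.+1 h) =
  (a - lvP cc n h) - (r ^+ 2)%:C *: (b - lvP cc n.+1 h) by rewrite scalerBr; zabel.
apply: le_trans (rnormB _ _) _; rewrite rnormZ cabs_real ger0_norm ?sqr_ge0 //.
have h1 := lapx_P n; have h2 := lapx_PP n; rewrite -/a in h1; rewrite -/b in h2.
have := r2; have := sqr_ge0 r; move: h1 h2; have := rnorm_ge0 (b - lvP cc n.+1 h).
set x := r ^+ 2; set y := rnorm (b - _); nra.
Qed.

(** The same telescoping under [<h, .>]; the remainder [- r^(2N) <h, P_N h>] is nonpositive and is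
    dropped. Each of the two inner products in a term is off by at most [(2 |h| + 1) e]. *)
Lemma dlist_sqr_le : complex.Re (dkf dlist dlist) <= rnorm h ^+ 2 + N%:R * (4 * rnorm h + 2) * e.
Proof.
have h0 := rnorm_ge0 h.
have close : cabs (dkf dlist dlist - (hip h h - (r ^+ (N + N))%:C * hip h (lvP cc N h))) <= N%:R * (4 * rnorm h + 2) * e.
  have <- : hip h (lvP cc 0 h - (r ^+ (N + N))%:C *: lvP cc N h) = hip h h - (r ^+ (N + N))%:C * hip h (lvP cc N h).
    by rewrite lvP0 hipBr hipZr.
  rewrite -(telescope (fun n => lvP cc n h)) dlist_sqr hip_sumr -sumrB; apply: le_trans (cabs_sum _ _) _.
  have -> : N%:R * (4 * rnorm h + 2) * e = \sum_(0 <= n < N) ((4 * rnorm h + 2) * e) by rewrite sumr_const_nat subn0 -[RHS]mulr_natl; ring.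
  apply: ler_sum => n _; rewrite hipZr -mulrBr cabsM cabs_real ger0_norm ?exprn_ge0 //.
  have rn : r ^+ (n + n) <= 1 by apply: exprn_ile1 => //; apply: ltW.
  apply: le_trans (ler_wpM2r (cabs_ge0 _) rn) _; rewrite mul1r hipBr hipZr.
  set a := lkf n _ _; set b := lkf n _ _.
  have -> : a - (r ^+ 2)%:C * b - (hip h (lvP cc n h) - (r ^+ 2)%:C * hip h (lvP cc n.+1 h)) =
    (a - hip h (lvP cc n h)) - (r ^+ 2)%:C * (b - hip h (lvP cc n.+1 h)) by rewrite mulrBr; zabel.
  apply: le_trans (cabsB _ _) _; rewrite cabsM cabs_real ger0_norm ?sqr_ge0 //.
  have kw : lkn n (w n) <= rnorm h + e := apx_kn (K n) (@lv_contr _ _ _ _ _ _ cc n) (ltW e0) (@hw n).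
  have bnd u k : lkn n u <= rnorm h + e -> rnorm (Q n u - k) <= e -> cabs (lkf n (w n) u - hip h k) <= (2 * rnorm h + 1) * e.
    move=> hu uk; have -> : lkf n (w n) u - hip h k = (lkf n (w n) u - hip h (Q n u)) + hip h (Q n u - k).
      by rewrite hipBr; zabel.
    apply: le_trans (cabsD _ _) _; have := @hw n u; have := hip_cauchy_schwarz h (Q n u - k).
    have := ler_wpM2l h0 uk; have := ler_wpM2l (ltW e0) hu; have : e * e <= e by rewrite ger_pMr.
    rewrite mulrDr; lra.
  have h1 : cabs (a - hip h (lvP cc n h)) <= (2 * rnorm h + 1) * e by apply: bnd.
  have h2 : cabs (b - hip h (lvP cc n.+1 h)) <= (2 * rnorm h + 1) * e.
    by apply: bnd => //; apply: le_trans (kn_map_lvP _) kw.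
  have := r2; have := sqr_ge0 r; move: h1 h2; have := cabs_ge0 (b - hip h (lvP cc n.+1 h)).
  set x := r ^+ 2; set y := cabs (b - _); nra.
move: close; rewrite (lvP_real N) hip_sqr -RCM -rmorphB => close.
have hr := le_trans (cabs_ge_Re _) close; rewrite raddfB /= in hr.
have := ler_norm (complex.Re (dkf dlist dlist) - (rnorm h ^+ 2 - r ^+ (N + N) * complex.Re (hip h (lvP cc N h)))).
have : 0 <= r ^+ (N + N) * complex.Re (hip h (lvP cc N h)) by rewrite mulr_ge0 ?exprn_ge0 //; apply/Re_ge0/lvP_pos.
lra.
Qed.

End Telescope.

Let pick_apx h e (e0 : 0 < e) : exists w : forall n, seq (X n * H), forall n, lapx n h e (w n).
Proof.
have ex n := apx_exists (K n) (@lvq_scl _ _ _ _ _ _ cc n) (@lv_contr _ _ _ _ _ _ cc n) h e0.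
by exists (fun n => sval (cid (ex n))) => n; apply: (svalP (cid (ex n))).
Qed.

(** By duality it suffices that [Q^* h] has norm at most [|h|], which is [dlist_sqr_le] up to a
    small error. The terms of [u] have bounded degree, so a truncation [dlist] represents [<h, Q .>]
    on [u]. *)
Lemma dq_contr u : rnorm (QD u) <= dkn u.
Proof.
suff hh h : cabs (hip h (QD u)) <= rnorm h * dkn u.
  have [->|ne] := eqVneq (rnorm (QD u)) 0; first exact: kn_ge0.
  have p0 : 0 < rnorm (QD u) by rewrite lt_neqAle eq_sym ne rnorm_ge0.
  by have := hh (QD u); rewrite hip_sqr cabs_real ger0_norm ?sqr_ge0 // expr2 ler_pM2l.
have [h0|ne] := eqVneq (rnorm h) 0; first by rewrite (rnorm_eq0 h0) hip0l cabs0 mulr_ge0 ?rnorm_ge0 ?kn_ge0.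
have hp : 0 < rnorm h by rewrite lt_neqAle eq_sym ne rnorm_ge0.
have [N hN] : exists N, all (fun q => projT1 q.1 < N)%N u.
  elim: u => [|q u [N hN]]; first by exists 0%N.
  exists (maxn N (projT1 q.1).+1); rewrite /= leq_maxr /=.
  by apply: sub_all hN => p pN; rewrite leq_max pN.
pose c (q : {n & X n} * H) := lkn (projT1 q.1) [:: (projT2 q.1, defect q.2)].
set C := N%:R * (4 * rnorm h + 2).
apply: (@le_small _ _ _ (C / rnorm h * dkn u + \sum_(q <- u) c q)) => e e0 e1.
have [w hw] := pick_apx h e0; set W := dlist N w.
have kW : dkn W <= rnorm h + C / rnorm h * e.
  have Ce : 0 <= C / rnorm h * e by rewrite mulr_ge0 ?divr_ge0 ?mulr_ge0 ?addr_ge0 ?ler0n ?rnorm_ge0 // ?mulr_ge0 ?rnorm_ge0 ?ltW.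
  apply: le_of_sqr; first by rewrite addr_ge0 ?rnorm_ge0.
  have -> : dkn W ^+ 2 = complex.Re (dkf W W) by rewrite -(kn_sqr dkernel).
  apply: le_trans (dlist_sqr_le N hw e0 e1) _; rewrite -/C sqrrD.
  have -> : rnorm h * (C / rnorm h * e) *+ 2 = C * e + C * e.
    by rewrite mulrA [rnorm h * _]mulrC divfK ?gt_eqF // mulr2n.
  have := sqr_ge0 (C / rnorm h * e); have : 0 <= C * e.
    by rewrite mulr_ge0 ?mulr_ge0 ?addr_ge0 ?ler0n ?rnorm_ge0 // ?mulr_ge0 ?rnorm_ge0 ?ltW.
  lra.
have h1 : cabs (dkf W u - hip h (QD u)) <= \sum_(q <- u) c q * e.
  rewrite (dlist_kf w hN) /ksum hip_sumr -sumrB; apply: le_trans (cabs_sum _ _) _.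
  apply: ler_sum => q _; rewrite /dq hipZr -mulrBr cabsM cabs_real ger0_norm ?exprn_ge0 //.
  have rn : r ^+ projT1 q.1 <= 1 by apply: exprn_ile1 => //; apply: ltW.
  apply: le_trans (ler_wpM2r (cabs_ge0 _) rn) _; rewrite mul1r mulrC.
  by have := @hw (projT1 q.1) [:: (projT2 q.1, defect q.2)]; rewrite /ksum big_seq1.
have -> : hip h (QD u) = dkf W u - (dkf W u - hip h (QD u)) by zabel.
apply: le_trans (cabsB _ _) _.
have h2 := kf_cauchy_schwarz dkernel W u.
have h3 := ler_wpM2r (kn_ge0 dbeta u) kW.
rewrite -mulr_suml in h1; rewrite mulrDl in h3; rewrite mulrDl addrA.
have -> : C / rnorm h * dkn u * e = C / rnorm h * e * dkn u by rewrite mulrAC.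
lra.
Qed.

(** By [gram_op_id_of_range] it suffices that [|h|^2 <= <h, P' h>]. For a truncation [W] of [Q^* h],
    [|h|^2] is nearly [<h, Q W>], whose square is at most [<h, P' h> |W|^2], and [|W|^2] exceeds
    [|h|^2] by little. *)
Lemma dgram_id P' : is_gram_op dbeta dq P' -> forall h, P' h = h.
Proof.
move=> hP h; have h0 := rnorm_ge0 h.
apply: (gram_op_id_of_range dkernel dq_scl dq_contr hP).
set a := complex.Re _; have a0 : 0 <= a by apply/Re_ge0/(gram_op_pos dkernel dq_scl dq_contr hP).
have aH : a <= rnorm h ^+ 2 := gram_op_le dkernel dq_scl dq_contr hP h.
set H2 := rnorm h ^+ 2 in aH *; have H0 : 0 <= H2 by apply: sqr_ge0.
suff : H2 ^+ 2 <= a * H2.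
  have [e _|ne] := eqVneq H2 0; first by rewrite e.
  by rewrite expr2 ler_pM2r // lt_neqAle eq_sym ne.
apply: (@le_small _ _ _ (a + 2 * (H2 + 1) ^+ 2 + (H2 + 1) ^+ 2)) => t t0 t1.
(* Here [r < 1] enters: [N] makes the factor of the telescoping remainder at most [t]. *)
have [N hN] := geometric_small r0 r1 t0.
have rN : r ^+ (N + N) <= t.
  apply: le_trans hN; rewrite exprD -[leRHS]mulr1; apply: ler_wpM2l; first exact: exprn_ge0.
  by apply: exprn_ile1 => //; apply: ltW.
have N0 : 0 <= N%:R :> R by apply: ler0n.
set C := N%:R * (4 * rnorm h + 2); have C0 : 0 <= C by rewrite /C; nra.
(* [B] exceeds the factor of [e] in [dlist_sqr_le] and [rnorm h] times the factor of [e] in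
   [dlist_ksum_close], so that [e = t / B] keeps both errors below [t]. *)
set B := C + N%:R * 2 * rnorm h + 1.
have D0 : 0 <= N%:R * 2 * rnorm h by rewrite !mulr_ge0.
have B0 : 0 < B by rewrite /B; lra.
have B1 : 1 <= B by rewrite /B; lra.
set e := t / B; have e0 : 0 < e by apply: divr_gt0.
have e1 : e <= 1 by rewrite /e ler_pdivrMr // mul1r; lra.
have eB : e * B = t by rewrite /e divfK // gt_eqF.
have [w hw] := pick_apx h e0; set W := dlist N w.
set x := cabs (hip h (QD W)); have x0 : 0 <= x by apply: cabs_ge0.
have hx1 : x ^+ 2 <= a * (H2 + t).
  apply: le_trans (gram_op_cauchy dkernel dq_scl dq_contr hP h W) _; apply: ler_wpM2l => //.
  have -> : dkn W ^+ 2 = complex.Re (dkf W W) by rewrite -(kn_sqr dkernel).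
  apply: le_trans (dlist_sqr_le N hw e0 e1) _; rewrite lerD2l -/C -eB /B.
  by have := mulr_ge0 (ltW e0) D0; nra.
have hx2 : H2 <= x + t * (H2 + 1).
  have e2 : H2 = cabs (hip h h) by rewrite hip_sqr cabs_real ger0_norm.
  rewrite [leLHS]e2.
  set y := QD W - (h - (r ^+ (N + N))%:C *: lvP cc N h).
  have {1}-> : hip h h = hip h (QD W) - (hip h y - (r ^+ (N + N))%:C * hip h (lvP cc N h)).
    by rewrite /y !hipBr hipZr; zabel.
  apply: le_trans (cabsB _ _) _; rewrite lerD2l; apply: le_trans (cabsB _ _) _.
  rewrite cabsM cabs_real ger0_norm ?exprn_ge0 //.
  have q1 := hip_cauchy_schwarz h y; have q2 := hip_cauchy_schwarz h (lvP cc N h).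
  have q3 := ler_wpM2l h0 (rnorm_lvP N h); rewrite -expr2 -/H2 in q3.
  have q4 := ler_wpM2l h0 (dlist_ksum_close N hw e0); rewrite -/y in q4.
  have q5 : rnorm h * (N%:R * 2 * e) <= t.
    by rewrite -eB /B; have := mulr_ge0 (ltW e0) C0; nra.
  have q6 : r ^+ (N + N) * cabs (hip h (lvP cc N h)) <= t * H2.
    by apply: ler_pM; rewrite ?exprn_ge0 ?cabs_ge0 //; apply: le_trans q2 q3.
  lra.
set S := H2 + 1 in hx2 *; have S1 : 1 <= S by rewrite /S; lra.
have xS : x <= S.
  apply: le_of_sqr; first by lra.
  apply: le_trans hx1 _; rewrite expr2; apply: ler_pM => //; rewrite /S; lra.
have s1 : H2 ^+ 2 <= (x + t * S) ^+ 2 by apply: lerXn2r; rewrite ?nnegrE // addr_ge0 // mulr_ge0 // ?ltW //; lra.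
apply: le_trans s1 _; rewrite sqrrD.
have s2 : x * (t * S) <= t * S ^+ 2 by rewrite mulrCA expr2; apply: ler_wpM2l; [exact: ltW|apply: ler_wpM2r => //; lra].
have s3 : (t * S) ^+ 2 <= t * S ^+ 2.
  by rewrite exprMn; apply: ler_wpM2r; [exact: sqr_ge0|rewrite expr2 ger_pMr].
rewrite mulr2n; move: hx1 s2 s3; rewrite mulrDr; set u := S ^+ 2; lra.
Qed.

(** As [Q Q^* = 1], the adjoint [Q^*] preserves inner products; here for approximants. *)
Lemma dapx_form h k e d v w : 0 <= e -> 0 <= d -> apx dbeta dq h e v -> apx dbeta dq k d w ->
  cabs (dkf v w - hip h k) <= e * (rnorm k + d) + rnorm h * d.
Proof.
move=> e0 d0 hv hw; have [P' hP] := gram_op_exists dkernel dq_scl dq_contr.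
by rewrite -{1}(dgram_id hP k); apply: (apx_form dkernel dq_contr hP).
Qed.

End Defect.

(** * Matrices of operators acting on tuples *)

Definition coord (V : zmodType) (k : nat) (i : 'I_k) (x : V) : 'I_k -> V := fun j => if j == i then x else 0.

Section TupleLists.
Variables (R : realType) (M : cstarAlgType R) (H : hilbertType R) (sigma : M -> H -> H).
Hypothesis rep : is_rep sigma.
Variable D : H -> H.
Hypothesis PD : pos_commutant sigma D.
Variables (F : hilbertModType M) (k : nat).
Notation fkf := (kf (mbeta sigma D (@mip R M F))).
Notation tkf := (kf (mbeta sigma D (@ipn R M F (@mip R M F) k))).
Notation tkn := (kn (mbeta sigma D (@ipn R M F (@mip R M F) k))).

(** A [k]-tuple of elements of [F (x) H] as one element of [F^k (x) H], on which a matrix of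
    operators acts as a single module map. Bounds and positivity of matrices thereby become those of
    one operator. *)
Definition tuple_list (v : 'I_k -> seq (F * H)) : seq (('I_k -> F) * H) :=
  flatten [seq map_fst (coord i) (v i) | i <- enum 'I_k].

Lemma tuple_kernel : is_kernel (mbeta sigma D (@ipn R M F (@mip R M F) k)) (@mscl R H _).
Proof. exact: (module_kernel rep PD (tuple_prehilbert F k)). Qed.

Lemma ipn_coord (i : 'I_k) x (y : 'I_k -> F) : ipn (@mip R M F) (coord i x) y = mip x (y i).
Proof.
rewrite /ipn (bigD1 i) //= /coord eqxx big1 ?addr0 // => j /negbTE ji.
by rewrite ji mip0l.
Qed.

Lemma mxapp_coord (a : 'M[F -> F]_k) i j y : (forall i j, linear (a i j)) -> mxapp a (coord j y) i = a i j y.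
Proof.
move=> la; rewrite /mxapp (bigD1 j) //= /coord eqxx big1 ?addr0 // => l /negbTE lj.
by rewrite lj (linear_fun0 (la i l)).
Qed.

Lemma tuple_kf (v w : 'I_k -> seq (F * H)) (L : ('I_k -> F) -> 'I_k -> F) :
  tkf (tuple_list v) (map_fst L (tuple_list w)) =
  \sum_i \sum_j fkf (v i) (map_fst (fun y => L (coord j y) i) (w j)).
Proof.
rewrite /tuple_list kf_flatten big_enum /=; apply: eq_bigr => i _.
rewrite /map_fst map_flatten -map_comp [LHS]/kf big_map.
under eq_bigr => p _ do rewrite big_flatten big_map big_enum /=.
rewrite exchange_big; apply: eq_bigr => j _; rewrite /kf; apply: eq_bigr => p _.
rewrite -map_comp !big_map; apply: eq_bigr => q _.
by rewrite /mbeta /= ipn_coord.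
Qed.

Lemma mxapp_tuple_kf (v w : 'I_k -> seq (F * H)) (a : 'M[F -> F]_k) : (forall i j, linear (a i j)) ->
  tkf (tuple_list v) (map_fst (mxapp a) (tuple_list w)) = \sum_i \sum_j fkf (v i) (map_fst (a i j) (w j)).
Proof.
move=> la; rewrite tuple_kf; apply: eq_bigr => i _; apply: eq_bigr => j _.
by congr (fkf _ _); apply: eq_map => q; rewrite mxapp_coord.
Qed.

Lemma tuple_kf_id (v w : 'I_k -> seq (F * H)) : tkf (tuple_list v) (tuple_list w) = \sum_i fkf (v i) (w i).
Proof.
have -> : tuple_list w = map_fst id (tuple_list w) by rewrite /map_fst -[LHS]map_id; apply: eq_map => -[].
rewrite tuple_kf; apply: eq_bigr => i _; rewrite (bigD1 i) //= [X in _ + X]big1 ?addr0.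
  by congr (fkf _ _); rewrite /map_fst -[RHS]map_id; apply: eq_map => -[x y] /=; rewrite /coord eqxx.
move=> j /negbTE ji; rewrite /kf; apply: big1 => p _; rewrite big_map; apply: big1 => q _.
by rewrite /mbeta /= /coord eq_sym ji mip0r (rep0 rep) hip0r.
Qed.

Lemma tuple_bounded (a : 'M[F -> F]_k) (c : R) u : 0 <= c -> (forall i j, adjointable (@mip R M F) (a i j)) ->
  mxnorm_le (@mip R M F) a c%:C -> tkn (map_fst (mxapp a) u) <= c * tkn u.
Proof.
move=> c0 ha hc; apply: (kn_sqr_le tuple_kernel); first by rewrite mulr_ge0 ?kn_ge0.
rewrite exprMn RCM (kn_sqr tuple_kernel).
have la i j := adjointable_lin (ha i j).
apply: (@module_bounded _ _ _ _ rep _ PD _ _ _ _ _ _ (mxapp a) (c ^+ 2) u (tuple_prehilbert F k) (tuple_prehilbert F k)).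
- move=> x b; apply/funext => i; rewrite /mxapp /tra /ura.
  rewrite (big_morph (fun z => ract z b.1) (fun u v => ractDl u v b.1) (ract0l _ b.1)) scaler_sumr -big_split.
  apply: eq_bigr => j _; rewrite (linear_funD (la i j)) (linear_funZ (la i j)) adjointable_ract //.
- move=> x y; apply/funext => i; rewrite /mxapp !fctE -big_split; apply: eq_bigr => j _.
  exact: linear_funD (la i j) _ _.
- apply/funext => i; rewrite /mxapp; apply: big1 => j _; exact: linear_fun0 (la i j).
- exact: sqr_ge0.
- by move=> x; rewrite -lecR RCM rmorphXn -!rnormE; apply: hc.
Qed.

Lemma tuple_form_bound (a : 'M[F -> F]_k) (c : R) v w : 0 <= c -> (forall i j, adjointable (@mip R M F) (a i j)) ->
  mxnorm_le (@mip R M F) a c%:C ->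
  cabs (\sum_i \sum_j fkf (v i) (map_fst (a i j) (w j))) *+ 2 <=
  complex.Re (\sum_i fkf (v i) (v i)) + c ^+ 2 * complex.Re (\sum_i fkf (w i) (w i)).
Proof.
move=> c0 ha hc; rewrite -mxapp_tuple_kf; last by move=> i j; apply: adjointable_lin.
rewrite -!tuple_kf_id -!(kn_sqr tuple_kernel) /=.
have h1 := kf_cauchy_schwarz tuple_kernel (tuple_list v) (map_fst (mxapp a) (tuple_list w)).
have h2 := ler_wpM2l (kn_ge0 (mbeta sigma D (@ipn R M F (@mip R M F) k)) (tuple_list v)) (tuple_bounded (tuple_list w) c0 ha hc).
have := sqr_ge0 (tkn (tuple_list v) - c * tkn (tuple_list w)).
rewrite mulr2n sqrrB exprMn mulr2n; lra.
Qed.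

Lemma tuple_form_pos (a b : 'M[F -> F]_k) w : (forall i j, adjointable (@mip R M F) (b i j)) ->
  (forall i j, a i j = \sum_l (adj (@mip R M F) (b l i) \o b l j)) ->
  0 <= \sum_i \sum_j fkf (w i) (map_fst (a i j) (w j)).
Proof.
move=> hb ha; rewrite -mxapp_tuple_kf; last first.
  move=> i j c x y; rewrite ha !fct_sumE scaler_sumr -big_split; apply: eq_bigr => l _ /=.
  by rewrite (adjointable_lin (hb l j)) (adjointable_lin (adjointable_adj (hb l i))).
have := kernel_pos tuple_kernel (map_fst (mxapp b) (tuple_list w)).
congr (0 <= _); rewrite /kf big_map; apply: eq_bigr => p _; rewrite !big_map; apply: eq_bigr => q _.
rewrite /mbeta /=; congr (hip _ (sigma _ _)); rewrite /ipn /mxapp.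
under eq_bigr => l _ do rewrite mip_suml.
rewrite exchange_big; apply: eq_bigr => i _ /=.
under eq_bigr => l _ do rewrite mip_adj // (linear_fun_sum (adjointable_lin (adjointable_adj (hb _ _)))).
rewrite -mip_sumr exchange_big; congr mip; apply: eq_bigr => j _ /=.
by rewrite ha fct_sumE.
Qed.

End TupleLists.

Lemma nonneg_limit (R : realType) (z : R[i]) : (forall e : R, 0 < e -> e <= 1 -> exists2 t, 0 <= t & cabs (z - t) <= e) -> 0 <= z.
Proof.
move=> h; rewrite lecE /=.
have hh e : 0 < e -> e <= 1 -> `|complex.Im z| <= 0 + 1 * e /\ - complex.Re z <= 0 + 1 * e.
  move=> e0 e1; have [t t0 zt] := h e e0 e1; rewrite add0r mul1r.
  have r0 := Re_ge0 t0; rewrite (cabs_ge0_Re t0) in zt.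
  have := le_trans (cabs_ge_Re _) zt; have := le_trans (cabs_ge_Im _) zt.
  rewrite !raddfB /= subr0 => hi hr; split=> //.
  by have := ler_norm (- (complex.Re z - complex.Re t)); rewrite normrN; lra.
apply/andP; split.
  rewrite -normr_le0; apply: (@le_small _ _ _ 1) => e e0 e1; exact: (hh e e0 e1).1.
rewrite -oppr_le0; apply: (@le_small _ _ _ 1) => e e0 e1; exact: (hh e e0 e1).2.
Qed.

(** * Compressions and their limit as r tends to 1 *)

Section Dilation.
Variables (R : realType) (M : cstarAlgType R) (s : setting M) (X : subproduct s) (F : fock X).
Variables (H : hilbertType R) (T : forall n, X n -> H -> H).
Hypothesis cc : is_cc_rep T.
Notation sigma := (base_rep T).
Notation adjbl := (adjointable (@mip R M F)).
Notation madj := (adj (@mip R M F)).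
Notation hadj := (adj (@hip R H)).
Notation dbeta := (dbeta F cc).
Notation dqc := (dq cc).
Notation dapx r := (apx (dbeta r) (dqc r)).
Notation fkf r := (kf (mbeta sigma (defect cc r) (@mip R M F))).
Notation fkn r := (kn (mbeta sigma (defect cc r) (@mip R M F))).
Notation demb := (@emb R M s X F H).
Notation gop := (@genop R M s X F).
Implicit Types (g : gen X).
Let rep : is_rep sigma := ccr_rep cc.

Definition tg g : H -> H := if g is Some p then T (projT2 p) else idfun.
Definition gdeg g : nat := if g is Some p then projT1 p else 0%N.

Lemma tg_bounded g : bounded_op (tg g).
Proof. by case: g => [[n x]|]; [apply: (ccr_bounded cc)|apply: bounded_op_id]. Qed.

Lemma lift_gen g : exists f, (forall p, demb (f p) = (gop g (demb p).1, p.2)) /\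
  forall r p, dqc r (f p) = (r ^+ gdeg g)%:C *: tg g (dqc r p).
Proof.
case: g => [[n x]|]; last first.
  by exists id; split=> [[[m y] h]|r p] //; rewrite expr0 scale1r.
exists (fun p => (existT (fun n => X n : Type) (n + projT1 p.1)%N (sprod x (projT2 p.1)), p.2)); split=> [[[m y] h]|r [[m y] h]] /=.
  by rewrite /emb /= shift_in.
rewrite /dq /= (linear_funZ (T_linear cc x)) scalerA -RCM -exprD.
by rewrite (ccr_mul cc).
Qed.

Lemma lift_gen_adj g : exists f, forall p, demb (f p) = (madj (gop g) (demb p).1, p.2).
Proof.
suff h p : exists p', demb p' = (madj (gop g) (demb p).1, p.2) by have [f hf] := choice h; exists f.
case: p => [[m y] h]; case: g => [[n x]|]; last by exists (existT _ m y, h); rewrite /= madj_id.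
by have [l [v e]] := shift_adj_in F x y; exists (existT _ l v, h); rewrite /emb /= e.
Qed.

Lemma map_emb (f : _ -> {n & X n} * H) (L : F -> F) v : (forall p, demb (f p) = (L (demb p).1, p.2)) ->
  [seq demb p | p <- map f v] = map_fst L [seq demb p | p <- v].
Proof. by move=> hf; rewrite /map_fst -!map_comp; apply: eq_map => p /=; rewrite hf. Qed.

Section FixedRadius.
Variables (r : R).
Hypothesis r0 : 0 <= r.
Hypothesis r1 : r < 1.
Let PD := defect_commutant cc r0 r1.
Let FK := list_kernel rep PD F.

Lemma fkn_bounded L c u : adjbl L -> 0 <= c -> (forall x, rnorm (L x) <= c * rnorm x) ->
  fkn r (map_fst L u) <= c * fkn r u.
Proof.
move=> aL c0 hc; apply: (kn_map_fst rep PD) => //; first exact: adjointable_lin.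
by move=> x a; apply: adjointable_ract.
Qed.

(** The relation [Q (S (x) 1) = r^n T Q] taken to adjoints: applying [S^*] to the module entries of
    [Q^* h] gives [Q^*] of [r^n T^* h]. *)
Lemma apx_gen_adj g f c h e v : (forall p, demb (f p) = (madj (gop g) (demb p).1, p.2)) ->
  0 <= c -> (forall x, rnorm (gop g x) <= c * rnorm x) -> 0 <= e -> dapx r h e v ->
  dapx r ((r ^+ gdeg g)%:C *: hadj (tg g) h) (e * c) (map f v).
Proof.
move=> hf c0 hc e0 hv u; have [f' [hf' hq']] := lift_gen g; have ag := genop_adjointable F g.
have -> : kf (dbeta r) (map f v) u = kf (dbeta r) v (map f' u).
  rewrite !dkf_emb (map_emb _ hf) (map_emb _ hf').
  by apply: kf_map_fst_adj => x y; rewrite mip_adjr.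
have -> : hip ((r ^+ gdeg g)%:C *: hadj (tg g) h) (ksum (dqc r) u) = hip h (ksum (dqc r) (map f' u)).
  rewrite hipZl conjc_real hip_cj -(hip_adj _ _ (tg_bounded g)) -hip_cj -hipZr; congr hip.
  rewrite /ksum big_map (linear_fun_sum (bounded_op_linear (tg_bounded g))) scaler_sumr.
  by apply: eq_bigr => p _; rewrite hq'.
apply: le_trans (hv _) _; rewrite -mulrA; apply: ler_wpM2l => //.
by rewrite !dkn_emb (map_emb _ hf'); apply: fkn_bounded.
Qed.

End FixedRadius.

(* [Q (a (x) 1) Q^*] tends weakly to [c] as [r -> 1]; [v] and [w] stand for
   [Q^* h] and [Q^* k]. *)
Definition dil (a : F -> F) (c : H -> H) := forall h k t, 0 < t -> exists2 C, 0 <= C &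
  forall r, 0 <= r -> r < 1 -> forall e, 0 < e -> e <= 1 -> forall v w, dapx r h e v -> dapx r k e w ->
  cabs (fkf r (map demb v) (map_fst a (map demb w)) - hip h (c k)) <= t + C * (e + (1 - r)).

Lemma bernoulli (r : R) n : 0 <= r -> r <= 1 -> 1 - r ^+ n <= n%:R * (1 - r).
Proof.
move=> r0 r1; elim: n => [|n IHn]; first by rewrite expr0 subrr mul0r.
have h : 0 <= r ^+ n <= 1 by rewrite exprn_ge0 // exprn_ile1.
rewrite exprS -natr1 mulrDl mul1r; case/andP: h => h1 h2; move: IHn; set x := r ^+ n in h1 h2 *; nra.
Qed.

(** Moving [S_g] to the left as its adjoint and using [apx_gen_adj] on both sides gives
    [r^(n+m) <T_g^* h, T_g'^* k>], because [Q^*] is isometric; the power of [r] is within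
    [(n + m) (1 - r)] of 1 by [bernoulli]. *)
Lemma dil_gens g g' : dil (gop g \o madj (gop g')) (tg g \o hadj (tg g')).
Proof.
move=> h k t t0.
have [c c0 hc] := genop_bounded F g; have [c' c'0 hc'] := genop_bounded F g'.
set h' := hadj (tg g) h; set k' := hadj (tg g') k.
have [f hf] := lift_gen_adj g; have [f' hf'] := lift_gen_adj g'.
have n0 : 0 <= (gdeg g + gdeg g')%:R :> R by apply: ler0n.
have h0 := rnorm_ge0 h'; have k0 := rnorm_ge0 k'.
exists (c * (rnorm k' + c') + rnorm h' * c' + (gdeg g + gdeg g')%:R * (rnorm h' * rnorm k')).
  by rewrite !addr_ge0 ?mulr_ge0 ?addr_ge0.
move=> r r0 r1 e e0 e1 v w hv hw.
have PD := defect_commutant cc r0 r1.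
have av := apx_gen_adj r0 r1 hf c0 hc (ltW e0) hv.
have aw := apx_gen_adj r0 r1 hf' c'0 hc' (ltW e0) hw.
have := dapx_form r0 r1 (mulr_ge0 (ltW e0) c0) (mulr_ge0 (ltW e0) c'0) av aw.
rewrite dkf_emb (map_emb _ hf) (map_emb _ hf') -/h' -/k'.
set z := kf _ _ _; have -> : fkf r (map demb v) (map_fst (gop g \o madj (gop g')) (map demb w)) = z.
  rewrite /z (kf_map_fst_adj _ _ (L' := gop g)); last by move=> x y; rewrite (mip_adjr _ _ (genop_adjointable F g)).
  by congr (kf _ _ _); rewrite /map_fst -[RHS]map_comp.
have -> : hip h ((tg g \o hadj (tg g')) k) = hip h' k'.
  by rewrite /= hip_cj (hip_adj _ _ (tg_bounded g)) -hip_cj.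
rewrite hipZl hipZr conjc_real !rnormZ !cabs_real !ger0_norm ?exprn_ge0 // (mulrA (r ^+ gdeg g)%:C) -RCM -exprD => hz.
have -> : z - hip h' k' = (z - (r ^+ (gdeg g + gdeg g'))%:C * hip h' k') - (1 - r ^+ (gdeg g + gdeg g'))%:C * hip h' k'.
  by rewrite RCD RCN mulrBl mul1r; zabel.
apply: le_trans (cabsB _ _) _; rewrite cabsM cabs_real.
have b1 := bernoulli (gdeg g + gdeg g') r0 (ltW r1).
have b2 : 0 <= 1 - r ^+ (gdeg g + gdeg g') by rewrite subr_ge0 exprn_ile1 // ltW.
rewrite (ger0_norm b2).
have d1 : r ^+ gdeg g <= 1 by rewrite exprn_ile1 // ltW.
have d2 : r ^+ gdeg g' <= 1 by rewrite exprn_ile1 // ltW.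
have b3 := hip_cauchy_schwarz h' k'.
have b4 : (1 - r ^+ (gdeg g + gdeg g')) * cabs (hip h' k') <= (gdeg g + gdeg g')%:R * (1 - r) * (rnorm h' * rnorm k').
  by apply: ler_pM => //; apply: cabs_ge0.
have d3 : 0 <= r ^+ gdeg g by apply: exprn_ge0.
have d4 : 0 <= r ^+ gdeg g' by apply: exprn_ge0.
have b5 : e * c * (r ^+ gdeg g' * rnorm k' + e * c') <= e * (c * (rnorm k' + c')).
  rewrite -mulrA; apply: ler_wpM2l; first exact: ltW.
  apply: ler_wpM2l => //; apply: lerD; by rewrite -[leRHS]mul1r; apply: ler_wpM2r.
have b6 : r ^+ gdeg g * rnorm h' * (e * c') <= e * (rnorm h' * c').
  rewrite [leRHS]mulrCA; apply: ler_wpM2r; first by rewrite mulr_ge0 // ltW.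
  by rewrite -[leRHS]mul1r; apply: ler_wpM2r.
have q0 : 0 <= 1 - r by rewrite subr_ge0 ltW.
have q1 : 0 <= (c * (rnorm k' + c') + rnorm h' * c') * (1 - r) by apply: mulr_ge0 => //; apply: addr_ge0; apply: mulr_ge0 => //; apply: addr_ge0.
have q2 : 0 <= (gdeg g + gdeg g')%:R * (rnorm h' * rnorm k') * e by rewrite !mulr_ge0 // ltW.
apply: le_trans (lerD hz b4) _.
have := ltW t0; move: b5 b6 q1 q2; set A := c * (rnorm k' + c'); set B := rnorm h' * c'; set N := (_)%:R; set G := rnorm h' * rnorm k'.
nra.
Qed.

Lemma dil_comb k a b c d : dil a c -> dil b d -> dil (k *: a + b) (k *: c + d).
Proof.
move=> ha hb h h' t t0; have k1 : 0 < 2 * (cabs k + 1) by rewrite mulr_gt0 // ltr_wpDl ?cabs_ge0.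
have [C C0 hC] := ha h h' _ (divr_gt0 t0 k1); have [D D0 hD] := hb h h' _ (divr_gt0 t0 (ltr0Sn R 1)).
exists (cabs k * C + D); first by rewrite addr_ge0 // mulr_ge0 ?cabs_ge0.
move=> r r0 r1 e e0 e1 v w hv hw.
have -> : fkf r (map demb v) (map_fst (k *: a + b) (map demb w)) =
   k * fkf r (map demb v) (map_fst a (map demb w)) + fkf r (map demb v) (map_fst b (map demb w)).
  rewrite /kf mulr_sumr -big_split; apply: eq_bigr => p _.
  rewrite !big_map mulr_sumr -big_split; apply: eq_bigr => q _.
  by rewrite /mbeta /= fctE mipDr mipZr (repD rep) (repZ rep) hipDr hipZr.
set A := fkf _ _ _; set B := fkf _ _ _.
have -> : k * A + B - hip h ((k *: c + d) h') = k * (A - hip h (c h')) + (B - hip h (d h')).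
  by rewrite fctE hipDr hipZr mulrBr; zabel.
apply: le_trans (cabsD _ _) _; rewrite cabsM.
have h1 := ler_wpM2l (cabs_ge0 k) (hC r r0 r1 e e0 e1 v w hv hw); have h2 := hD r r0 r1 e e0 e1 v w hv hw.
have h3 : cabs k * (t / (2 * (cabs k + 1))) <= t / 2.
  have -> : t / (2 * (cabs k + 1)) = t / 2 / (cabs k + 1) by rewrite invfM mulrA.
  rewrite mulrCA ger_pMr ?divr_gt0 // ler_pdivrMr ?mul1r ?lerDl // ltr_wpDl ?cabs_ge0 //.
rewrite mulrDr in h1; rewrite mulrDl -mulrA; move: h1 h2 h3; rewrite -/A -/B; lra.
Qed.

Lemma dil_zero : dil 0 0.
Proof.
move=> h h' t t0; exists 0 => // r r0 r1 e e0 e1 v w _ _.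
rewrite mul0r addr0 hip0r subr0 /kf big1 ?cabs0 ?ltW // => p _; rewrite !big_map big1 // => q _.
by rewrite /mbeta /= mip0r (rep0 rep) hip0r.
Qed.

(** The approximants of [Q^* h] have norm at most [|h| + 1] for every [r], so a norm approximation
    of [a] is uniform in [r]. The allowance [t] in [dil] makes room for this passage to the limit,
    since the constant [C] obtained for [b] depends on the precision. *)
Lemma dil_closed a c : adjbl a -> (forall e : R, 0 < e -> exists b d, [/\ dil b d, adjbl b,
    forall x, rnorm (a x - b x) <= e * rnorm x & forall y, rnorm (c y - d y) <= e * rnorm y]) -> dil a c.
Proof.
move=> aa hac h k t t0; have h0 := rnorm_ge0 h; have k0 := rnorm_ge0 k.
(* Twice the sum of the coefficients of [z] in the two approximation errors, plus 2: together they
   use at most [t / 2], and the other half goes to the error of [b]. *)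
have B0 : 0 < 2 * ((rnorm h + 1) * (rnorm k + 1) + rnorm h * rnorm k + 1) by nra.
set B := 2 * _ in B0; set z := t / B; have z0 : 0 < z by apply: divr_gt0.
have [b [d [hbd ab ha hc]]] := hac z z0.
have [C C0 hC] := hbd h k _ (divr_gt0 t0 (ltr0Sn R 1)); exists C => // r r0 r1 e e0 e1 v w hv hw.
have PD := defect_commutant cc r0 r1; have FK := list_kernel rep PD F.
have h1 := hC r r0 r1 e e0 e1 v w hv hw.
have h2 : cabs (hip h (d k) - hip h (c k)) <= rnorm h * (z * rnorm k).
  rewrite -hipBr; apply: le_trans (hip_cauchy_schwarz _ _) _; apply: ler_wpM2l => //.
  by rewrite rnorm_distC.
have nv : fkn r (map demb v) <= rnorm h + 1.
  by rewrite -dkn_emb; apply: le_trans (apx_kn (dkernel _ _ r0 r1) (dq_contr _ _ r0 r1) (ltW e0) hv) _; rewrite lerD2l.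
have nw : fkn r (map demb w) <= rnorm k + 1.
  by rewrite -dkn_emb; apply: le_trans (apx_kn (dkernel _ _ r0 r1) (dq_contr _ _ r0 r1) (ltW e0) hw) _; rewrite lerD2l.
have ab' x : (-1 *: b + a) x = a x - b x by rewrite fctE scaleN1r addrC.
have h3 : cabs (fkf r (map demb v) (map_fst a (map demb w)) - fkf r (map demb v) (map_fst b (map demb w))) <= (rnorm h + 1) * (z * (rnorm k + 1)).
  have -> : fkf r (map demb v) (map_fst a (map demb w)) - fkf r (map demb v) (map_fst b (map demb w)) =
     fkf r (map demb v) (map_fst (-1 *: b + a) (map demb w)).
    rewrite /kf -sumrB; apply: eq_bigr => p _; rewrite !big_map -sumrB; apply: eq_bigr => q _.
    rewrite /mbeta /= ab' mipBr (repD rep) hipDr.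
    by rewrite -(scaleN1r (mip _ (b _))) (repZ rep) hipZr mulN1r.
  apply: le_trans (kf_cauchy_schwarz FK _ _) _; apply: ler_pM; rewrite ?kn_ge0 //.
  apply: le_trans (fkn_bounded r0 r1 (map demb w) (adjointable_comb (-1) ab aa) (ltW z0) _) _.
    by move=> x; rewrite ab'.
  by apply: ler_wpM2l; rewrite // ltW.
set A' := fkf _ _ (map_fst b _) in h1 h3; set A := fkf _ _ (map_fst a _) in h3 *.
have -> : A - hip h (c k) = (A - A') + ((A' - hip h (d k)) + (hip h (d k) - hip h (c k))) by zabel.
have h4 : z * B = t by rewrite /z divfK // gt_eqF.
have q1 := cabsD (A' - hip h (d k)) (hip h (d k) - hip h (c k)).
apply: le_trans (cabsD _ _) _.
have : z * B = 2 * ((rnorm h + 1) * (z * (rnorm k + 1)) + rnorm h * (z * rnorm k) + z) by rewrite /B; ring.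
rewrite h4; lra.
Qed.

Section Matrices.
Variables (k : nat) (a : 'M[F -> F]_k) (c : 'M[H -> H]_k).
Hypothesis hac : forall i j, dil (a i j) (c i j).
Hypothesis aa : forall i j, adjbl (a i j).
Hypothesis cb : forall i j, bounded_op (c i j).

Lemma dil_mx (h h' : 'I_k -> H) t : 0 < t -> exists2 C, 0 <= C &
  forall r, 0 <= r -> r < 1 -> forall e, 0 < e -> e <= 1 -> forall v w,
  (forall i, dapx r (h i) e (v i)) -> (forall i, dapx r (h' i) e (w i)) ->
  cabs (\sum_i \sum_j fkf r (map demb (v i)) (map_fst (a i j) (map demb (w j))) - \sum_i \sum_j hip (h i) (c i j (h' j)))
    <= t + C * (e + (1 - r)).
Proof.
move=> t0; have n0 : 0 < k%:R * k%:R + 1 :> R by rewrite ltr_wpDl // mulr_ge0.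
have exC (p : 'I_k * 'I_k) : exists C, 0 <= C /\ forall r, 0 <= r -> r < 1 -> forall e, 0 < e -> e <= 1 -> forall v w,
    dapx r (h p.1) e v -> dapx r (h' p.2) e w ->
    cabs (fkf r (map demb v) (map_fst (a p.1 p.2) (map demb w)) - hip (h p.1) (c p.1 p.2 (h' p.2))) <=
       t / (k%:R * k%:R + 1) + C * (e + (1 - r)).
  by have [C C0 hC] := hac p.1 p.2 (h p.1) (h' p.2) (divr_gt0 t0 n0); exists C.
have [C hC] := choice exC.
exists (\sum_i \sum_j C (i, j)).
  by apply: sumr_ge0 => i _; apply: sumr_ge0 => j _; case: (hC (i, j)).
move=> r r0 r1 e e0 e1 v w hv hw; rewrite -sumrB; apply: le_trans (cabs_sum _ _) _.
have hi i : cabs (\sum_j fkf r (map demb (v i)) (map_fst (a i j) (map demb (w j))) - \sum_j hip (h i) (c i j (h' j))) <=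
    k%:R * (t / (k%:R * k%:R + 1)) + \sum_j C (i, j) * (e + (1 - r)).
  rewrite -sumrB; apply: le_trans (cabs_sum _ _) _.
  have -> : k%:R * (t / (k%:R * k%:R + 1)) = \sum_(j < k) (t / (k%:R * k%:R + 1)).
    by rewrite sumr_const card_ord mulr_natl.
  rewrite -big_split; apply: ler_sum => j _; exact: (hC (i, j)).2.
apply: le_trans (ler_sum _ (fun i _ => hi i)) _; rewrite big_split /= sumr_const card_ord.
apply: lerD.
  have -> : k%:R * (t / (k%:R * k%:R + 1)) *+ k = t * (k%:R * k%:R / (k%:R * k%:R + 1)) by rewrite -[LHS]mulr_natl; ring.
  by rewrite ger_pMr // ler_pdivrMr // mul1r lerDl.
by rewrite mulr_suml; apply: ler_sum => i _; rewrite mulr_suml.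
Qed.

Lemma pick_dapx r e (h : 'I_k -> H) : 0 <= r -> r < 1 -> 0 < e -> exists v, forall i, dapx r (h i) e (v i).
Proof.
move=> r0 r1 e0; have ex i := apx_exists (dkernel F cc r0 r1) (dq_scl cc r0 r1) (dq_contr F cc r0 r1) (h i) e0.
by have [v hv] := choice ex; exists v.
Qed.

(** For [y = c h] the form at [y] and [h] is [|y|^2]. In the limit [tuple_form_bound] becomes
    [2 |y|^2 <= |y|^2 + z^2 |h|^2]. *)
Lemma dil_mx_contractive (z : R[i]) : 0 <= z -> mxnorm_le (@mip R M F) a z -> mxnorm_le (V := R[i]) (@hip R H) c z.
Proof.
move=> z0; rewrite (cabs_ge0_Re z0); move: (complex.Re z) (Re_ge0 z0) => {}z {}z0 hz h.
pose y := mxapp c h.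
have nn (u : 'I_k -> H) : `|ipn (@hip R H) u u| = (\sum_i rnorm (u i) ^+ 2)%:C.
  rewrite ger0_norm; last by apply: sumr_ge0 => i _; apply: hip_ge0.
  by rewrite /ipn rmorph_sum; apply: eq_bigr => i _; rewrite hip_sqr.
rewrite !nn -rmorphXn -RCM lecR -/y.
set Y := \sum_i rnorm (y i) ^+ 2; set Z := \sum_i rnorm (h i) ^+ 2.
apply: (@le_small _ _ _ 2) => t t0 t1.
have [C C0 hC] := dil_mx y h t0.
pose B (u : 'I_k -> H) := \sum_i (2 * rnorm (u i) + 1).
apply: (@le_small _ _ _ (B y + z ^+ 2 * B h + 4 * C)) => e e0 e1.
have r0 : 0 <= 1 - e by rewrite subr_ge0.
have r1 : 1 - e < 1 by rewrite gtrDl oppr_lt0.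
have [v hv] := pick_dapx y r0 r1 e0; have [w hw] := pick_dapx h r0 r1 e0.
have PD := defect_commutant cc r0 r1.
have h1 := hC _ r0 r1 e e0 e1 v w hv hw.
have h2 := tuple_form_bound rep PD (fun i => map demb (v i)) (fun i => map demb (w i)) z0 aa hz.
have h3 (x : 'I_k -> seq _) (u : 'I_k -> H) : (forall i, dapx (1 - e) (u i) e (x i)) ->
   complex.Re (\sum_i fkf (1 - e) (map demb (x i)) (map demb (x i))) <= \sum_i rnorm (u i) ^+ 2 + B u * e.
  move=> hx; rewrite raddf_sum /B mulr_suml -big_split; apply: ler_sum => i _ /=.
  rewrite -dkf_emb -(kn_sqr (dkernel _ _ r0 r1)) /=.
  have k1 := apx_kn (dkernel _ _ r0 r1) (dq_contr _ _ r0 r1) (ltW e0) (@hx i).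
  have u0 := rnorm_ge0 (u i).
  have : kn (dbeta (1 - e)) (x i) ^+ 2 <= (rnorm (u i) + e) ^+ 2.
    by apply: lerXn2r; rewrite ?nnegrE ?kn_ge0 // addr_ge0 // ltW.
  have : e * e <= e by rewrite ger_pMr.
  rewrite sqrrD expr2 mulr2n; nra.
have h4 := h3 v y hv; have h5 := ler_wpM2l (sqr_ge0 z) (h3 w h hw).
have h6 : cabs (\sum_i \sum_j hip (y i) (c i j (h j))) = Y.
  have -> : \sum_i \sum_j hip (y i) (c i j (h j)) = Y%:C.
    rewrite rmorph_sum; apply: eq_bigr => i _; rewrite -hip_sumr; exact: hip_sqr.
  by rewrite cabs_real ger0_norm // sumr_ge0 // => i _; apply: sqr_ge0.
set A := \sum_i \sum_j fkf _ _ _ in h1 h2; set A' := \sum_i \sum_j _ in h1 h6.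
have h7 := cabsB A (A - A'); rewrite (_ : A - (A - A') = A') in h7; last by zabel.
rewrite h6 in h7; move: h1 h2 h4 h5 h7; rewrite -/Y -/Z mulr2n (_ : e + (1 - (1 - e)) = e + e); last by ring.
lra.
Qed.

Lemma dil_mx_pos (b : 'M[F -> F]_k) (h : 'I_k -> H) : (forall i j, adjbl (b i j)) ->
  (forall i j, a i j = \sum_l (madj (b l i) \o b l j)) ->
  0 <= \sum_i \sum_j hip (h i) (c i j (h j)).
Proof.
move=> hb hab; apply: nonneg_limit => t t0 t1.
have t2 : 0 < t / 2 by rewrite divr_gt0.
have [C C0 hC] := dil_mx h h t2.
have C1 : 0 < 4 * (C + 1) by lra.
(* With the radius [1 - e], the total error is [t / 2 + C (e + e)], which this choice keeps below
   [t]. *)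
set e := t / (4 * (C + 1)); have e0 : 0 < e by apply: divr_gt0.
have eC : e * (4 * (C + 1)) = t by rewrite /e divfK // gt_eqF.
have e1 : e <= 1 by nra.
have r0 : 0 <= 1 - e by rewrite subr_ge0.
have r1 : 1 - e < 1 by rewrite gtrDl oppr_lt0.
have [v hv] := pick_dapx h r0 r1 e0; have PD := defect_commutant cc r0 r1.
exists (\sum_i \sum_j fkf (1 - e) (map demb (v i)) (map_fst (a i j) (map demb (v j)))).
  exact: (tuple_form_pos rep PD (fun i => map demb (v i)) hb hab).
rewrite cabs_distC; apply: le_trans (hC _ r0 r1 e e0 e1 v v hv hv) _.
rewrite (_ : e + (1 - (1 - e)) = e + e); last by ring.
nra.
Qed.

End Matrices.
End Dilation.

(** * Positive matrices of Hilbert space operators *)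

(* A Hilbert space given by its inner product only; nontriviality makes the
   operators below a ring with [1 != 0]. *)
Record ip_space (R : realType) := IpSpace {
  ips_sort :> lmodType R[i];
  ips_ip : ips_sort -> ips_sort -> R[i];
  ips_linearr : forall (k : R[i]) x y z, ips_ip x (k *: y + z) = k * ips_ip x y + ips_ip x z;
  ips_conj : forall x y, ips_ip x y = (ips_ip y x)^cj;
  ips_ge0 : forall x, 0 <= ips_ip x x;
  ips_eq0 : forall x, ips_ip x x = 0 -> x = 0;
  ips_complete : forall u : nat -> ips_sort,
    (forall e : R, 0 < e -> exists N, forall m n, (N <= m)%N -> (N <= n)%N ->
       complex.Re (ips_ip (u m - u n) (u m - u n)) <= e) ->
    exists l, forall e : R, 0 < e -> exists N, forall n, (N <= n)%N ->
      complex.Re (ips_ip (u n - l) (u n - l)) <= e;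
  ips_neq0 : exists x : ips_sort, x != 0
}.

Section OperatorRing.
Variables (R : realType) (V : ip_space R).
Notation ip := (@ips_ip R V).
Implicit Types (x y z : V) (f g : V -> V).

Lemma ipDr x y z : ip x (y + z) = ip x y + ip x z.
Proof. by rewrite -[y]scale1r ips_linearr mul1r scale1r. Qed.
Lemma ip0r x : ip x 0 = 0. Proof. by have := ipDr x 0 0; rewrite addr0 => /eqP; rewrite addrC -subr_eq subrr => /eqP. Qed.
Lemma ipZr k x y : ip x (k *: y) = k * ip x y.
Proof. by rewrite -[_ *: _]addr0 ips_linearr ip0r addr0. Qed.
Lemma ipDl x y z : ip (x + y) z = ip x z + ip y z.
Proof. by rewrite ips_conj ipDr conjcD -!ips_conj. Qed.
Lemma ipZl k x y : ip (k *: x) y = k^cj * ip x y.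
Proof. by rewrite ips_conj ipZr conjcM -ips_conj. Qed.
Lemma ipNr x y : ip x (- y) = - ip x y.
Proof. by rewrite -scaleN1r ipZr mulN1r. Qed.
Lemma ipBr x y z : ip x (y - z) = ip x y - ip x z.
Proof. by rewrite ipDr ipNr. Qed.
Lemma ipBl x y z : ip (x - y) z = ip x z - ip y z.
Proof. by rewrite ips_conj ipBr conjcD conjcN -!ips_conj. Qed.
Lemma ip_ext x y : (forall z, ip z x = ip z y) -> x = y.
Proof. by move=> h; apply/eqP; rewrite -subr_eq0; apply/eqP/ips_eq0; rewrite ipBr h subrr. Qed.

Lemma ip_sumr (I : Type) (r : seq I) (f : I -> V) x : ip x (\sum_(i <- r) f i) = \sum_(i <- r) ip x (f i).
Proof. by elim: r => [|i r IHr]; rewrite ?big_nil ?ip0r // !big_cons ipDr IHr. Qed.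
Lemma ip_suml (I : Type) (r : seq I) (f : I -> V) x : ip (\sum_(i <- r) f i) x = \sum_(i <- r) ip (f i) x.
Proof. by rewrite ips_conj ip_sumr conjc_sum; apply: eq_bigr => i _; rewrite -ips_conj. Qed.

Lemma ip_kernel : is_kernel ip (fun k x => k *: x).
Proof.
split=> [x y|k x y|u]; [exact: ips_conj|exact: ipZr|].
suff -> : kf ip u u = ip (\sum_(x <- u) x) (\sum_(x <- u) x) by exact: ips_ge0.
by rewrite ip_suml; apply: eq_bigr => x _; rewrite ip_sumr.
Qed.

Definition hn x : R := kn ip [:: x].

Lemma hn_sqr x : (hn x ^+ 2)%:C = ip x x.
Proof. by rewrite (kn_sqr ip_kernel) /kf !big_seq1. Qed.
Lemma hn_sqr_cabs x : hn x ^+ 2 = cabs (ip x x).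
Proof. by rewrite -hn_sqr cabs_real ger0_norm ?sqr_ge0. Qed.
Lemma hn_ge0 x : 0 <= hn x. Proof. exact: kn_ge0. Qed.
Lemma ip_cs x y : cabs (ip x y) <= hn x * hn y.
Proof. by have := kf_cauchy_schwarz ip_kernel [:: x] [:: y]; rewrite /kf !big_seq1. Qed.
Lemma hn_sum u : kn ip u = hn (\sum_(x <- u) x).
Proof.
rewrite /hn /kn; congr (Num.sqrt (complex.Re _)); rewrite /kf !big_seq1 ip_suml.
by apply: eq_bigr => x _; rewrite ip_sumr.
Qed.
Lemma hnD x y : hn (x + y) <= hn x + hn y.
Proof. by have := kn_cat ip_kernel [:: x] [:: y]; rewrite [kn _ (_ ++ _)]hn_sum big_cons big_seq1. Qed.
Lemma hnZ k x : hn (k *: x) = cabs k * hn x.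
Proof. exact: (kn_scl ip_kernel k [:: x]). Qed.
Lemma hnN x : hn (- x) = hn x.
Proof. by rewrite -scaleN1r hnZ cabsN -[1]/(1%:C) cabs_real normr1 mul1r. Qed.
Lemma hnB x y : hn (x - y) <= hn x + hn y.
Proof. by rewrite -(hnN y); apply: hnD. Qed.
Lemma hn_eq0 x : hn x = 0 -> x = 0.
Proof. by move=> h; apply: ips_eq0; rewrite -hn_sqr h expr0n. Qed.
Lemma hn0 : hn 0 = 0.
Proof. by rewrite -(scale0r (0 : V)) hnZ cabs0 mul0r. Qed.

Definition opr_ok : set (V -> V) :=
  [set f | [/\ linear f, adjointable ip f & exists2 c, 0 <= c & forall x, hn (f x) <= c * hn x]].

Lemma opr_ok_comb k f g : opr_ok f -> opr_ok g -> opr_ok (k *: f + g).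
Proof.
move=> [lf [f' hf] [c c0 hc]] [lg [g' hg] [d d0 hd]]; split.
- by move=> l x y; rewrite !fctE lf lg !scalerDr !scalerA [k * l]mulrC; zabel.
- by exists (k^cj *: f' + g') => x y; rewrite !fctE ipDl ipZl ipDr ipZr hf hg.
- exists (cabs k * c + d); first by rewrite addr_ge0 // mulr_ge0 ?cabs_ge0.
  move=> x; rewrite fctE; apply: le_trans (hnD _ _) _; rewrite hnZ mulrDl -mulrA lerD //.
  by apply: ler_wpM2l; rewrite ?cabs_ge0.
Qed.

Lemma opr_ok_comp f g : opr_ok f -> opr_ok g -> opr_ok (f \o g).
Proof.
move=> [lf [f' hf] [c c0 hc]] [lg [g' hg] [d d0 hd]]; split.
- by move=> l x y /=; rewrite lg lf.
- by exists (g' \o f') => x y /=; rewrite hf hg.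
- exists (c * d); first exact: mulr_ge0.
  by move=> x /=; apply: le_trans (hc _) _; rewrite -mulrA; apply: ler_wpM2l.
Qed.

Lemma opr_ok_scale k : opr_ok (fun x => k *: x).
Proof.
split; first by move=> l x y; rewrite scalerDr !scalerA mulrC.
  by exists (fun x => k^cj *: x) => x y; rewrite ipZl ipZr.
by exists (cabs k); [apply: cabs_ge0|move=> x; rewrite hnZ].
Qed.

Lemma opr_ok0 : opr_ok 0.
Proof.
split; first by move=> l x y; rewrite scaler0 addr0.
  by exists 0 => x y; rewrite ip0r ips_conj ip0r conjc0.
by exists 0 => // x; rewrite mul0r hn0.
Qed.

Lemma adj_bounded_opr f f' c : is_adjoint ip f f' -> 0 <= c -> (forall x, hn (f x) <= c * hn x) ->
  forall x, hn (f' x) <= c * hn x.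
Proof.
move=> hf c0 hc x; have [->|ne] := eqVneq (hn (f' x)) 0; first by rewrite mulr_ge0 ?hn_ge0.
have p0 : 0 < hn (f' x) by rewrite lt_neqAle eq_sym ne hn_ge0.
rewrite -(ler_pM2l p0) -expr2 hn_sqr_cabs -hf.
apply: le_trans (ip_cs _ _) _; rewrite mulrA; apply: ler_wpM2r; rewrite ?hn_ge0 // mulrC; exact: hc.
Qed.

Lemma opr_ok_adj f : opr_ok f -> opr_ok (adj ip f) /\ is_adjoint ip f (adj ip f).
Proof.
move=> [lf af [c c0 hc]]; have hf := xgetPex (fun=> 0) af; split=> //; split.
- move=> k x y; apply: ip_ext => z; rewrite -[LHS](hf z) !ipDr !ipZr.
  by rewrite (hf z x) (hf z y).
- by exists f => x y; rewrite ips_conj -(hf y x) -ips_conj.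
- by exists c => //; apply: adj_bounded_opr hf c0 hc.
Qed.

Definition opr : Type := {f : V -> V | `[< opr_ok f >]}.
HB.instance Definition _ := gen_eqMixin opr.
HB.instance Definition _ := gen_choiceMixin opr.
Implicit Types a b c : opr.

Definition ofun a : V -> V := sval a.
Definition mkopr f (h : opr_ok f) : opr := exist _ f (asboolT h).
Lemma ofunP a : opr_ok (ofun a). Proof. exact/asboolP/(svalP a). Qed.
Lemma ofun_inj : injective ofun. Proof. by move=> a b; apply: val_inj. Qed.
Lemma ofun_lin a : linear (ofun a). Proof. by case: (ofunP a). Qed.

Lemma opr_okD f g : opr_ok f -> opr_ok g -> opr_ok (f + g).
Proof. by move=> hf hg; rewrite -[f]scale1r; apply: opr_ok_comb. Qed.
Lemma opr_okN f : opr_ok f -> opr_ok (- f).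
Proof. by move=> hf; rewrite -scaleN1r -[_ *: _]addr0; apply: opr_ok_comb => //; apply: opr_ok0. Qed.

Definition oadd a b := mkopr (opr_okD (ofunP a) (ofunP b)).
Definition oopp a := mkopr (opr_okN (ofunP a)).
Definition ozero := mkopr opr_ok0.
Definition omul a b := mkopr (opr_ok_comp (ofunP a) (ofunP b)).
Definition osc k := mkopr (opr_ok_scale k).
Definition ost a := mkopr (opr_ok_adj (ofunP a)).1.

Lemma oaddA : associative oadd.
Proof. by move=> a b c; apply: ofun_inj; apply: addrA. Qed.
Lemma oaddC : commutative oadd.
Proof. by move=> a b; apply: ofun_inj; apply: addrC. Qed.
Lemma oadd0 : left_id ozero oadd.
Proof. by move=> a; apply: ofun_inj; apply: add0r. Qed.
Lemma oaddN : left_inverse ozero oopp oadd.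
Proof. by move=> a; apply: ofun_inj; apply: addNr. Qed.
HB.instance Definition _ := GRing.isZmodule.Build opr oaddA oaddC oadd0 oaddN.

Lemma omulA : associative omul. Proof. by move=> a b c; apply: ofun_inj. Qed.
Lemma omul1l : left_id (osc 1) omul.
Proof. by move=> a; apply: ofun_inj; apply/funext => x /=; rewrite scale1r. Qed.
Lemma omul1r : right_id (osc 1) omul.
Proof. by move=> a; apply: ofun_inj; apply/funext => x /=; rewrite scale1r. Qed.
Lemma omulDl : left_distributive omul +%R.
Proof. by move=> a b c; apply: ofun_inj. Qed.
Lemma omulDr : right_distributive omul +%R.
Proof. by move=> a b c; apply: ofun_inj; apply/funext => x; apply: linear_funD (ofun_lin a) _ _. Qed.
Lemma oone_neq0 : osc 1 != 0 :> opr.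
Proof.
apply/eqP => h; have [x] := ips_neq0 V; have := congr1 (fun a => ofun a x) h.
by rewrite /= scale1r => ->; rewrite eqxx.
Qed.
HB.instance Definition _ := GRing.Zmodule_isNzRing.Build opr omulA omul1l omul1r omulDl omulDr oone_neq0.

Lemma ofunD a b x : ofun (a + b) x = ofun a x + ofun b x. Proof. by []. Qed.
Lemma ofunB a b x : ofun (a - b) x = ofun a x - ofun b x. Proof. by []. Qed.
Lemma ofunM a b x : ofun (a * b) x = ofun a (ofun b x). Proof. by []. Qed.
Lemma ofun_sc k x : ofun (osc k) x = k *: x. Proof. by []. Qed.
Lemma ost_adj a x y : ip (ofun a x) y = ip x (ofun (ost a) y).
Proof. exact: (opr_ok_adj (ofunP a)).2. Qed.
Lemma ost_unique a b : is_adjoint ip (ofun a) (ofun b) -> ost a = b.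
Proof.
move=> h; apply: ofun_inj; apply/funext => y; apply: ip_ext => x.
by rewrite -ost_adj h.
Qed.

Definition obounds a : set R := [set c | 0 <= c /\ forall x, hn (ofun a x) <= c * hn x].
Definition onr a : R := inf (obounds a).
Lemma has_inf_obounds a : has_inf (obounds a).
Proof. by split; [have [_ _ [c c0 hc]] := ofunP a; exists c|exists 0 => c []]. Qed.
Lemma onr_ge0 a : 0 <= onr a.
Proof. by apply: lb_le_inf; [case: (has_inf_obounds a)|move=> c []]. Qed.
Lemma onr_le a (c : R) : 0 <= c -> (forall x, hn (ofun a x) <= c * hn x) -> onr a <= c.
Proof. by move=> c0 h; apply: ge_inf; [case: (has_inf_obounds a)|]. Qed.
Lemma onrP a x : hn (ofun a x) <= onr a * hn x.
Proof.
have [e|ne] := eqVneq (hn x) 0.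
  by have [_ _ [c c0 hc]] := ofunP a; have := hc x; rewrite e !mulr0.
have xp : 0 < hn x by rewrite lt_neqAle eq_sym ne hn_ge0.
rewrite -ler_pdivrMr //; apply: lb_le_inf; first by case: (has_inf_obounds a).
by move=> c [c0 h]; rewrite ler_pdivrMr.
Qed.

Lemma hn_complete (u : nat -> V) :
  (forall e, 0 < e -> exists N, forall m n, (N <= m)%N -> (N <= n)%N -> hn (u m - u n) <= e) ->
  exists l, forall e, 0 < e -> exists N, forall n, (N <= n)%N -> hn (u n - l) <= e.
Proof.
have ReE x : complex.Re (ip x x) = hn x ^+ 2 by rewrite -hn_sqr.
move=> hu; have [|l hl] := @ips_complete R V u.
  move=> e e0; have s0 : 0 < Num.sqrt e by rewrite sqrtr_gt0.
  have [N hN] := hu _ s0; exists N => m n Nm Nn; rewrite ReE -(sqr_sqrtr (ltW e0)).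
  by apply: lerXn2r; rewrite ?nnegrE ?hn_ge0 ?sqrtr_ge0 ?hN.
exists l => e e0; have [N hN] := hl _ (exprn_gt0 2 e0); exists N => n Nn.
by apply: le_of_sqr (ltW e0) _; rewrite -ReE; apply: hN.
Qed.

Lemma opr_pointwise_limit (u : nat -> opr) :
  (forall e, 0 < e -> exists N, forall m n, (N <= m)%N -> (N <= n)%N -> onr (u m - u n) <= e) ->
  exists l : V -> V, forall e, 0 < e -> exists N, forall n, (N <= n)%N ->
    forall x, hn (ofun (u n) x - l x) <= e * hn x.
Proof.
move=> hu.
have ex x : exists l, forall e, 0 < e -> exists N, forall n, (N <= n)%N -> hn (ofun (u n) x - l) <= e.
  apply: hn_complete => e e0; have x1 : 0 < hn x + 1 by rewrite ltr_wpDl ?hn_ge0.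
  have [N hN] := hu _ (divr_gt0 e0 x1); exists N => m n Nm Nn; rewrite -ofunB.
  apply: le_trans (onrP _ _) _; apply: le_trans (ler_wpM2r (hn_ge0 x) (hN m n Nm Nn)) _.
  by rewrite mulrC mulrCA ger_pMr // ler_pdivrMr // mul1r lerDl.
have [l hl] := choice ex; exists l => e e0; have [N hN] := hu e e0; exists N => n Nn x.
apply/ler_addgt0Pr => d d0; have [N' hN'] := hl x d d0; set m := maxn N N'.
have -> : ofun (u n) x - l x = ofun (u n - u m) x + (ofun (u m) x - l x) by rewrite ofunB; zabel.
apply: le_trans (hnD _ _) _; apply: lerD; last by apply: hN'; apply: leq_maxr.
by apply: le_trans (onrP _ _) _; apply: ler_wpM2r; rewrite ?hn_ge0 // hN // leq_maxl.
Qed.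

(** The limit must again have an adjoint, so the adjoints are taken to their limit as well; they are
    Cauchy with the same bounds. *)
Lemma opr_limit (u : nat -> opr) :
  (forall e, 0 < e -> exists N, forall m n, (N <= m)%N -> (N <= n)%N -> onr (u m - u n) <= e) ->
  exists l, forall e, 0 < e -> exists N, forall n, (N <= n)%N -> onr (u n - l) <= e.
Proof.
move=> hu; have [l hl] := opr_pointwise_limit hu.
have [l' hl'] : exists l : V -> V, forall e, 0 < e -> exists N, forall n, (N <= n)%N ->
    forall x, hn (ofun (ost (u n)) x - l x) <= e * hn x.
  apply: opr_pointwise_limit => e e0; have [N hN] := hu e e0; exists N => m n Nm Nn.
  apply: onr_le; first exact: ltW.
  have hadj : is_adjoint ip (ofun (u m - u n)) (fun x => ofun (ost (u m)) x - ofun (ost (u n)) x).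
    by move=> x y; rewrite ofunB ipBl ipBr !ost_adj.
  apply: (adj_bounded_opr hadj (ltW e0)) => x.
  by apply: le_trans (onrP _ _) _; apply: ler_wpM2r; rewrite ?hn_ge0 ?hN.
have okl : opr_ok l.
  split.
  - move=> k x y; apply/eqP; rewrite -subr_eq0; apply/eqP/hn_eq0/le_anti; rewrite hn_ge0 andbT.
    apply: (@le_small _ _ _ (hn (k *: x + y) + cabs k * hn x + hn y)) => e e0 e1; rewrite add0r.
    have [N hN] := hl e e0; have h := hN N (leqnn _).
    have -> : l (k *: x + y) - (k *: l x + l y) = k *: (ofun (u N) x - l x) + (ofun (u N) y - l y) -
       (ofun (u N) (k *: x + y) - l (k *: x + y)) by rewrite ofun_lin scalerBr; zabel.
    apply: le_trans (hnB _ _) _; have h1 := hnD (k *: (ofun (u N) x - l x)) (ofun (u N) y - l y).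
    rewrite hnZ in h1; have := ler_wpM2l (cabs_ge0 k) (h x); have := h y; have := h (k *: x + y); lra.
  - exists l' => x y; apply: (@cabs_small_eq _ _ _ (hn x * hn y + hn x * hn y)) => e e0 e1.
    have [N hN] := hl e e0; have [N' hN'] := hl' e e0; set n := maxn N N'.
    have h1 := hN n (leq_maxl _ _) x; have h2 := hN' n (leq_maxr _ _) y.
    have -> : ip (l x) y - ip x (l' y) = ip x (ofun (ost (u n)) y - l' y) - ip (ofun (u n) x - l x) y.
      by rewrite ipBr ipBl ost_adj; zabel.
    apply: le_trans (cabsB _ _) _; have := ip_cs x (ofun (ost (u n)) y - l' y); have := ip_cs (ofun (u n) x - l x) y.
    have := ler_wpM2l (hn_ge0 x) h2; have := ler_wpM2r (hn_ge0 y) h1; lra.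
  - have [N hN] := hl 1 ltr01; exists (onr (u N) + 1); first by rewrite addr_ge0 ?onr_ge0.
    move=> x; have -> : l x = ofun (u N) x - (ofun (u N) x - l x) by zabel.
    by apply: le_trans (hnB _ _) _; rewrite mulrDl lerD ?onrP // hN.
exists (mkopr okl) => e e0; have [N hN] := hl e e0; exists N => n Nn.
by apply: onr_le (ltW e0) _ => x; rewrite ofunB; apply: hN.
Qed.

Theorem opr_cstar : cstar_ring osc ost onr.
Proof.
split=> //.
- by move=> k l; apply: ofun_inj; apply/funext => x; rewrite ofunD !ofun_sc scalerDl.
- by move=> k l; apply: ofun_inj; apply/funext => x; rewrite ofunM !ofun_sc scalerA.
- by move=> k a; apply: ofun_inj; apply/funext => x; rewrite !ofunM !ofun_sc (linear_funZ (ofun_lin a)).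
- by move=> a b; apply: ost_unique => x y; rewrite !ofunD ipDl ipDr !ost_adj.
- by move=> a b; apply: ost_unique => x y; rewrite !ofunM !ost_adj.
- by move=> a; apply: ost_unique => x y; rewrite ips_conj -ost_adj -ips_conj.
- by move=> k; apply: ost_unique => x y; rewrite !ofun_sc ipZl ipZr.
- exact: onr_ge0.
- move=> a b; apply: onr_le; first by rewrite addr_ge0 ?onr_ge0.
  move=> x; rewrite ofunD mulrDl; apply: le_trans (hnD _ _) _; apply: lerD; exact: onrP.
- move=> a b; apply: onr_le; first by rewrite mulr_ge0 ?onr_ge0.
  move=> x; rewrite ofunM -mulrA; apply: le_trans (onrP _ _) _.
  by apply: ler_wpM2l; rewrite ?onr_ge0 ?onrP.
- by move=> k; apply: onr_le; [apply: cabs_ge0|move=> x; rewrite ofun_sc hnZ].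
- move=> a; have s0 := onr_ge0 (ost a * a).
  suff h : onr a <= Num.sqrt (onr (ost a * a)).
    by rewrite -(sqr_sqrtr s0); apply: lerXn2r; rewrite ?nnegrE ?onr_ge0 ?sqrtr_ge0.
  apply: onr_le; first exact: sqrtr_ge0.
  move=> x; apply: le_of_sqr; first by rewrite mulr_ge0 ?sqrtr_ge0 ?hn_ge0.
  rewrite exprMn (sqr_sqrtr s0) hn_sqr_cabs ost_adj -ofunM.
  apply: le_trans (ip_cs _ _) _; have := onrP (ost a * a) x; have := hn_ge0 x; nra.
- move=> a a0; apply: ofun_inj; apply/funext => x; apply: hn_eq0.
  by apply/le_anti; rewrite hn_ge0 andbT; have := onrP a x; rewrite a0 mul0r.
- exact: opr_limit.
Qed.

Notation opos := (cstar_pos osc ost onr).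

(** Polarization: the form is real at [x + y] and at [x + i y], which settles the two parts of the
    identity [<x, a y> = <a x, y>]. *)
Lemma form_real_adj a : (forall x, 0 <= ip x (ofun a x)) -> ost a = a.
Proof.
move=> h; apply: ost_unique => x y; pose B u v := ip u (ofun a v).
have real z : B z z = (B z z)^cj.
  by rewrite /B (cabs_ge0_Re (h z)) conjc_real.
have BD u v : B (u + v) (u + v) = B u u + B u v + (B v u + B v v).
  by rewrite /B (linear_funD (ofun_lin a)) ipDl !ipDr.
have e1 := real (x + y); have e2 := real (x + 'i *: y); rewrite !BD !conjcD in e1 e2.
pose j : R[i] := Complex 0 1; have cj : j^cj = - j by apply/eqP; rewrite eq_complex /= oppr0 !eqxx.
have j0 : j != 0 by rewrite eq_complex /= oner_eq0 andbF.
have Bi1 u v : B u (j *: v) = j * B u v by rewrite /B (linear_funZ (ofun_lin a)) ipZr.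
have Bi2 u v : B (j *: u) v = - (j * B u v) by rewrite /B ipZl cj mulNr.
rewrite -!real in e1 e2; rewrite !Bi1 !Bi2 conjcN !conjcM cj in e2.
rewrite ips_conj -/(B y x) -/(B x y); move: e1 e2; set p := B x y; set q := B y x; set p' := p^cj; set q' := q^cj.
move=> e1 e2; have e3 : p + q - (p' + q') = 0.
  have -> : p + q - (p' + q') = (B x x + p + (q + B y y)) - (B x x + p' + (q' + B y y)) by ring.
  by rewrite e1 subrr.
have e4 : p - q + p' - q' = 0.
  apply: (mulfI j0).
  have -> : j * (p - q + p' - q') = B x x + j * p + (- (j * q) + j * - (j * B y y)) - (B x x + - j * p' + (- (- j * q') + j * - (j * B y y))) by ring.
  by rewrite e2 subrr mulr0.
apply/eqP; rewrite -subr_eq0; apply/eqP; apply: (mulfI (_ : 2%:R != 0)); first by rewrite pnatr_eq0.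
have -> : 2%:R * (q' - p) = - ((p + q - (p' + q')) + (p - q + p' - q')) by ring.
by rewrite e3 e4 addr0 oppr0 mulr0.
Qed.

(** With [m] twice the negative part of [a], [<m x, a m x> = - |r m x|^2]; so [r m = 0], and [a] is
    its own absolute value. *)
Lemma form_opos a : (forall x, 0 <= ip x (ofun a x)) -> opos a.
Proof.
move=> h; have CB := opr_cstar.
have [p [r [m [[hp sr sm epa] [nan srn _ rn0]]]]] := selfadjoint_abs CB (form_real_adj h).
suff w0 : r * m = 0 by move: epa; rewrite (rn0 w0) addr0 => <-.
apply: ofun_inj; apply/funext => x; apply: ips_eq0; apply/le_anti; rewrite ips_ge0 andbT.
rewrite ost_adj srn -ofunM -oppr_ge0 -ipNr.
have -> : - ofun (r * m * (r * m)) x = ofun (m * a * m) x by rewrite nan.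
by rewrite !ofunM -{1}sm -ost_adj.
Qed.

End OperatorRing.

Section OperatorMatrices.
Variables (R : realType) (H : hilbertType R) (k : nat).
Notation tip := (@ipn R R[i] H (@hip R H) k).
Implicit Types (x y : 'I_k -> H) (c : 'M[H -> H]_k).

Lemma tuple_ip_sqr x : tip x x = (\sum_i rnorm (x i) ^+ 2)%:C.
Proof. by rewrite /ipn rmorph_sum; apply: eq_bigr => i _; apply: hip_sqr. Qed.

Lemma rnorm_le_tuple x i : rnorm (x i) ^+ 2 <= complex.Re (tip x x).
Proof. by rewrite tuple_ip_sqr /= (bigD1 i) //= lerDl sumr_ge0 // => j _; apply: sqr_ge0. Qed.

Lemma tuple_ip_complete (u : nat -> 'I_k -> H) :
  (forall e : R, 0 < e -> exists N, forall m n, (N <= m)%N -> (N <= n)%N ->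
     complex.Re (tip (u m - u n) (u m - u n)) <= e) ->
  exists l, forall e : R, 0 < e -> exists N, forall n, (N <= n)%N -> complex.Re (tip (u n - l) (u n - l)) <= e.
Proof.
move=> hu; have ex i : exists l, lim_to (fun n => u n i) l.
  apply: rnorm_complete => e e0; have [N hN] := hu _ (exprn_gt0 2 e0); exists N => m n Nm Nn.
  by apply: le_of_sqr (ltW e0) _; apply: le_trans (hN m n Nm Nn); apply: (rnorm_le_tuple (u m - u n) i).
have [l hl] := choice ex; exists l => e e0.
have d0 : 0 < e + k%:R + 1 by rewrite ltr_wpDl // addr_ge0 // ltW.
set d := e / (e + k%:R + 1); have dp : 0 < d by apply: divr_gt0.
have k0 : 0 <= k%:R :> R by apply: ler0n.
have d1 : d <= 1 by rewrite ler_pdivrMr // mul1r; lra.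
have [N hN] := choice (fun i => hl i d dp); exists (\max_i N i)%N => n Nn.
rewrite tuple_ip_sqr /=; apply: (@le_trans _ _ (\sum_(i < k) d)).
  apply: ler_sum => i _; have h : rnorm ((u n - l) i) <= d.
    by apply: hN; apply: leq_trans Nn; apply: leq_bigmax.
  have := rnorm_ge0 ((u n - l) i); have := ltW dp; nra.
rewrite sumr_const card_ord -[d *+ k]mulr_natl /d mulrCA ger_pMr // ler_pdivrMr // mul1r; lra.
Qed.

Definition tuple_space (ne : exists x : 'I_k -> H, x != 0) : ip_space R.
Proof.
refine (@IpSpace R ('I_k -> H) tip _ _ _ _ tuple_ip_complete ne).
- move=> c x y z; rewrite /ipn mulr_sumr -big_split; apply: eq_bigr => i _.
  by rewrite !fctE hipDr hipZr.
- by move=> x y; rewrite /ipn conjc_sum; apply: eq_bigr => i _; rewrite -hip_cj.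
- by move=> x; apply: sumr_ge0 => i _; apply: hip_ge0.
- move=> x; rewrite tuple_ip_sqr => h; apply/funext => i; apply: rnorm_eq0; apply/eqP.
  rewrite -sqrf_eq0; apply/eqP/le_anti; rewrite sqr_ge0 andbT.
  by have := rnorm_le_tuple x i; rewrite tuple_ip_sqr h.
Defined.

Section Nontrivial.
Hypothesis ne : exists x : 'I_k -> H, x != 0.
Notation W := (tuple_space ne).

Lemma ip_coordr x i z : @ips_ip R W x (coord i z) = hip (x i) z.
Proof.
rewrite /ips_ip /= /ipn (bigD1 i) //= /coord eqxx big1 ?addr0 // => j /negbTE ji.
by rewrite ji hip0r.
Qed.
Lemma ip_coordl x i z : @ips_ip R W (coord i z) x = hip z (x i).
Proof. by rewrite ips_conj ip_coordr -hip_cj. Qed.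

Lemma hn_coord i z : @hn R W (coord i z) = rnorm z.
Proof.
apply/eqP; rewrite -(@eqrXn2 _ 2) ?rnorm_ge0 ?hn_ge0 // hn_sqr_cabs ip_coordl /coord eqxx hip_sqr.
by rewrite cabs_real ger0_norm ?sqr_ge0.
Qed.

Lemma rnorm_le_hn x i : rnorm (x i) <= @hn R W x.
Proof.
apply: le_of_sqr; first exact: hn_ge0.
have := rnorm_le_tuple x i; congr (_ <= _).
by rewrite -[tip x x]/(@ips_ip R W x x) -hn_sqr.
Qed.

Lemma sum_coord x : x = \sum_i coord i (x i).
Proof.
apply/funext => j; rewrite fct_sumE (bigD1 j) //= /coord eqxx big1 ?addr0 // => i /negbTE ij.
by rewrite eq_sym ij.
Qed.

Lemma hn_le_sum x : @hn R W x <= \sum_i rnorm (x i).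
Proof.
rewrite {1}(sum_coord x); elim/big_ind2: _ => [|y a z b hy hz|i _]; first by rewrite (@hn0 R W).
  by apply: le_trans (@hnD R W _ _) _; apply: lerD.
by rewrite hn_coord.
Qed.

Lemma mxapp_opr_ok c : (forall i j, bounded_op (c i j)) -> @opr_ok R W (mxapp c).
Proof.
move=> hc; have lc i j := bounded_op_linear (hc i j); split.
- move=> l x y; apply/funext => i; rewrite /mxapp !fctE scaler_sumr -big_split; apply: eq_bigr => j _ /=.
  by rewrite lc.
- exists (mxapp (\matrix_(i, j) adj (@hip R H) (c j i))) => x y.
  rewrite /ips_ip /= /ipn /mxapp; under eq_bigr => i _ do rewrite hip_suml.
  rewrite exchange_big; apply: eq_bigr => j _; rewrite hip_sumr; apply: eq_bigr => i _ /=.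
  by rewrite mxE hip_adj.
- have exb (p : 'I_k * 'I_k) : exists d : R, 0 <= d /\ real_bound (c p.1 p.2) d.
    by have [_ [d h1 h2]] := (bounded_opP _).1 (hc p.1 p.2); exists d.
  have [b hb] := choice exb.
  exists (\sum_i \sum_j b (i, j)).
    by apply: sumr_ge0 => i _; apply: sumr_ge0 => j _; case: (hb (i, j)).
  move=> x; apply: le_trans (hn_le_sum _) _; rewrite mulr_suml; apply: ler_sum => i _.
  rewrite mulr_suml; apply: le_trans (rnorm_sum _ _) _; apply: ler_sum => j _.
  have [b0 bb] := hb (i, j); apply: le_trans (bb _) _; apply: ler_wpM2l => //; exact: rnorm_le_hn.
Qed.

(** The matrix acts as a positive operator on tuples; its self-adjoint root [v] is cut into entries
    [b i j]. As the adjoint of [b l i] is [b i l], the sum over [l] is an entry of [v^2]. *)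
Lemma form_mxpos_nontrivial c : (forall i j, bounded_op (c i j)) ->
  (forall x, 0 <= \sum_i \sum_j hip (x i) (c i j (x j))) -> mxpos (V := R[i]) (@hip R H) (@bounded_op R H) c.
Proof.
move=> hc hpos; pose a : opr W := mkopr (mxapp_opr_ok hc).
have ap : cstar_pos (@osc R W) (@ost R W) (@onr R W) a.
  apply: form_opos => x; rewrite /ips_ip /= /ipn /mxapp; under eq_bigr => i _ do rewrite hip_sumr.
  exact: hpos.
have [v [sv vv _]] := pos_sqrt (opr_cstar W) ap.
have vadj x y : @ips_ip R W (ofun v x) y = @ips_ip R W x (ofun v y) by rewrite ost_adj sv.
pose b : 'M[H -> H]_k := \matrix_(i, j) (fun z => (ofun v (coord j z)) i).
have coord_lin j : linear (@coord H k j).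
  by move=> l x y; apply/funext => i; rewrite !fctE /coord; case: ifP => // _; rewrite scaler0 addr0.
have bE i j z : b i j z = (ofun v (coord j z)) i by rewrite mxE.
have bb i j : bounded_op (b i j).
  apply/bounded_opP; split; first by move=> l x y; rewrite !bE coord_lin ofun_lin.
  exists (onr v); first exact: onr_ge0.
  move=> z; rewrite bE; apply: le_trans (rnorm_le_hn _ _) _.
  by apply: le_trans (onrP _ _) _; rewrite hn_coord.
have badj i j : adj (@hip R H) (b i j) = b j i.
  by apply: adj_unique => x y; rewrite !bE -ip_coordr -ip_coordl.
exists b; split=> // i j; apply/funext => z; rewrite fct_sumE.
under eq_bigr => l _ do rewrite /= badj !bE.
transitivity ((\sum_l ofun v (coord l (ofun v (coord j z) l)) : W) i); last by rewrite fct_sumE.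
rewrite -(linear_fun_sum (ofun_lin v)) -sum_coord.
rewrite -ofunM vv /= /mxapp (bigD1 j) //= /coord eqxx big1 ?addr0 // => l /negbTE lj.
by rewrite lj (linear_fun0 (bounded_op_linear (hc i l))).
Qed.

End Nontrivial.

(** In the zero space any two operators agree, and [c] itself serves as the factor [b]. *)
Lemma form_mxpos c : (forall i j, bounded_op (c i j)) ->
  (forall x, 0 <= \sum_i \sum_j hip (x i) (c i j (x j))) -> mxpos (V := R[i]) (@hip R H) (@bounded_op R H) c.
Proof.
move=> hc hpos; have [ne|tr] := pselect (exists x : 'I_k -> H, x != 0).
  exact: form_mxpos_nontrivial.
have z0 (i : 'I_k) (z : H) : z = 0.
  apply: contrapT => zn; apply: tr; exists (coord i z); apply/eqP => e.
  by apply: zn; have := congr1 (fun f : 'I_k -> H => f i) e; rewrite /coord eqxx.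
exists c; split=> // i j; apply/funext => z; by rewrite [LHS](z0 i) [RHS](z0 i).
Qed.

End OperatorMatrices.

(** * The Poisson map *)

Section PoissonMap.
Variables (R : realType) (M : cstarAlgType R) (s : setting M) (X : subproduct s) (F : fock X).
Variables (H : hilbertType R) (T : forall n, X n -> H -> H).
Hypothesis cc : is_cc_rep T.
Notation adjbl := (adjointable (@mip R M F)).
Notation madj := (adj (@mip R M F)).
Notation hadj := (adj (@hip R H)).
Notation gop := (@genop R M s X F).
Notation tg := (tg T).
Notation Sh := (@Defs.shift R M s X F _).
Notation cgens := (@cgens R M s X F).
Notation TA := (@tensor_algebra R M s X F).
Notation OS := (@operator_system R M s X F).
Notation dil := (@dil R M s X F H T cc).

Definition pgens : set ((F -> F) * (H -> H)) :=
  [set p | exists g g', p = (gop g \o madj (gop g'), tg g \o hadj (tg g'))].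

(* The graph of the map to be constructed. *)
Definition rel (a : F -> F) (c : H -> H) := forall e : R, 0 < e -> exists2 p, lspan pgens p &
  (forall x, rnorm (a x - p.1 x) <= e * rnorm x) /\ (forall y, rnorm (c y - p.2 y) <= e * rnorm y).

Lemma bounded_op_0 : bounded_op (0 : H -> H).
Proof. by split; [move=> k x y; rewrite scaler0 addr0|exists 0 => x; rewrite normr0 mul0r]. Qed.

Lemma bounded_op_closed (c : H -> H) : opclosure (@bounded_op R H) c -> bounded_op c.
Proof.
move=> /opclosureP hc; apply/bounded_opP; split; last first.
  have [b /bounded_opP[lb [d d0 hd]] cb] := hc 1 ltr01; exists (d + 1); first by rewrite addr_ge0.
  move=> x; have -> : c x = b x + (c x - b x) by zabel.
  by apply: le_trans (rnormD _ _) _; rewrite mulrDl lerD.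
move=> k x y; apply/eqP; rewrite -subr_eq0; apply/eqP.
apply: (@rnorm_small0 _ _ (rnorm (k *: x + y) + cabs k * rnorm x + rnorm y)) => e e0.
have [b bb cb] := hc e e0; have lb := bounded_op_linear bb.
have -> : c (k *: x + y) - (k *: c x + c y) = (c (k *: x + y) - b (k *: x + y)) - (k *: (c x - b x) + (c y - b y)).
  by rewrite lb scalerBr; zabel.
apply: le_trans (rnormB _ _) _; have h1 := rnormD (k *: (c x - b x)) (c y - b y).
rewrite rnormZ in h1; have := ler_wpM2l (cabs_ge0 k) (cb x); have := cb y; have := cb (k *: x + y); lra.
Qed.

Lemma pspan_dil p : lspan pgens p -> [/\ dil p.1 p.2, adjbl p.1, bounded_op p.2 & lspan cgens p.1].
Proof.
move: p; apply: lspan_min.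
- by split; [exact: dil_zero|exact: adjointable_0|exact: bounded_op_0|exact: lspan0].
- move=> k p q [d1 a1 b1 l1] [d2 a2 b2 l2]; split.
  + exact: dil_comb.
  + exact: adjointable_comb.
  + exact: bounded_op_lin.
  + exact: lspan_lin.
- move=> _ [g [g' ->]]; split=> /=.
  + exact: dil_gens.
  + exact: adjointable_comp (genop_adjointable F g) (adjointable_adj (genop_adjointable F g')).
  + by apply: bounded_op_comp (tg_bounded cc g) (adj_bounded (tg_bounded cc g')).
  + by apply: lspan_sub; exists g, g'.
Qed.

Lemma pspan_lift a : lspan cgens a -> exists2 p, lspan pgens p & p.1 = a.
Proof.
move: a; apply: lspan_min.
- by exists 0 => //; apply: lspan0.
- move=> k a b [p hp <-] [q hq <-]; exists (k *: p + q) => //; exact: lspan_lin.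
- move=> _ [g [g' ->]]; exists (gop g \o madj (gop g'), tg g \o hadj (tg g')) => //.
  by apply: lspan_sub; exists g, g'.
Qed.

Lemma rel_span p : lspan pgens p -> rel p.1 p.2.
Proof. by move=> hp e e0; exists p => //; split=> x; rewrite subrr rnorm0 mulr_ge0 ?rnorm_ge0 // ltW. Qed.

Lemma rel_gens g g' : rel (gop g \o madj (gop g')) (tg g \o hadj (tg g')).
Proof. by apply: (@rel_span (_, _)); apply: lspan_sub; exists g, g'. Qed.

Lemma rel_props a c : rel a c -> [/\ dil a c, adjbl a & bounded_op c].
Proof.
move=> hac; have aa : adjbl a.
  apply: adjointable_closed; apply/opclosureP => e /hac[p hp [h1 h2]]; exists p.1 => //.
  by case: (pspan_dil hp).
split=> //.
  apply: dil_closed => // e /hac[p hp [h1 h2]]; exists p.1, p.2.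
  by case: (pspan_dil hp).
apply: bounded_op_closed; apply/opclosureP => e /hac[p hp [h1 h2]]; exists p.2 => //.
by case: (pspan_dil hp).
Qed.

Lemma rel_comb k a b c d : rel a c -> rel b d -> rel (k *: a + b) (k *: c + d).
Proof.
move=> ha hb e e0; have k1 : 0 < cabs k + 1 by rewrite ltr_wpDl ?cabs_ge0.
have e1 := divr_gt0 e0 k1; have [p hp [p1 p2]] := ha _ e1; have [q hq [q1 q2]] := hb _ e1.
exists (k *: p + q); first exact: lspan_lin.
have ee : cabs k * (e / (cabs k + 1)) + e / (cabs k + 1) = e.
  by rewrite -[X in _ + X]mul1r -mulrDl mulrC divfK // gt_eqF.
have est (V : normedModType R[i]) (u u' v v' x : V) : rnorm (u - u') <= e / (cabs k + 1) * rnorm x ->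
   rnorm (v - v') <= e / (cabs k + 1) * rnorm x -> rnorm (k *: u + v - (k *: u' + v')) <= e * rnorm x.
  move=> h1 h2; have -> : k *: u + v - (k *: u' + v') = k *: (u - u') + (v - v') by rewrite scalerBr; zabel.
  apply: le_trans (rnormD _ _) _; rewrite rnormZ -[X in X * rnorm x]ee mulrDl -mulrA lerD //.
  by apply: ler_wpM2l; rewrite ?cabs_ge0.
by split=> x; rewrite !fctE; apply: est.
Qed.

Lemma rel_mx_contractive k (a : 'M[F -> F]_k) (c : 'M[H -> H]_k) (z : R[i]) :
  (forall i j, rel (a i j) (c i j)) -> 0 <= z -> mxnorm_le (@mip R M F) a z -> mxnorm_le (V := R[i]) (@hip R H) c z.
Proof.
move=> h z0; have hd i j := rel_props (h i j).
apply: (dil_mx_contractive (cc := cc)) => // i j; by case: (hd i j).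
Qed.

Lemma mxnorm_le1 (a : 'M[F -> F]_1) K : 0 <= K -> (forall x, rnorm (a ord0 ord0 x) <= K * rnorm x) ->
  mxnorm_le (@mip R M F) a K%:C.
Proof.
move=> K0 ha x; rewrite /ipn /mxapp !big_ord1 !rnormE !rnorm_mip_sqr -rmorphXn -RCM lecR -exprMn.
by apply: lerXn2r; rewrite ?nnegrE ?mulr_ge0 ?rnorm_ge0.
Qed.

Lemma mxnorm_le1_bound (c : 'M[H -> H]_1) K : 0 <= K -> mxnorm_le (V := R[i]) (@hip R H) c K%:C ->
  forall y, rnorm (c ord0 ord0 y) <= K * rnorm y.
Proof.
move=> K0 hc y; have := hc (fun=> y).
rewrite /ipn /mxapp !big_ord1 !hip_sqr !cabsE !cabs_real !ger0_norm ?sqr_ge0 // -rmorphXn -RCM lecR -exprMn => hh.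
by apply: le_of_sqr; rewrite ?mulr_ge0 ?rnorm_ge0.
Qed.

(** The case of 1 by 1 matrices of [rel_mx_contractive]. It makes the relation single-valued and
    extends it to norm limits. *)
Lemma rel_bound a c K : rel a c -> 0 <= K -> (forall x, rnorm (a x) <= K * rnorm x) ->
  forall y, rnorm (c y) <= K * rnorm y.
Proof.
move=> h K0 ha y; rewrite -[c](mxE matrix_key (fun _ _ : 'I_1 => c) ord0 ord0).
apply: mxnorm_le1_bound => //; apply: (rel_mx_contractive (a := \matrix_(i < 1, j < 1) a)).
- by move=> i j; rewrite !mxE.
- by rewrite ler0c.
- by apply: mxnorm_le1 => // x; rewrite mxE.
Qed.

Lemma rel_unique a c d : rel a c -> rel a d -> c = d.
Proof.
move=> h1 h2; have h := rel_comb (-1) h1 h2; apply/funext => y.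
have := rel_bound h (lexx 0) _ y; rewrite mul0r => hh.
have : rnorm ((-1 *: c + d) y) = 0.
  apply/le_anti; rewrite rnorm_ge0 andbT; apply: hh => x.
  by rewrite !fctE scaleN1r addNr rnorm0 mul0r.
by move=> /rnorm_eq0; rewrite !fctE scaleN1r addrC => /eqP; rewrite subr_eq0 => /eqP ->.
Qed.

(** Approximations of [a] in the span of the generators are Cauchy in norm, and by [rel_bound] so
    are the corresponding operators on [H]. *)
Lemma rel_exists a : opclosure (lspan cgens) a -> exists c, rel a c.
Proof.
move=> /opclosureP ha.
have exp (n : nat) : exists p, lspan pgens p /\ forall x, rnorm (a x - p.1 x) <= n.+1%:R^-1 * rnorm x.
  have [|b /pspan_lift[p hp <-] hb] := ha (n.+1%:R^-1); first by rewrite invr_gt0.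
  by exists p.
have [p hp] := choice exp.
have i0 (n : nat) : 0 <= n.+1%:R^-1 :> R by rewrite invr_ge0.
have diff m n y : rnorm ((p m).2 y - (p n).2 y) <= (m.+1%:R^-1 + n.+1%:R^-1) * rnorm y.
  have hr : rel (-1 *: (p n).1 + (p m).1) (-1 *: (p n).2 + (p m).2).
    by apply: rel_comb; apply: rel_span; case: (hp n) => // h _; case: (hp m).
  have := rel_bound hr (addr_ge0 (i0 m) (i0 n)) _ y; rewrite !fctE scaleN1r addrC; apply => x.
  rewrite scaleN1r addrC.
  have -> : (p m).1 x - (p n).1 x = (a x - (p n).1 x) - (a x - (p m).1 x) by zabel.
  by apply: le_trans (rnormB _ _) _; rewrite mulrDl addrC lerD //; [case: (hp m)|case: (hp n)].
have ex y : exists l, lim_to (fun n => (p n).2 y) l.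
  apply: rnorm_complete => e e0; have [N hN] := archi_inv (2 * rnorm y) e0; exists N => m n Nm Nn.
  apply: le_trans (diff m n y) _; have := hN m Nm; have := hN n Nn.
  by move: (m.+1%:R^-1) (n.+1%:R^-1) => u v; lra.
have [c hc] := choice ex; exists c => e e0.
have [n hn] : exists n, 2 / n.+1%:R <= e by have [N hN] := archi_inv 2 e0; exists N; apply: hN.
exists (p n); first by case: (hp n).
have ne : n.+1%:R^-1 <= e by move: hn (i0 n); move: (n.+1%:R^-1) => u; lra.
split=> x; first by apply: le_trans ((hp n).2 x) _; apply: ler_wpM2r; rewrite ?rnorm_ge0.
apply/ler_addgt0Pr => d d0; have [N hN] := hc x d d0; set m := maxn N n.
have nm : m.+1%:R^-1 <= n.+1%:R^-1 :> R by rewrite lef_pV2 ?posrE // ler_nat ltnS leq_maxr.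
have -> : c x - (p n).2 x = ((p m).2 x - (p n).2 x) - ((p m).2 x - c x) by zabel.
apply: le_trans (rnormB _ _) _; apply: lerD; last by apply: hN; apply: leq_maxl.
apply: le_trans (diff m n x) _; apply: ler_wpM2r; rewrite ?rnorm_ge0 //.
move: hn nm; move: (m.+1%:R^-1) (n.+1%:R^-1) => u v; lra.
Qed.

Definition poisson (a : F -> F) : H -> H := xget (fun=> 0) [set c | rel a c].

Lemma poissonE a c : rel a c -> poisson a = c.
Proof.
move=> h; have h' : rel a (poisson a) := @xgetPex _ (fun=> 0) [set c | rel a c] (ex_intro _ c h).
exact: rel_unique h' h.
Qed.

Lemma poisson_rel a : opclosure (lspan cgens) a -> rel a (poisson a).
Proof. by move=> /rel_exists h; apply: (@xgetPex _ (fun=> 0) [set c | rel a c]). Qed.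

Lemma hadj_id : hadj idfun = idfun. Proof. exact: adj_unique. Qed.

Lemma rel_shift n (x : X n) : rel (Sh x) (T x).
Proof. by have := rel_gens (Some (existT _ n x)) None; rewrite /= madj_id hadj_id. Qed.

Lemma rel_shift_adj n (x : X n) : rel (madj (Sh x)) (hadj (T x)).
Proof. exact: (rel_gens None (Some (existT _ n x))). Qed.

Lemma rel_id : rel idfun idfun.
Proof. by have := rel_gens None None; rewrite /= madj_id hadj_id. Qed.

Lemma rel_sub a c a' c' K : rel a c -> rel a' c' -> 0 <= K -> (forall x, rnorm (a x - a' x) <= K * rnorm x) ->
  forall y, rnorm (c y - c' y) <= K * rnorm y.
Proof.
move=> h h' K0 ha y; have := rel_bound (rel_comb (-1) h' h) K0 _ y; rewrite !fctE scaleN1r addrC; apply => x.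
by rewrite scaleN1r addrC.
Qed.

Lemma rel_closed a c : (forall e : R, 0 < e -> exists a' c', [/\ rel a' c',
   forall x, rnorm (a x - a' x) <= e * rnorm x & forall y, rnorm (c y - c' y) <= e * rnorm y]) -> rel a c.
Proof.
move=> h e e0; have e2 : 0 < e / 2 by rewrite divr_gt0.
have [a' [c' [h' ha hc]]] := h _ e2; have [p hp [p1 p2]] := h' _ e2; exists p => //.
have est (V : normedModType R[i]) (u v w x : V) : rnorm (u - v) <= e / 2 * rnorm x ->
    rnorm (v - w) <= e / 2 * rnorm x -> rnorm (u - w) <= e * rnorm x.
  move=> h1 h2; have -> : u - w = (u - v) + (v - w) by zabel.
  by apply: le_trans (rnormD _ _) _; lra.
by split=> x; [apply: est (ha x) (p1 x)|apply: est (hc x) (p2 x)].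
Qed.

Lemma rel_opbounded a c : rel a c -> opbounded a.
Proof.
move=> h; apply: (opclosure_bounded (lspan_opbounded (@cgens_opbounded _ _ _ _ F))).
apply/opclosureP => e /h[p hp [h1 _]]; exists p.1 => //; by case: (pspan_dil hp).
Qed.

(** A shift multiplied from the left onto [S_g S_g'^*] is absorbed in [S_g]. From the right this
    fails in general, which is why multiplicativity is claimed for left factors in the tensor
    algebra. *)
Lemma tg_shift n (x : X n) g : exists g', Sh x \o gop g = gop g' /\ T x \o tg g = tg g'.
Proof.
case: g => [[m y]|]; last by exists (Some (existT _ n x)).
by exists (Some (existT _ (n + m)%N (sprod x y))); rewrite /= shift_comp (ccr_mul cc).
Qed.

Lemma pspan_shift n (x : X n) p : lspan pgens p -> lspan pgens (Sh x \o p.1, T x \o p.2).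
Proof.
have lS := adjointable_lin (shift_adjointable F x); have lT := bounded_op_linear (ccr_bounded cc x).
move: p; apply: lspan_min.
- have -> : (Sh x \o (0 : (F -> F) * (H -> H)).1, T x \o (0 : (F -> F) * (H -> H)).2) = 0; last exact: lspan0.
  by congr pair; apply/funext => y /=; rewrite ?(linear_fun0 lS) ?(linear_fun0 lT).
- move=> k p q hp hq; have := lspan_lin k hp hq; congr (lspan _ _); congr pair; apply/funext => y /=.
    by rewrite !fctE /= lS.
  by rewrite !fctE /= lT.
- move=> _ [g [g' ->]]; apply: lspan_sub; have [g2 [e1 e2]] := tg_shift x g; exists g2, g'.
  by rewrite /= -e1 -e2.
Qed.

Lemma mul_small (c e : R) : 0 <= c -> 0 < e -> c * (e / (c + 1)) <= e.
Proof. by move=> c0 e0; rewrite mulrCA ger_pMr // ler_pdivrMr ?mul1r ?lerDl // ltr_wpDl. Qed.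

Lemma rel_shift_comp n (x : X n) b d : rel b d -> rel (Sh x \o b) (T x \o d).
Proof.
move=> h; have x0 := rnorm_ge0 x; have bS := @rnorm_shift _ _ _ _ F _ x.
have bT := rel_bound (rel_shift x) x0 bS.
have lS := adjointable_lin (shift_adjointable F x); have lT := bounded_op_linear (ccr_bounded cc x).
move=> e e0; have e1 : 0 < e / (rnorm x + 1) by rewrite divr_gt0 // ltr_wpDl.
have [p hp [p1 p2]] := h _ e1; exists (Sh x \o p.1, T x \o p.2); first exact: pspan_shift.
split=> y /=; rewrite -?(linear_funB lS) -?(linear_funB lT).
  apply: le_trans (bS _) _; apply: le_trans (ler_wpM2l x0 (p1 y)) _.
  by rewrite mulrA; apply: ler_wpM2r; rewrite ?rnorm_ge0 ?mul_small.
apply: le_trans (bT _) _; apply: le_trans (ler_wpM2l x0 (p2 y)) _.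
by rewrite mulrA; apply: ler_wpM2r; rewrite ?rnorm_ge0 ?mul_small.
Qed.

Lemma rel_zero : rel 0 0.
Proof. exact: (rel_span (@lspan0 _ _ _)). Qed.

(** The operators [a] with this property form a subspace that contains the shifts; its closure is
    reached because [rel_sub] bounds the error of the image of [a] by the error of [a]. *)
Lemma rel_tensor_algebra a : TA a -> exists2 c, rel a c & forall b d, rel b d -> rel (a \o b) (c \o d).
Proof.
pose B := [set a | exists2 c, rel a c & forall b d, rel b d -> rel (a \o b) (c \o d)].
have hB : lspan [set a | exists n (x : X n), a = Sh x] `<=` B.
  apply: lspan_min.
  - by exists 0; [apply: rel_zero|move=> b d _; apply: rel_zero].
  - move=> k u v [c hc hu] [c' hc' hv]; exists (k *: c + c'); first exact: rel_comb.
    by move=> b d h; apply: (rel_comb k (hu _ _ h) (hv _ _ h)).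
  - by move=> _ [n [x ->]]; exists (T x); [apply: rel_shift|apply: rel_shift_comp].
move=> /tensor_algebra_sub /(opclosure_mono hB) /opclosureP ha.
have /rel_exists[c hc] : opclosure (lspan cgens) a.
  apply: opclosure_idem; apply/opclosureP => e /ha[a' [c' h' _] aa']; exists a' => //.
  by apply/opclosureP => d /h'[p hp [h1 _]]; exists p.1 => //; case: (pspan_dil hp).
exists c => // b d hbd; have [K K0 hb] := rel_opbounded hbd.
have hd := rel_bound hbd K0 hb.
apply: rel_closed => e e0; have e1 : 0 < e / (K + 1) by rewrite divr_gt0 // ltr_wpDl.
have [a' [c' h' hm] aa'] := ha _ e1; have cc' := rel_sub hc h' (ltW e1) aa'.
exists (a' \o b), (c' \o d); split; first exact: hm.
- move=> x /=; apply: le_trans (aa' _) _; apply: le_trans (ler_wpM2l (ltW e1) (hb x)) _.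
  by rewrite mulrA; apply: ler_wpM2r; rewrite ?rnorm_ge0 // mulrC mul_small.
- move=> x /=; apply: le_trans (cc' _) _; apply: le_trans (ler_wpM2l (ltW e1) (hd x)) _.
  by rewrite mulrA; apply: ler_wpM2r; rewrite ?rnorm_ge0 // mulrC mul_small.
Qed.

Lemma poisson_mul a b : TA a -> OS b -> poisson (a \o b) = poisson a \o poisson b.
Proof.
move=> /rel_tensor_algebra[c hc hm] /operator_system_sub /poisson_rel hb.
by rewrite (poissonE hc); apply/poissonE/hm.
Qed.

Lemma poisson_is_poisson_map : is_poisson_map T poisson.
Proof.
have sub := @operator_system_sub R M s X F; have prel a : OS a -> rel a (poisson a).
  by move=> /sub; apply: poisson_rel.
split.
- by move=> a /prel /rel_props[].
- by move=> k a b ha hb; apply/poissonE/rel_comb; apply: prel.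
- exact: poissonE rel_id.
- move=> k a ha [b [hb hab]]; have hr i j := rel_props (prel _ (ha i j)).
  apply: form_mxpos => [i j|x]; first by rewrite mxE; case: (hr i j).
  have hd i j : dil (a i j) ((map_mx poisson a) i j) by rewrite mxE; case: (hr i j).
  exact: (dil_mx_pos hd x hb hab).
- move=> k a z ha z0; apply: rel_mx_contractive => // i j.
  by rewrite mxE; apply: prel.
- by move=> n x; apply/poissonE/rel_shift.
- by move=> n x; apply/poissonE/rel_shift_adj.
- exact: poisson_mul.
Qed.

(** * Uniqueness *)

Lemma operator_system_adj g : OS (madj (gop g)).
Proof. exact: (operator_system_cgens F None g). Qed.

(** Unitality covers [None], and multiplicativity splits off a left factor that is a shift; so the
    values on all generators are prescribed. *)
Lemma poisson_map_cgens Psi g g' : is_poisson_map T Psi ->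
  Psi (gop g \o madj (gop g')) = tg g \o hadj (tg g').
Proof.
move=> h; have adjE : Psi (madj (gop g')) = hadj (tg g').
  case: g' => [[n x]|]; first exact: (pm_shift_adj h).
  by rewrite /= madj_id hadj_id (pm_unital h).
case: g => [[n x]|] //=.
by rewrite (pm_mul h (@tensor_algebra_shift _ _ _ _ F _ x) (operator_system_adj g')) adjE (pm_shift h).
Qed.

Lemma poisson_map_contractive Psi a K : is_poisson_map T Psi -> OS a -> 0 <= K ->
  (forall x, rnorm (a x) <= K * rnorm x) -> forall y, rnorm (Psi a y) <= K * rnorm y.
Proof.
move=> h oa K0 ha y; have -> : Psi a = map_mx Psi (\matrix_(i < 1, j < 1) a) ord0 ord0 by rewrite !mxE.
apply: mxnorm_le1_bound => //; apply: (pm_cc h); first by move=> i j; rewrite mxE.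
  by rewrite ler0c.
by apply: mxnorm_le1 => // x; rewrite mxE.
Qed.

(** Agreement on the generators passes to their span by linearity and to the norm closure by
    contractivity, the 1 by 1 case of complete contractivity. *)
Lemma poisson_map_unique Psi Psi' : is_poisson_map T Psi -> is_poisson_map T Psi' ->
  forall a, OS a -> Psi a = Psi' a.
Proof.
move=> h h' a oa; have hl : lspan cgens `<=` [set b | OS b /\ Psi b = Psi' b].
  have zero (P : (F -> F) -> H -> H) : is_poisson_map T P -> P 0 = 0.
    move=> hP; have oi := operator_system_adj None; rewrite /= madj_id in oi.
    by have := (pm_linear hP) (-1) _ _ oi oi; rewrite !scaleN1r !addNr.
  apply: lspan_min.
  - by split; [apply: operator_system_lspan; apply: lspan0|rewrite !zero].
  - move=> k b c [ob hb] [oc hc]; split; first exact: operator_system_comb.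
    by rewrite (pm_linear h) // (pm_linear h') // hb hc.
  - move=> _ [g [g' ->]]; split; first exact: operator_system_cgens.
    by rewrite !poisson_map_cgens.
apply/funext => y; apply/eqP; rewrite -subr_eq0; apply/eqP.
apply: (@rnorm_small0 _ _ (rnorm y + rnorm y)) => e e0.
have /operator_system_sub /opclosureP /(_ e e0) [b /hl[ob hb] ab] := oa.
have est P : is_poisson_map T P -> rnorm (P a y - P b y) <= e * rnorm y.
  move=> hP; have := poisson_map_contractive hP (operator_system_comb (-1) ob oa) (ltW e0) _ y.
  rewrite (pm_linear hP) // !fctE scaleN1r addrC; apply => x.
  by rewrite scaleN1r addrC.
have -> : Psi a y - Psi' a y = (Psi a y - Psi b y) - (Psi' a y - Psi' b y) by rewrite hb; zabel.
apply: le_trans (rnormB _ _) _; rewrite mulrDl ![_ * e]mulrC; apply: lerD; exact: est.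
Qed.

End PoissonMap.

Theorem theorem2p15 (R : realType) (M : cstarAlgType R) (s : setting M)
    (X : subproduct s) (F : fock X) (H : hilbertType R)
    (T : forall n, X n -> H -> H) :
  is_cc_rep T ->
  exists Psi : (F -> F) -> (H -> H),
    is_poisson_map T Psi /\
    forall Psi' : (F -> F) -> (H -> H), is_poisson_map T Psi' ->
      forall a : F -> F, operator_system a -> Psi' a = Psi a.
Proof.
move=> cc; exists (poisson T); split; first exact: poisson_is_poisson_map cc.
by move=> Psi' h'; apply: poisson_map_unique (poisson_is_poisson_map F cc).
Qed.
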